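(* Let $\theta_1 \in [0,\pi/2)$, $\theta_2 \in [0,\pi/2]$, $p \in \mathcal{C}^2([0,1])$ with $p>0$, and $\tilde q \in \mathcal{C}^0([0,1])$. Let $q \in \mathcal{C}^0([0,1])$ and $q_c \in \mathbb{R}$ be such that $\tilde q = q - q_c$ and $q>0$ on $[0,1]$. Let $\delta>0$ and $N_0 \ge 1$ be such that $-\lambda_n + q_c < -\delta$ for all $n \ge N_0+1$. Let $K \in \mathbb{R}^{1\times N_0}\setminus\{0\}$ and $L=(l_1,\dots,l_{N_0})^\top \in \mathbb{R}^{N_0}$ be such that $A_0+\mathfrak{B}_0K$ and $A_0 - LC_0$ are Hurwitz with all eigenvalues of real part strictly less than $-\delta$. Let $h>0$. For a given $N \ge N_0+1$, assume there exist $\epsilon\in(0,1/2]$, a symmetric $P \succ 0$, $\alpha>1$ and $\beta,\gamma>0$ such that $$\Theta_1 \preceq 0, \qquad \Theta_2 \le 0, \qquad \Theta_3\ge 0,$$ where $$\Theta_1 = \begin{bmatrix} F^\top P + PF + 2\delta P + \alpha\gamma \|\mathcal{R}_N a\|_{L^2}^2 \tilde K^\top \tilde K & P\mathcal{L} \\ \mathcal{L}^\top P & -\beta e^{-2\delta h}\end{bmatrix} + \alpha\gamma\|\mathcal{R}_N b\|_{L^2}^2 E^\top E,$$ $$\Theta_2 = 2\gamma\left\{-\left(1-\tfrac{1}{\alpha}\right)\lambda_{N+1} + q_c + \delta\right\} + \beta M_\phi(\epsilon)\lambda_{N+1}^{1/2+\epsilon},\qquad \Theta_3 = 2\gamma\left(1-\tfrac1\alpha\right)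 - \frac{\beta M_\phi(\epsilon)}{\lambda_{N+1}^{1/2-\epsilon}},$$ $$M_\phi(\epsilon) = \sum_{n\ge N+1}\frac{|\phi_n'(0)|^2}{\lambda_n^{3/2+\epsilon}} < +\infty.$$ Then there exists $M>0$ such that for any initial condition $z_0 \in H^2(0,1)$ and $\hat z_n(0)\in\mathbb{R}$ ($1\le n\le N$) with $\cos\theta_1 z_0(0) - \sin\theta_1 z_0'(0) = 0$ and $\cos\theta_2 z_0(1) + \sin\theta_2 z_0'(1) = u_0 = K\hat Z_A^{N_0}(0)$, and any Lipschitz continuous $y_0 \in \mathcal{C}^0([-h,0])$ with $y_0(0)=z_0'(0)$, the (classical) trajectories of the closed-loop system consisting of the plant, the delayed Neumann measurement $y_N$, and the controller described in the context satisfy $$\|z(t,\cdot)\|_{H^1}^2 + \sum_{n=1}^N \hat z_n(t)^2 \le M e^{-2\delta t}\left(\|\mathcal{A}w_0\|_{L^2}^2 + \sum_{n=1}^N \hat z_n(0)^2 + u_0^2 + \|y_0\|_\infty^2\right)\quad\text{for all } t\ge0,$$ where $w_0(x) = z_0(x) - \frac{x^2}{\cos\theta_2+2\sin\theta_2}u_0$. Moreover, for any given $h>0$, the constraints $\Theta_1\preceq0$, $\Theta_2\le0$, $\Theta_3\ge0$ are feasible provided $N$ is selected large enough.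
   Context: Notation: $c_{\theta_i}=\cos\theta_i$, $s_{\theta_i}=\sin\theta_i$; $L^2(0,1)$ with inner product $\langle f,g\rangle=\int_0^1 fg\,dx$. The Sturm–Liouville operator $\mathcal{A}f = -(pf')' + qf$ on $D(\mathcal{A}) = \{f\in H^2(0,1): c_{\theta_1}f(0)-s_{\theta_1}f'(0) = c_{\theta_2}f(1)+s_{\theta_2}f'(1)=0\}$ has simple eigenvalues $0<\lambda_1<\lambda_2<\dots\to+\infty$ with associated unit eigenfunctions $\phi_n$ forming a Hilbert basis of $L^2(0,1)$. For $f\in L^2(0,1)$, $\mathcal{R}_N f = \sum_{n\ge N+1}\langle f,\phi_n\rangle\phi_n$. Plant: for $t>0$, $x\in(0,1)$: $z_t = (p z_x)_x - \tilde q z$, $c_{\theta_1}z(t,0)-s_{\theta_1}z_x(t,0)=0$, $c_{\theta_2}z(t,1)+s_{\theta_2}z_x(t,1)=u(t)$, $z(0,\cdot)=z_0$; $u_0 = c_{\theta_2}z_0(1)+s_{\theta_2}z_0'(1)$. Delayed Neumann measurement: $y_N(t) = z_x(t-h,0)$ for $t\ge h$ and $y_N(t)=y_0(t-h)$ for $0\le t\le h$. Coefficients: $a(x) = \frac{2p(x)+2xp'(x)-x^2\tilde q(x)}{c_{\theta_2}+2s_{\theta_2}}$, $b(x) = -\frac{x^2}{c_{\theta_2}+2s_{\theta_2}}$, $a_n=\langle a,\phi_n\rangle$, $b_n=\langle b,\phi_n\rangle$, $\beta_n = p(1)\{-c_{\theta_2}\phi_n'(1)+s_{\theta_2}\phi_n(1)\}$.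 Controller (for $t\ge0$, with convention $u(\tau)=u_0$ for $\tau\le 0$): $\hat w_n(t) = \hat z_n(t) + b_n u(t-h)$; for $1\le n\le N_0$: $\dot{\hat z}_n = (-\lambda_n+q_c)\hat z_n + \beta_n u(t-h) - l_n\{\sum_{k=1}^N \hat w_k(t)\phi_k'(0) - y_N(t)\}$; for $N_0+1\le n\le N$: $\dot{\hat z}_n = (-\lambda_n+q_c)\hat z_n + \beta_n u(t-h)$. With $\hat Z^{N_0} = (\hat z_1,\dots,\hat z_{N_0})^\top$, $A_0 = \mathrm{diag}(-\lambda_1+q_c,\dots,-\lambda_{N_0}+q_c)$, $\mathfrak{B}_0 = (\beta_1,\dots,\beta_{N_0})^\top$, the predictor is $\hat Z_A^{N_0}(t) = e^{A_0h}\hat Z^{N_0}(t) + \int_{t-h}^t e^{A_0(t-s)}\mathfrak{B}_0u(s)\,ds$ and the control is $u(t) = K\hat Z_A^{N_0}(t)$ for $t\ge 0$. Matrices: $C_0 = [\phi_1'(0)\ \cdots\ \phi_{N_0}'(0)]$, $\tilde C_1 = [\phi_{N_0+1}'(0)/\lambda_{N_0+1}\ \cdots\ \phi_N'(0)/\lambda_N]$, $A_1 = \mathrm{diag}(-\lambda_{N_0+1}+q_c,\dots,-\lambda_N+q_c)$, $\tilde{\mathfrak{B}}_1 = (\beta_{N_0+1}/\lambda_{N_0+1},\dots,\beta_N/\lambda_N)^\top$, $$F = \begin{bmatrix} A_0+\mathfrak{B}_0K & e^{A_0h}LC_0 & 0 & e^{A_0h}L\tilde C_1\\ 0 & A_0-LC_0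 & 0 & -L\tilde C_1\\ \tilde{\mathfrak{B}}_1K & 0 & A_1 & 0\\ 0&0&0&A_1\end{bmatrix},\quad \mathcal{L} = \begin{bmatrix} e^{A_0h}L\\ -L\\ 0\\ 0\end{bmatrix},$$ $\tilde K = [K\ 0\ 0\ 0]$ (size compatible with $F$), and $E = K\,[A_0+\mathfrak{B}_0K\ \ e^{A_0h}LC_0\ \ 0\ \ e^{A_0h}L\tilde C_1\ \ e^{A_0h}L]$ (a row vector of size $1\times(2N+1)$). *)

(* Defs.v *)
(* Stdlib reals + Coquelicot (Riemann integrals, derivatives, series),
   with MathComp-Analysis's Lebesgue integral used only for the H^2(0,1)
   initial datum (second derivative merely square-integrable). *)
From Stdlib Require Import Reals Lra.
From Coquelicot Require Import Coquelicot.
From mathcomp Require all_boot all_algebra all_classical all_reals all_analysis Rstruct Rstruct_topology.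

Module Leb.
Import all_boot all_algebra all_classical all_reals all_analysis Rstruct.
Definition MR := measurableTypeR R.
Definition sqint01 (g : R -> R) : Prop :=
  @measurable_fun _ _ MR MR (`[0%R, 1%R]%classic : set MR) g /\
  (@lebesgue_measure R).-integrable (`[0%R, 1%R]%classic : set MR)
     (fun x => ((g x) ^+ 2)%:E).
Definition lint (a b : R) (g : R -> R) : R :=
  Rintegral (@lebesgue_measure R) (`[a, b]%classic : set MR) g.
End Leb.

Open Scope R_scope.

Fixpoint fsum (n : nat) (f : nat -> R) : R :=
  match n with O => 0 | S k => fsum k f + f k end.

Definition cont01 (f : R -> R) : Prop :=
  forall x, 0 <= x <= 1 -> forall eps, 0 < eps -> exists d, 0 < d /\
    forall y, 0 <= y <= 1 -> Rabs (y - x) < d -> Rabs (f y - f x) < eps.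

(* g is the (continuous) derivative of f on [0,1]:  f in C^1([0,1]), f' = g *)
Definition deriv01 (f g : R -> R) : Prop :=
  cont01 g /\ forall x, 0 <= x <= 1 -> f x = f 0 + RInt g 0 x.

Definition ip (f g : R -> R) : R := RInt (fun x => f x * g x) 0 1.

Definition H2_01 (f df d2f : R -> R) : Prop :=
  deriv01 f df /\ Leb.sqint01 d2f /\
  forall x, 0 <= x <= 1 -> df x = df 0 + Leb.lint 0 x d2f.

(* Sturm-Liouville eigenpair of A f = -(p f')' + q f with the boundary conditions *)
Definition SL_eigen (p q : R -> R) (th1 th2 mu : R) (f df : R -> R) : Prop :=
  deriv01 f df /\ deriv01 (fun x => p x * df x) (fun x => (q x - mu) * f x) /\
  cos th1 * f 0 - sin th1 * df 0 = 0 /\ cos th2 * f 1 + sin th2 * df 1 = 0.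

Definition SL_spectrum (p q : R -> R) (th1 th2 : R) (lam : nat -> R)
  (phi dphi : nat -> R -> R) : Prop :=
  0 < lam 1%nat /\
  (forall n, (1 <= n)%nat -> lam n < lam (S n)) /\
  (forall n, (1 <= n)%nat ->
     SL_eigen p q th1 th2 (lam n) (phi n) (dphi n) /\ ip (phi n) (phi n) = 1) /\
  (forall mu f df, SL_eigen p q th1 th2 mu f df ->
     (exists x, 0 <= x <= 1 /\ f x <> 0) -> exists n, (1 <= n)%nat /\ mu = lam n).

Record SysData := mkData {
  th1 : R; th2 : R; pp : R -> R; dpp : R -> R; qq : R -> R; qc : R;
  lam : nat -> R; phi : nat -> R -> R; dphi : nat -> R -> R;
  N0 : nat; Kg : nat -> R; Lg : nat -> R; hd : R; delta : R }.

Section Defs.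
Variable D : SysData.

Definition den : R := cos (th2 D) + 2 * sin (th2 D).
Definition qtil (x : R) : R := qq D x - qc D.
Definition acoef (x : R) : R :=
  (2 * pp D x + 2 * x * dpp D x - x ^ 2 * qtil x) / den.
Definition bcoef (x : R) : R := - x ^ 2 / den.
Definition an (n : nat) : R := ip acoef (phi D n).
Definition bn (n : nat) : R := ip bcoef (phi D n).
Definition betan (n : nat) : R :=
  pp D 1 * (- cos (th2 D) * dphi D n 1 + sin (th2 D) * phi D n 1).

(* || R_N f ||_{L^2}^2 = sum_{n >= N+1} <f, phi_n>^2 *)
Definition tailsq (f : R -> R) (N : nat) : R :=
  Series (fun k => (ip f (phi D (N + 1 + k)%nat)) ^ 2).

Definition Mphi_term (N : nat) (eps : R) (k : nat) : R :=
  (dphi D (N + 1 + k)%nat 0) ^ 2 / Rpower (lam D (N + 1 + k)%nat) (3 / 2 + eps).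
Definition Mphi (N : nat) (eps : R) : R := Series (Mphi_term N eps).

(* Matrices, 0-based indices: row/column r corresponds to mode r+1 *)
Definition kd (i j : nat) : R := if Nat.eqb i j then 1 else 0.
Definition A0d (r : nat) : R := - lam D (S r) + qc D.
Definition eA0h (r : nat) : R := exp (A0d r * hd D).
Definition B0 (r : nat) : R := betan (S r).
Definition C0 (c : nat) : R := dphi D (S c) 0.
Definition A1d (r : nat) : R := - lam D (N0 D + 1 + r)%nat + qc D.
Definition C1t (c : nat) : R := dphi D (N0 D + 1 + c)%nat 0 / lam D (N0 D + 1 + c)%nat.
Definition B1t (r : nat) : R := betan (N0 D + 1 + r)%nat / lam D (N0 D + 1 + r)%nat.

Definition A0BK (i j : nat) : R := kd i j * A0d i + B0 i * Kg D j.
Definition A0LC (i j : nat) : R := kd i j * A0d i - Lg D i * C0 j.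

(* block structure of indices 0..2N-1: sizes N0, N0, N-N0, N-N0 *)
Definition blk (N i : nat) : nat :=
  (if Nat.ltb i (N0 D) then 0 else if Nat.ltb i (2 * N0 D) then 1
  else if Nat.ltb i (N0 D + N) then 2 else 3)%nat.
Definition off (N i : nat) : nat :=
  (match blk N i with
  | O => i | S O => i - N0 D | S (S O) => i - 2 * N0 D | _ => i - (N0 D + N) end)%nat.

Definition Fmat (N i j : nat) : R :=
  let r := off N i in let c := off N j in
  match blk N i, blk N j with
  | O, O => A0BK r c
  | O, S O => eA0h r * Lg D r * C0 c
  | O, S (S (S O)) => eA0h r * Lg D r * C1t c
  | S O, S O => A0LC r c
  | S O, S (S (S O)) => - (Lg D r * C1t c)
  | S (S O), O => B1t r * Kg D c
  | S (S O), S (S O) => kd r c * A1d r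
  | S (S (S O)), S (S (S O)) => kd r c * A1d r
  | _, _ => 0
  end.

Definition Lvec (N i : nat) : R :=
  match blk N i with
  | O => eA0h (off N i) * Lg D (off N i)
  | S O => - Lg D (off N i)
  | _ => 0 end.

Definition Ktil (N i : nat) : R :=
  match blk N i with O => Kg D (off N i) | _ => 0 end.

(* E = K [A0+B0K, e^{A0h}LC0, 0, e^{A0h}L C1t, e^{A0h}L], indices 0..2N *)
Definition Erow (N j : nat) : R :=
  fsum (N0 D) (fun r => Kg D r *
    (if Nat.ltb j (2 * N) then Fmat N r j else eA0h r * Lg D r)).

Definition Theta1 (N : nat) (P : nat -> nat -> R) (alpha beta gamma : R)
  (i j : nat) : R :=
  let m := (2 * N)%nat in
  (if andb (Nat.ltb i m) (Nat.ltb j m) then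
     fsum m (fun k => Fmat N k i * P k j) + fsum m (fun k => P i k * Fmat N k j)
     + 2 * delta D * P i j
     + alpha * gamma * tailsq acoef N * Ktil N i * Ktil N j
   else if Nat.ltb i m then fsum m (fun k => P i k * Lvec N k)
   else if Nat.ltb j m then fsum m (fun k => Lvec N k * P k j)
   else - beta * exp (- 2 * delta D * hd D))
  + alpha * gamma * tailsq bcoef N * Erow N i * Erow N j.

Definition Theta2 (N : nat) (eps alpha beta gamma : R) : R :=
  2 * gamma * (- (1 - 1 / alpha) * lam D (N + 1)%nat + qc D + delta D)
  + beta * Mphi N eps * Rpower (lam D (N + 1)%nat) (1 / 2 + eps).

Definition Theta3 (N : nat) (eps alpha beta gamma : R) : R :=
  2 * gamma * (1 - 1 / alpha)
  - beta * Mphi N eps / Rpower (lam D (N + 1)%nat) (1 / 2 - eps).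
End Defs.

Definition qform (n : nat) (M : nat -> nat -> R) (x : nat -> R) : R :=
  fsum n (fun i => fsum n (fun j => x i * M i j * x j)).
Definition nsd (n : nat) (M : nat -> nat -> R) : Prop :=
  forall x, qform n M x <= 0.
Definition posdef (n : nat) (M : nat -> nat -> R) : Prop :=
  forall x, (exists i, (i < n)%nat /\ x i <> 0) -> 0 < qform n M x.
Definition symm (n : nat) (M : nat -> nat -> R) : Prop :=
  forall i j, (i < n)%nat -> (j < n)%nat -> M i j = M j i.

(* every (complex) eigenvalue lr + i li of the real n x n matrix M
   (eigenvector vr + i vi <> 0) has real part < b *)
Definition eig_re_lt (n : nat) (M : nat -> nat -> R) (b : R) : Prop :=
  forall lr li (vr vi : nat -> R),
    (exists k, (k < n)%nat /\ (vr k <> 0 \/ vi k <> 0)) ->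
    (forall i, (i < n)%nat ->
       fsum n (fun j => M i j * vr j) = lr * vr i - li * vi i /\
       fsum n (fun j => M i j * vi j) = li * vr i + lr * vi i) ->
    lr < b.

Definition Constraints (D : SysData) (N : nat) (eps : R) (P : nat -> nat -> R)
  (alpha beta gamma : R) : Prop :=
  0 < eps <= 1 / 2 /\ symm (2 * N) P /\ posdef (2 * N) P /\
  1 < alpha /\ 0 < beta /\ 0 < gamma /\
  ex_series (Mphi_term D N eps) /\
  nsd (2 * N + 1) (Theta1 D N P alpha beta gamma) /\
  Theta2 D N eps alpha beta gamma <= 0 /\ 0 <= Theta3 D N eps alpha beta gamma.

Definition cont_pos (f : R -> R) : Prop :=
  forall t, 0 <= t -> forall eps, 0 < eps -> exists d, 0 < d /\
    forall s, 0 <= s -> Rabs (s - t) < d -> Rabs (f s - f t) < eps.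

Definition cont2 (S : R -> R -> Prop) (f : R -> R -> R) : Prop :=
  forall t x, S t x -> forall eps, 0 < eps -> exists d, 0 < d /\
    forall s y, S s y -> Rabs (s - t) < d -> Rabs (y - x) < d ->
      Rabs (f s y - f t x) < eps.

Definition ZA (D : SysData) (zh : nat -> R -> R) (u : R -> R) (r : nat) (t : R) : R :=
  eA0h D r * zh (S r) t
  + RInt (fun s => exp (A0d D r * (t - s)) * B0 D r * u s) (t - hd D) t.

Definition yN (D : SysData) (zx : R -> R -> R) (y0 : R -> R) (t : R) : R :=
  if Rlt_dec t (hd D) then y0 (t - hd D) else zx (t - hd D) 0.

Definition closed_loop (D : SysData) (N : nat) (z0 : R -> R) (u0 : R)
  (y0 : R -> R) (z zx zt : R -> R -> R) (zh : nat -> R -> R) (u : R -> R) : Prop :=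
  cont2 (fun t x => 0 <= t /\ 0 <= x <= 1) z /\
  cont2 (fun t x => 0 <= t /\ 0 <= x <= 1) zx /\
  cont2 (fun t x => 0 < t /\ 0 <= x <= 1) zt /\
  (forall t, 0 <= t -> deriv01 (z t) (zx t)) /\
  (forall t x, 0 < t -> 0 <= x <= 1 -> is_derive (fun s => z s x) t (zt t x)) /\
  (* plant: z_t = (p z_x)_x - qtil z *)
  (forall t, 0 < t ->
     deriv01 (fun x => pp D x * zx t x) (fun x => zt t x + qtil D x * z t x)) /\
  (forall t, 0 < t -> cos (th1 D) * z t 0 - sin (th1 D) * zx t 0 = 0) /\
  (forall t, 0 < t -> cos (th2 D) * z t 1 + sin (th2 D) * zx t 1 = u t) /\
  (forall x, 0 <= x <= 1 -> z 0 x = z0 x) /\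
  (forall t, t <= 0 -> u t = u0) /\
  (forall t, 0 <= t -> u t = fsum (N0 D) (fun r => Kg D r * ZA D zh u r t)) /\
  (forall n, (1 <= n <= N)%nat -> cont_pos (zh n)) /\
  (forall n t, (1 <= n <= N0 D)%nat -> 0 < t ->
     is_derive (zh n) t
       ((- lam D n + qc D) * zh n t + betan D n * u (t - hd D)
        - Lg D (n - 1)%nat *
          (fsum N (fun k => (zh (S k) t + bn D (S k) * u (t - hd D)) * dphi D (S k) 0)
           - yN D zx y0 t))) /\
  (forall n t, (N0 D + 1 <= n <= N)%nat -> 0 < t ->
     is_derive (zh n) t ((- lam D n + qc D) * zh n t + betan D n * u (t - hd D))).

Definition supnorm (h : R) (y0 : R -> R) : R :=
  real (Lub_Rbar (fun r => exists s, - h <= s <= 0 /\ r = Rabs (y0 s))).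

Definition Aw0_sq (D : SysData) (z0 dz0 d2z0 : R -> R) (u0 : R) : R :=
  let w := fun x => z0 x - x ^ 2 / den D * u0 in
  let dw := fun x => dz0 x - 2 * x / den D * u0 in
  let d2w := fun x => d2z0 x - 2 / den D * u0 in
  Leb.lint 0 1 (fun x => (- (dpp D x * dw x + pp D x * d2w x) + qq D x * w x) ^ 2).

Definition state_sq (N : nat) (z zx : R -> R -> R) (zh : nat -> R -> R) (t : R) : R :=
  RInt (fun x => (z t x) ^ 2) 0 1 + RInt (fun x => (zx t x) ^ 2) 0 1
  + fsum N (fun k => (zh (S k) t) ^ 2).

(* Main.v *)
(** The substitution w = z - x^2 u / (cos th2 + 2 sin th2) makes the boundary conditions homogeneous,
    so that w(t) lies in the domain of A for t > 0, and its modes obey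
    w_n' = (- lam_n + qc) w_n + a_n u + b_n u'.  For t > h the predictor components, the delayed errors
    z_n(t-h) - zh_n(t) and their rescaled copies for N0 < n <= N form a vector X solving
    X' = F X + L zeta(t-h), where zeta is the part of the trace w_x(.,0) carried by the modes n > N.
    Along trajectories the functional
      e^{2 delta t} (<P X, X> + gamma sum_{n>N} lam_n w_n^2) + beta int_{t-h}^t e^{2 delta s} zeta(s)^2 ds
    is nonincreasing: Theta1 <= 0 handles X and zeta(t-h), while Theta2 <= 0 <= Theta3 and
    zeta^2 <= M_phi sum_{n>N} lam_n^{3/2+eps} w_n^2 handle the tail.  To avoid differentiating infinite
    sums the tail is truncated at n <= M; the error in the trace vanishes as M tends to infinity,
    uniformly on compact subsets of t > 0, since |r'(0)| is small against ||A w|| for the spectral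
    remainder r of w.  On [0,h] the controller solves linear equations with known forcing, and the
    dissipation sum lam_n^2 w_n^2 of the energy controls int_0^h zeta^2.
    For feasibility P is block diagonal: Lyapunov forms of A0 + B0 K and A0 - L C0, and multiples of the
    identity, weighted along the cascade of couplings; all coupling norms are bounded independently of
    N, and ||R_N a||, ||R_N b||, M_phi tend to 0. *)

Require Import Defs.
From Stdlib Require Import Reals Lra Lia Classical.
From Coquelicot Require Import Coquelicot.
From mathcomp Require all_boot all_order all_algebra all_classical all_reals all_analysis Rstruct Rstruct_topology complex.
Import Defs.
Open Scope R_scope.

(** * Finite sums *)

(** [SL_spectrum] records that the [lam n] exhaust the eigenvalues, not that the [phi n] are
    complete, so Parseval is not at hand. It is replaced by a Rayleigh bound: the spectral residual
    of w has energy at most |A w|^2 / lam_{M+1}. This comes from shooting and an a priori estimate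
    for the initial value problem, so the spectral theory needs only continuous functions and
    Riemann integrals, and no compactness. No asymptotics are used either: the growth of [lam n]
    follows from Sobolev's inequality, and the summability of (phi_n'(0)/lam_n)^2 and
    (beta_n/lam_n)^2 from Bessel's inequality for cubic test functions. The first of these sums is
    M_phi at eps = 1/2, hence the choice of eps in the feasibility part.

    The other obstacle is time 0: z_t is continuous only for t > 0, and zeta is not bounded
    pointwise by the energy. Only the integral of zeta^2 over [0,h] is estimated, which is exactly
    what the functional contains at its starting time t = h. Every constant is fixed before the
    trajectory is introduced, so that the final M is uniform. *)

Lemma fsum_ext n f g : (forall i, (i < n)%nat -> f i = g i) -> fsum n f = fsum n g.
Proof.
  induction n as [|n IH]; intros H; simpl; [reflexivity|].
  rewrite IH; [rewrite H; [reflexivity|lia]|intros; apply H; lia].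
Qed.

Lemma fsum_plus n f g : fsum n (fun i => f i + g i) = fsum n f + fsum n g.
Proof. induction n as [|n IH]; simpl; [|rewrite IH]; ring. Qed.

Lemma fsum_scal n c f : fsum n (fun i => c * f i) = c * fsum n f.
Proof. induction n as [|n IH]; simpl; [|rewrite IH]; ring. Qed.

Lemma fsum_scal_r n c f : fsum n (fun i => f i * c) = fsum n f * c.
Proof. induction n as [|n IH]; simpl; [|rewrite IH]; ring. Qed.

Lemma fsum_minus n f g : fsum n (fun i => f i - g i) = fsum n f - fsum n g.
Proof. induction n as [|n IH]; simpl; [|rewrite IH]; ring. Qed.

Lemma fsum_0 n f : (forall i, (i < n)%nat -> f i = 0) -> fsum n f = 0.
Proof.
  intros H. rewrite (fsum_ext n f (fun _ => 0 * 0)).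
  - rewrite fsum_scal. ring.
  - intros i Hi. rewrite H; [ring|exact Hi].
Qed.

Lemma fsum_le n f g : (forall i, (i < n)%nat -> f i <= g i) -> fsum n f <= fsum n g.
Proof.
  induction n as [|n IH]; intros H; simpl; [lra|].
  apply Rplus_le_compat; [apply IH; intros; apply H|apply H]; lia.
Qed.

Lemma fsum_nonneg n f : (forall i, (i < n)%nat -> 0 <= f i) -> 0 <= fsum n f.
Proof.
  intros H. rewrite <- (fsum_0 n (fun _ => 0)); [apply fsum_le, H|reflexivity].
Qed.

Lemma fsum_term_le n f k :
  (forall i, (i < n)%nat -> 0 <= f i) -> (k < n)%nat -> f k <= fsum n f.
Proof.
  induction n as [|n IH]; intros H Hk; simpl; [lia|].
  destruct (Nat.eq_dec k n) as [->|Hkn].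
  - assert (0 <= fsum n f) by (apply fsum_nonneg; intros; apply H; lia). lra.
  - assert (f k <= fsum n f) by (apply IH; [intros; apply H|]; lia).
    assert (0 <= f n) by (apply H; lia). lra.
Qed.

Lemma fsum_swap n m (f : nat -> nat -> R) :
  fsum n (fun i => fsum m (fun j => f i j)) = fsum m (fun j => fsum n (fun i => f i j)).
Proof.
  induction n as [|n IH]; simpl.
  - symmetry. apply fsum_0. reflexivity.
  - rewrite IH, <- fsum_plus. reflexivity.
Qed.

Lemma fsum_app n m f : fsum (n + m) f = fsum n f + fsum m (fun i => f (n + i)%nat).
Proof.
  induction m as [|m IH].
  - rewrite Nat.add_0_r. simpl. ring.
  - rewrite Nat.add_succ_r. simpl. rewrite IH. ring.
Qed.

Lemma fsum_mult n m f g :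
  fsum n f * fsum m g = fsum n (fun i => fsum m (fun j => f i * g j)).
Proof.
  rewrite <- fsum_scal_r. apply fsum_ext. intros. rewrite fsum_scal. reflexivity.
Qed.

Lemma fsum_kd n f k : (k < n)%nat -> fsum n (fun j => kd k j * f j) = f k.
Proof.
  induction n as [|n IH]; intros Hk; simpl; [lia|].
  unfold kd at 2. destruct (Nat.eqb_spec k n) as [->|Hkn].
  - rewrite fsum_0; [ring|]. intros i Hi. unfold kd.
    destruct (Nat.eqb_spec n i); [lia|ring].
  - rewrite IH; [ring|lia].
Qed.

Lemma fsum_abs n f : Rabs (fsum n f) <= fsum n (fun i => Rabs (f i)).
Proof.
  induction n as [|n IH]; simpl.
  - rewrite Rabs_R0. lra.
  - eapply Rle_trans; [apply Rabs_triang|lra].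
Qed.

(** Common core of the Cauchy-Schwarz inequalities for sums, for [ip] and for the form of the
    inverse operator in [rayleigh]. For c > 0 the minimiser s = -b/c gives the claim; for c <= 0 a
    suitable s makes the polynomial at most -1, unless b = c = 0. *)
Lemma quad_discr a b c :
  0 <= a -> (forall s, 0 <= a + 2 * s * b + s ^ 2 * c) -> b ^ 2 <= a * c.
Proof.
  intros Ha H.
  destruct (Rle_lt_dec c 0) as [Hc|Hc].
  - destruct (Req_dec b 0) as [->|Hb].
    + assert (c = 0 \/ c < 0) as [->|Hc'] by lra; [lra|].
      specialize (H (sqrt ((a + 1) / - c))).
      assert (sqrt ((a + 1) / - c) ^ 2 = (a + 1) / - c).
      { simpl. rewrite Rmult_1_r. apply sqrt_sqrt.
        apply Rlt_le, Rdiv_lt_0_compat; lra. }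
      rewrite H0 in H.
      replace ((a + 1) / - c * c) with (- (a + 1)) in H by (field; lra). lra.
    + specialize (H (- (a + 1) / (2 * b))).
      replace (2 * (- (a + 1) / (2 * b)) * b) with (- (a + 1)) in H by (field; lra).
      assert (0 <= (- (a + 1) / (2 * b)) ^ 2) by apply pow2_ge_0. nra.
  - specialize (H (- b / c)).
    replace (a + 2 * (- b / c) * b + (- b / c) ^ 2 * c) with (a - b ^ 2 / c) in H
      by (field; lra).
    apply Rmult_le_reg_r with (/ c); [apply Rinv_0_lt_compat, Hc|].
    replace (a * c * / c) with a by (field; lra). unfold Rdiv in H. lra.
Qed.

Lemma fsum_cs n f g :
  fsum n (fun i => f i * g i) ^ 2 <= fsum n (fun i => f i ^ 2) * fsum n (fun i => g i ^ 2).
Proof.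
  apply quad_discr.
  - apply fsum_nonneg. intros. apply pow2_ge_0.
  - intros s.
    replace (_ + _ + _) with (fsum n (fun i => (f i + s * g i) ^ 2)).
    + apply fsum_nonneg. intros. apply pow2_ge_0.
    + rewrite <- 2 fsum_scal, <- 2 fsum_plus. apply fsum_ext. intros. ring.
Qed.

Lemma fsum_is_derive n (f : nat -> R -> R) (g : nat -> R) x :
  (forall i, (i < n)%nat -> is_derive (f i) x (g i)) ->
  is_derive (fun y => fsum n (fun i => f i y)) x (fsum n g).
Proof.
  induction n as [|n IH]; intros H; simpl.
  - apply (is_derive_const (K := R_AbsRing) (V := R_NormedModule) 0).
  - apply (is_derive_plus (K := R_AbsRing) (V := R_NormedModule)).
    + apply IH. intros. apply H. lia.
    + apply H. lia.
Qed.

Lemma fsum_const n c : fsum n (fun _ => c) = INR n * c.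
Proof. induction n as [|n IH]; [simpl; ring|]. rewrite S_INR. simpl. rewrite IH. ring. Qed.

(** * Continuous and C^1 functions on [0,1] *)

(** Retraction of the line onto [0,1]. Composing with it turns continuity relative to [0,1] into
    continuity on the whole line, which is what the Coquelicot lemmas ask for. *)
Definition clamp (x : R) : R := Rmax 0 (Rmin 1 x).

Lemma clamp_in x : 0 <= clamp x <= 1.
Proof. unfold clamp, Rmax, Rmin. destruct (Rle_dec 1 x), (Rle_dec 0 _); lra. Qed.

Lemma clamp_id x : 0 <= x <= 1 -> clamp x = x.
Proof. intros H. unfold clamp. rewrite Rmin_right, Rmax_right; lra. Qed.

Lemma clamp_lip x y : Rabs (clamp y - clamp x) <= Rabs (y - x).
Proof.
  unfold clamp, Rmax, Rmin.
  destruct (Rle_dec 1 x), (Rle_dec 1 y); repeat destruct (Rle_dec 0 _);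
    unfold Rabs; repeat destruct (Rcase_abs _); lra.
Qed.

Lemma continuous_eps (f : R -> R) x :
  (forall eps, 0 < eps -> exists d, 0 < d /\
     forall y, Rabs (y - x) < d -> Rabs (f y - f x) < eps) ->
  continuous f x.
Proof.
  intros H. apply filterlim_locally. intros eps.
  destruct (H eps (cond_pos eps)) as [d [Hd Hf]].
  exists (mkposreal d Hd). intros y Hy. apply Hf, Hy.
Qed.

Lemma continuous_eps_inv (f : R -> R) x :
  continuous f x -> forall eps, 0 < eps -> exists d, 0 < d /\
     forall y, Rabs (y - x) < d -> Rabs (f y - f x) < eps.
Proof.
  intros H eps Heps.
  destruct (proj1 (filterlim_locally _ _) H (mkposreal eps Heps)) as [d Hd].
  exists d. split; [apply cond_pos|]. intros y Hy. apply Hd, Hy.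
Qed.

Lemma cont01_ext f x : cont01 f -> continuous (fun y => f (clamp y)) x.
Proof.
  intros H. apply continuous_eps. intros eps Heps.
  destruct (H (clamp x) (clamp_in x) eps Heps) as [d [Hd Hf]].
  exists d. split; [exact Hd|]. intros y Hy. apply Hf; [apply clamp_in|].
  eapply Rle_lt_trans; [apply clamp_lip|exact Hy].
Qed.

Lemma continuous_cont01 f : (forall x, 0 <= x <= 1 -> continuous f x) -> cont01 f.
Proof.
  intros H x Hx eps Heps.
  destruct (continuous_eps_inv f x (H x Hx) eps Heps) as [d [Hd Hf]].
  exists d. split; [exact Hd|]. intros y _ Hy. apply Hf, Hy.
Qed.

Lemma cont01_eq f g : (forall x, 0 <= x <= 1 -> f x = g x) -> cont01 f -> cont01 g.
Proof.
  intros E H x Hx eps Heps. destruct (H x Hx eps Heps) as [d [Hd Hf]].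
  exists d. split; [exact Hd|]. intros y Hy Hyx. rewrite <- !E by assumption. auto.
Qed.

Lemma cont01_lift1 (F : R -> R) f :
  (forall x, 0 <= x <= 1 -> continuous F (f x)) -> cont01 f -> cont01 (fun x => F (f x)).
Proof.
  intros HF H. apply (cont01_eq (fun x => F (f (clamp x)))).
  { intros. rewrite clamp_id by assumption. reflexivity. }
  apply continuous_cont01. intros x Hx.
  apply (continuous_comp (fun x => f (clamp x)) F).
  - apply cont01_ext, H.
  - apply HF, clamp_in.
Qed.

Lemma cont01_const c : cont01 (fun _ => c).
Proof. apply continuous_cont01. intros. apply continuous_const. Qed.

Lemma cont01_id : cont01 (fun x => x).
Proof. apply continuous_cont01. intros. apply continuous_id. Qed.

Lemma cont01_plus f g : cont01 f -> cont01 g -> cont01 (fun x => f x + g x).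
Proof.
  intros Hf Hg. apply (cont01_eq (fun x => f (clamp x) + g (clamp x))).
  { intros. rewrite !clamp_id by assumption. reflexivity. }
  apply continuous_cont01. intros x Hx.
  apply (continuous_plus (U := R_UniformSpace) (V := R_NormedModule)
    (fun x => f (clamp x)) (fun x => g (clamp x))); apply cont01_ext; assumption.
Qed.

Lemma cont01_mult f g : cont01 f -> cont01 g -> cont01 (fun x => f x * g x).
Proof.
  intros Hf Hg. apply (cont01_eq (fun x => f (clamp x) * g (clamp x))).
  { intros. rewrite !clamp_id by assumption. reflexivity. }
  apply continuous_cont01. intros x Hx.
  apply (continuous_mult (U := R_UniformSpace) (K := R_AbsRing)
    (fun x => f (clamp x)) (fun x => g (clamp x))); apply cont01_ext; assumption.
Qed.

Lemma cont01_scal c f : cont01 f -> cont01 (fun x => c * f x).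
Proof. intros. apply cont01_mult; [apply cont01_const|assumption]. Qed.

Lemma cont01_opp f : cont01 f -> cont01 (fun x => - f x).
Proof.
  intros. apply (cont01_eq (fun x => (-1) * f x)); [intros; ring|].
  apply cont01_scal. assumption.
Qed.

Lemma cont01_minus f g : cont01 f -> cont01 g -> cont01 (fun x => f x - g x).
Proof. intros. unfold Rminus. apply cont01_plus; [|apply cont01_opp]; assumption. Qed.

Lemma cont01_pow f n : cont01 f -> cont01 (fun x => f x ^ n).
Proof.
  intros H. induction n; simpl; [apply cont01_const|apply cont01_mult; assumption].
Qed.

Lemma cont01_inv f :
  (forall x, 0 <= x <= 1 -> f x <> 0) -> cont01 f -> cont01 (fun x => / f x).
Proof.
  intros H0 H. apply (cont01_lift1 Rinv); [|exact H].
  intros x Hx. apply continuous_Rinv. apply H0, Hx.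
Qed.

Lemma cont01_div_const f c : cont01 f -> cont01 (fun x => f x / c).
Proof. intros. unfold Rdiv. apply cont01_mult; [assumption|apply cont01_const]. Qed.

Lemma cont01_fsum n (f : nat -> R -> R) :
  (forall i, (i < n)%nat -> cont01 (f i)) -> cont01 (fun x => fsum n (fun i => f i x)).
Proof.
  induction n as [|n IH]; intros H; simpl; [apply cont01_const|].
  apply cont01_plus; [apply IH; intros|]; apply H; lia.
Qed.

Lemma cont01_abs f : cont01 f -> cont01 (fun x => Rabs (f x)).
Proof. apply cont01_lift1. intros. apply continuous_Rabs. Qed.

Lemma deriv01_cont_deriv f g : deriv01 f g -> cont01 g.
Proof. intros H. apply H. Qed.

Create HintDb c01.
#[export] Hint Resolve cont01_const cont01_id cont01_plus cont01_mult cont01_opp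
  cont01_minus cont01_pow cont01_div_const cont01_abs : c01.

Lemma ex_RInt_c01 f a b : cont01 f -> 0 <= a <= 1 -> 0 <= b <= 1 -> ex_RInt f a b.
Proof.
  intros H Ha Hb. apply (ex_RInt_ext (fun x => f (clamp x))).
  - intros x Hx. rewrite clamp_id; [reflexivity|].
    unfold Rmin, Rmax in Hx. destruct (Rle_dec a b); lra.
  - apply (ex_RInt_continuous (V := R_CompleteNormedModule)).
    intros. apply cont01_ext, H.
Qed.

Lemma RInt_c01_ext (f g : R -> R) a b : 0 <= a <= 1 -> 0 <= b <= 1 ->
  (forall x, 0 <= x <= 1 -> f x = g x) -> RInt f a b = RInt g a b :> R.
Proof.
  intros Ha Hb H. apply RInt_ext. intros x Hx. apply H.
  unfold Rmin, Rmax in Hx. destruct (Rle_dec a b); lra.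
Qed.

Ltac in01 := match goal with |- _ <= _ <= _ => lra | |- _ <= _ => lra | |- _ < _ => lra end.

Lemma RInt_c01_plus f g a b : cont01 f -> cont01 g -> 0 <= a <= 1 -> 0 <= b <= 1 ->
  RInt (fun x => f x + g x) a b = RInt f a b + RInt g a b :> R.
Proof.
  intros. apply (RInt_plus (V := R_CompleteNormedModule)); apply ex_RInt_c01; assumption.
Qed.

Lemma RInt_c01_minus f g a b : cont01 f -> cont01 g -> 0 <= a <= 1 -> 0 <= b <= 1 ->
  RInt (fun x => f x - g x) a b = RInt f a b - RInt g a b :> R.
Proof.
  intros. apply (RInt_minus (V := R_CompleteNormedModule)); apply ex_RInt_c01; assumption.
Qed.

Lemma RInt_c01_scal c f a b : cont01 f -> 0 <= a <= 1 -> 0 <= b <= 1 ->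
  RInt (fun x => c * f x) a b = c * RInt f a b :> R.
Proof.
  intros. apply (RInt_scal (V := R_CompleteNormedModule)); apply ex_RInt_c01; assumption.
Qed.

Lemma RInt_c01_opp f a b : cont01 f -> 0 <= a <= 1 -> 0 <= b <= 1 ->
  RInt (fun x => - f x) a b = - RInt f a b :> R.
Proof.
  intros. apply (RInt_opp (V := R_CompleteNormedModule)); apply ex_RInt_c01; assumption.
Qed.

Lemma RInt_c01_fsum n (f : nat -> R -> R) a b : 0 <= a <= 1 -> 0 <= b <= 1 ->
  (forall i, (i < n)%nat -> cont01 (f i)) ->
  RInt (fun x => fsum n (fun i => f i x)) a b =
  fsum n (fun i => RInt (V := R_CompleteNormedModule) (f i) a b) :> R.
Proof.
  intros Ha Hb. induction n as [|n IH]; intros H; simpl.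
  - rewrite (RInt_const (V := R_CompleteNormedModule)). apply Rmult_0_r.
  - rewrite RInt_c01_plus, IH; auto; try (intros; apply H; lia).
    apply cont01_fsum. intros. apply H. lia.
Qed.

Lemma RInt_c01_Chasles f a b c : cont01 f -> 0 <= a <= 1 -> 0 <= b <= 1 -> 0 <= c <= 1 ->
  RInt f a b + RInt f b c = RInt f a c :> R.
Proof.
  intros. apply (RInt_Chasles (V := R_CompleteNormedModule)); apply ex_RInt_c01; assumption.
Qed.

Lemma RInt_c01_le f g a b : cont01 f -> cont01 g -> 0 <= a -> a <= b -> b <= 1 ->
  (forall x, a <= x <= b -> f x <= g x) -> RInt f a b <= RInt g a b.
Proof.
  intros Hf Hg Ha Hab Hb H. apply RInt_le; [exact Hab| | |intros; apply H; lra];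
    apply ex_RInt_c01; auto; lra.
Qed.

Lemma RInt_c01_nonneg f a b : cont01 f -> 0 <= a -> a <= b -> b <= 1 ->
  (forall x, a <= x <= b -> 0 <= f x) -> 0 <= RInt f a b.
Proof.
  intros Hf Ha Hab Hb H. apply RInt_ge_0; [exact Hab| |intros; apply H; lra].
  apply ex_RInt_c01; auto; lra.
Qed.

Lemma RInt_c01_abs f a b : cont01 f -> 0 <= a -> a <= b -> b <= 1 ->
  Rabs (RInt f a b) <= RInt (fun x => Rabs (f x)) a b.
Proof.
  intros. apply abs_RInt_le; [assumption|]. apply ex_RInt_c01; auto; lra.
Qed.

Lemma RInt_c01_mono_dom f a b : cont01 f -> 0 <= a -> a <= b -> b <= 1 ->
  (forall x, 0 <= x <= 1 -> 0 <= f x) -> RInt f a b <= RInt f 0 1.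
Proof.
  intros Hf Ha Hab Hb H.
  rewrite <- (RInt_c01_Chasles f 0 a 1), <- (RInt_c01_Chasles f a b 1); auto; try lra.
  assert (0 <= RInt f 0 a) by (apply RInt_c01_nonneg; auto; intros; try apply H; lra).
  assert (0 <= RInt f b 1) by (apply RInt_c01_nonneg; auto; intros; try apply H; lra).
  lra.
Qed.

Lemma RInt_const01 c a b : RInt (fun _ => c) a b = (b - a) * c :> R.
Proof. apply (RInt_const (V := R_CompleteNormedModule)). Qed.

(* [f 0 + RInt (g o clamp) 0 x] is a C^1 extension of [f] to the whole line. *)
Lemma deriv01_extension f g : deriv01 f g ->
  exists F : R -> R, (forall x, is_derive F x (g (clamp x))) /\
            (forall x, 0 <= x <= 1 -> F x = f x).
Proof.
  intros [Hg Hf]. exists (fun x => f 0 + RInt (fun y => g (clamp y)) 0 x). split.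
  - intros x. replace (g (clamp x)) with (0 + g (clamp x)) by ring.
    apply (is_derive_plus (K := R_AbsRing) (V := R_NormedModule)).
    + apply (is_derive_const (K := R_AbsRing) (V := R_NormedModule)).
    + apply (is_derive_RInt (V := R_NormedModule) (fun y => g (clamp y)) _ 0).
      * apply filter_forall. intros y. apply (RInt_correct (V := R_CompleteNormedModule)).
        apply (ex_RInt_continuous (V := R_CompleteNormedModule)).
        intros. apply cont01_ext, Hg.
      * apply cont01_ext, Hg.
  - intros x Hx. rewrite (Hf x Hx). f_equal. apply RInt_ext.
    intros y Hy. rewrite Rmin_left, Rmax_right in Hy by lra. rewrite clamp_id; [reflexivity|lra].
Qed.

Lemma deriv01_of_extension f g (F : R -> R) :
  cont01 g -> (forall x, is_derive F x (g (clamp x))) ->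
  (forall x, 0 <= x <= 1 -> F x = f x) -> deriv01 f g.
Proof.
  intros Hg HF E. split; [exact Hg|]. intros x Hx.
  rewrite <- !E by lra.
  assert (H : is_RInt (fun y => g (clamp y)) 0 x (minus (F x) (F 0))).
  { apply (is_RInt_derive (V := R_CompleteNormedModule)).
    - intros. apply HF.
    - intros. apply cont01_ext, Hg. }
  apply (is_RInt_unique (V := R_CompleteNormedModule)) in H.
  rewrite (RInt_ext _ g) in H.
  - unfold minus, plus, opp in H; simpl in H.
    rewrite H. ring.
  - intros y Hy. rewrite Rmin_left, Rmax_right in Hy by lra. rewrite clamp_id; [reflexivity|lra].
Qed.

Lemma deriv01_cont f g : deriv01 f g -> cont01 f.
Proof.
  intros H. destruct (deriv01_extension f g H) as [F [HF E]].
  apply (cont01_eq F); [exact E|]. apply continuous_cont01. intros x _.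
  apply (ex_derive_continuous (K := R_AbsRing) (V := R_NormedModule)).
  exists (g (clamp x)). apply HF.
Qed.

Lemma deriv01_eq f1 g1 f2 g2 :
  (forall x, 0 <= x <= 1 -> f1 x = f2 x) -> (forall x, 0 <= x <= 1 -> g1 x = g2 x) ->
  deriv01 f1 g1 -> deriv01 f2 g2.
Proof.
  intros Ef Eg [Hg Hf]. split; [apply (cont01_eq g1); assumption|].
  intros x Hx. rewrite <- !Ef by lra. rewrite Hf by assumption. f_equal.
  apply RInt_c01_ext; auto; lra.
Qed.

Lemma deriv01_const c : deriv01 (fun _ => c) (fun _ => 0).
Proof.
  split; [apply cont01_const|]. intros. rewrite RInt_const01. ring.
Qed.

Lemma deriv01_is_derive (F G : R -> R) :
  (forall x, is_derive F x (G x)) -> (forall x, continuous G x) -> deriv01 F G.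
Proof.
  intros HF HG. split; [apply continuous_cont01; auto|]. intros x _.
  assert (H : is_RInt G 0 x (minus (F x) (F 0))).
  { apply (is_RInt_derive (V := R_CompleteNormedModule)); auto. }
  apply (is_RInt_unique (V := R_CompleteNormedModule)) in H.
  unfold minus, plus, opp in H; simpl in H.
  rewrite H. ring.
Qed.

Lemma deriv01_id : deriv01 (fun x => x) (fun _ => 1).
Proof.
  apply deriv01_is_derive; intros; [|apply continuous_const].
  apply (is_derive_id (K := R_AbsRing)).
Qed.

Lemma deriv01_plus f f' g g' : deriv01 f f' -> deriv01 g g' ->
  deriv01 (fun x => f x + g x) (fun x => f' x + g' x).
Proof.
  intros Hf Hg. destruct (deriv01_extension _ _ Hf) as [F [HF EF]].
  destruct (deriv01_extension _ _ Hg) as [G [HG EG]].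
  apply (deriv01_of_extension _ _ (fun x => F x + G x)).
  - apply cont01_plus; [apply Hf|apply Hg].
  - intros. apply (is_derive_plus (K := R_AbsRing) (V := R_NormedModule)); auto.
  - intros. rewrite EF, EG; auto.
Qed.

Lemma deriv01_mult f f' g g' : deriv01 f f' -> deriv01 g g' ->
  deriv01 (fun x => f x * g x) (fun x => f' x * g x + f x * g' x).
Proof.
  intros Hf Hg. destruct (deriv01_extension _ _ Hf) as [F [HF EF]].
  destruct (deriv01_extension _ _ Hg) as [G [HG EG]].
  apply (deriv01_eq (fun x => F x * G x) (fun x => f' (clamp x) * G x + F x * g' (clamp x))).
  - intros. rewrite EF, EG; auto.
  - intros. rewrite EF, EG, clamp_id; auto.
  - apply deriv01_is_derive.
    + intros x. apply (is_derive_mult (K := R_AbsRing)); auto. intros; apply Rmult_comm.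
    + intros x. apply (continuous_plus (U := R_UniformSpace) (V := R_NormedModule)
        (fun x => f' (clamp x) * G x) (fun x => F x * g' (clamp x)));
      apply (continuous_mult (U := R_UniformSpace) (K := R_AbsRing));
      try (apply cont01_ext; [apply Hf||apply Hg]);
      apply (ex_derive_continuous (K := R_AbsRing) (V := R_NormedModule));
      eexists; auto.
Qed.

Lemma deriv01_scal c f f' : deriv01 f f' -> deriv01 (fun x => c * f x) (fun x => c * f' x).
Proof.
  intros H. eapply deriv01_eq; [| |apply (deriv01_mult _ _ _ _ (deriv01_const c) H)];
    intros; simpl; ring.
Qed.

Lemma deriv01_minus f f' g g' : deriv01 f f' -> deriv01 g g' ->
  deriv01 (fun x => f x - g x) (fun x => f' x - g' x).
Proof.
  intros Hf Hg. eapply deriv01_eq;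
    [| |apply (deriv01_plus _ _ _ _ Hf (deriv01_scal (-1) _ _ Hg))]; intros; simpl; ring.
Qed.

Lemma deriv01_RInt c g : cont01 g -> deriv01 (fun x => c + RInt g 0 x) g.
Proof.
  intros H. split; [exact H|]. intros x Hx. rewrite RInt_point.
  change (zero (G := R_CompleteNormedModule)) with 0. rewrite (Rplus_0_r c). reflexivity.
Qed.

Lemma FTC01 f g a b : deriv01 f g -> 0 <= a <= 1 -> 0 <= b <= 1 -> RInt g a b = f b - f a :> R.
Proof.
  intros [Hg Hf] Ha Hb. rewrite (Hf a Ha), (Hf b Hb).
  rewrite <- (RInt_c01_Chasles g 0 a b); auto; [lra|lra].
Qed.

Lemma cont01_limit f : cont01 f -> (forall x, 0 < x < 1 -> f x = 0) ->
  forall x, 0 <= x <= 1 -> f x = 0.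
Proof.
  intros H H0 x Hx. destruct (Req_dec (f x) 0) as [|Hn]; [assumption|exfalso].
  destruct (H x Hx (Rabs (f x))) as [d [Hd Hf]]; [apply Rabs_pos_lt, Hn|].
  set (e := Rmin (d / 2) (1 / 4)).
  assert (0 < e) by (apply Rmin_pos; lra).
  assert (e <= d / 2) by apply Rmin_l. assert (e <= 1 / 4) by apply Rmin_r.
  assert (exists y, 0 < y < 1 /\ Rabs (y - x) < d) as [y [Hy Hyx]].
  { destruct (Rle_dec x (1/2)).
    - exists (x + e). split; [lra|]. rewrite Rabs_right; lra.
    - exists (x - e). split; [lra|]. rewrite Rabs_left; lra. }
  specialize (Hf y (conj (Rlt_le _ _ (proj1 Hy)) (Rlt_le _ _ (proj2 Hy))) Hyx).
  rewrite (H0 y Hy), Rminus_0_l, Rabs_Ropp in Hf. lra.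
Qed.

(** Two C^1 extensions of f agree near each interior point, so their derivatives agree there;
    continuity carries the equality to the endpoints. *)
Lemma deriv01_unique f g1 g2 : deriv01 f g1 -> deriv01 f g2 ->
  forall x, 0 <= x <= 1 -> g1 x = g2 x.
Proof.
  intros H1 H2 x Hx.
  cut (g1 x - g2 x = 0); [lra|].
  apply (cont01_limit (fun x => g1 x - g2 x)); [|clear x Hx; intros x Hx|exact Hx].
  { apply cont01_minus; [apply H1|apply H2]. }
  destruct (deriv01_extension _ _ H1) as [F1 [D1 E1]].
  destruct (deriv01_extension _ _ H2) as [F2 [D2 E2]].
  specialize (D1 x). specialize (D2 x). rewrite clamp_id in D1, D2 by lra.
  apply (is_derive_ext_loc F1 F2) in D1.
  - apply is_derive_unique in D1. apply is_derive_unique in D2. lra.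
  - assert (0 < Rmin x (1 - x)) by (apply Rmin_pos; lra).
    exists (mkposreal _ H). intros y Hy. simpl in Hy.
    apply Rabs_lt_between in Hy. unfold minus, plus, opp in Hy; simpl in Hy.
    assert (Rmin x (1 - x) <= x) by apply Rmin_l.
    assert (Rmin x (1 - x) <= 1 - x) by apply Rmin_r.
    rewrite E1, E2; lra.
Qed.

Lemma cont01_bounded f : cont01 f -> exists B, 0 < B /\ forall x, 0 <= x <= 1 -> Rabs (f x) <= B.
Proof.
  intros H.
  destruct (continuity_ab_maj (fun x => Rabs (f (clamp x))) 0 1) as [m [Hm _]]; [lra| |].
  - intros x _. apply continuity_pt_filterlim.
    apply (continuous_comp (fun x => f (clamp x)) Rabs).
    + apply cont01_ext, H.
    + apply continuous_Rabs.
  - exists (Rabs (f (clamp m)) + 1). split.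
    + assert (0 <= Rabs (f (clamp m))) by apply Rabs_pos. lra.
    + intros x Hx. specialize (Hm x Hx). simpl in Hm. rewrite (clamp_id x Hx) in Hm. lra.
Qed.

Lemma cont01_pos_min f : cont01 f -> (forall x, 0 <= x <= 1 -> 0 < f x) ->
  exists m, 0 < m /\ forall x, 0 <= x <= 1 -> m <= f x.
Proof.
  intros H H0.
  destruct (continuity_ab_min (fun x => f (clamp x)) 0 1) as [m [Hm Hm1]]; [lra| |].
  - intros x _. apply continuity_pt_filterlim, cont01_ext, H.
  - exists (f (clamp m)). split; [apply H0, clamp_in|].
    intros x Hx. specialize (Hm x Hx). simpl in Hm. rewrite (clamp_id x Hx) in Hm. exact Hm.
Qed.

(** * The L^2 inner product on continuous functions *)

Lemma ip_comm f g : ip f g = ip g f.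
Proof. unfold ip. apply RInt_ext. intros. apply Rmult_comm. Qed.

Lemma ip_ext f1 g1 f2 g2 : (forall x, 0 <= x <= 1 -> f1 x = f2 x) ->
  (forall x, 0 <= x <= 1 -> g1 x = g2 x) -> ip f1 g1 = ip f2 g2.
Proof.
  intros Hf Hg. apply RInt_c01_ext; [lra|lra|]. intros x Hx. rewrite Hf, Hg; auto.
Qed.

Lemma ip_plus_l f1 f2 g : cont01 f1 -> cont01 f2 -> cont01 g ->
  ip (fun x => f1 x + f2 x) g = ip f1 g + ip f2 g.
Proof.
  intros. unfold ip. rewrite <- RInt_c01_plus; auto with c01; try lra.
  apply RInt_c01_ext; [lra|lra|]. intros. ring.
Qed.

Lemma ip_scal_l c f g : cont01 f -> cont01 g -> ip (fun x => c * f x) g = c * ip f g.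
Proof.
  intros. unfold ip. rewrite <- RInt_c01_scal; auto with c01; try lra.
  apply RInt_c01_ext; [lra|lra|]. intros. ring.
Qed.

Lemma ip_minus_l f1 f2 g : cont01 f1 -> cont01 f2 -> cont01 g ->
  ip (fun x => f1 x - f2 x) g = ip f1 g - ip f2 g.
Proof.
  intros. unfold ip. rewrite <- RInt_c01_minus; auto with c01; try lra.
  apply RInt_c01_ext; [lra|lra|]. intros. ring.
Qed.

Lemma ip_fsum_l n (f : nat -> R -> R) g : (forall i, (i < n)%nat -> cont01 (f i)) -> cont01 g ->
  ip (fun x => fsum n (fun i => f i x)) g = fsum n (fun i => ip (f i) g).
Proof.
  intros Hf Hg. unfold ip. rewrite <- RInt_c01_fsum; try lra.
  - apply RInt_ext. intros. rewrite fsum_scal_r. reflexivity.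
  - intros. auto with c01.
Qed.

Lemma ip_nonneg f : cont01 f -> 0 <= ip f f.
Proof. intros. apply RInt_c01_nonneg; auto with c01; try lra. intros. nra. Qed.

Lemma ip_quad f g s : cont01 f -> cont01 g ->
  ip (fun x => f x + s * g x) (fun x => f x + s * g x) = ip f f + 2 * s * ip f g + s ^ 2 * ip g g.
Proof.
  intros Hf Hg. assert (Hs : cont01 (fun x => s * g x)) by (apply cont01_scal, Hg).
  rewrite ip_plus_l, ip_scal_l by auto with c01.
  rewrite (ip_comm f), (ip_comm g), !ip_plus_l, !ip_scal_l by auto with c01.
  rewrite (ip_comm g f). ring.
Qed.

Lemma ip_cs f g : cont01 f -> cont01 g -> ip f g ^ 2 <= ip f f * ip g g.
Proof.
  intros Hf Hg. apply quad_discr; [apply ip_nonneg, Hf|].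
  intros s. rewrite <- ip_quad by assumption. apply ip_nonneg. auto with c01.
Qed.

(** The primitive of f^2 is squeezed between 0 and its value at 1, so it vanishes identically, and
    so does its derivative f^2. *)
Lemma ip_zero f : cont01 f -> ip f f = 0 -> forall x, 0 <= x <= 1 -> f x = 0.
Proof.
  intros Hf H0 x Hx.
  assert (HD : deriv01 (fun x => 0 + RInt (fun y => f y * f y) 0 x) (fun y => f y * f y)).
  { apply deriv01_RInt. auto with c01. }
  assert (HE : forall x, 0 <= x <= 1 -> RInt (fun y => f y * f y) 0 x = 0).
  { intros y Hy. apply Rle_antisym.
    - rewrite <- H0. apply RInt_c01_mono_dom; auto with c01; try lra. intros; nra.
    - apply RInt_c01_nonneg; auto with c01; try lra. intros; nra. }
  assert (HZ : deriv01 (fun _ => 0) (fun y => f y * f y)).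
  { eapply deriv01_eq; [| |exact HD]; intros; simpl; [rewrite HE by assumption; ring|reflexivity]. }
  assert (f x * f x = 0).
  { apply (deriv01_unique _ _ _ HZ (deriv01_const 0)), Hx. }
  nra.
Qed.

Lemma deriv01_exp_scal c : deriv01 (fun x => exp (c * x)) (fun x => c * exp (c * x)).
Proof.
  apply deriv01_is_derive; intros x.
  - auto_derive; [trivial|ring].
  - apply (ex_derive_continuous (K := R_AbsRing) (V := R_NormedModule)).
    auto_derive. trivial.
Qed.

(** Integrates the derivative of exp(-C x) f(x). Since r >= 0, the weight on r can be bounded by 1
    and the domain of its integral enlarged to [0,1]. *)
Lemma gronwall01 f g r C : deriv01 f g -> cont01 r -> 0 <= C ->
  (forall x, 0 <= x <= 1 -> 0 <= r x) ->
  (forall x, 0 <= x <= 1 -> g x <= C * f x + r x) ->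
  forall x, 0 <= x <= 1 -> f x <= exp (C * x) * (f 0 + RInt r 0 1).
Proof.
  intros Hf Hr HC Hr0 H x Hx.
  assert (HD := deriv01_mult _ _ _ _ (deriv01_exp_scal (- C)) Hf).
  assert (H1 : exp (- C * x) * f x - exp (- C * 0) * f 0 <= RInt r 0 x).
  { rewrite <- (FTC01 _ _ 0 x HD) by lra.
    apply RInt_c01_le; try lra; [apply HD|assumption|].
    intros y Hy. specialize (H y ltac:(lra)). specialize (Hr0 y ltac:(lra)).
    assert (exp (- C * y) <= 1).
    { rewrite <- exp_0. destruct (Req_dec (C * y) 0) as [E|E].
      - replace (- C * y) with 0 by lra. lra.
      - apply Rlt_le, exp_increasing. assert (0 <= C * y) by (apply Rmult_le_pos; lra). lra. }
    assert (0 < exp (- C * y)) by apply exp_pos.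
    replace (- C * exp (- C * y) * f y + exp (- C * y) * g y)
      with (exp (- C * y) * (g y - C * f y)) by ring.
    apply Rle_trans with (exp (- C * y) * r y); [apply Rmult_le_compat_l; lra|nra]. }
  rewrite Rmult_0_r, exp_0 in H1.
  assert (H2 : RInt r 0 x <= RInt r 0 1) by (apply RInt_c01_mono_dom; auto; lra).
  assert (E : exp (C * x) * exp (- C * x) = 1).
  { rewrite <- exp_plus. replace (C * x + - C * x) with 0 by ring. apply exp_0. }
  replace (f x) with (exp (C * x) * (exp (- C * x) * f x)) by (rewrite <- Rmult_assoc, E; ring).
  apply Rmult_le_compat_l; [apply Rlt_le, exp_pos|lra].
Qed.

(** * Linear initial value problems *)

Lemma half_pow_small D eps : 0 <= D -> 0 < eps -> exists k, D * (1 / 2) ^ k < eps.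
Proof.
  intros HD He. destruct (pow_lt_1_zero (1 / 2)) with (y := eps / (D + 1)) as [k Hk].
  - rewrite Rabs_right; lra.
  - apply Rdiv_lt_0_compat; lra.
  - exists k. specialize (Hk k (le_n k)). rewrite Rabs_right in Hk.
    + assert (0 < (1 / 2) ^ k) by (apply pow_lt; lra).
      apply Rle_lt_trans with ((D + 1) * (1 / 2) ^ k); [nra|].
      apply Rlt_le_trans with ((D + 1) * (eps / (D + 1))).
      * apply Rmult_lt_compat_l; lra.
      * right. field. lra.
    + apply Rle_ge, pow_le. lra.
Qed.

Lemma geometric_uniform_limit (u : nat -> R -> R) D :
  (forall k, cont01 (u k)) ->
  (forall k x, 0 <= x <= 1 -> Rabs (u (S k) x - u k x) <= D * (1 / 2) ^ k) ->
  exists v, cont01 v /\ forall k x, 0 <= x <= 1 -> Rabs (v x - u k x) <= 2 * D * (1 / 2) ^ k.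
Proof.
  intros Hu Hd.
  assert (HD : 0 <= D).
  { specialize (Hd 0%nat 0 ltac:(lra)). simpl in Hd.
    assert (0 <= Rabs (u 1%nat 0 - u 0%nat 0)) by apply Rabs_pos. lra. }
  (* The exact geometric partial sum, with its factor 1 - (1/2)^j, is what an induction on j
     reproduces. *)
  assert (Hj : forall x, 0 <= x <= 1 -> forall k j,
    Rabs (u (k + j)%nat x - u k x) <= 2 * D * (1 / 2) ^ k * (1 - (1 / 2) ^ j)).
  { intros x Hx k j. induction j as [|j IH].
    - rewrite Nat.add_0_r, Rminus_diag, Rabs_R0. simpl. lra.
    - rewrite Nat.add_succ_r. specialize (Hd (k + j)%nat x Hx).
      replace (u (S (k + j)) x - u k x)
        with ((u (S (k + j)) x - u (k + j)%nat x) + (u (k + j)%nat x - u k x)) by ring.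
      eapply Rle_trans; [apply Rabs_triang|].
      rewrite pow_add in Hd. simpl. lra. }
  assert (Hj' : forall x, 0 <= x <= 1 -> forall k m, (k <= m)%nat ->
    Rabs (u m x - u k x) <= 2 * D * (1 / 2) ^ k).
  { intros x Hx k m Hkm. replace m with (k + (m - k))%nat by lia.
    eapply Rle_trans; [apply Hj, Hx|].
    assert (0 < (1 / 2) ^ (m - k)) by (apply pow_lt; lra).
    assert (0 <= 2 * D * (1 / 2) ^ k).
    { apply Rmult_le_pos; [lra|]. apply pow_le. lra. }
    nra. }
  assert (Hlim : forall x, 0 <= x <= 1 ->
    is_lim_seq (fun k => u k x) (real (Lim_seq (fun k => u k x)))).
  { intros x Hx. apply Lim_seq_correct', ex_lim_seq_cauchy_corr. intros eps.
    destruct (half_pow_small (2 * (2 * D)) eps) as [K HK]; [lra|apply cond_pos|].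
    exists K. intros n m Hn Hm.
    replace (u n x - u m x) with ((u n x - u K x) - (u m x - u K x)) by ring.
    eapply Rle_lt_trans; [apply Rabs_triang|]. rewrite Rabs_Ropp.
    assert (A := Hj' x Hx K n Hn). assert (B := Hj' x Hx K m Hm). lra. }
  set (v := fun x => real (Lim_seq (fun k => u k x))).
  assert (Hv : forall k x, 0 <= x <= 1 -> Rabs (v x - u k x) <= 2 * D * (1 / 2) ^ k).
  { intros k x Hx.
    apply (is_lim_seq_le_loc (fun m => Rabs (u m x - u k x)) (fun _ => 2 * D * (1 / 2) ^ k)
       (Rabs (v x - u k x)) (2 * D * (1 / 2) ^ k)).
    - exists k. intros m Hm. apply Hj'; assumption.
    - apply (is_lim_seq_abs (fun m => u m x - u k x) (v x - u k x)).
      apply is_lim_seq_minus'; [apply Hlim, Hx|apply is_lim_seq_const].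
    - apply is_lim_seq_const. }
  exists v. split; [|exact Hv].
  intros x Hx eps He. destruct (half_pow_small (2 * D) (eps / 3)) as [K HK]; [lra|lra|].
  destruct (Hu K x Hx (eps / 3)) as [d [Hd0 Hdd]]; [lra|].
  exists d. split; [exact Hd0|]. intros y Hy Hyx.
  specialize (Hdd y Hy Hyx). assert (A := Hv K x Hx). assert (B := Hv K y Hy).
  replace (v y - v x) with ((v y - u K y) + (u K y - u K x) - (v x - u K x)) by ring.
  eapply Rle_lt_trans; [apply Rabs_triang|]. rewrite Rabs_Ropp.
  eapply Rle_lt_trans; [apply Rplus_le_compat_r, Rabs_triang|]. lra.
Qed.

(* Picard iteration contracts by 1/2 in the norm sup |y(x)| e^{-Kx}. *)
Lemma linear_ivp (c g r : R -> R) (y0 Y0 : R) : cont01 c -> cont01 g -> cont01 r ->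
  exists y Y, deriv01 y (fun x => c x * Y x) /\ deriv01 Y (fun x => g x * y x + r x)
              /\ y 0 = y0 /\ Y 0 = Y0.
Proof.
  intros Hc Hg Hr.
  destruct (cont01_bounded c Hc) as [B1 [HB1 Hb1]].
  destruct (cont01_bounded g Hg) as [B2 [HB2 Hb2]].
  set (Q := fun y x => Y0 + RInt (fun s => g s * y s + r s) 0 x).
  set (Phi := fun y x => y0 + RInt (fun s => c s * Q y s) 0 x).
  assert (HQ : forall y, cont01 y -> deriv01 (Q y) (fun s => g s * y s + r s)).
  { intros. apply deriv01_RInt. auto with c01. }
  assert (HQc : forall y, cont01 y -> cont01 (Q y)).
  { intros. apply (deriv01_cont _ _ (HQ y H)). }
  assert (HPhi : forall y, cont01 y -> deriv01 (Phi y) (fun s => c s * Q y s)).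
  { intros. apply deriv01_RInt. apply cont01_mult; auto. }
  assert (HPc : forall y, cont01 y -> cont01 (Phi y)).
  { intros. apply (deriv01_cont _ _ (HPhi y H)). }
  (* Each of the two nested integrations gains a factor 1/K in the weighted norm, so the map
     contracts by B1 B2 / K^2, which this K makes at most 1/2. *)
  set (K := 2 * (B1 + B2 + B1 * B2)).
  assert (HK : 0 < K) by (unfold K; nra).
  assert (HKK : B1 * B2 / (K * K) <= 1 / 2).
  { apply Rle_div_l; [nra|]. unfold K. nra. }
  assert (Hexp : forall M x, 0 <= M -> 0 <= x <= 1 ->
     RInt (fun s => M * exp (K * s)) 0 x <= M / K * exp (K * x)).
  { intros M x HM Hx.
    assert (HD := deriv01_scal (M / K) _ _ (deriv01_exp_scal K)).
    rewrite (RInt_c01_ext _ (fun x => M / K * (K * exp (K * x)))); try lra.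
    - rewrite (FTC01 _ _ 0 x HD) by lra. rewrite Rmult_0_r, exp_0.
      assert (0 <= M / K) by (apply Rdiv_le_0_compat; lra). lra.
    - intros. field. lra. }
  assert (Hec : forall M, cont01 (fun s => M * exp (K * s))).
  { intros. apply cont01_scal. apply (deriv01_cont _ _ (deriv01_exp_scal K)). }
  assert (Hint : forall f M x, cont01 f -> 0 <= M -> 0 <= x <= 1 ->
    (forall s, 0 <= s <= 1 -> Rabs (f s) <= M * exp (K * s)) ->
    Rabs (RInt f 0 x) <= M / K * exp (K * x)).
  { intros f M x Hf HM Hx Hb. eapply Rle_trans; [apply RInt_c01_abs; auto; lra|].
    eapply Rle_trans; [|apply Hexp; assumption].
    apply RInt_c01_le; auto with c01; try lra. intros; apply Hb; lra. }
  assert (Hcontr : forall y z M, cont01 y -> cont01 z -> 0 <= M ->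
    (forall s, 0 <= s <= 1 -> Rabs (y s - z s) <= M * exp (K * s)) ->
    forall s, 0 <= s <= 1 -> Rabs (Phi y s - Phi z s) <= M * (1 / 2) * exp (K * s)).
  { intros y z M Hy Hz HM Hyz s Hs.
    assert (HQd : forall x, 0 <= x <= 1 -> Rabs (Q y x - Q z x) <= B2 * M / K * exp (K * x)).
    { intros x Hx. unfold Q.
      replace (_ - _) with (RInt (fun s => g s * y s + r s) 0 x - RInt (fun s => g s * z s + r s) 0 x)
        by lra.
      rewrite <- RInt_c01_minus by (auto with c01; lra).
      apply Hint; auto 6 with c01; [nra|].
      intros t Ht. replace (_ - _) with (g t * (y t - z t)) by ring.
      rewrite Rabs_mult, Rmult_assoc. apply Rmult_le_compat; auto using Rabs_pos. }
    unfold Phi.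
    replace (_ - _) with (RInt (fun s => c s * Q y s) 0 s - RInt (fun s => c s * Q z s) 0 s) by lra.
    rewrite <- RInt_c01_minus by (auto with c01; lra).
    assert (0 <= B2 * M / K) by (apply Rdiv_le_0_compat; nra).
    apply Rle_trans with (B1 * (B2 * M / K) / K * exp (K * s)).
    - apply Hint; auto 6 with c01; [nra|].
      intros t Ht. replace (_ - _) with (c t * (Q y t - Q z t)) by ring.
      rewrite Rabs_mult, Rmult_assoc. apply Rmult_le_compat; auto using Rabs_pos.
    - apply Rmult_le_compat_r; [apply Rlt_le, exp_pos|].
      replace (B1 * (B2 * M / K) / K) with (M * (B1 * B2 / (K * K))) by (field; lra).
      apply Rmult_le_compat_l; lra. }
  set (u := fix u k := match k with O => fun _ => y0 | S k => Phi (u k) end).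
  assert (Huc : forall k, cont01 (u k)).
  { induction k; simpl; [apply cont01_const|auto]. }
  destruct (cont01_bounded (fun s => u 1%nat s - u 0%nat s)) as [D [HD Hd]]; [auto with c01|].
  assert (He1 : forall x, 0 <= x <= 1 -> 1 <= exp (K * x) <= exp K).
  { intros x Hx. split.
    - rewrite <- exp_0. destruct (Req_dec x 0) as [->|]; [rewrite Rmult_0_r; lra|].
      apply Rlt_le, exp_increasing. nra.
    - destruct (Req_dec x 1) as [->|]; [rewrite Rmult_1_r; lra|].
      apply Rlt_le, exp_increasing. nra. }
  assert (Hstep : forall k x, 0 <= x <= 1 ->
    Rabs (u (S k) x - u k x) <= D * (1 / 2) ^ k * exp (K * x)).
  { induction k as [|k IH]; intros x Hx.
    - specialize (Hd x Hx). specialize (He1 x Hx). simpl in *. nra.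
    - replace (D * (1 / 2) ^ S k * exp (K * x))
        with (D * (1 / 2) ^ k * (1 / 2) * exp (K * x)) by (simpl; ring).
      apply (Hcontr (u (S k)) (u k)); auto.
      apply Rmult_le_pos; [lra|]. apply pow_le; lra. }
  destruct (geometric_uniform_limit u (D * exp K)) as [y [Hy Hyu]]; [exact Huc| |].
  { intros k x Hx. specialize (Hstep k x Hx). specialize (He1 x Hx).
    eapply Rle_trans; [exact Hstep|].
    replace (D * exp K * (1 / 2) ^ k) with (D * (1 / 2) ^ k * exp K) by ring.
    apply Rmult_le_compat_l; [|lra].
    apply Rmult_le_pos; [lra|]. apply pow_le; lra. }
  assert (Hfix : forall x, 0 <= x <= 1 -> y x = Phi y x).
  { intros x Hx. apply cond_eq. intros eps He.
    assert (0 < exp K) by apply exp_pos.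
    set (E := 2 * (D * exp K)).
    assert (HE : 0 <= E) by (unfold E; nra).
    destruct (half_pow_small (E * (1 + exp K)) eps) as [k Hk]; [nra|exact He|].
    assert (A := Hyu (S k) x Hx). fold E in A.
    assert (0 < (1 / 2) ^ k) by (apply pow_lt; lra).
    assert (B : Rabs (Phi y x - Phi (u k) x) <= E * (1 / 2) ^ k * (1 / 2) * exp (K * x)).
    { apply Hcontr; auto.
      - nra.
      - intros s Hs. specialize (Hyu k s Hs). specialize (He1 s Hs). fold E in Hyu.
        eapply Rle_trans; [exact Hyu|]. rewrite <- (Rmult_1_r (E * _)) at 1.
        apply Rmult_le_compat_l; [|lra]. nra. }
    replace (y x - Phi y x) with ((y x - u (S k) x) - (Phi y x - Phi (u k) x)) by (simpl; ring).
    eapply Rle_lt_trans; [apply Rabs_triang|]. rewrite Rabs_Ropp.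
    specialize (He1 x Hx).
    assert (E * (1 / 2) ^ k * (1 / 2) * exp (K * x) <= E * (1 / 2) ^ k * (1 / 2) * exp K).
    { apply Rmult_le_compat_l; [|lra]. nra. }
    assert (0 <= E * (1 + exp K) * (1 / 2) ^ k) by (apply Rmult_le_pos; nra).
    rewrite <- tech_pow_Rmult in A. lra. }
  exists y, (Q y). split; [|split; [apply HQ, Hy|split]].
  - eapply deriv01_eq; [| |apply HPhi, Hy]; simpl; [symmetry; auto|reflexivity].
  - rewrite Hfix by lra. unfold Phi. rewrite RInt_point. apply Rplus_0_r.
  - unfold Q. rewrite RInt_point. apply Rplus_0_r.
Qed.

(** * Sturm-Liouville theory *)

(** v(x)^2 - v(y)^2 is the integral of 2 v v', hence at most |v|^2 + |v'|^2 for every y; averaging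
    over y adds another |v|^2. *)
Lemma sobolev v dv x : deriv01 v dv -> 0 <= x <= 1 -> v x ^ 2 <= 2 * ip v v + ip dv dv.
Proof.
  intros H Hx. assert (Hv := deriv01_cont _ _ H). assert (Hdv := deriv01_cont_deriv _ _ H).
  assert (Hb : forall y, 0 <= y <= 1 -> v x ^ 2 - (ip v v + ip dv dv) <= v y * v y).
  { intros y Hy.
    assert (E := FTC01 _ _ y x (deriv01_mult _ _ _ _ H H) Hy Hx).
    assert (Hle : Rabs (RInt (fun z => dv z * v z + v z * dv z) y x) <= ip v v + ip dv dv).
    { assert (aux : forall a b, 0 <= a -> a <= b -> b <= 1 ->
        Rabs (RInt (fun z => dv z * v z + v z * dv z) a b) <= ip v v + ip dv dv).
      { intros a b Ha Hab Hb. eapply Rle_trans; [apply RInt_c01_abs; auto 6 with c01|].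
        eapply Rle_trans; [apply RInt_c01_mono_dom; auto 7 with c01; intros; apply Rabs_pos|].
        unfold ip. rewrite <- RInt_c01_plus by (auto with c01; lra).
        apply RInt_c01_le; auto 7 with c01; try lra. intros z _.
        assert (0 <= (v z + dv z) ^ 2) by apply pow2_ge_0.
        assert (0 <= (v z - dv z) ^ 2) by apply pow2_ge_0.
        apply Rabs_le. split; lra. }
      destruct (Rle_dec y x); [apply aux; lra|].
      rewrite <- (opp_RInt_swap (V := R_CompleteNormedModule)).
      - unfold opp; simpl. rewrite Rabs_Ropp. apply aux; lra.
      - apply ex_RInt_c01; auto 6 with c01; lra. }
    apply Rabs_le_between in Hle. rewrite E in Hle. simpl. lra. }
  assert (Hi : RInt (fun _ => v x ^ 2 - (ip v v + ip dv dv)) 0 1 <= ip v v).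
  { apply RInt_c01_le; auto with c01; lra. }
  rewrite RInt_const01 in Hi. lra.
Qed.

Section SturmLiouville.
Variables (p dp q : R -> R) (th1 th2 : R).
Hypothesis Hth1 : 0 <= th1 < PI / 2.
Hypothesis Hth2 : 0 <= th2 <= PI / 2.
Hypothesis Hp : deriv01 p dp.
Hypothesis Hppos : forall x, 0 <= x <= 1 -> 0 < p x.
Hypothesis Hq : cont01 q.
Hypothesis Hqpos : forall x, 0 <= x <= 1 -> 0 < q x.

Let Hpc : cont01 p := deriv01_cont _ _ Hp.

Definition bc (f df : R -> R) : Prop :=
  cos th1 * f 0 - sin th1 * df 0 = 0 /\ cos th2 * f 1 + sin th2 * df 1 = 0.

(** The graph of A restricted to those f for which A f is continuous. The second derivative appears
    only through (p f')' = q f - A f, so Riemann integrals suffice; for t > 0 the homogenised state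
    lies in this class. *)
Definition inD (f df Af : R -> R) : Prop :=
  deriv01 f df /\ deriv01 (fun x => p x * df x) (fun x => q x * f x - Af x) /\ bc f df.

(** The Robin coefficients of the energy form. At a Dirichlet end the sine is 0 and the convention /
    0 = 0 makes the coefficient vanish, which is consistent because the functions vanish there. *)
Definition k0 : R := p 0 * (cos th1 / sin th1).
Definition k1 : R := p 1 * (cos th2 / sin th2).

(** The symmetric form of A. It makes sense for all C^1 functions and equals <A f, g> when f is in
    the domain and g meets the boundary conditions ([aform_green]). *)
Definition aform (f df g dg : R -> R) : R :=
  RInt (fun x => p x * df x * dg x + q x * f x * g x) 0 1
  + k0 * f 0 * g 0 + k1 * f 1 * g 1.

Lemma inD_c0 f df Af : inD f df Af -> cont01 f.
Proof. intros H; apply (deriv01_cont _ df), H. Qed.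

Lemma inD_c1 f df Af : inD f df Af -> cont01 df.
Proof. intros H. apply H. Qed.

Lemma inD_cA f df Af : inD f df Af -> cont01 Af.
Proof.
  intros H. apply (cont01_eq (fun x => q x * f x - (q x * f x - Af x))); [intros; ring|].
  apply cont01_minus; [apply cont01_mult; [exact Hq|apply (inD_c0 _ _ _ H)]|].
  apply H.
Qed.

Hint Resolve Hpc Hq : c01.

Lemma trig1 : 0 < cos th1 /\ 0 <= sin th1.
Proof.
  assert (PI > 0) by apply PI_RGT_0. split.
  - apply cos_gt_0; lra.
  - apply sin_ge_0; lra.
Qed.

Lemma trig2 : 0 <= cos th2 /\ 0 <= sin th2.
Proof.
  assert (PI > 0) by apply PI_RGT_0. split.
  - apply cos_ge_0; lra.
  - apply sin_ge_0; lra.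
Qed.

Lemma div_nonneg a b : 0 <= a -> 0 <= b -> 0 <= a / b.
Proof.
  intros Ha [Hb|<-].
  - apply Rdiv_le_0_compat; assumption.
  - unfold Rdiv. rewrite Rinv_0. lra.
Qed.

Lemma k0_nonneg : 0 <= k0.
Proof.
  destruct trig1. apply Rmult_le_pos; [apply Rlt_le, Hppos; lra|]. apply div_nonneg; lra.
Qed.

Lemma k1_nonneg : 0 <= k1.
Proof.
  destruct trig2. apply Rmult_le_pos; [apply Rlt_le, Hppos; lra|]. apply div_nonneg; lra.
Qed.

(** At a Dirichlet end both sides vanish with g(0); otherwise the condition on f reads f'(0) =
    cot(th1) f(0). *)
Lemma k0_bc f df g dg : bc f df -> bc g dg -> p 0 * df 0 * g 0 = k0 * f 0 * g 0.
Proof.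
  intros [Hf _] [Hg _]. destruct trig1 as [Hc Hs]. unfold k0.
  destruct (Req_dec (sin th1) 0) as [E|E].
  - rewrite E in *. assert (g 0 = 0) as -> by nra. ring.
  - replace (df 0) with (cos th1 / sin th1 * f 0); [ring|].
    apply Rmult_eq_reg_l with (sin th1); [|exact E]. field_simplify; [|exact E]. lra.
Qed.

Lemma k1_bc f df g dg : bc f df -> bc g dg -> p 1 * df 1 * g 1 = - (k1 * f 1 * g 1).
Proof.
  intros [_ Hf] [_ Hg]. destruct trig2 as [Hc Hs]. unfold k1.
  destruct (Req_dec (sin th2) 0) as [E|E].
  - assert (cos th2 <> 0) by (intros E'; assert (X := sin2_cos2 th2);
      unfold Rsqr in X; rewrite E, E' in X; lra).
    rewrite E in *. assert (g 1 = 0) as ->; [|ring].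
    apply Rmult_eq_reg_l with (cos th2); [lra|assumption].
  - replace (df 1) with (- (cos th2 / sin th2 * f 1)); [ring|].
    apply Rmult_eq_reg_l with (sin th2); [|exact E]. field_simplify; [|exact E]. lra.
Qed.

Lemma green f df Af g dg : deriv01 f df ->
  deriv01 (fun x => p x * df x) (fun x => q x * f x - Af x) -> deriv01 g dg -> cont01 Af ->
  RInt (fun x => p x * df x * dg x + q x * f x * g x) 0 1
  = ip Af g + p 1 * df 1 * g 1 - p 0 * df 0 * g 0.
Proof.
  intros Hf HA Hg HcA.
  assert (HP := deriv01_mult _ _ _ _ HA Hg).
  assert (E := FTC01 _ _ 0 1 HP ltac:(lra) ltac:(lra)). simpl in E.
  assert (cont01 f) by apply (deriv01_cont _ _ Hf).
  assert (cont01 df) by apply Hf.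
  assert (cont01 g) by apply (deriv01_cont _ _ Hg).
  assert (cont01 dg) by apply Hg.
  unfold ip. replace (p 1 * df 1 * g 1) with (p 0 * df 0 * g 0 +
    RInt (fun x => (q x * f x - Af x) * g x + p x * df x * dg x) 0 1) by lra.
  transitivity (RInt (fun x => Af x * g x) 0 1 +
     RInt (fun x => (q x * f x - Af x) * g x + p x * df x * dg x) 0 1); [|lra].
  rewrite <- RInt_c01_plus by (auto 8 with c01; lra).
  apply RInt_c01_ext; [lra|lra|]. intros; ring.
Qed.

Lemma aform_green f df Af g dg : inD f df Af -> deriv01 g dg -> bc g dg ->
  aform f df g dg = ip Af g.
Proof.
  intros H Hg Hb. unfold aform.
  rewrite (green f df Af g dg); [|apply H|apply H|exact Hg|apply (inD_cA _ _ _ H)].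
  assert (E0 := k0_bc _ _ _ _ (proj2 (proj2 H)) Hb).
  assert (E1 := k1_bc _ _ _ _ (proj2 (proj2 H)) Hb). lra.
Qed.

Lemma aform_sym f df g dg : aform f df g dg = aform g dg f df.
Proof.
  unfold aform. rewrite (RInt_c01_ext _ (fun x => p x * dg x * df x + q x * g x * f x)); try lra.
  intros. ring.
Qed.

Lemma aform_plus_l f df f' df' g dg : deriv01 f df -> deriv01 f' df' -> deriv01 g dg ->
  aform (fun x => f x + f' x) (fun x => df x + df' x) g dg
  = aform f df g dg + aform f' df' g dg.
Proof.
  intros Hf Hf' Hg. unfold aform.
  assert (cont01 f) by apply (deriv01_cont _ _ Hf). assert (cont01 df) by apply Hf.
  assert (cont01 f') by apply (deriv01_cont _ _ Hf'). assert (cont01 df') by apply Hf'.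
  assert (cont01 g) by apply (deriv01_cont _ _ Hg). assert (cont01 dg) by apply Hg.
  rewrite (RInt_c01_ext _ (fun x => (p x * df x * dg x + q x * f x * g x)
    + (p x * df' x * dg x + q x * f' x * g x))); [|lra|lra|intros; ring].
  rewrite RInt_c01_plus by (auto 6 with c01; lra). lra.
Qed.

Lemma aform_scal_l c f df g dg : deriv01 f df -> deriv01 g dg ->
  aform (fun x => c * f x) (fun x => c * df x) g dg = c * aform f df g dg.
Proof.
  intros Hf Hg. unfold aform.
  assert (cont01 f) by apply (deriv01_cont _ _ Hf). assert (cont01 df) by apply Hf.
  assert (cont01 g) by apply (deriv01_cont _ _ Hg). assert (cont01 dg) by apply Hg.
  rewrite (RInt_c01_ext _ (fun x => c * (p x * df x * dg x + q x * f x * g x)));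
    [|lra|lra|intros; ring].
  rewrite RInt_c01_scal by (auto 6 with c01; lra). lra.
Qed.

Lemma coercive : exists m, 0 < m /\ forall f df, deriv01 f df ->
  m * (ip f f + ip df df) <= aform f df f df.
Proof.
  destruct (cont01_pos_min p Hpc Hppos) as [m1 [Hm1 H1]].
  destruct (cont01_pos_min q Hq Hqpos) as [m2 [Hm2 H2]].
  exists (Rmin m1 m2). split; [apply Rmin_pos; assumption|]. intros f df Hf.
  assert (cont01 f) by apply (deriv01_cont _ _ Hf). assert (cont01 df) by apply Hf.
  unfold aform, ip. rewrite <- RInt_c01_plus, <- RInt_c01_scal by (auto with c01; lra).
  assert (Hi : RInt (fun x => Rmin m1 m2 * (f x * f x + df x * df x)) 0 1
     <= RInt (fun x => p x * df x * df x + q x * f x * f x) 0 1).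
  { apply RInt_c01_le; auto 6 with c01; try lra. intros x Hx.
    specialize (H1 x Hx). specialize (H2 x Hx).
    assert (A1 := Rmin_l m1 m2). assert (A2 := Rmin_r m1 m2).
    assert (0 <= f x * f x) by nra. assert (0 <= df x * df x) by nra. nra. }
  assert (A := k0_nonneg). assert (B := k1_nonneg).
  assert (0 <= k0 * (f 0 * f 0)) by (apply Rmult_le_pos; nra).
  assert (0 <= k1 * (f 1 * f 1)) by (apply Rmult_le_pos; nra). lra.
Qed.

Lemma aform_nonneg f df : deriv01 f df -> 0 <= aform f df f df.
Proof.
  intros H. destruct coercive as [m [Hm Hc]]. specialize (Hc f df H).
  assert (0 <= ip f f) by (apply ip_nonneg, (deriv01_cont _ _ H)).
  assert (0 <= ip df df) by (apply ip_nonneg, H). nra.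
Qed.

Lemma bc_lin f df g dg a b : bc f df -> bc g dg ->
  bc (fun x => a * f x + b * g x) (fun x => a * df x + b * dg x).
Proof.
  intros [H1 H2] [H3 H4]. split.
  - replace (_ - _) with (a * (cos th1 * f 0 - sin th1 * df 0)
      + b * (cos th1 * g 0 - sin th1 * dg 0)) by ring. rewrite H1, H3; ring.
  - replace (_ + _) with (a * (cos th2 * f 1 + sin th2 * df 1)
      + b * (cos th2 * g 1 + sin th2 * dg 1)) by ring. rewrite H2, H4; ring.
Qed.

Lemma inD_lin f df Af g dg Ag a b : inD f df Af -> inD g dg Ag ->
  inD (fun x => a * f x + b * g x) (fun x => a * df x + b * dg x)
      (fun x => a * Af x + b * Ag x).
Proof.
  intros (F1 & F2 & F3) (G1 & G2 & G3). split; [|split].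
  - apply deriv01_plus; apply deriv01_scal; assumption.
  - eapply deriv01_eq; [| |apply (deriv01_plus _ _ _ _ (deriv01_scal a _ _ F2)
      (deriv01_scal b _ _ G2))]; intros; simpl; ring.
  - apply bc_lin; assumption.
Qed.

Lemma inD_zero : inD (fun _ => 0) (fun _ => 0) (fun _ => 0).
Proof.
  split; [apply deriv01_const|]. split; [|split; ring].
  eapply deriv01_eq; [| |apply (deriv01_const 0)]; intros; simpl; ring.
Qed.

Lemma inD_eq f df Af f' df' Af' :
  (forall x, 0 <= x <= 1 -> f x = f' x) -> (forall x, 0 <= x <= 1 -> df x = df' x) ->
  (forall x, 0 <= x <= 1 -> Af x = Af' x) -> inD f df Af -> inD f' df' Af'.
Proof.
  intros E1 E2 E3 (F1 & F2 & F3 & F4). split; [|split; [|split]].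
  - eapply deriv01_eq; [| |exact F1]; assumption.
  - eapply deriv01_eq; [| |exact F2]; intros x Hx; simpl;
      rewrite ?E1, ?E2, ?E3 by assumption; reflexivity.
  - rewrite <- E1, <- E2 by lra. exact F3.
  - rewrite <- E1, <- E2 by lra. exact F4.
Qed.

Lemma inD_fsum n (c : nat -> R) (f df Af : nat -> R -> R) :
  (forall i, (i < n)%nat -> inD (f i) (df i) (Af i)) ->
  inD (fun x => fsum n (fun i => c i * f i x)) (fun x => fsum n (fun i => c i * df i x))
      (fun x => fsum n (fun i => c i * Af i x)).
Proof.
  induction n as [|n IH]; intros H; simpl; [apply inD_zero|].
  eapply inD_eq; [| | |apply (inD_lin _ _ _ _ _ _ 1 (c n) (IH ltac:(intros; apply H; lia))
    (H n ltac:(lia)))]; intros; simpl; ring.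
Qed.

Lemma inD_sym f df Af g dg Ag : inD f df Af -> inD g dg Ag -> ip Af g = ip f Ag.
Proof.
  intros Hf Hg. rewrite <- (aform_green _ _ _ _ _ Hf) by apply Hg.
  rewrite aform_sym, (aform_green _ _ _ _ _ Hg) by apply Hf. apply ip_comm.
Qed.

Lemma inD_energy f df Af : inD f df Af -> aform f df f df = ip Af f.
Proof. intros H. apply aform_green; [exact H|apply H|apply H]. Qed.


Lemma aform_quad f df g dg s : deriv01 f df -> deriv01 g dg ->
  aform (fun x => f x + s * g x) (fun x => df x + s * dg x)
        (fun x => f x + s * g x) (fun x => df x + s * dg x)
  = aform f df f df + 2 * s * aform g dg f df + s ^ 2 * aform g dg g dg.
Proof.
  intros Hf Hg.
  assert (Hs := deriv01_scal s _ _ Hg). assert (Hfs := deriv01_plus _ _ _ _ Hf Hs).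
  rewrite aform_plus_l, aform_scal_l by assumption.
  rewrite (aform_sym f df), (aform_sym g dg).
  rewrite !aform_plus_l, !aform_scal_l by assumption.
  rewrite (aform_sym f df g dg). ring.
Qed.

(** * Eigenfunction expansions, Bessel inequalities and the growth of the eigenvalues *)

Variables (lam : nat -> R) (phi dphi : nat -> R -> R).
Hypothesis HS : SL_spectrum p q th1 th2 lam phi dphi.

Lemma lam_lt n m : (1 <= n)%nat -> (n < m)%nat -> lam n < lam m.
Proof.
  intros Hn Hnm. destruct HS as (_ & Hinc & _).
  induction Hnm as [|m Hnm IH]; [apply Hinc, Hn|].
  eapply Rlt_trans; [exact IH|]. apply Hinc. lia.
Qed.

Lemma lam_le n m : (1 <= n)%nat -> (n <= m)%nat -> lam n <= lam m.
Proof.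
  intros Hn Hnm. destruct (Nat.eq_dec n m) as [->|]; [lra|].
  apply Rlt_le, lam_lt; lia.
Qed.

Lemma lam_pos n : (1 <= n)%nat -> 0 < lam n.
Proof.
  intros Hn. apply Rlt_le_trans with (lam 1%nat); [apply HS|apply lam_le; lia].
Qed.

Lemma phi_inD n : (1 <= n)%nat -> inD (phi n) (dphi n) (fun x => lam n * phi n x).
Proof.
  intros Hn. destruct HS as (_ & _ & He & _). destruct (He n Hn) as [(H1 & H2 & H3) _].
  split; [exact H1|split; [|exact H3]].
  eapply deriv01_eq; [| |exact H2]; intros; simpl; ring.
Qed.

Lemma phi_cont n : (1 <= n)%nat -> cont01 (phi n).
Proof. intros Hn. apply (inD_c0 _ _ _ (phi_inD n Hn)). Qed.

Lemma phi_cont_S k : cont01 (phi (S k)).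
Proof. apply phi_cont. lia. Qed.
Hint Resolve phi_cont_S : c01.

Lemma inD_coef f df Af n : (1 <= n)%nat -> inD f df Af ->
  ip Af (phi n) = lam n * ip f (phi n).
Proof.
  intros Hn Hf. rewrite (inD_sym _ _ _ _ _ _ Hf (phi_inD n Hn)).
  rewrite ip_comm, ip_scal_l, ip_comm; [reflexivity|apply phi_cont, Hn|].
  apply (inD_c0 _ _ _ Hf).
Qed.

Lemma phi_kd i j : ip (phi (S i)) (phi (S j)) = kd i j.
Proof.
  unfold kd. destruct (Nat.eqb_spec i j) as [->|Hij].
  - destruct HS as (_ & _ & He & _). apply He. lia.
  - assert (E := inD_coef _ _ _ (S j) ltac:(lia) (phi_inD (S i) ltac:(lia))).
    rewrite ip_scal_l in E by apply phi_cont_S.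
    assert (lam (S i) <> lam (S j)).
    { destruct (Nat.lt_total i j) as [H|[H|H]]; [|lia|].
      - assert (lam (S i) < lam (S j)) by (apply lam_lt; lia). lra.
      - assert (lam (S j) < lam (S i)) by (apply lam_lt; lia). lra. }
    apply Rmult_eq_reg_l with (lam (S i) - lam (S j)); lra.
Qed.

Definition proj (M : nat) (w : R -> R) (x : R) : R :=
  fsum M (fun k => ip w (phi (S k)) * phi (S k) x).
Definition dproj (M : nat) (w : R -> R) (x : R) : R :=
  fsum M (fun k => ip w (phi (S k)) * dphi (S k) x).
Definition Aproj (M : nat) (w : R -> R) (x : R) : R :=
  fsum M (fun k => ip w (phi (S k)) * (lam (S k) * phi (S k) x)).

Lemma proj_inD M w : inD (proj M w) (dproj M w) (Aproj M w).
Proof.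
  apply (inD_fsum M (fun k => ip w (phi (S k))) (fun k => phi (S k)) (fun k => dphi (S k))
    (fun k x => lam (S k) * phi (S k) x)).
  intros. apply phi_inD. lia.
Qed.

Lemma proj_cont M w : cont01 (proj M w).
Proof. apply (inD_c0 _ _ _ (proj_inD M w)). Qed.
Hint Resolve proj_cont : c01.

Lemma ip_proj M w g : cont01 g ->
  ip (proj M w) g = fsum M (fun k => ip w (phi (S k)) * ip (phi (S k)) g).
Proof.
  intros Hg. unfold proj. rewrite ip_fsum_l by auto with c01.
  apply fsum_ext. intros k _. apply ip_scal_l; auto with c01.
Qed.

Lemma ip_proj_phi M w k : (k < M)%nat -> ip (proj M w) (phi (S k)) = ip w (phi (S k)).
Proof.
  intros Hk. rewrite ip_proj by auto with c01.
  rewrite (fsum_ext _ _ (fun j => kd k j * ip w (phi (S j)))).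
  - apply (fsum_kd M (fun j => ip w (phi (S j)))), Hk.
  - intros j _. rewrite phi_kd. unfold kd. rewrite Nat.eqb_sym. ring.
Qed.

Lemma ip_proj_proj M w : ip (proj M w) (proj M w) = fsum M (fun k => ip w (phi (S k)) ^ 2).
Proof.
  rewrite ip_proj by auto with c01. apply fsum_ext. intros k Hk.
  rewrite (ip_comm (phi (S k))), ip_proj_phi by assumption. ring.
Qed.

Lemma residual_norm M w : cont01 w ->
  ip (fun x => w x + -1 * proj M w x) (fun x => w x + -1 * proj M w x)
  = ip w w - fsum M (fun k => ip w (phi (S k)) ^ 2).
Proof.
  intros Hw. rewrite ip_quad, ip_proj_proj by auto with c01.
  rewrite (ip_comm w (proj M w)), ip_proj by assumption.
  rewrite (fsum_ext M (fun k => ip w (phi (S k)) * ip (phi (S k)) w)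
    (fun k => ip w (phi (S k)) ^ 2)); [ring|].
  intros k _. rewrite (ip_comm (phi (S k))). ring.
Qed.

Lemma bessel M w : cont01 w -> fsum M (fun k => ip w (phi (S k)) ^ 2) <= ip w w.
Proof.
  intros Hw. assert (E := residual_norm M w Hw).
  assert (0 <= ip (fun x => w x + -1 * proj M w x) (fun x => w x + -1 * proj M w x)).
  { apply ip_nonneg. auto with c01. }
  lra.
Qed.

(** Pythagoras for [aform]: the projection is in the domain, so its products with w and with itself
    are both obtained by pairing [Aproj M w] with a function having the same first M coefficients as
    w. *)
Lemma residual_energy M w dw : deriv01 w dw -> bc w dw ->
  aform (fun x => w x + -1 * proj M w x) (fun x => dw x + -1 * dproj M w x)
        (fun x => w x + -1 * proj M w x) (fun x => dw x + -1 * dproj M w x)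
  = aform w dw w dw - fsum M (fun k => lam (S k) * ip w (phi (S k)) ^ 2).
Proof.
  intros Hw Hb. assert (HP := proj_inD M w).
  assert (Hwc := deriv01_cont _ _ Hw).
  rewrite aform_quad; [|exact Hw|apply HP].
  assert (E : forall g, cont01 g ->
    (forall k, (k < M)%nat -> ip g (phi (S k)) = ip w (phi (S k))) ->
    ip (Aproj M w) g = fsum M (fun k => lam (S k) * ip w (phi (S k)) ^ 2)).
  { intros g Hg Hgw. unfold Aproj. rewrite ip_fsum_l by auto 6 with c01.
    apply fsum_ext. intros k Hk. rewrite !ip_scal_l by auto with c01.
    rewrite (ip_comm (phi (S k))), Hgw by assumption. ring. }
  rewrite (aform_green _ _ _ w dw HP Hw Hb), (inD_energy _ _ _ HP).
  rewrite !E by (auto using ip_proj_phi with c01). ring.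
Qed.

Lemma bessel_energy M w dw : deriv01 w dw -> bc w dw ->
  fsum M (fun k => lam (S k) * ip w (phi (S k)) ^ 2) <= aform w dw w dw.
Proof.
  intros Hw Hb. assert (E := residual_energy M w dw Hw Hb).
  assert (A := aform_nonneg (fun x => w x + -1 * proj M w x) (fun x => dw x + -1 * dproj M w x)).
  rewrite E in A. assert (HP := proj_inD M w).
  specialize (A (deriv01_plus _ _ _ _ Hw (deriv01_scal (-1) _ _ (proj1 HP)))). lra.
Qed.

Lemma aform_controls : exists C, 0 < C /\ forall f df, deriv01 f df ->
  ip f f + ip df df <= C * aform f df f df /\
  forall x, 0 <= x <= 1 -> f x ^ 2 <= C * aform f df f df.
Proof.
  destruct coercive as [m [Hm Hc]].
  assert (0 < / m) by (apply Rinv_0_lt_compat, Hm).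
  exists (2 * / m). split; [lra|].
  intros f df Hf. specialize (Hc f df Hf).
  assert (A : ip f f + ip df df <= / m * aform f df f df).
  { apply Rmult_le_reg_l with m; [exact Hm|]. rewrite <- Rmult_assoc, Rinv_r by lra. lra. }
  assert (0 <= ip f f) by (apply ip_nonneg, (deriv01_cont _ _ Hf)).
  assert (0 <= ip df df) by (apply ip_nonneg, Hf).
  split; [lra|]. intros x Hx. assert (B := sobolev _ _ x Hf Hx). lra.
Qed.

(* With v = sum_{k<M} phi_k(x) phi_k one has v(x) = sum phi_k(x)^2 and
   a(v,v) <= lam_M v(x), so that Sobolev's inequality bounds sum phi_k(x)^2 by C lam_M. *)
Lemma lam_growth : exists C, 0 < C /\ forall M, (1 <= M)%nat -> INR M <= C * lam M.
Proof.
  destruct aform_controls as [C [HC Hc]]. exists C. split; [exact HC|]. intros M HM.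
  assert (HSx : forall x, 0 <= x <= 1 -> fsum M (fun k => phi (S k) x * phi (S k) x) <= C * lam M).
  { intros x Hx. set (s := fsum M (fun k => phi (S k) x * phi (S k) x)).
    assert (HV := inD_fsum M (fun k => phi (S k) x) (fun k => phi (S k)) (fun k => dphi (S k))
      (fun k y => lam (S k) * phi (S k) y) ltac:(intros; apply phi_inD; lia)).
    simpl in HV. set (v := fun y => fsum M (fun k => phi (S k) x * phi (S k) y)) in HV.
    assert (Hv : cont01 v) by apply (inD_c0 _ _ _ HV).
    assert (Hs := proj2 (Hc _ _ (proj1 HV)) x Hx). rewrite (inD_energy _ _ _ HV) in Hs.
    assert (Ha : ip (fun y => fsum M (fun k => phi (S k) x * (lam (S k) * phi (S k) y))) v
      <= lam M * s).
    { rewrite ip_fsum_l by auto 6 with c01. unfold s. rewrite <- fsum_scal.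
      apply fsum_le. intros k Hk. rewrite !ip_scal_l by auto with c01.
      assert (E : ip (phi (S k)) v = phi (S k) x).
      { rewrite ip_comm. unfold v. rewrite ip_fsum_l by auto with c01.
        rewrite (fsum_ext _ _ (fun j => kd k j * phi (S j) x)).
        - apply (fsum_kd M (fun j => phi (S j) x)), Hk.
        - intros j _. rewrite ip_scal_l, phi_kd by auto with c01.
          unfold kd. rewrite Nat.eqb_sym. ring. }
      rewrite E. assert (lam (S k) <= lam M) by (apply lam_le; lia).
      assert (0 <= phi (S k) x * phi (S k) x) by nra. nra. }
    assert (Hs0 : 0 <= s) by (apply fsum_nonneg; intros; nra).
    change (v x) with s in Hs. assert (0 < lam M) by (apply lam_pos; lia).
    destruct Hs0 as [Hs0|<-]; [|nra].
    apply Rmult_le_reg_r with s; [exact Hs0|].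
    replace (s ^ 2) with (s * s) in Hs by ring. eapply Rle_trans; [exact Hs|].
    rewrite Rmult_assoc. apply Rmult_le_compat_l; lra. }
  (* Integrating the pointwise bound over x: by orthonormality the sum of the phi_k^2 integrates to
     M. *)
  replace (INR M) with (RInt (fun x => fsum M (fun k => phi (S k) x * phi (S k) x)) 0 1).
  - apply Rle_trans with (RInt (fun _ => C * lam M) 0 1).
    + apply RInt_c01_le; try lra; auto with c01.
      apply cont01_fsum. intros. auto with c01.
    + rewrite RInt_const01. lra.
  - rewrite RInt_c01_fsum by (try lra; intros; auto with c01).
    rewrite (fsum_ext _ _ (fun _ => 1)).
    + clear. induction M; [reflexivity|]. rewrite S_INR. simpl. rewrite IHM. reflexivity.
    + intros k _. assert (E := phi_kd k k). unfold kd in E. rewrite Nat.eqb_refl in E. exact E.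
Qed.

Lemma lam_unbounded B : exists M0, forall M, (M0 <= M)%nat -> B < lam (S M).
Proof.
  destruct lam_growth as [C [HC Hc]].
  destruct (INR_unbounded (C * B)) as [M0 HM0]. exists M0. intros M HM.
  specialize (Hc (S M) ltac:(lia)).
  assert (INR M0 <= INR (S M)) by (apply le_INR; lia).
  apply Rmult_lt_reg_l with C; [exact HC|lra].
Qed.

(** * Initial and boundary value problems, shooting, and the Rayleigh bound *)

Lemma ivp_apriori l : exists B, 0 < B /\ forall d dd r,
  deriv01 d dd -> deriv01 (fun x => p x * dd x) (fun x => (q x - l) * d x - r x) -> cont01 r ->
  d 0 = 0 -> dd 0 = 0 -> forall x, 0 <= x <= 1 ->
  d x ^ 2 <= B * ip r r /\ dd x ^ 2 <= B * ip r r.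
Proof.
  destruct (cont01_pos_min p Hpc Hppos) as [m [Hm Hpm]].
  destruct (cont01_bounded (fun x => q x - l)) as [b [Hb Hqb]]; [auto with c01|].
  (* Gronwall constant for d^2 + (p d')^2: the three summands bound the contributions of d', of q -
     l and of the source r, in this order. *)
  set (C := / m + b + 1). assert (0 < / m) by (apply Rinv_0_lt_compat, Hm).
  assert (HC : 0 < C) by (unfold C; lra).
  assert (He : 0 < exp C) by apply exp_pos.
  assert (Him : 0 < / m ^ 2) by (apply Rinv_0_lt_compat, pow_lt, Hm).
  exists (exp C * (1 + / m ^ 2)). split; [nra|].
  intros d dd r Hd HD Hr E0 E1.
  assert (Hn : 0 <= ip r r) by (apply ip_nonneg, Hr).
  set (D := fun x => p x * dd x) in HD.
  assert (HF := deriv01_plus _ _ _ _ (deriv01_mult _ _ _ _ Hd Hd) (deriv01_mult _ _ _ _ HD HD)).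
  assert (HG : forall x, 0 <= x <= 1 -> d x * d x + D x * D x <= exp C * ip r r).
  { intros x Hx.
    eapply Rle_trans; [apply (gronwall01 _ _ (fun x => r x * r x) C HF); auto with c01; try lra|].
    - intros y _. nra.
    - intros y Hy. specialize (Hpm y Hy). specialize (Hqb y Hy).
      apply Rabs_le_between in Hqb.
      replace (dd y) with (D y * / p y) by (unfold D; field; assert (0 < p y) by (apply Hppos, Hy); lra).
      assert (0 < / p y <= / m).
      { split; [apply Rinv_0_lt_compat; lra|apply Rinv_le_contravar; lra]. }
      set (ip' := / p y) in *. set (g := q y - l) in *. clearbody ip' g.
      assert (A1 : 2 * ip' * (d y * D y) <= ip' * (d y * d y + D y * D y)).
      { assert (0 <= (d y - D y) ^ 2) by apply pow2_ge_0. nra. }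
      assert (A2 : 2 * (d y * D y) * g <= b * (d y * d y + D y * D y)).
      { assert (0 <= (d y - D y) ^ 2) by apply pow2_ge_0.
        assert (0 <= (d y + D y) ^ 2) by apply pow2_ge_0. nra. }
      assert (A3 : - 2 * D y * r y <= D y * D y + r y * r y).
      { assert (0 <= (D y + r y) ^ 2) by apply pow2_ge_0. nra. }
      assert (A4 : ip' * (d y * d y + D y * D y) <= / m * (d y * d y + D y * D y)) by nra.
      assert (0 <= d y * d y) by nra.
      unfold C. lra.
    - rewrite E0. unfold D at 1 2. rewrite E1.
      replace (0 * 0 + p 0 * 0 * (p 0 * 0) + RInt (fun x => r x * r x) 0 1) with (ip r r)
        by (unfold ip; lra).
      apply Rmult_le_compat_r; [exact Hn|].
      destruct (Req_dec x 1) as [->|]; [rewrite Rmult_1_r; lra|].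
      apply Rlt_le, exp_increasing. nra. }
  intros x Hx. specialize (HG x Hx). specialize (Hpm x Hx).
  assert (0 <= d x * d x) by nra. assert (0 <= D x * D x) by nra.
  assert (0 <= exp C * ip r r) by nra.
  split; [nra|].
  apply Rle_trans with (/ m ^ 2 * (exp C * ip r r)); [|nra].
  apply Rmult_le_reg_l with (m ^ 2); [apply pow_lt, Hm|].
  rewrite <- Rmult_assoc, Rinv_r, Rmult_1_l by (apply pow_nonzero; lra).
  apply Rle_trans with (D x * D x); [|lra].
  unfold D. replace (p x * dd x * (p x * dd x)) with (p x ^ 2 * dd x ^ 2) by ring.
  apply Rmult_le_compat_r; [apply pow2_ge_0|]. apply pow_incr. lra.
Qed.

Lemma ivp_solution l r y0 y1 : cont01 r -> exists d dd,
  deriv01 d dd /\ deriv01 (fun x => p x * dd x) (fun x => (q x - l) * d x - r x) /\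
  d 0 = y0 /\ dd 0 = y1.
Proof.
  intros Hr.
  destruct (linear_ivp (fun x => / p x) (fun x => q x - l) (fun x => - r x) y0 (p 0 * y1))
    as (y & Y & H1 & H2 & H3 & H4); auto with c01.
  { apply cont01_inv; [|exact Hpc]. intros x Hx. assert (0 < p x) by (apply Hppos, Hx). lra. }
  exists y, (fun x => / p x * Y x). split; [exact H1|]. split; [|split; [exact H3|]].
  - eapply deriv01_eq; [| |exact H2]; intros x Hx; simpl; [|ring].
    assert (0 < p x) by (apply Hppos, Hx). field. lra.
  - rewrite H4. assert (0 < p 0) by (apply Hppos; lra). field. lra.
Qed.

Lemma ivp_zero l d dd : deriv01 d dd ->
  deriv01 (fun x => p x * dd x) (fun x => (q x - l) * d x) ->
  d 0 = 0 -> dd 0 = 0 -> forall x, 0 <= x <= 1 -> d x = 0.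
Proof.
  intros H1 H2 H3 H4 x Hx. destruct (ivp_apriori l) as [B [_ HB]].
  destruct (HB d dd (fun _ => 0)) with (x := x) as [H _]; auto with c01.
  - eapply deriv01_eq; [| |exact H2]; intros; simpl; ring.
  - unfold ip in H. rewrite (RInt_c01_ext _ (fun _ => 0)) in H; [|lra|lra|intros; ring].
    rewrite RInt_const01 in H. assert (0 <= d x ^ 2) by apply pow2_ge_0.
    assert (d x * d x = 0) by nra. nra.
Qed.

Lemma trig1_sq : sin th1 ^ 2 + cos th1 ^ 2 = 1.
Proof. assert (H := sin2_cos2 th1). unfold Rsqr in H. lra. Qed.

(* Cauchy data satisfying the condition at 0 are proportional to (sin th1, cos th1), the data of the
   shooting solution. *)
Lemma bc0_data f df : cos th1 * f 0 - sin th1 * df 0 = 0 ->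
  f 0 = (f 0 * sin th1 + df 0 * cos th1) * sin th1 /\
  df 0 = (f 0 * sin th1 + df 0 * cos th1) * cos th1.
Proof.
  intros H. assert (E := trig1_sq). split.
  - replace (_ * sin th1) with (f 0 * (sin th1 ^ 2 + cos th1 ^ 2)
      - cos th1 * (cos th1 * f 0 - sin th1 * df 0)) by ring. rewrite E, H. ring.
  - replace (_ * cos th1) with (df 0 * (sin th1 ^ 2 + cos th1 ^ 2)
      + sin th1 * (cos th1 * f 0 - sin th1 * df 0)) by ring. rewrite E, H. ring.
Qed.

(** The data (sin th1, cos th1) satisfy the condition at 0 and are not both 0, so u is nontrivial;
    if u also meets the condition at 1 it is an eigenfunction. The exhaustiveness clause of
    [SL_spectrum] enters here. *)
Lemma shooting l : exists u du, deriv01 u du /\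
  deriv01 (fun x => p x * du x) (fun x => (q x - l) * u x) /\
  u 0 = sin th1 /\ du 0 = cos th1 /\ 0 < ip u u /\
  (cos th2 * u 1 + sin th2 * du 1 = 0 -> exists n, (1 <= n)%nat /\ l = lam n).
Proof.
  destruct (ivp_solution l (fun _ => 0) (sin th1) (cos th1)) as (u & du & H1 & H2 & H3 & H4).
  { auto with c01. }
  assert (H2' : deriv01 (fun x => p x * du x) (fun x => (q x - l) * u x)).
  { eapply deriv01_eq; [| |exact H2]; intros; simpl; ring. }
  assert (Hnz : exists x, 0 <= x <= 1 /\ u x <> 0).
  { destruct (classic (exists x, 0 <= x <= 1 /\ u x <> 0)) as [|Hn]; [assumption|exfalso].
    assert (Hz : forall x, 0 <= x <= 1 -> u x = 0).
    { intros x Hx. destruct (Req_dec (u x) 0); [assumption|]. exfalso. apply Hn. eauto. }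
    assert (Hdz : deriv01 u (fun _ => 0)).
    { eapply deriv01_eq; [| |apply (deriv01_const 0)]; intros; simpl; [symmetry; auto|reflexivity]. }
    assert (E := deriv01_unique _ _ _ H1 Hdz 0 ltac:(lra)).
    assert (E' := Hz 0 ltac:(lra)). assert (T := trig1_sq).
    rewrite <- H3, <- H4, E, E' in T. lra. }
  exists u, du. repeat split; auto; try apply H1; try apply H2'.
  - assert (Hc := deriv01_cont _ _ H1). destruct (ip_nonneg u Hc) as [|E]; [assumption|].
    destruct Hnz as [x [Hx Hux]]. exfalso. apply Hux. apply ip_zero; auto.
  - intros Hb. destruct HS as (_ & _ & _ & Hall). apply (Hall l u du); [|exact Hnz].
    split; [exact H1|]. split; [exact H2'|]. split; [|exact Hb].
    rewrite H3, H4. ring.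
Qed.

(** The solution with zero data at 0 is corrected by a multiple of the shooting solution at l = 0.
    The division by its boundary value at 1 is legitimate because 0 is below all eigenvalues. *)
Lemma bvp_solution f : cont01 f -> exists v dv, inD v dv f.
Proof.
  intros Hf. destruct (shooting 0) as (u & du & U1 & U2 & U3 & U4 & _ & U5).
  destruct (ivp_solution 0 f 0 0 Hf) as (v & dv & V1 & V2 & V3 & V4).
  set (b := cos th2 * u 1 + sin th2 * du 1).
  assert (Hb : b <> 0).
  { intros E. destruct (U5 E) as [n [Hn Hl]]. assert (0 < lam n) by (apply lam_pos, Hn). lra. }
  set (c := - (cos th2 * v 1 + sin th2 * dv 1) / b).
  exists (fun x => v x + c * u x), (fun x => dv x + c * du x). split; [|split; [|split]].
  - apply deriv01_plus; [exact V1|apply deriv01_scal, U1].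
  - eapply deriv01_eq; [| |apply (deriv01_plus _ _ _ _ V2 (deriv01_scal c _ _ U2))];
      intros; simpl; ring.
  - rewrite U3, U4, V3, V4. ring.
  - replace (_ + _) with (cos th2 * v 1 + sin th2 * dv 1 + c * b) by (unfold b; ring).
    unfold c. field. exact Hb.
Qed.

(** v solves the equation with parameter l and source r = f - l v, so v = d + c u, where d has zero
    data at 0 and is controlled by [ivp_apriori], and u is the shooting solution. It remains to
    bound the scalar c, uniformly in v; this takes the role that compactness of the resolvent
    usually plays. *)
Lemma resolvent_bound M l : l < lam (S M) -> exists B, 0 < B /\ forall v dv f,
  inD v dv f -> (forall k, (k < M)%nat -> ip f (phi (S k)) = 0) ->
  ip v v <= B * ip (fun x => f x + - l * v x) (fun x => f x + - l * v x).
Proof.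
  intros Hl. destruct (shooting l) as (u & du & U1 & U2 & U3 & U4 & U5 & U6).
  destruct (ivp_apriori l) as [B0 [HB0 Hap]].
  assert (Huc := deriv01_cont _ _ U1).
  assert (Hred : exists Bc, 0 <= Bc /\ forall v dv f c d dd, inD v dv f ->
    (forall k, (k < M)%nat -> ip f (phi (S k)) = 0) ->
    (forall x, 0 <= x <= 1 -> v x = d x + c * u x) ->
    (forall x, 0 <= x <= 1 -> dv x = dd x + c * du x) -> cont01 d ->
    forall G, (forall x, 0 <= x <= 1 -> d x ^ 2 <= G /\ dd x ^ 2 <= G) -> c ^ 2 <= Bc * G).
  { set (b := cos th2 * u 1 + sin th2 * du 1). destruct (Req_dec b 0) as [Hb|Hb].
    (* Here l is an eigenvalue, necessarily one of the first M, and u is a multiple of its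
       eigenfunction. Orthogonality of v to u then expresses c through <d,u>. *)
    - destruct (U6 Hb) as [n [Hn Hln]].
      assert (HnM : (n <= M)%nat).
      { destruct (Nat.le_gt_cases n M); [assumption|].
        assert (lam (S M) <= lam n) by (apply lam_le; lia). lra. }
      assert (Hpn := phi_inD n Hn). destruct Hpn as (P1 & P2 & P3 & P4).
      destruct (bc0_data _ _ P3) as [D1 D2].
      set (e := phi n 0 * sin th1 + dphi n 0 * cos th1) in *.
      assert (Hpe : forall x, 0 <= x <= 1 -> phi n x = e * u x).
      { intros x Hx. cut (phi n x - e * u x = 0); [lra|].
        apply (ivp_zero l (fun x => phi n x - e * u x) (fun x => dphi n x - e * du x)); auto.
        - apply deriv01_minus; [exact P1|apply deriv01_scal, U1].
        - eapply deriv01_eq; [| |apply (deriv01_minus _ _ _ _ P2 (deriv01_scal e _ _ U2))];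
            intros; simpl; rewrite ?Hln; ring.
        - rewrite U3. lra.
        - rewrite U4. lra. }
      assert (He : e <> 0).
      { intros E. destruct n as [|n]; [lia|]. assert (Z := phi_kd n n).
        unfold kd in Z. rewrite Nat.eqb_refl in Z.
        rewrite (ip_ext _ _ (fun _ => 0) (fun _ => 0)) in Z;
          try (intros x Hx; rewrite Hpe, E by assumption; ring).
        unfold ip in Z. rewrite RInt_const01 in Z. lra. }
      exists (/ ip u u). split; [apply Rlt_le, Rinv_0_lt_compat, U5|].
      intros v dv f c d dd Hv Hf Ev Edv Hd G HG.
      assert (Hvu : ip v u = 0).
      { destruct n as [|n]; [lia|].
        assert (Z := inD_coef _ _ _ (S n) ltac:(lia) Hv). rewrite Hf in Z by lia.
        rewrite (ip_comm v), (ip_ext (phi (S n)) v (fun x => e * u x) v) in Z by auto.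
        rewrite ip_scal_l, ip_comm in Z; [|exact Huc|apply (inD_c0 _ _ _ Hv)].
        assert (0 < lam (S n)) by (apply lam_pos; lia).
        apply Rmult_eq_reg_l with (lam (S n) * e); [|apply Rmult_integral_contrapositive; lra].
        lra. }
      rewrite (ip_ext v u (fun x => d x + c * u x) u), ip_plus_l, ip_scal_l in Hvu
        by auto with c01.
      assert (Hcs := ip_cs d u Hd Huc).
      assert (HdG : ip d d <= G).
      { apply Rle_trans with (RInt (fun _ => G) 0 1); [|rewrite RInt_const01; lra].
        apply RInt_c01_le; auto with c01; try lra. intros x Hx.
        destruct (HG x Hx) as [H1 _]. simpl in H1. lra. }
      replace (ip d u) with (- (c * ip u u)) in Hcs by lra.
      apply Rmult_le_reg_l with (ip u u); [exact U5|].
      rewrite <- Rmult_assoc, Rinv_r by lra.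
      apply Rmult_le_reg_l with (ip u u); [exact U5|]. nra.
    (* Here l is not an eigenvalue, and the boundary condition of v at 1 gives c b = -(cos th2 d(1)
       + sin th2 d'(1)). *)
    - exists (4 * / b ^ 2).
      assert (Hib : 0 < / b ^ 2).
      { apply Rinv_0_lt_compat. assert (0 < b * b) by (apply Rsqr_pos_lt, Hb). simpl. lra. }
      split; [lra|].
      intros v dv f c d dd Hv Hf Ev Edv Hd G HG.
      destruct Hv as (_ & _ & _ & Hbc). rewrite Ev, Edv in Hbc by lra.
      assert (E : c * b = - (cos th2 * d 1 + sin th2 * dd 1)) by (unfold b; lra).
      destruct (HG 1 ltac:(lra)) as [G1 G2].
      assert (T := sin2_cos2 th2). unfold Rsqr in T.
      assert (Hcb : (c * b) ^ 2 <= 4 * G).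
      { rewrite E.
        assert (0 <= (cos th2 * dd 1 - sin th2 * d 1) ^ 2) by apply pow2_ge_0.
        assert (0 <= d 1 ^ 2) by apply pow2_ge_0.
        replace ((- (cos th2 * d 1 + sin th2 * dd 1)) ^ 2) with
          ((sin th2 * sin th2 + cos th2 * cos th2) * (d 1 ^ 2 + dd 1 ^ 2)
           - (cos th2 * dd 1 - sin th2 * d 1) ^ 2) by ring.
        rewrite T. lra. }
      replace (c ^ 2) with (/ b ^ 2 * (c * b) ^ 2) by (field; exact Hb).
      rewrite (Rmult_comm 4), Rmult_assoc. apply Rmult_le_compat_l; lra. }
  destruct Hred as [Bc [HBc Hred]].
  exists (2 * B0 + 2 * (Bc * B0) * ip u u).
  assert (HBcB0 : 0 <= Bc * B0) by nra. split; [nra|].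
  intros v dv f Hv Hf.
  set (r := fun x => f x + - l * v x).
  assert (Hvc := inD_c0 _ _ _ Hv). assert (Hfc := inD_cA _ _ _ Hv).
  assert (Hrc : cont01 r) by (unfold r; auto with c01).
  assert (Hr0 : 0 <= ip r r) by (apply ip_nonneg, Hrc).
  destruct Hv as (V1 & V2 & V3) eqn:EHv. clear EHv.
  destruct (bc0_data _ _ (proj1 V3)) as [D1 D2].
  set (c := v 0 * sin th1 + dv 0 * cos th1) in *.
  set (d := fun x => v x - c * u x). set (dd := fun x => dv x - c * du x).
  assert (HG : forall x, 0 <= x <= 1 -> d x ^ 2 <= B0 * ip r r /\ dd x ^ 2 <= B0 * ip r r).
  { apply Hap; auto.
    - apply deriv01_minus; [exact V1|apply deriv01_scal, U1].
    - eapply deriv01_eq; [| |apply (deriv01_minus _ _ _ _ V2 (deriv01_scal c _ _ U2))];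
        intros; unfold d, dd, r; simpl; ring.
    - unfold d. rewrite U3. lra.
    - unfold dd. rewrite U4. lra. }
  assert (Hdc : cont01 d) by (unfold d; auto with c01).
  assert (Hcc : c ^ 2 <= Bc * (B0 * ip r r)).
  { apply (Hred v dv f c d dd); auto; intros; unfold d, dd; ring. }
  assert (HI : RInt (fun x => v x * v x) 0 1
     <= RInt (fun x => 2 * (B0 * ip r r) + 2 * c ^ 2 * (u x * u x)) 0 1).
  { apply RInt_c01_le; auto with c01; try lra. intros x Hx.
    destruct (HG x Hx) as [H1 _].
    replace (v x) with (d x + c * u x) by (unfold d; ring).
    assert (0 <= (d x - c * u x) ^ 2) by apply pow2_ge_0. nra. }
  rewrite RInt_c01_plus, (RInt_c01_scal (2 * c ^ 2)), RInt_const01 in HI by (auto with c01; lra).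
  change (RInt (fun x => u x * u x) 0 1) with (ip u u) in HI.
  change (RInt (fun x => v x * v x) 0 1) with (ip v v) in HI.
  assert (2 * c ^ 2 * ip u u <= 2 * (Bc * (B0 * ip r r)) * ip u u).
  { apply Rmult_le_compat_r; lra. }
  lra.
Qed.

(* The supremum mu of <Tf,f> over unit f orthogonal to phi_1 .. phi_M (T = A^{-1}) cannot exceed
   1 / lam_{M+1}: near-maximisers satisfy |Tf - mu f| -> 0, against [resolvent_bound]. *)
Lemma rayleigh M v dv f : inD v dv f ->
  (forall k, (k < M)%nat -> ip f (phi (S k)) = 0) -> lam (S M) * ip v f <= ip f f.
Proof.
  intros Hv Hf. apply Rnot_lt_le. intros Hlt.
  assert (HlS : 0 < lam (S M)) by (apply lam_pos; lia).
  set (orth := fun f : R -> R => forall k, (k < M)%nat -> ip f (phi (S k)) = 0).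
  assert (Hz : forall v dv f, inD v dv f -> ip f f = 0 -> ip v f = 0).
  { intros v' dv' f' Hi E. assert (Hc := ip_cs v' f' (inD_c0 _ _ _ Hi) (inD_cA _ _ _ Hi)).
    rewrite E, Rmult_0_r in Hc. assert (0 <= ip v' f' ^ 2) by apply pow2_ge_0.
    assert (ip v' f' * ip v' f' = 0) by nra. nra. }
  assert (Hnorm : forall v dv f, inD v dv f -> orth f -> 0 < ip f f ->
    exists v' dv' f', inD v' dv' f' /\ orth f' /\ ip f' f' = 1 /\ ip v' f' = ip v f / ip f f).
  { clear v dv f Hv Hf Hlt. intros v dv f Hv Hf H0.
    assert (Hvc := inD_c0 _ _ _ Hv). assert (Hfc := inD_cA _ _ _ Hv).
    assert (Hs := sqrt_lt_R0 _ H0). assert (Hss := sqrt_sqrt (ip f f) (Rlt_le _ _ H0)).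
    set (s := sqrt (ip f f)) in *.
    exists (fun x => / s * v x), (fun x => / s * dv x), (fun x => / s * f x).
    split; [|split; [|split]].
    - eapply inD_eq; [| | |apply (inD_lin _ _ _ _ _ _ (/ s) 0 Hv Hv)]; intros; simpl; ring.
    - intros k Hk. rewrite ip_scal_l, Hf by auto with c01. ring.
    - rewrite ip_scal_l, ip_comm, ip_scal_l, <- Hss by auto with c01. field. lra.
    - rewrite ip_scal_l, ip_comm, ip_scal_l, <- Hss, (ip_comm f v) by auto with c01.
      field. lra. }
  destruct coercive as [m [Hm Hco]].
  set (E := fun r => exists v dv f, inD v dv f /\ orth f /\ ip f f = 1 /\ r = ip v f).
  assert (Hbd : bound E).
  { exists (/ m). intros r (v' & dv' & f' & Hi & _ & E1 & ->).
    assert (Hc := ip_cs v' f' (inD_c0 _ _ _ Hi) (inD_cA _ _ _ Hi)). rewrite E1 in Hc.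
    specialize (Hco v' dv' (proj1 Hi)). rewrite (inD_energy _ _ _ Hi), (ip_comm f') in Hco.
    assert (0 <= ip v' v') by (apply ip_nonneg, (inD_c0 _ _ _ Hi)).
    assert (0 <= ip dv' dv') by (apply ip_nonneg, (inD_c1 _ _ _ Hi)).
    apply Rmult_le_reg_l with m; [exact Hm|]. rewrite Rinv_r by lra.
    assert (m * ip v' v' <= ip v' f') by nra.
    assert (m * ip v' f' ^ 2 <= ip v' f') by nra. nra. }
  assert (Hff : 0 < ip f f).
  { destruct (ip_nonneg f (inD_cA _ _ _ Hv)) as [|E0]; [assumption|].
    rewrite (Hz _ _ _ Hv (eq_sym E0)) in Hlt. lra. }
  destruct (Hnorm v dv f Hv Hf Hff) as (v0 & dv0 & f0 & Hv0 & Hf0 & Hn0 & Hr0).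
  assert (Hgt : / lam (S M) < ip v0 f0).
  { rewrite Hr0. apply Rmult_lt_reg_l with (lam (S M)); [exact HlS|].
    rewrite Rinv_r by lra. apply Rmult_lt_reg_r with (ip f f); [exact Hff|].
    unfold Rdiv. rewrite Rmult_1_l, !Rmult_assoc, Rinv_l by lra. lra. }
  destruct (completeness E Hbd) as [mu [Hub Hlub]].
  { exists (ip v0 f0), v0, dv0, f0. auto. }
  assert (Hmu0 : / lam (S M) < mu).
  { eapply Rlt_le_trans; [exact Hgt|]. apply Hub. exists v0, dv0, f0. auto. }
  assert (Hil : 0 < / lam (S M)) by (apply Rinv_0_lt_compat, HlS).
  assert (Hmu : forall v dv f, inD v dv f -> orth f -> ip v f <= mu * ip f f).
  { intros v1 dv1 f1 Hi Ho. destruct (ip_nonneg f1 (inD_cA _ _ _ Hi)) as [Hp1|E0].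
    - destruct (Hnorm v1 dv1 f1 Hi Ho Hp1) as (v2 & dv2 & f2 & A1 & A2 & A3 & A4).
      assert (A5 : ip v2 f2 <= mu) by (apply Hub; exists v2, dv2, f2; auto).
      rewrite A4 in A5. apply Rle_div_l in A5; lra.
    - rewrite <- E0, (Hz _ _ _ Hi (eq_sym E0)). lra. }
  (* If mu exceeded 1 / lam_{M+1}, then 1/mu would be below lam_{M+1}, where [resolvent_bound] holds
     even when 1/mu is one of the first M eigenvalues. *)
  assert (Hl : / mu < lam (S M)).
  { rewrite <- (Rinv_inv (lam (S M))). apply Rinv_lt_contravar; [nra|exact Hmu0]. }
  destruct (resolvent_bound M (/ mu) Hl) as [B [HB Hres]].
  (* The final contradiction reads 1 = <f1,f1> <= 2 |rr|^2 + (2 / mu^2) |v1|^2 <= 2 (1 + B / mu^2)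
     eps / mu = c eps, against eps <= 1 / (2 c). *)
  set (c := 2 * (1 + / mu ^ 2 * B) / mu).
  assert (Him : 0 < / mu ^ 2) by (apply Rinv_0_lt_compat, pow_lt; lra).
  assert (Hc : 0 < c) by (unfold c; apply Rdiv_lt_0_compat; nra).
  set (eps := Rmin (/ (2 * c)) mu).
  assert (He : 0 < eps).
  { apply Rmin_pos; [apply Rinv_0_lt_compat; lra|lra]. }
  assert (exists r, E r /\ mu - eps < r) as [r [(v1 & dv1 & f1 & Hi & Ho & E1 & ->) Hr]].
  { destruct (classic (exists r, E r /\ mu - eps < r)) as [|Hn]; [assumption|exfalso].
    assert (mu <= mu - eps); [|lra]. apply Hlub. intros r Er.
    apply Rnot_lt_le. intros Hr. apply Hn. eauto. }
  assert (Hvc := inD_c0 _ _ _ Hi). assert (Hfc := inD_cA _ _ _ Hi).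
  assert (Hvo : orth v1).
  { intros k Hk. assert (Z := inD_coef _ _ _ (S k) ltac:(lia) Hi). rewrite Ho in Z by assumption.
    assert (0 < lam (S k)) by (apply lam_pos; lia).
    apply Rmult_eq_reg_l with (lam (S k)); lra. }
  (* Cauchy-Schwarz for the form <Tf,g>, T being the inverse of A: with v1 = T f1 and w = T v1,
     |v1|^4 = <T f1, v1>^2 <= <v1,f1> <w,v1> <= <v1,f1> mu |v1|^2. *)
  assert (Hvv : ip v1 v1 <= mu * ip v1 f1).
  { destruct (bvp_solution v1 Hvc) as (w & dw & Hw).
    assert (Hwv := Hmu w dw v1 Hw Hvo). assert (Hwc := inD_c0 _ _ _ Hw).
    assert (Hq1 : ip v1 v1 ^ 2 <= ip v1 f1 * ip w v1).
    { apply quad_discr.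
      - rewrite ip_comm, <- (inD_energy _ _ _ Hi). apply aform_nonneg, Hi.
      - intros s. assert (Hsum := inD_lin _ _ _ _ _ _ 1 s Hi Hw).
        assert (A := aform_nonneg _ _ (proj1 Hsum)). rewrite (inD_energy _ _ _ Hsum) in A.
        rewrite ip_plus_l, !ip_scal_l in A by auto with c01.
        rewrite (ip_comm f1), (ip_comm v1 (fun x => _)) in A.
        rewrite !ip_plus_l, !ip_scal_l in A by auto with c01.
        assert (Z := inD_sym _ _ _ _ _ _ Hi Hw).
        rewrite (ip_comm f1 w) in Z. rewrite Z in A. lra. }
    assert (0 <= ip v1 v1) by (apply ip_nonneg, Hvc).
    assert (Hvf : 0 <= ip v1 f1).
    { rewrite ip_comm, <- (inD_energy _ _ _ Hi). apply aform_nonneg, Hi. }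
    destruct H as [H|H]; [|nra].
    apply Rmult_le_reg_r with (ip v1 v1); [exact H|]. nra. }
  assert (Hres1 := Hres v1 dv1 f1 Hi Ho).
  set (rr := fun x => f1 x + - / mu * v1 x) in *.
  assert (Hrc : cont01 rr) by (unfold rr; auto with c01).
  (* Expanding, mu^2 |rr|^2 = mu^2 - 2 mu <v1,f1> + |v1|^2 <= mu (mu - <v1,f1>) <= mu eps, by the
     preceding estimate and near-maximality. *)
  assert (Hrn : ip rr rr <= eps / mu).
  { unfold rr. rewrite ip_quad, E1, (ip_comm f1) by auto with c01.
    apply Rmult_le_reg_l with (mu ^ 2); [apply pow_lt; lra|].
    replace (mu ^ 2 * (eps / mu)) with (mu * eps) by (field; lra).
    replace (mu ^ 2 * (1 + 2 * - / mu * ip v1 f1 + (- / mu) ^ 2 * ip v1 v1))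
      with (mu ^ 2 - 2 * mu * ip v1 f1 + ip v1 v1) by (field; lra).
    nra. }
  assert (H1 : 1 <= 2 * ip rr rr + 2 * (/ mu ^ 2 * ip v1 v1)).
  { rewrite <- E1.
    assert (HI : RInt (fun x => f1 x * f1 x) 0 1
       <= RInt (fun x => 2 * (rr x * rr x) + 2 * / mu ^ 2 * (v1 x * v1 x)) 0 1).
    { apply RInt_c01_le; auto with c01; try lra. intros x Hx.
      replace (f1 x) with (rr x + / mu * v1 x) by (unfold rr; ring).
      replace (/ mu ^ 2) with (/ mu * / mu) by (field; lra).
      assert (0 <= (rr x - / mu * v1 x) ^ 2) by apply pow2_ge_0. nra. }
    rewrite RInt_c01_plus, !RInt_c01_scal in HI by (auto with c01; lra).
    unfold ip. lra. }
  assert (H2 : 1 <= c * eps).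
  { unfold c. replace (2 * (1 + / mu ^ 2 * B) / mu * eps)
      with (2 * (eps / mu) + 2 * (/ mu ^ 2 * (B * (eps / mu)))) by (field; lra).
    assert (/ mu ^ 2 * ip v1 v1 <= / mu ^ 2 * (B * (eps / mu))).
    { apply Rmult_le_compat_l; [lra|]. eapply Rle_trans; [exact Hres1|].
      apply Rmult_le_compat_l; lra. }
    lra. }
  assert (eps <= / (2 * c)) by apply Rmin_l.
  assert (c * / (2 * c) = 1 / 2) by (field; lra). nra.
Qed.

(** * Spectral residuals and the trace of the derivative at 0 *)

Lemma residual_inD M w dw f : inD w dw f ->
  inD (fun x => w x + -1 * proj M w x) (fun x => dw x + -1 * dproj M w x)
      (fun x => f x + -1 * Aproj M w x).
Proof.
  intros H. eapply inD_eq; [| | |apply (inD_lin _ _ _ _ _ _ 1 (-1) H (proj_inD M w))];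
    intros; simpl; ring.
Qed.

Lemma Aproj_proj M w dw f : inD w dw f -> forall x, Aproj M w x = proj M f x.
Proof.
  intros H x. apply fsum_ext. intros k Hk. rewrite (inD_coef _ _ _ (S k) ltac:(lia) H). ring.
Qed.

(** Stands in for Parseval in the energy norm: the residual of w satisfies the orthogonality
    hypothesis of [rayleigh], and its image under A is the L^2 residual of f, whose norm does not
    exceed that of f. *)
Lemma energy_tail M w dw f : inD w dw f ->
  lam (S M) * (aform w dw w dw - fsum M (fun k => lam (S k) * ip w (phi (S k)) ^ 2)) <= ip f f.
Proof.
  intros H. rewrite <- residual_energy by apply H.
  assert (HR := residual_inD M _ _ _ H). rewrite (inD_energy _ _ _ HR), ip_comm.
  assert (Hfc := inD_cA _ _ _ H).
  eapply Rle_trans; [apply (rayleigh M _ _ _ HR)|].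
  - intros k Hk.
    rewrite (ip_ext _ (phi (S k)) (fun x => f x + -1 * proj M f x) (phi (S k)));
      [|intros; rewrite (Aproj_proj _ _ _ _ H); reflexivity|reflexivity].
    rewrite ip_plus_l, ip_scal_l, ip_proj_phi by auto with c01. ring.
  - rewrite (ip_ext _ _ (fun x => f x + -1 * proj M f x) (fun x => f x + -1 * proj M f x));
      try (intros; rewrite (Aproj_proj _ _ _ _ H); reflexivity).
    rewrite residual_norm by assumption.
    assert (0 <= fsum M (fun k => ip f (phi (S k)) ^ 2)).
    { apply fsum_nonneg. intros. apply pow2_ge_0. }
    lra.
Qed.

(** Interpolation for U = p w': U(0)^2 differs from U(y)^2 by the integral of 2 U U', with U' = q w
    - f. A weighted Young inequality puts an arbitrarily small weight on |f|^2 and the rest on the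
    energy. *)
Lemma trace_bound eta : 0 < eta -> exists C, 0 < C /\ forall w dw f, inD w dw f ->
  dw 0 ^ 2 <= C * aform w dw w dw + eta * ip f f.
Proof.
  intros Heta.
  destruct aform_controls as [C1 [HC1 Hc]].
  destruct (cont01_bounded p Hpc) as [b [Hb Hpb]].
  destruct (cont01_bounded q Hq) as [b' [Hb' Hqb]].
  assert (Hp0 : 0 < p 0) by (apply Hppos; lra).
  (* The bound for U(0)^2 = p(0)^2 w'(0)^2 contains 2 s |f|^2; division by p(0)^2 must leave eta
     |f|^2. *)
  set (s := eta * p 0 ^ 2 / 2).
  assert (Hs : 0 < s) by (unfold s; assert (0 < p 0 ^ 2) by (apply pow_lt; lra); nra).
  set (k := 1 + / s). assert (Hk : 0 < k) by (unfold k; assert (0 < / s) by (apply Rinv_0_lt_compat, Hs); lra).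
  set (C2 := (k * b ^ 2 + 2 * s * b' ^ 2) * C1).
  assert (HC2 : 0 < C2).
  { unfold C2. apply Rmult_lt_0_compat; [|exact HC1].
    assert (0 < b ^ 2) by (apply pow_lt; lra). assert (0 < b' ^ 2) by (apply pow_lt; lra). nra. }
  assert (Hp2 : 0 < p 0 ^ 2) by (apply pow_lt; lra).
  exists (C2 / p 0 ^ 2). split; [apply Rdiv_lt_0_compat; assumption|].
  intros w dw f H. assert (Hfc := inD_cA _ _ _ H). assert (Hwc := inD_c0 _ _ _ H).
  assert (Hdc := inD_c1 _ _ _ H).
  set (U := fun x => p x * dw x). set (dU := fun x => q x * w x - f x).
  assert (HU : deriv01 U dU) by apply H.
  assert (HUc : cont01 U) by (unfold U; auto with c01).
  assert (HdUc : cont01 dU) by (unfold dU; auto with c01).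
  assert (Hb1 : forall y, 0 <= y <= 1 ->
    U 0 ^ 2 - (/ s * ip U U + s * ip dU dU) <= U y * U y).
  { intros y Hy.
    assert (E := FTC01 _ _ 0 y (deriv01_mult _ _ _ _ HU HU) ltac:(lra) Hy). simpl in E.
    assert (Hle : RInt (fun x => - (dU x * U x + U x * dU x)) 0 y
        <= RInt (fun x => / s * (U x * U x) + s * (dU x * dU x)) 0 y).
    { apply RInt_c01_le; auto 7 with c01; try lra. intros x _.
      assert (0 <= / s * (U x + s * dU x) ^ 2).
      { apply Rmult_le_pos; [apply Rlt_le, Rinv_0_lt_compat, Hs|apply pow2_ge_0]. }
      replace (/ s * (U x + s * dU x) ^ 2) with
        (/ s * (U x * U x) + 2 * (U x * dU x) + s * (dU x * dU x)) in H0 by (field; lra). lra. }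
    rewrite RInt_c01_opp in Hle by (auto with c01; lra).
    assert (Hm : RInt (fun x => / s * (U x * U x) + s * (dU x * dU x)) 0 y
      <= RInt (fun x => / s * (U x * U x) + s * (dU x * dU x)) 0 1).
    { apply RInt_c01_mono_dom; auto 7 with c01; try lra. intros x _.
      assert (0 < / s) by (apply Rinv_0_lt_compat, Hs). nra. }
    rewrite (RInt_c01_plus _ _ 0 1), !(RInt_c01_scal _ _ 0 1) in Hm by (auto with c01; lra).
    unfold ip. lra. }
  assert (Hi : RInt (fun _ => U 0 ^ 2 - (/ s * ip U U + s * ip dU dU)) 0 1 <= ip U U).
  { apply RInt_c01_le; auto with c01; lra. }
  rewrite RInt_const01 in Hi.
  assert (HUU : ip U U <= b ^ 2 * ip dw dw).
  { unfold ip. rewrite <- RInt_c01_scal by (auto with c01; lra).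
    apply RInt_c01_le; auto 6 with c01; try lra. intros x Hx. unfold U.
    specialize (Hpb x Hx). apply Rabs_le_between in Hpb. assert (0 < p x) by (apply Hppos, Hx).
    replace (p x * dw x * (p x * dw x)) with (p x ^ 2 * (dw x * dw x)) by ring.
    apply Rmult_le_compat_r; [nra|]. apply pow_incr. lra. }
  assert (HdU : ip dU dU <= 2 * b' ^ 2 * ip w w + 2 * ip f f).
  { unfold ip. rewrite <- !RInt_c01_scal, <- RInt_c01_plus by (auto with c01; lra).
    apply RInt_c01_le; auto 7 with c01; try lra. intros x Hx. unfold dU.
    specialize (Hqb x Hx). apply Rabs_le_between in Hqb. assert (0 < q x) by (apply Hqpos, Hx).
    assert (q x ^ 2 <= b' ^ 2) by (apply pow_incr; lra).
    assert (0 <= (q x * w x + f x) ^ 2) by apply pow2_ge_0.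
    assert (q x ^ 2 * (w x * w x) <= b' ^ 2 * (w x * w x)) by (apply Rmult_le_compat_r; nra).
    lra. }
  destruct (Hc w dw (proj1 H)) as [Hcw _].
  assert (0 <= ip w w) by (apply ip_nonneg, Hwc). assert (0 <= ip dw dw) by (apply ip_nonneg, Hdc).
  set (a := aform w dw w dw) in *.
  apply Rmult_le_reg_l with (p 0 ^ 2); [exact Hp2|].
  replace (p 0 ^ 2 * (C2 / p 0 ^ 2 * a + eta * ip f f)) with (C2 * a + 2 * s * ip f f)
    by (unfold s; field; lra).
  replace (p 0 ^ 2 * dw 0 ^ 2) with (U 0 ^ 2) by (unfold U; ring).
  assert (A1 : U 0 ^ 2 <= k * ip U U + s * ip dU dU) by (unfold k; lra).
  assert (A2 : k * ip U U <= k * (b ^ 2 * ip dw dw)) by (apply Rmult_le_compat_l; lra).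
  assert (A3 : s * ip dU dU <= s * (2 * b' ^ 2 * ip w w + 2 * ip f f)) by (apply Rmult_le_compat_l; lra).
  assert (A4 : (k * b ^ 2 + 2 * s * b' ^ 2) * (ip w w + ip dw dw) <= C2 * a).
  { unfold C2. rewrite (Rmult_assoc (k * b ^ 2 + 2 * s * b' ^ 2)).
    apply Rmult_le_compat_l; [|exact Hcw].
    assert (0 <= b ^ 2) by apply pow2_ge_0. assert (0 <= b' ^ 2) by apply pow2_ge_0. nra. }
  assert (0 <= k * b ^ 2 * ip w w).
  { apply Rmult_le_pos; [|assumption]. apply Rmult_le_pos; [lra|apply pow2_ge_0]. }
  assert (0 <= 2 * s * b' ^ 2 * ip dw dw).
  { apply Rmult_le_pos; [|assumption]. apply Rmult_le_pos; [lra|apply pow2_ge_0]. }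
  lra.
Qed.

(** [trace_bound] with eta/2, applied to the residual: by [energy_tail] its energy is at most |f|^2
    / lam_{M+1}, and the constant of [trace_bound] is beaten by lam_{M+1} for large M. M0 does not
    depend on w, which makes the convergence of the trace uniform in time wherever |A w| is
    bounded. *)
Lemma trace_tail eta : 0 < eta -> exists M0, forall M w dw f, (M0 <= M)%nat -> inD w dw f ->
  (dw 0 - fsum M (fun k => ip w (phi (S k)) * dphi (S k) 0)) ^ 2 <= eta * ip f f.
Proof.
  intros Heta. destruct (trace_bound (eta / 2)) as [C [HC Ht]]; [lra|].
  destruct (lam_unbounded (2 * C / eta)) as [M0 HM0]. exists M0. intros M w dw f HM H.
  assert (HR := residual_inD M _ _ _ H). specialize (Ht _ _ _ HR).
  assert (Hfc := inD_cA _ _ _ H).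
  assert (E : ip (fun x => f x + -1 * Aproj M w x) (fun x => f x + -1 * Aproj M w x) <= ip f f).
  { rewrite (ip_ext _ _ (fun x => f x + -1 * proj M f x) (fun x => f x + -1 * proj M f x));
      try (intros; rewrite (Aproj_proj _ _ _ _ H); reflexivity).
    rewrite residual_norm by assumption.
    assert (0 <= fsum M (fun k => ip f (phi (S k)) ^ 2)).
    { apply fsum_nonneg. intros. apply pow2_ge_0. }
    lra. }
  assert (Ha := energy_tail M _ _ _ H). rewrite <- residual_energy in Ha by apply H.
  set (a := aform _ _ _ _) in *.
  replace (dw 0 - _) with (dw 0 + -1 * dproj M w 0) by (unfold dproj; ring).
  assert (0 < lam (S M)) by (apply lam_pos; lia).
  assert (HCa : C * a <= eta / 2 * ip f f).
  { specialize (HM0 M HM). apply Rmult_le_reg_l with (lam (S M)); [assumption|].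
    replace (lam (S M) * (C * a)) with (C * (lam (S M) * a)) by ring.
    apply Rle_trans with (C * ip f f); [apply Rmult_le_compat_l; lra|].
    rewrite <- Rmult_assoc. apply Rmult_le_compat_r; [apply ip_nonneg, Hfc|].
    apply Rmult_le_reg_r with (2 / eta); [apply Rdiv_lt_0_compat; lra|].
    replace (lam (S M) * (eta / 2) * (2 / eta)) with (lam (S M)) by (field; lra).
    replace (C * (2 / eta)) with (2 * C / eta) by (field; lra). lra. }
  assert (eta / 2 * ip (fun x => f x + -1 * Aproj M w x) (fun x => f x + -1 * Aproj M w x)
    <= eta / 2 * ip f f) by (apply Rmult_le_compat_l; lra).
  lra.
Qed.

(* Testing phi_n against a function v outside the domain represents a boundary functional of phi_n
   as lam_n <phi_n,v> - <phi_n,g> with g = -(p v')' + q v. *)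
Lemma boundary_test v dv g (l : nat -> R) : deriv01 v dv ->
  deriv01 (fun x => p x * dv x) (fun x => q x * v x - g x) -> cont01 g ->
  (forall n, (1 <= n)%nat -> l n = p 0 * (dphi n 0 * v 0 - phi n 0 * dv 0)
                           - p 1 * (dphi n 1 * v 1 - phi n 1 * dv 1)) ->
  exists C, 0 < C /\ forall M n, (1 <= n)%nat ->
    fsum M (fun k => (l (n + k)%nat / lam (n + k)%nat) ^ 2) <= C.
Proof.
  intros Hv Hpv Hg Hl. assert (Hvc := deriv01_cont _ _ Hv).
  assert (E : forall n, (1 <= n)%nat -> l n = lam n * ip v (phi n) - ip g (phi n)).
  { intros n Hn. rewrite (Hl n Hn). assert (Hph := phi_inD n Hn).
    assert (Hpc' := phi_cont n Hn).
    assert (E1 := green _ _ _ _ _ (proj1 Hph) (proj1 (proj2 Hph)) Hv (inD_cA _ _ _ Hph)).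
    assert (E2 := green v dv g _ _ Hv Hpv (proj1 Hph) Hg).
    rewrite (RInt_c01_ext _ (fun x => p x * dv x * dphi n x + q x * v x * phi n x)) in E1;
      [|lra|lra|intros; ring].
    rewrite ip_scal_l, (ip_comm (phi n)) in E1 by auto with c01. lra. }
  assert (H1 : 0 < lam 1%nat) by (apply lam_pos; lia).
  assert (Hi1 : 0 < / lam 1%nat ^ 2) by (apply Rinv_0_lt_compat, pow_lt, H1).
  assert (Hvv : 0 <= ip v v) by (apply ip_nonneg, Hvc).
  assert (Hgg : 0 <= ip g g) by (apply ip_nonneg, Hg).
  exists (2 * ip v v + 2 * / lam 1%nat ^ 2 * ip g g + 1). split; [nra|].
  intros M n Hn. destruct n as [|n]; [lia|].
  apply Rle_trans with (fsum (n + M) (fun k => (l (S k) / lam (S k)) ^ 2)).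
  { rewrite fsum_app. assert (0 <= fsum n (fun k => (l (S k) / lam (S k)) ^ 2)).
    { apply fsum_nonneg. intros. apply pow2_ge_0. }
    rewrite (fsum_ext M _ (fun i => (l (S (n + i)) / lam (S (n + i))) ^ 2)) by reflexivity. lra. }
  apply Rle_trans with (fsum (n + M) (fun k => 2 * ip v (phi (S k)) ^ 2
     + 2 * / lam 1%nat ^ 2 * ip g (phi (S k)) ^ 2)).
  - apply fsum_le. intros k _. rewrite E by lia.
    assert (Hk : 0 < lam (S k)) by (apply lam_pos; lia).
    assert (Hk1 : lam 1%nat <= lam (S k)) by (apply lam_le; lia).
    set (x := ip v (phi (S k))). set (y := ip g (phi (S k))).
    replace ((lam (S k) * x - y) / lam (S k)) with (x - / lam (S k) * y) by (field; lra).
    assert (Hy : (/ lam (S k) * y) ^ 2 <= / lam 1%nat ^ 2 * y ^ 2).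
    { rewrite Rpow_mult_distr. apply Rmult_le_compat_r; [apply pow2_ge_0|].
      rewrite pow_inv. apply Rinv_le_contravar; [apply pow_lt, H1|].
      apply pow_incr. lra. }
    assert (0 <= (x + / lam (S k) * y) ^ 2) by apply pow2_ge_0. lra.
  - rewrite fsum_plus, !fsum_scal.
    assert (B1 := bessel (n + M) v Hvc). assert (B2 := bessel (n + M) g Hg). nra.
Qed.

Lemma dphi0_summable : exists C, 0 < C /\ forall M n, (1 <= n)%nat ->
  fsum M (fun k => (dphi (n + k)%nat 0 / lam (n + k)%nat) ^ 2) <= C.
Proof.
  assert (Hp0 : 0 < p 0) by (apply Hppos; lra).
  set (c := / p 0).
  (* Cubic with v(0) = 1/p(0) and v'(0) = v(1) = v'(1) = 0: the only boundary term left is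
     phi_n'(0). *)
  set (v := fun x => c * (1 - 3 * x ^ 2 + 2 * x ^ 3)).
  set (dv := fun x => c * (6 * x ^ 2 - 6 * x)). set (d2v := fun x => c * (12 * x - 6)).
  assert (Hdv : deriv01 dv d2v).
  { apply deriv01_is_derive; intros x; unfold dv, d2v; [auto_derive; [trivial|ring]|].
    apply (ex_derive_continuous (K := R_AbsRing) (V := R_NormedModule)). auto_derive. trivial. }
  apply (boundary_test v dv (fun x => q x * v x - (dp x * dv x + p x * d2v x)) (fun n => dphi n 0)).
  - apply deriv01_is_derive; intros x; unfold v, dv; [auto_derive; [trivial|ring]|].
    apply (ex_derive_continuous (K := R_AbsRing) (V := R_NormedModule)). auto_derive. trivial.
  - eapply deriv01_eq; [| |apply (deriv01_mult _ _ _ _ Hp Hdv)]; intros; simpl; ring.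
  - assert (cont01 v) by (unfold v; auto 8 with c01). assert (cont01 dv) by (unfold dv; auto 8 with c01).
    assert (cont01 d2v) by (unfold d2v; auto 8 with c01). assert (cont01 dp) by apply Hp.
    auto 8 with c01.
  - intros n Hn. unfold v, dv, c. field. lra.
Qed.

Lemma beta_summable : exists C, 0 < C /\ forall M n, (1 <= n)%nat ->
  fsum M (fun k => (p 1 * (- cos th2 * dphi (n + k)%nat 1 + sin th2 * phi (n + k)%nat 1)
                    / lam (n + k)%nat) ^ 2) <= C.
Proof.
  (* Coefficients of the cubic with v(0) = v'(0) = 0, v(1) = cos th2 and v'(1) = sin th2, whose
     boundary functional is beta_n. *)
  set (a := 3 * cos th2 - sin th2). set (b := sin th2 - 2 * cos th2).
  set (v := fun x => a * x ^ 2 + b * x ^ 3).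
  set (dv := fun x => 2 * a * x + 3 * b * x ^ 2). set (d2v := fun x => 2 * a + 6 * b * x).
  assert (Hdv : deriv01 dv d2v).
  { apply deriv01_is_derive; intros x; unfold dv, d2v; [auto_derive; [trivial|ring]|].
    apply (ex_derive_continuous (K := R_AbsRing) (V := R_NormedModule)). auto_derive. trivial. }
  apply (boundary_test v dv (fun x => q x * v x - (dp x * dv x + p x * d2v x))
    (fun n => p 1 * (- cos th2 * dphi n 1 + sin th2 * phi n 1))).
  - apply deriv01_is_derive; intros x; unfold v, dv; [auto_derive; [trivial|ring]|].
    apply (ex_derive_continuous (K := R_AbsRing) (V := R_NormedModule)). auto_derive. trivial.
  - eapply deriv01_eq; [| |apply (deriv01_mult _ _ _ _ Hp Hdv)]; intros; simpl; ring.
  - assert (cont01 v) by (unfold v; auto 8 with c01). assert (cont01 dv) by (unfold dv; auto 8 with c01).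
    assert (cont01 d2v) by (unfold d2v; auto 8 with c01). assert (cont01 dp) by apply Hp.
    auto 8 with c01.
  - intros n Hn. unfold v, dv, a, b. ring.
Qed.
End SturmLiouville.

(** * Quadratic forms *)

Definition bform (n : nat) (P : nat -> nat -> R) (x y : nat -> R) : R :=
  fsum n (fun i => fsum n (fun j => x i * P i j * y j)).

Lemma qform_bform n P x : qform n P x = bform n P x x.
Proof. reflexivity. Qed.

Lemma bform_ext n P x y x' y' : (forall i, (i < n)%nat -> x i = x' i) ->
  (forall i, (i < n)%nat -> y i = y' i) -> bform n P x y = bform n P x' y'.
Proof.
  intros Hx Hy. apply fsum_ext; intros i Hi; apply fsum_ext; intros j Hj.
  rewrite Hx, Hy by assumption. reflexivity.
Qed.

Lemma bform_sym n P x y : symm n P -> bform n P x y = bform n P y x.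
Proof.
  intros HP. unfold bform. rewrite fsum_swap.
  apply fsum_ext; intros i Hi; apply fsum_ext; intros j Hj. rewrite (HP i j) by assumption. ring.
Qed.

Lemma bform_plus_r n P x y z :
  bform n P x (fun i => y i + z i) = bform n P x y + bform n P x z.
Proof.
  unfold bform. rewrite <- fsum_plus. apply fsum_ext; intros i _.
  rewrite <- fsum_plus. apply fsum_ext; intros; ring.
Qed.

Lemma bform_scal_r n P x c y : bform n P x (fun i => c * y i) = c * bform n P x y.
Proof.
  unfold bform. rewrite <- fsum_scal. apply fsum_ext; intros i _.
  rewrite <- fsum_scal. apply fsum_ext; intros; ring.
Qed.

Lemma qform_upper n P : exists C, 0 < C /\
  forall x, Rabs (qform n P x) <= C * fsum n (fun i => x i ^ 2).
Proof.
  exists (fsum n (fun i => fsum n (fun j => Rabs (P i j))) + 1). split.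
  { assert (0 <= fsum n (fun i => fsum n (fun j => Rabs (P i j)))); [|lra].
    apply fsum_nonneg; intros; apply fsum_nonneg; intros; apply Rabs_pos. }
  intros x. set (s := fsum n (fun i => x i ^ 2)).
  assert (Hs : forall i, (i < n)%nat -> x i ^ 2 <= s).
  { intros i Hi. apply (fsum_term_le n (fun i => x i ^ 2)); [intros; apply pow2_ge_0|exact Hi]. }
  assert (Hs0 : 0 <= s) by (apply fsum_nonneg; intros; apply pow2_ge_0).
  apply Rle_trans with (fsum n (fun i => fsum n (fun j => Rabs (P i j))) * s); [|nra].
  unfold qform. eapply Rle_trans; [apply fsum_abs|]. rewrite <- fsum_scal_r.
  apply fsum_le; intros i Hi. eapply Rle_trans; [apply fsum_abs|]. rewrite <- fsum_scal_r.
  apply fsum_le; intros j Hj. specialize (Hs i Hi) as Hsi. specialize (Hs j Hj) as Hsj.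
  replace (x i * P i j * x j) with (P i j * (x i * x j)) by ring. rewrite Rabs_mult.
  apply Rmult_le_compat_l; [apply Rabs_pos|]. apply Rabs_le.
  assert (0 <= (x i + x j) ^ 2) by apply pow2_ge_0.
  assert (0 <= (x i - x j) ^ 2) by apply pow2_ge_0. split; lra.
Qed.

(** Induction on the dimension by completing the square in the last variable: the Schur complement
    P' is again symmetric and positive definite. *)
Lemma posdef_lower n : forall P, symm n P -> posdef n P -> exists c, 0 < c /\
  forall x, c * fsum n (fun i => x i ^ 2) <= qform n P x.
Proof.
  induction n as [|n IH]; intros P HS HP.
  { exists 1. split; [lra|]. intros. unfold qform. simpl. lra. }
  assert (Hexp : forall x, qform (S n) P x = qform n P x
     + 2 * x n * fsum n (fun j => P n j * x j) + P n n * x n ^ 2).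
  { intros x. unfold qform. simpl. rewrite fsum_plus.
    rewrite (fsum_ext n (fun i => x i * P i n * x n) (fun j => x n * (P n j * x j))).
    - rewrite (fsum_ext n (fun i => x n * P n i * x i) (fun j => x n * (P n j * x j)))
        by (intros; ring).
      rewrite fsum_scal. ring.
    - intros i Hi. rewrite (HS i n) by lia. ring. }
  assert (Ha : 0 < P n n).
  { assert (H := HP (fun i => if Nat.eqb i n then 1 else 0)). rewrite Hexp, Nat.eqb_refl in H.
    rewrite (fsum_0 n (fun j => P n j * _)) in H.
    - unfold qform in H. rewrite fsum_0 in H.
      + replace (P n n) with (0 + 2 * 1 * 0 + P n n * 1 ^ 2) by ring. apply H.
        exists n. split; [lia|]. rewrite Nat.eqb_refl. lra.
      + intros i Hi. apply fsum_0. intros j Hj. destruct (Nat.eqb_spec i n); [lia|]. ring.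
    - intros i Hi. destruct (Nat.eqb_spec i n); [lia|]. ring. }
  set (a := P n n) in *. set (l := fun x : nat -> R => fsum n (fun j => P n j * x j)) in *.
  set (P' := fun i j => P i j - P i n * P n j / a).
  assert (Hsq : forall x, qform (S n) P x = qform n P' x + a * (x n + l x / a) ^ 2).
  { intros x. rewrite Hexp. fold (l x).
    assert (E : qform n P' x = qform n P x - l x ^ 2 / a).
    { unfold qform, P', l. unfold Rdiv. replace (fsum n (fun j => P n j * x j) ^ 2)
        with (fsum n (fun j => P n j * x j) * fsum n (fun j => P n j * x j)) by ring.
      rewrite fsum_mult, <- fsum_scal_r, <- fsum_minus. apply fsum_ext; intros i Hi.
      rewrite <- fsum_scal_r, <- fsum_minus. apply fsum_ext; intros j Hj.
      rewrite (HS i n) by lia. ring. }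
    rewrite E. field. lra. }
  destruct (IH P') as [c [Hc Hcx]].
  - intros i j Hi Hj. unfold P'. rewrite (HS i j), (HS i n), (HS n j) by lia.
    unfold Rdiv. ring.
  - intros x [i [Hi Hx]].
    (* The last coordinate is chosen to annihilate the square, so the form of P at x' is the form of
       P' at x. *)
    set (x' := fun i => if Nat.eqb i n then - l x / a else x i).
    assert (Hx' : forall i, (i < n)%nat -> x' i = x i).
    { intros k Hk. unfold x'. destruct (Nat.eqb_spec k n); [lia|reflexivity]. }
    assert (H : 0 < qform (S n) P x').
    { apply HP. exists i. split; [lia|]. rewrite Hx'; assumption. }
    rewrite Hsq in H.
    replace (l x') with (l x) in H by (apply fsum_ext; intros; rewrite Hx'; auto).
    replace (x' n) with (- l x / a) in H by (unfold x'; rewrite Nat.eqb_refl; reflexivity).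
    rewrite (qform_bform n P' x'), (bform_ext n P' x' x' x x Hx' Hx') in H.
    replace (- l x / a + l x / a) with 0 in H by (field; lra).
    unfold bform in H. unfold qform. lra.
  - set (L := fsum n (fun j => P n j ^ 2)).
    assert (HL : 0 <= L) by (apply fsum_nonneg; intros; apply pow2_ge_0).
    (* With s the squared norm of the first n coordinates and y the completed variable, x_n = y -
       l(x)/a gives s + x_n^2 <= (1 + 2 L / a^2) s + 2 y^2; the two terms are bounded by the form of
       P' and by a y^2. *)
    set (k := (1 + 2 * L / a ^ 2) / c + 2 / a).
    assert (Ha2 : 0 < a ^ 2) by (apply pow_lt, Ha).
    assert (HLa : 0 <= 2 * L / a ^ 2) by (apply Rdiv_le_0_compat; lra).
    assert (H2a : 0 < 2 / a) by (apply Rdiv_lt_0_compat; lra).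
    assert (H1c : 0 < (1 + 2 * L / a ^ 2) / c) by (apply Rdiv_lt_0_compat; lra).
    assert (Hk : 0 < k) by (unfold k; lra).
    exists (/ k). split; [apply Rinv_0_lt_compat, Hk|]. intros x.
    apply Rmult_le_reg_l with k; [exact Hk|]. rewrite <- Rmult_assoc, Rinv_r, Rmult_1_l by lra.
    change (fsum (S n) (fun i => x i ^ 2)) with (fsum n (fun i => x i ^ 2) + x n ^ 2).
    set (s := fsum n (fun i => x i ^ 2)).
    specialize (Hcx x). fold s in Hcx. rewrite Hsq.
    assert (Hl : l x ^ 2 <= L * s) by apply fsum_cs.
    set (y := x n + l x / a).
    assert (Hxn : x n ^ 2 <= 2 * y ^ 2 + 2 * L / a ^ 2 * s).
    { replace (x n) with (y - l x / a) by (unfold y; ring).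
      assert (0 <= (y + l x / a) ^ 2) by apply pow2_ge_0.
      assert ((l x / a) ^ 2 <= L / a ^ 2 * s).
      { replace ((l x / a) ^ 2) with (/ a ^ 2 * l x ^ 2) by (field; lra).
        replace (L / a ^ 2 * s) with (/ a ^ 2 * (L * s)) by (field; lra).
        apply Rmult_le_compat_l; [apply Rlt_le, Rinv_0_lt_compat, Ha2|exact Hl]. }
      unfold Rdiv in *. lra. }
    assert (Hs0 : 0 <= s) by (apply fsum_nonneg; intros; apply pow2_ge_0).
    assert (E1 : (1 + 2 * L / a ^ 2) * s <= (1 + 2 * L / a ^ 2) / c * qform n P' x).
    { replace ((1 + 2 * L / a ^ 2) * s) with ((1 + 2 * L / a ^ 2) / c * (c * s)) by (field; lra).
      apply Rmult_le_compat_l; lra. }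
    assert (E2 : 2 * y ^ 2 = 2 / a * (a * y ^ 2)) by (field; lra).
    assert (0 <= a * y ^ 2) by (apply Rmult_le_pos; [lra|apply pow2_ge_0]).
    assert (0 <= qform n P' x) by (assert (0 <= c * s) by (apply Rmult_le_pos; lra); lra).
    assert (0 <= (1 + 2 * L / a ^ 2) / c * (a * y ^ 2)) by (apply Rmult_le_pos; lra).
    assert (0 <= 2 / a * qform n P' x) by (apply Rmult_le_pos; lra).
    unfold k. lra.
Qed.

(** * Series of nonnegative terms *)

Lemma sum_n_fsum (a : nat -> R) n : sum_n a n = fsum (S n) a :> R.
Proof.
  induction n as [|n IH].
  - rewrite sum_O. simpl. lra.
  - rewrite sum_Sn, IH. reflexivity.
Qed.

Lemma fsum_mono a n m : (forall k, 0 <= a k) -> (n <= m)%nat -> fsum n a <= fsum m a.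
Proof.
  intros Ha Hnm. replace m with (n + (m - n))%nat by lia. rewrite fsum_app.
  assert (0 <= fsum (m - n) (fun i => a (n + i)%nat)) by (apply fsum_nonneg; auto). lra.
Qed.

Lemma ex_series_bounded a C : (forall k, 0 <= a k) -> (forall n, fsum n a <= C) -> ex_series a.
Proof.
  intros Ha HC.
  destruct (ex_finite_lim_seq_incr (fun n => sum_n a n) C) as [l Hl].
  - intros n. rewrite !sum_n_fsum. apply fsum_mono; [exact Ha|lia].
  - intros n. rewrite sum_n_fsum. apply HC.
  - exists l. exact Hl.
Qed.

Lemma fsum_le_Series (a : nat -> R) n : (forall k, 0 <= a k) -> ex_series a -> fsum n a <= Series a.
Proof.
  intros Ha Hex. apply Rle_trans with (fsum (S n) a); [apply fsum_mono; [exact Ha|lia]|].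
  rewrite <- sum_n_fsum. apply Series_correct in Hex.
  apply (is_lim_seq_incr_compare (fun n => sum_n a n)); [exact Hex|].
  intros k. rewrite !sum_n_fsum. apply fsum_mono; [exact Ha|lia].
Qed.

Lemma ex_series_shift (a : nat -> R) n : ex_series a -> ex_series (fun k => a (n + k)%nat).
Proof. intros H. apply (ex_series_incr_n a n), H. Qed.

Lemma Series_nonneg (a : nat -> R) : (forall k, 0 <= a k) -> ex_series a -> 0 <= Series a.
Proof. intros Ha H. apply (fsum_le_Series a 0 Ha H). Qed.

Lemma Series_tail_small (a : nat -> R) eps : (forall k, 0 <= a k) -> ex_series a -> 0 < eps ->
  exists n0, forall n, (n0 <= n)%nat -> Series (fun k => a (n + k)%nat) < eps.
Proof.
  intros Ha Hex He. assert (H := Series_correct a Hex).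
  destruct (proj2 (is_lim_seq_spec (fun n => sum_n a n) (Series a)) H (mkposreal eps He)) as [n0 Hn0].
  exists (S n0). intros n Hn. destruct n as [|n]; [lia|].
  assert (E := Series_incr_n a (S n) ltac:(lia) Hex). simpl pred in E.
  specialize (Hn0 n ltac:(lia)). simpl in Hn0.
  rewrite <- sum_n_Reals, sum_n_fsum in E. rewrite sum_n_fsum in Hn0.
  assert (A := fsum_le_Series a (S n) Ha Hex).
  apply Rabs_lt_between in Hn0. lra.
Qed.

(** * Lyapunov forms of stable matrices *)

Module Schur.
Import all_boot all_algebra Rstruct complex.
Import GRing.Theory Num.Theory.
Local Open Scope ring_scope.

Local Notation C := (complex R).
Local Notation re := (@complex.Re R).
Local Notation im := (@complex.Im R).

#[local] Arguments fsum : simpl never.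

Lemma fsum_big n (f : nat -> R) : fsum n f = \sum_(i < n) f i.
Proof.
elim: n => [|n IH]; first by rewrite big_ord0.
by rewrite big_ord_recr [LHS]/(fsum n f + f n) IH.
Qed.

Lemma Re_sum n (f : 'I_n -> C) : re (\sum_i f i) = \sum_i re (f i).
Proof. by rewrite (big_morph re (id1 := 0) (op1 := +%R)) // => -[? ?] [? ?]. Qed.

Lemma Im_sum n (f : 'I_n -> C) : im (\sum_i f i) = \sum_i im (f i).
Proof. by rewrite (big_morph im (id1 := 0) (op1 := +%R)) // => -[? ?] [? ?]. Qed.

Lemma ReM (x y : C) : re (x * y) = re x * re y - im x * im y.
Proof. by case: x y => [? ?] [? ?]. Qed.

Lemma ImM (x y : C) : im (x * y) = re x * im y + im x * re y.
Proof. by case: x y => [? ?] [? ?]. Qed.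

(** Schur triangularisation over C, written in real coordinates. With a = ar + i ai, t = tr + i ti
    and b = br + i bi, the clauses say that a M = t a, that t is upper triangular with Re t_kk < d,
    and that Re (b a) is the identity. The real part is enough to recover a real vector from its
    complex coordinates. *)
Lemma triangular_form m (M : nat -> nat -> R) (d : R) :
  eig_re_lt m.+1 M d ->
  exists ar ai tr ti br bi : nat -> nat -> R,
  [/\ forall i j, (i < m.+1)%N -> (j < m.+1)%N ->
      fsum m.+1 (fun k => Rmult (ar i k) (M k j)) =
        fsum m.+1 (fun k => Rminus (Rmult (tr i k) (ar k j)) (Rmult (ti i k) (ai k j))) /\
      fsum m.+1 (fun k => Rmult (ai i k) (M k j)) =
        fsum m.+1 (fun k => Rplus (Rmult (tr i k) (ai k j)) (Rmult (ti i k) (ar k j))),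
     forall i j, (j < i)%N -> (i < m.+1)%N -> tr i j = 0 /\ ti i j = 0,
     forall i, (i < m.+1)%N -> Rlt (tr i i) d &
     forall i j, (i < m.+1)%N -> (j < m.+1)%N ->
      fsum m.+1 (fun k => Rminus (Rmult (br i k) (ar k j)) (Rmult (bi i k) (ai k j))) = kd i j].
Proof.
move=> Hd.
(* Transposed, because MathComp's eigenvectors are rows whereas those of [eig_re_lt] are columns;
   the lower triangular form of A is then read as an upper triangular one for M. *)
pose A : 'M[C]_m.+1 := \matrix_(i, j) (M j i)%:C%C.
have [P Pu Ptr] := spectral.Schur A (ltn0Sn m).
have Pun := unitarymx_unit Pu.
move: Ptr; rewrite /similar_to /= => /is_trig_mxP Ttr.
set T := conjmx P A in Ttr.
pose Q := invmx P.
have TE : T = P *m A *m Q by rewrite /T conjumx.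
clearbody T.
have AQ k l : \sum_i A k i * Q i l = \sum_i Q k i * T i l.
  have : (A *m Q) k l = (Q *m T) k l by rewrite TE /Q !mulmxA mulVmx // mul1mx.
  by rewrite !mxE.
have QP k l : \sum_i Q k i * P i l = (k == l)%:R.
  have : (Q *m P) k l = 1%:M k l by rewrite /Q mulVmx.
  by rewrite !mxE.
have ordK (i : nat) : (i < m.+1)%N -> (inord i : 'I_m.+1) = i :> nat by move=> ?; rewrite inordK.
exists (fun i k => re (Q (inord k) (inord i))), (fun i k => im (Q (inord k) (inord i))),
  (fun i k => re (T (inord k) (inord i))), (fun i k => im (T (inord k) (inord i))),
  (fun i k => re (P (inord k) (inord i))), (fun i k => im (P (inord k) (inord i))).
split.
- move=> i j ilt jlt.
  have E := AQ (inord j) (inord i); split; rewrite 2!(fsum_big m.+1).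
  + move: (congr1 re E); rewrite !Re_sum => E'.
    transitivity (\sum_i0 re (A (inord j) i0 * Q i0 (inord i))).
      by apply: eq_bigr => k _; rewrite mxE ReM /= inord_val ordK // mul0r subr0 mulrC.
    rewrite E'; apply: eq_bigr => k _; rewrite ReM inord_val.
    by rewrite [re (Q _ _) * _]mulrC [im (Q _ _) * _]mulrC.
  + move: (congr1 im E); rewrite !Im_sum => E'.
    transitivity (\sum_i0 im (A (inord j) i0 * Q i0 (inord i))).
      by apply: eq_bigr => k _; rewrite mxE ImM /= inord_val ordK // mul0r addr0 mulrC.
    rewrite E'; apply: eq_bigr => k _; rewrite ImM inord_val.
    by rewrite [re (Q _ _) * _]mulrC [im (Q _ _) * _]mulrC addrC.
- move=> i j ji ilt.
  have -> : T (inord j) (inord i) = 0 by apply: Ttr; rewrite !ordK // (ltn_trans ji).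
  by [].
- move=> i ilt; set a := T (inord i) (inord i).
  (* The diagonal entries of T are roots of its characteristic polynomial, which is that of A by
     conjugation. *)
  have : eigenvalue A a.
    rewrite eigenvalue_root_char.
    have -> : char_poly A = char_poly T.
      rewrite /char_poly /char_poly_mx.
      have -> : map_mx polyC T = map_mx polyC P *m map_mx polyC A *m map_mx polyC Q.
        by rewrite -!map_mxM TE.
      have PQ : map_mx polyC P *m map_mx polyC Q = 1%:M.
        by rewrite -map_mxM /Q mulmxV // map_mx1.
      have -> : 'X%:M - map_mx polyC P *m map_mx polyC A *m map_mx polyC Q =
         map_mx polyC P *m ('X%:M - map_mx polyC A) *m map_mx polyC Q.
        by rewrite mulmxBr mulmxBl scalar_mxC -(mulmxA 'X%:M) PQ mulmx1.
      by rewrite !det_mulmx mulrAC -det_mulmx PQ det1 mul1r.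
    rewrite char_poly_trig; last by apply/is_trig_mxP.
    rewrite (bigD1 (inord i)) //= rootM root_XsubC /a eqxx //.
  case/eigenvalueP => v /rowP Ev vn0.
  apply: (Hd (re a) (im a) (fun k => re (v 0 (inord k))) (fun k => im (v 0 (inord k)))).
    have [k vk] : exists k, v 0 k != 0.
      apply/existsP; rewrite -negb_forall; apply: contra vn0 => /forallP v0.
      by apply/eqP/rowP => k; rewrite mxE; apply/eqP.
    exists k; split; first by apply/ltP.
    rewrite inord_val; case: (v 0 k) vk => [x y] /= xy.
    case: (Req_dec x 0) => [x0|]; last by left.
    by right => y0; move: xy; rewrite x0 y0 eqxx.
  move=> k /ltP klt; have := Ev (inord k).
  rewrite !mxE => E; split; rewrite (fsum_big m.+1).
    move: (congr1 re E); rewrite Re_sum ReM => E'; etransitivity; last exact: E'.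
    apply: eq_bigr => l _.
    by rewrite inord_val mxE ReM /= ordK // mulr0 subr0 mulrC.
  move: (congr1 im E); rewrite Im_sum ImM addrC => E'; etransitivity; last exact: E'.
  apply: eq_bigr => l _.
  by rewrite inord_val mxE ImM /= ordK // mulr0 add0r mulrC.
- move=> i j ilt jlt.
  move: (congr1 re (QP (inord j) (inord i))); rewrite Re_sum => E.
  rewrite (fsum_big m.+1).
  transitivity (re ((inord j == inord i :> 'I_m.+1)%:R : C)).
    rewrite -E; apply: eq_bigr => k _; rewrite ReM inord_val.
    by rewrite [re (Q _ _) * _]mulrC [im (Q _ _) * _]mulrC.
  rewrite /kd; case: (PeanoNat.Nat.eqb_spec i j) => [->|ij]; first by rewrite eqxx.
  by case: eqP => // /(congr1 val) /=; rewrite !ordK // => ji; case: ij.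
Qed.
End Schur.

Lemma finite_gap n (f : nat -> R) d : (forall i, (i < n)%nat -> f i < d) ->
  exists eta, 0 < eta /\ forall i, (i < n)%nat -> f i <= d - 2 * eta.
Proof.
  induction n as [|n IH]; intros H; [exists 1; split; [lra|lia]|].
  destruct IH as [e [He Hf]]; [intros; apply H; lia|].
  specialize (H n ltac:(lia)).
  exists (Rmin e ((d - f n) / 2)). split; [apply Rmin_pos; lra|].
  intros i Hi. assert (Rmin e ((d - f n) / 2) <= e) by apply Rmin_l.
  assert (Rmin e ((d - f n) / 2) <= (d - f n) / 2) by apply Rmin_r.
  destruct (Nat.eq_dec i n) as [->|]; [lra|]. specialize (Hf i ltac:(lia)). lra.
Qed.

Lemma finite_bound2 n (f : nat -> nat -> R) :
  exists B, 0 < B /\ forall i j, (i < n)%nat -> (j < n)%nat -> Rabs (f i j) <= B.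
Proof.
  exists (fsum n (fun i => fsum n (fun j => Rabs (f i j))) + 1).
  assert (A : forall i, (i < n)%nat -> 0 <= fsum n (fun j => Rabs (f i j))).
  { intros. apply fsum_nonneg. intros. apply Rabs_pos. }
  split; [assert (B := fsum_nonneg n _ A); lra|]. intros i j Hi Hj.
  assert (H1 := fsum_term_le n (fun i => fsum n (fun j => Rabs (f i j))) i A Hi).
  assert (H2 := fsum_term_le n (fun j => Rabs (f i j)) j ltac:(intros; apply Rabs_pos) Hj).
  simpl in H1, H2. lra.
Qed.

(* M is conjugate over C to an upper triangular matrix, and geometric weights G^i make its
   off-diagonal part negligible. *)
Lemma lyapunov n M d : (1 <= n)%nat -> eig_re_lt n M d -> exists P, symm n P /\
  (exists c, 0 < c /\ forall x, c * fsum n (fun i => x i ^ 2) <= qform n P x) /\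
  forall x, 2 * bform n P x (fun j => fsum n (fun k => M j k * x k))
            <= 2 * d * qform n P x - fsum n (fun i => x i ^ 2).
Proof.
  intros Hn HM. destruct n as [|m]; [lia|].
  destruct (Schur.triangular_form m M d HM) as (ar & ai & tr & ti & br & bi & [H1 H2 H3 H4]).
  set (n := S m) in *.
  assert (lt_bool : forall i k, (i < k)%nat -> ssrnat.leq (S i) k = true).
  { intros i k Hik. apply (ssrbool.introT ssrnat.ltP). exact Hik. }
  assert (H1' : forall i j, (i < n)%nat -> (j < n)%nat -> _) by
    (intros i j Hi Hj; exact (H1 i j (lt_bool _ _ Hi) (lt_bool _ _ Hj))).
  assert (H2' : forall i j, (j < i)%nat -> (i < n)%nat -> tr i j = 0 /\ ti i j = 0) by
    (intros i j Hi Hj; exact (H2 i j (lt_bool _ _ Hi) (lt_bool _ _ Hj))).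
  assert (H3' : forall i, (i < n)%nat -> tr i i < d) by
    (intros i Hi; exact (H3 i (lt_bool _ _ Hi))).
  assert (H4' : forall i j, (i < n)%nat -> (j < n)%nat -> _) by
    (intros i j Hi Hj; exact (H4 i j (lt_bool _ _ Hi) (lt_bool _ _ Hj))).
  clear H1 H2 H3 H4 lt_bool.
  (* U + i V are the complex coordinates a x of x, in which M acts as the triangular matrix t. *)
  set (U := fun (x : nat -> R) i => fsum n (fun k => ar i k * x k)).
  set (V := fun (x : nat -> R) i => fsum n (fun k => ai i k * x k)).
  set (Mx := fun (x : nat -> R) j => fsum n (fun k => M j k * x k)).
  assert (Hgen : forall (a : nat -> R) (g : nat -> R) x,
    (forall j, (j < n)%nat -> fsum n (fun k => a k * M k j) = g j) ->
    fsum n (fun k => a k * Mx x k) = fsum n (fun j => g j * x j)).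
  { intros a g x Hg. unfold Mx.
    rewrite (fsum_ext n _ (fun k => fsum n (fun j => a k * M k j * x j)))
      by (intros; rewrite <- fsum_scal; apply fsum_ext; intros; ring).
    rewrite fsum_swap. apply fsum_ext; intros j Hj. rewrite fsum_scal_r, Hg by assumption.
    reflexivity. }
  assert (HU : forall x i, (i < n)%nat ->
    U (Mx x) i = fsum n (fun k => tr i k * U x k - ti i k * V x k)).
  { intros x i Hi. unfold U at 1. rewrite (Hgen (ar i) _ x (fun j Hj => proj1 (H1' i j Hi Hj))).
    rewrite (fsum_ext n _ (fun j => fsum n (fun k => (tr i k * ar k j - ti i k * ai k j) * x j)))
      by (intros; rewrite fsum_scal_r; reflexivity).
    rewrite fsum_swap. apply fsum_ext; intros k Hk. unfold U, V.
    rewrite <- !fsum_scal, <- fsum_minus. apply fsum_ext; intros; ring. }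
  assert (HV : forall x i, (i < n)%nat ->
    V (Mx x) i = fsum n (fun k => tr i k * V x k + ti i k * U x k)).
  { intros x i Hi. unfold V at 1. rewrite (Hgen (ai i) _ x (fun j Hj => proj2 (H1' i j Hi Hj))).
    rewrite (fsum_ext n _ (fun j => fsum n (fun k => (tr i k * ai k j + ti i k * ar k j) * x j)))
      by (intros; rewrite fsum_scal_r; reflexivity).
    rewrite fsum_swap. apply fsum_ext; intros k Hk. unfold U, V.
    rewrite <- !fsum_scal, <- fsum_plus. apply fsum_ext; intros; ring. }
  destruct (finite_gap n (fun i => tr i i) d H3') as [eta [Heta Hgap]].
  destruct (finite_bound2 n (fun i k => Rabs (tr i k) + Rabs (ti i k))) as [tau [Htau Htb]].
  assert (Hn0 : 0 < INR n) by (apply lt_0_INR; lia).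
  (* Every off-diagonal cell (i,k) may cost s/2 of each of its two diagonal terms. Summed over all
     cells this is n s = eta times Q, half of the spectral gap 2 eta. *)
  set (s := eta / INR n).
  assert (Hs : 0 < s) by (apply Rdiv_lt_0_compat; lra).
  (* Ratio of consecutive weights: for i < k the entry t_ik is bounded by tau, and (tau/s)^2 w_i <=
     w_k lets Young's inequality pay for it with s/2 on each side. *)
  set (G := 1 + (tau / s) ^ 2).
  assert (HG : 1 <= G) by (unfold G; assert (0 <= (tau / s) ^ 2) by apply pow2_ge_0; lra).
  set (w := fun i => G ^ i).
  assert (Hw : forall i, 1 <= w i) by (intros; apply pow_R1_Rle, HG).
  assert (Hww : forall i k, (i < k)%nat -> (tau / s) ^ 2 * w i <= w k).
  { intros i k Hik. unfold w. replace k with (S i + (k - S i))%nat by lia.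
    rewrite pow_add. simpl (G ^ S i).
    assert (1 <= G ^ (k - S i)) by (apply pow_R1_Rle, HG).
    assert (1 <= G ^ i) by (apply pow_R1_Rle, HG).
    apply Rle_trans with (G * G ^ i * 1); [|apply Rmult_le_compat_l; nra].
    unfold G at 2. nra. }
  set (N2 := fun x i => U x i ^ 2 + V x i ^ 2).
  assert (HN2 : forall x i, 0 <= N2 x i).
  { intros. unfold N2. assert (0 <= U x i ^ 2) by apply pow2_ge_0.
    assert (0 <= V x i ^ 2) by apply pow2_ge_0. lra. }
  set (Q := fun x => fsum n (fun i => w i * N2 x i)).
  set (Bf := fun x => fsum n (fun i => w i * (U x i * U (Mx x) i + V x i * V (Mx x) i))).
  assert (HB : forall x, Bf x <= (d - eta) * Q x).
  { intros x.
    assert (Hcell : forall i k, (i < n)%nat -> (k < n)%nat ->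
      w i * (U x i * (tr i k * U x k - ti i k * V x k) + V x i * (tr i k * V x k + ti i k * U x k))
      <= (if Nat.eqb i k then (d - 2 * eta) * (w k * N2 x k) else 0)
         + (s / 2 * (w i * N2 x i) + s / 2 * (w k * N2 x k))).
    { intros i k Hi Hk. specialize (Hw i) as Hwi. specialize (Hw k) as Hwk.
      specialize (HN2 x i) as Hni. specialize (HN2 x k) as Hnk.
      assert (0 <= s / 2 * (w i * N2 x i)) by (apply Rmult_le_pos; [lra|apply Rmult_le_pos; lra]).
      assert (0 <= s / 2 * (w k * N2 x k)) by (apply Rmult_le_pos; [lra|apply Rmult_le_pos; lra]).
      destruct (Nat.eqb_spec i k) as [->|Hik].
      - specialize (Hgap k Hk). simpl in Hgap.
        replace (_ * _) with (tr k k * (w k * N2 x k)) by (unfold N2; ring).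
        assert (tr k k * (w k * N2 x k) <= (d - 2 * eta) * (w k * N2 x k)); [|lra].
        apply Rmult_le_compat_r; [apply Rmult_le_pos; lra|exact Hgap].
      - destruct (Nat.lt_total i k) as [Hlt|[|Hlt]]; [|lia|].
        + specialize (Hww i k Hlt). specialize (Htb i k Hi Hk). simpl in Htb.
          rewrite Rabs_right in Htb by (assert (A := Rabs_pos (tr i k)); assert (B := Rabs_pos (ti i k)); lra).
          set (a := tr i k) in *. set (b := ti i k) in *.
          set (u := U x i) in *. set (v := V x i) in *. set (u' := U x k) in *. set (v' := V x k) in *.
          assert (Hab : a ^ 2 + b ^ 2 <= tau ^ 2).
          { rewrite <- (pow2_abs a), <- (pow2_abs b).
            assert (A := Rabs_pos a). assert (B := Rabs_pos b). nra. }
          assert (Hy : 2 * (u * (a * u' - b * v') + v * (a * v' + b * u'))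
            <= s * (u ^ 2 + v ^ 2) + (tau ^ 2 / s) * (u' ^ 2 + v' ^ 2)).
          { apply Rle_trans with (s * (u ^ 2 + v ^ 2) + (a ^ 2 + b ^ 2) / s * (u' ^ 2 + v' ^ 2)).
            - assert (0 <= / s * ((s * u - (a * u' - b * v')) ^ 2 + (s * v - (a * v' + b * u')) ^ 2)).
              { apply Rmult_le_pos; [apply Rlt_le, Rinv_0_lt_compat, Hs|].
                apply Rplus_le_le_0_compat; apply pow2_ge_0. }
              replace (/ s * ((s * u - (a * u' - b * v')) ^ 2 + (s * v - (a * v' + b * u')) ^ 2))
                with (s * (u ^ 2 + v ^ 2) - 2 * (u * (a * u' - b * v') + v * (a * v' + b * u'))
                   + (a ^ 2 + b ^ 2) / s * (u' ^ 2 + v' ^ 2)) in H1 by (field; lra). lra.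
            - apply Rplus_le_compat_l, Rmult_le_compat_r; [exact Hnk|].
              apply Rmult_le_compat_r; [apply Rlt_le, Rinv_0_lt_compat, Hs|exact Hab]. }
          change (N2 x i) with (u ^ 2 + v ^ 2) in *. change (N2 x k) with (u' ^ 2 + v' ^ 2) in *.
          assert (Hwk2 : tau ^ 2 / s * w i <= s * w k).
          { replace (tau ^ 2 / s * w i) with (s * ((tau / s) ^ 2 * w i)) by (field; lra).
            apply Rmult_le_compat_l; lra. }
          apply Rmult_le_compat_l with (r := w i) in Hy; [|lra].
          apply Rmult_le_compat_r with (r := u' ^ 2 + v' ^ 2) in Hwk2; [|exact Hnk].
          lra.
        + destruct (H2' i k Hlt Hi) as [-> ->]. ring_simplify. lra. }
    unfold Bf.
    apply Rle_trans with (fsum n (fun i => fsum n (fun k =>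
       (if Nat.eqb i k then (d - 2 * eta) * (w k * N2 x k) else 0)
         + (s / 2 * (w i * N2 x i) + s / 2 * (w k * N2 x k))))).
    - apply fsum_le; intros i Hi. rewrite HU, HV by assumption.
      rewrite <- !fsum_scal, <- fsum_plus, <- fsum_scal. apply fsum_le; intros k Hk.
      apply Hcell; assumption.
    - right. rewrite (fsum_ext n _ (fun i => (d - 2 * eta) * (w i * N2 x i)
         + (INR n * (s / 2 * (w i * N2 x i)) + s / 2 * Q x))).
      + rewrite !fsum_plus, !fsum_scal. fold (Q x).
        rewrite (fsum_const n (Q x)). unfold s. field. lra.
      + intros i Hi. rewrite !fsum_plus. f_equal; [|f_equal].
        * rewrite (fsum_ext n _ (fun k => kd i k * ((d - 2 * eta) * (w k * N2 x k)))).
          -- apply (fsum_kd n (fun k => (d - 2 * eta) * (w k * N2 x k))), Hi.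
          -- intros k _. unfold kd. destruct (Nat.eqb i k); ring.
        * apply fsum_const.
        * unfold Q. rewrite <- fsum_scal. reflexivity. }
  assert (Hlow : exists C, 0 < C /\ forall x, fsum n (fun i => x i ^ 2) <= C * Q x).
  { set (c := fun j => 2 * (fsum n (fun k => br j k ^ 2) + fsum n (fun k => bi j k ^ 2))).
    exists (fsum n c + 1).
    assert (Hc : forall j, 0 <= c j).
    { intros. unfold c. assert (0 <= fsum n (fun k => br j k ^ 2)) by
        (apply fsum_nonneg; intros; apply pow2_ge_0).
      assert (0 <= fsum n (fun k => bi j k ^ 2)) by (apply fsum_nonneg; intros; apply pow2_ge_0).
      lra. }
    assert (Hc' := fsum_nonneg n c (fun i _ => Hc i)). split; [lra|]. intros x.
    assert (HQ0 : 0 <= Q x).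
    { apply fsum_nonneg; intros. apply Rmult_le_pos; [specialize (Hw i); lra|apply HN2]. }
    apply Rle_trans with (fsum n c * Q x); [|nra].
    rewrite <- fsum_scal_r. apply fsum_le; intros j Hj.
    (* x is real, so the real part of b (a x) gives it back. *)
    assert (Hx : x j = fsum n (fun k => br j k * U x k) - fsum n (fun k => bi j k * V x k)).
    { rewrite <- (fsum_kd n x j Hj).
      rewrite (fsum_ext n _ (fun i => fsum n (fun k => (br j k * ar k i - bi j k * ai k i) * x i)))
        by (intros; rewrite fsum_scal_r, H4' by assumption; reflexivity).
      rewrite fsum_swap, <- fsum_minus. apply fsum_ext; intros k Hk. unfold U, V.
      rewrite <- !fsum_scal, <- fsum_minus. apply fsum_ext; intros; ring. }
    assert (A := fsum_cs n (br j) (U x)). assert (B := fsum_cs n (bi j) (V x)).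
    assert (HUQ : fsum n (fun k => U x k ^ 2) <= Q x).
    { apply fsum_le; intros k _. specialize (Hw k). unfold N2.
      assert (0 <= U x k ^ 2) by apply pow2_ge_0. assert (0 <= V x k ^ 2) by apply pow2_ge_0. nra. }
    assert (HVQ : fsum n (fun k => V x k ^ 2) <= Q x).
    { apply fsum_le; intros k _. specialize (Hw k). unfold N2.
      assert (0 <= U x k ^ 2) by apply pow2_ge_0. assert (0 <= V x k ^ 2) by apply pow2_ge_0. nra. }
    assert (0 <= fsum n (fun k => br j k ^ 2)) by (apply fsum_nonneg; intros; apply pow2_ge_0).
    assert (0 <= fsum n (fun k => bi j k ^ 2)) by (apply fsum_nonneg; intros; apply pow2_ge_0).
    rewrite Hx. unfold c.
    set (X := fsum n (fun k => br j k * U x k)) in *. set (Y := fsum n (fun k => bi j k * V x k)) in *.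
    assert (0 <= (X + Y) ^ 2) by apply pow2_ge_0.
    assert (fsum n (fun k => br j k ^ 2) * fsum n (fun k => U x k ^ 2)
      <= fsum n (fun k => br j k ^ 2) * Q x) by (apply Rmult_le_compat_l; assumption).
    assert (fsum n (fun k => bi j k ^ 2) * fsum n (fun k => V x k ^ 2)
      <= fsum n (fun k => bi j k ^ 2) * Q x) by (apply Rmult_le_compat_l; assumption).
    lra. }
  destruct Hlow as [C [HC Hlow]].
  (* Scaling so that the margin 2 c eta Q equals C Q, which dominates |x|^2. *)
  set (c := C / (2 * eta)). assert (Hc : 0 < c) by (apply Rdiv_lt_0_compat; lra).
  set (P := fun k l => c * fsum n (fun i => w i * (ar i k * ar i l + ai i k * ai i l))).
  assert (HP : forall x y, bform n P x y = c * fsum n (fun i => w i * (U x i * U y i + V x i * V y i))).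
  { intros x y. unfold bform, P.
    rewrite (fsum_ext n (fun k => fsum n (fun j => x k * (c * fsum n _) * y j))
      (fun k => fsum n (fun l => fsum n (fun i => c * (w i * ((ar i k * x k) * (ar i l * y l)
         + (ai i k * x k) * (ai i l * y l))))))).
    - rewrite (fsum_ext n (fun k => fsum n (fun l => fsum n _)) (fun k => fsum n (fun i => fsum n (fun l =>
        c * (w i * ((ar i k * x k) * (ar i l * y l) + (ai i k * x k) * (ai i l * y l)))))))
        by (intros; apply fsum_swap).
      rewrite fsum_swap, <- fsum_scal. apply fsum_ext; intros i Hi. unfold U, V.
      rewrite !fsum_mult, <- fsum_plus, <- !fsum_scal. apply fsum_ext; intros k Hk.
      rewrite <- fsum_plus, <- !fsum_scal. reflexivity.
    - intros k Hk. apply fsum_ext; intros l Hl.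
      rewrite <- fsum_scal, <- fsum_scal, <- fsum_scal_r. apply fsum_ext; intros; ring. }
  assert (HPQ : forall x, qform n P x = c * Q x).
  { intros x. rewrite qform_bform, HP. f_equal. apply fsum_ext; intros. unfold N2. ring. }
  exists P. split; [|split].
  - intros k l _ _. unfold P. f_equal. apply fsum_ext; intros; ring.
  - exists (c / C). split; [apply Rdiv_lt_0_compat; lra|]. intros x. rewrite HPQ.
    replace (c * Q x) with (c / C * (C * Q x)) by (field; lra).
    apply Rmult_le_compat_l; [apply Rlt_le, Rdiv_lt_0_compat; lra|apply Hlow].
  - intros x. fold (Mx x). rewrite HP, HPQ. fold (Bf x).
    specialize (HB x). specialize (Hlow x).
    apply Rmult_le_compat_l with (r := 2 * c) in HB; [|lra].
    assert (2 * c * ((d - eta) * Q x) = 2 * d * (c * Q x) - C * Q x) by (unfold c; field; lra).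
    lra.
Qed.

(** * Block structure of the matrix inequality *)

Section Blocks.
Variables (D : SysData) (N : nat).
Hypothesis HN : (N0 D <= N)%nat.

Lemma fsum_blocks f : fsum (2 * N) f =
  fsum (N0 D) f + fsum (N0 D) (fun r => f (N0 D + r)%nat)
  + fsum (N - N0 D) (fun r => f (2 * N0 D + r)%nat)
  + fsum (N - N0 D) (fun r => f (N0 D + N + r)%nat).
Proof.
  replace (2 * N)%nat with (N0 D + N0 D + (N - N0 D) + (N - N0 D))%nat by lia.
  rewrite !fsum_app. f_equal; [f_equal|]; apply fsum_ext; intros r Hr; f_equal; lia.
Qed.

Lemma index_blocks (Q : nat -> Prop) :
  (forall r, (r < N0 D)%nat -> Q r) -> (forall r, (r < N0 D)%nat -> Q (N0 D + r)%nat) ->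
  (forall r, (r < N - N0 D)%nat -> Q (2 * N0 D + r)%nat) ->
  (forall r, (r < N - N0 D)%nat -> Q (N0 D + N + r)%nat) ->
  forall i, (i < 2 * N)%nat -> Q i.
Proof.
  intros H0 H1 H2 H3 i Hi.
  destruct (Nat.lt_ge_cases i (N0 D)); [auto|].
  destruct (Nat.lt_ge_cases i (2 * N0 D)).
  { replace i with (N0 D + (i - N0 D))%nat by lia. apply H1. lia. }
  destruct (Nat.lt_ge_cases i (N0 D + N)).
  { replace i with (2 * N0 D + (i - 2 * N0 D))%nat by lia. apply H2. lia. }
  replace i with (N0 D + N + (i - (N0 D + N)))%nat by lia. apply H3. lia.
Qed.

Ltac blk_tac := unfold blk;
  repeat match goal with |- context [Nat.ltb ?a ?b] => destruct (Nat.ltb_spec a b); try lia end.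

Lemma blk0 r : (r < N0 D)%nat -> blk D N r = 0%nat.
Proof. intros. blk_tac. Qed.
Lemma blk1 r : (r < N0 D)%nat -> blk D N (N0 D + r) = 1%nat.
Proof. intros. blk_tac. Qed.
Lemma blk2 r : (r < N - N0 D)%nat -> blk D N (2 * N0 D + r) = 2%nat.
Proof. intros. blk_tac. Qed.
Lemma blk3 r : (r < N - N0 D)%nat -> blk D N (N0 D + N + r) = 3%nat.
Proof. intros. blk_tac. Qed.
Lemma off0 r : (r < N0 D)%nat -> off D N r = r.
Proof. intros. unfold off. rewrite blk0 by assumption. reflexivity. Qed.
Lemma off1 r : (r < N0 D)%nat -> off D N (N0 D + r) = r.
Proof. intros. unfold off. rewrite blk1 by assumption. lia. Qed.
Lemma off2 r : (r < N - N0 D)%nat -> off D N (2 * N0 D + r) = r.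
Proof. intros. unfold off. rewrite blk2 by assumption. lia. Qed.
Lemma off3 r : (r < N - N0 D)%nat -> off D N (N0 D + N + r) = r.
Proof. intros. unfold off. rewrite blk3 by assumption. lia. Qed.

End Blocks.

Ltac blk_simpl := repeat match goal with
  | HN : (N0 ?D <= ?N)%nat, H : (?r < N0 ?D)%nat |- context [off ?D ?N ?r] =>
      rewrite (off0 D N HN r H)
  | HN : (N0 ?D <= ?N)%nat, H : (?r < N0 ?D)%nat |- context [blk ?D ?N ?r] =>
      rewrite (blk0 D N HN r H)
  | HN : (N0 ?D <= ?N)%nat, H : (?r < N0 ?D)%nat |- context [off ?D ?N (N0 ?D + ?r)] =>
      rewrite (off1 D N HN r H)
  | HN : (N0 ?D <= ?N)%nat, H : (?r < N0 ?D)%nat |- context [blk ?D ?N (N0 ?D + ?r)] =>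
      rewrite (blk1 D N HN r H)
  | HN : (N0 ?D <= ?N)%nat, H : (?r < ?N - N0 ?D)%nat |- context [off ?D ?N (2 * N0 ?D + ?r)] =>
      rewrite (off2 D N HN r H)
  | HN : (N0 ?D <= ?N)%nat, H : (?r < ?N - N0 ?D)%nat |- context [blk ?D ?N (2 * N0 ?D + ?r)] =>
      rewrite (blk2 D N HN r H)
  | HN : (N0 ?D <= ?N)%nat, H : (?r < ?N - N0 ?D)%nat |- context [off ?D ?N (N0 ?D + ?N + ?r)] =>
      rewrite (off3 D N HN r H)
  | HN : (N0 ?D <= ?N)%nat, H : (?r < ?N - N0 ?D)%nat |- context [blk ?D ?N (N0 ?D + ?N + ?r)] =>
      rewrite (blk3 D N HN r H)
  end.

Section BlockForms.
Variables (D : SysData) (N : nat).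
Hypothesis HN : (N0 D <= N)%nat.

Definition Fvec (x : nat -> R) (i : nat) : R := fsum (2 * N) (fun k => Fmat D N i k * x k).
Definition Kx (x : nat -> R) : R := fsum (N0 D) (fun c => Kg D c * x c).
Definition C0x (x : nat -> R) : R := fsum (N0 D) (fun c => C0 D c * x (N0 D + c)%nat).
Definition C1x (x : nat -> R) : R :=
  fsum (N - N0 D) (fun c => C1t D c * x (N0 D + N + c)%nat).

Lemma Fvec_split x i : Fvec x i =
  fsum (N0 D) (fun c => Fmat D N i c * x c)
  + fsum (N0 D) (fun c => Fmat D N i (N0 D + c) * x (N0 D + c)%nat)
  + fsum (N - N0 D) (fun c => Fmat D N i (2 * N0 D + c) * x (2 * N0 D + c)%nat)
  + fsum (N - N0 D) (fun c => Fmat D N i (N0 D + N + c) * x (N0 D + N + c)%nat).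
Proof. apply fsum_blocks, HN. Qed.

Lemma Fvec0 x r : (r < N0 D)%nat -> Fvec x r =
  fsum (N0 D) (fun c => A0BK D r c * x c) + eA0h D r * Lg D r * (C0x x + C1x x).
Proof.
  intros Hr. rewrite Fvec_split. unfold Fmat, C0x, C1x.
  rewrite Rmult_plus_distr_l, <- !fsum_scal.
  rewrite (fsum_0 (N - N0 D) (fun c => _ * x (2 * N0 D + c)%nat))
    by (intros; blk_simpl; ring).
  rewrite Rplus_0_r, <- Rplus_assoc. f_equal; [f_equal|];
    apply fsum_ext; intros c Hc; blk_simpl; ring.
Qed.

Lemma Fvec1 x r : (r < N0 D)%nat -> Fvec x (N0 D + r) =
  fsum (N0 D) (fun c => A0LC D r c * x (N0 D + c)%nat) - Lg D r * C1x x.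
Proof.
  intros Hr. rewrite Fvec_split. unfold Fmat, C1x. unfold Rminus.
  rewrite Ropp_mult_distr_l, <- fsum_scal.
  rewrite (fsum_0 (N - N0 D) (fun c => _ * x (2 * N0 D + c)%nat))
    by (intros; blk_simpl; ring).
  rewrite (fsum_0 (N0 D) (fun c => _ * x c)) by (intros; blk_simpl; ring).
  rewrite Rplus_0_r, Rplus_0_l. f_equal; apply fsum_ext; intros c Hc; blk_simpl; ring.
Qed.

Lemma Fvec2 x r : (r < N - N0 D)%nat -> Fvec x (2 * N0 D + r) =
  B1t D r * Kx x + A1d D r * x (2 * N0 D + r)%nat.
Proof.
  intros Hr. rewrite Fvec_split. unfold Fmat, Kx.
  rewrite (fsum_0 (N - N0 D) (fun c => _ * x (N0 D + N + c)%nat))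
    by (intros; blk_simpl; ring).
  rewrite (fsum_0 (N0 D) (fun c => _ * x (N0 D + c)%nat)) by (intros; blk_simpl; ring).
  rewrite !Rplus_0_r, <- fsum_scal. f_equal; [apply fsum_ext; intros c Hc; blk_simpl; ring|].
  rewrite <- (fsum_kd (N - N0 D) (fun c => A1d D r * x (2 * N0 D + c)%nat) r Hr).
  apply fsum_ext; intros c Hc; blk_simpl; ring.
Qed.

Lemma Fvec3 x r : (r < N - N0 D)%nat -> Fvec x (N0 D + N + r) =
  A1d D r * x (N0 D + N + r)%nat.
Proof.
  intros Hr. rewrite Fvec_split. unfold Fmat.
  rewrite (fsum_0 (N - N0 D) (fun c => _ * x (2 * N0 D + c)%nat))
    by (intros; blk_simpl; ring).
  rewrite (fsum_0 (N0 D) (fun c => _ * x (N0 D + c)%nat)) by (intros; blk_simpl; ring).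
  rewrite (fsum_0 (N0 D) (fun c => _ * x c)) by (intros; blk_simpl; ring).
  rewrite !Rplus_0_l.
  rewrite <- (fsum_kd (N - N0 D) (fun c => A1d D r * x (N0 D + N + c)%nat) r Hr).
  apply fsum_ext; intros c Hc; blk_simpl; ring.
Qed.

Lemma Lvec0 r : (r < N0 D)%nat -> Lvec D N r = eA0h D r * Lg D r.
Proof. intros. unfold Lvec. blk_simpl. reflexivity. Qed.
Lemma Lvec1 r : (r < N0 D)%nat -> Lvec D N (N0 D + r) = - Lg D r.
Proof. intros. unfold Lvec. blk_simpl. reflexivity. Qed.
Lemma Lvec2 r : (r < N - N0 D)%nat -> Lvec D N (2 * N0 D + r) = 0.
Proof. intros. unfold Lvec. blk_simpl. reflexivity. Qed.
Lemma Lvec3 r : (r < N - N0 D)%nat -> Lvec D N (N0 D + N + r) = 0.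
Proof. intros. unfold Lvec. blk_simpl. reflexivity. Qed.

Lemma Ktil_sum x : fsum (2 * N) (fun i => Ktil D N i * x i) = Kx x.
Proof.
  rewrite (fsum_blocks D N HN). unfold Ktil, Kx.
  rewrite (fsum_0 (N - N0 D) (fun c => _ * x (N0 D + N + c)%nat)) by (intros; blk_simpl; ring).
  rewrite (fsum_0 (N - N0 D) (fun c => _ * x (2 * N0 D + c)%nat)) by (intros; blk_simpl; ring).
  rewrite (fsum_0 (N0 D) (fun c => _ * x (N0 D + c)%nat)) by (intros; blk_simpl; ring).
  rewrite !Rplus_0_r. apply fsum_ext; intros c Hc; blk_simpl; ring.
Qed.

Lemma Erow_sum x : fsum (S (2 * N)) (fun j => Erow D N j * x j) =
  fsum (N0 D) (fun r => Kg D r * (Fvec x r + eA0h D r * Lg D r * x (2 * N)%nat)).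
Proof.
  cbn [fsum]. unfold Erow at 2. rewrite Nat.ltb_irrefl.
  rewrite (fsum_ext (2 * N) _ (fun j => fsum (N0 D) (fun r => Kg D r * (Fmat D N r j * x j)))).
  - rewrite fsum_swap, <- fsum_scal_r, <- fsum_plus. apply fsum_ext; intros r Hr.
    rewrite fsum_scal. unfold Fvec. ring.
  - intros j Hj. unfold Erow. rewrite <- fsum_scal_r. apply fsum_ext; intros r Hr.
    destruct (Nat.ltb_spec j (2 * N)); [ring|lia].
Qed.

(** Reads the matrix as a derivative: the first two terms are the rate of <P x, x> along x' = F x +
    Lvec y, with y stored in slot 2N, plus its exponential weight. Feasibility and the Lyapunov
    analysis both work with this identity instead of matrix entries. *)
Lemma Theta1_qform P alpha beta gamma x : symm (2 * N) P ->
  qform (2 * N + 1) (Theta1 D N P alpha beta gamma) x =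
  2 * bform (2 * N) P x (fun i => Fvec x i + Lvec D N i * x (2 * N)%nat)
  + 2 * delta D * qform (2 * N) P x
  - beta * exp (- 2 * delta D * hd D) * x (2 * N)%nat ^ 2
  + alpha * gamma * tailsq D (acoef D) N * Kx x ^ 2
  + alpha * gamma * tailsq D (bcoef D) N *
    fsum (N0 D) (fun r => Kg D r * (Fvec x r + eA0h D r * Lg D r * x (2 * N)%nat)) ^ 2.
Proof.
  intros HP. rewrite <- Erow_sum, <- Ktil_sum.
  set (m := (2 * N)%nat) in *. replace (m + 1)%nat with (S m) by lia.
  set (ta := alpha * gamma * tailsq D (acoef D) N).
  set (tb := alpha * gamma * tailsq D (bcoef D) N).
  set (y := x m).
  set (PL := fun i => fsum m (fun k => P i k * Lvec D N k)).
  set (Fs := fun i j => fsum m (fun k => Fmat D N k i * P k j)).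
  set (Gs := fun i j => fsum m (fun k => P i k * Fmat D N k j)).
  set (T := fun i j => if andb (Nat.ltb i m) (Nat.ltb j m) then
     Fs i j + Gs i j + 2 * delta D * P i j + ta * Ktil D N i * Ktil D N j
   else if Nat.ltb i m then PL i else if Nat.ltb j m then
     fsum m (fun k => Lvec D N k * P k j) else - beta * exp (- 2 * delta D * hd D)).
  assert (E : qform (S m) (Theta1 D N P alpha beta gamma) x
    = qform (S m) T x + tb * fsum (S m) (fun j => Erow D N j * x j) ^ 2).
  { unfold qform. replace (fsum (S m) (fun j => Erow D N j * x j) ^ 2)
      with (fsum (S m) (fun j => Erow D N j * x j) * fsum (S m) (fun j => Erow D N j * x j)) by ring.
    rewrite fsum_mult, <- fsum_scal, <- fsum_plus. apply fsum_ext; intros i Hi.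
    rewrite <- fsum_scal, <- fsum_plus. apply fsum_ext; intros j Hj.
    unfold Theta1. fold m. change (x i * (T i j + tb * Erow D N i * Erow D N j) * x j =
      x i * T i j * x j + tb * (Erow D N i * x i * (Erow D N j * x j))). ring. }
  rewrite E. f_equal. clear E.
  unfold qform at 1. cbn [fsum].
  rewrite (fsum_ext m _ (fun i => (x i * fsum m (fun j => Fs i j * x j) + x i * fsum m (fun j => Gs i j * x j)
     + 2 * delta D * fsum m (fun j => x i * P i j * x j)
     + ta * (Ktil D N i * x i) * fsum m (fun j => Ktil D N j * x j)) + x i * PL i * y)).
  2:{ intros i Hi. f_equal.
      - rewrite <- !fsum_scal, <- !fsum_plus. apply fsum_ext; intros j Hj. unfold T.
        destruct (Nat.ltb_spec i m); [|lia]. destruct (Nat.ltb_spec j m); [|lia]. simpl. ring.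
      - unfold T, y. destruct (Nat.ltb_spec i m); [|lia]. rewrite Nat.ltb_irrefl. reflexivity. }
  rewrite (fsum_ext m (fun j => x m * T m j * x j) (fun j => x j * PL j * y)).
  2:{ intros j Hj. unfold T. rewrite Nat.ltb_irrefl. simpl. destruct (Nat.ltb_spec j m); [|lia].
      replace (fsum m (fun k => Lvec D N k * P k j)) with (PL j).
      - unfold y. ring.
      - apply fsum_ext; intros k Hk. rewrite (HP j k) by assumption. ring. }
  replace (T m m) with (- beta * exp (- 2 * delta D * hd D))
    by (unfold T; rewrite Nat.ltb_irrefl; reflexivity).
  rewrite !fsum_plus, fsum_scal, fsum_scal_r.
  rewrite (fsum_scal m ta (fun i => Ktil D N i * x i)). fold (qform m P x).
  rewrite bform_plus_r, (bform_ext m P x (fun i => Lvec D N i * y) x (fun i => y * Lvec D N i))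
    by (intros; ring).
  rewrite bform_scal_r.
  assert (E1 : bform m P x (Lvec D N) = fsum m (fun i => x i * PL i)).
  { unfold bform, PL. apply fsum_ext; intros i Hi. rewrite <- fsum_scal.
    apply fsum_ext; intros; ring. }
  assert (E2 : fsum m (fun i => x i * fsum m (fun j => Gs i j * x j)) = bform m P x (Fvec x)).
  { unfold bform, Gs, Fvec. fold m. apply fsum_ext; intros i Hi.
    rewrite <- fsum_scal. rewrite (fsum_ext m _ (fun j => fsum m (fun k => x i * P i k * (Fmat D N k j * x j)))).
    - rewrite fsum_swap. apply fsum_ext; intros k Hk. rewrite fsum_scal. reflexivity.
    - intros j Hj. rewrite <- fsum_scal_r, <- fsum_scal. apply fsum_ext; intros; ring. }
  assert (E3 : fsum m (fun i => x i * fsum m (fun j => Fs i j * x j)) = bform m P x (Fvec x)).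
  { rewrite (bform_sym m P x (Fvec x) HP).
    rewrite (fsum_ext m _ (fun i => fsum m (fun j => fsum m (fun k => Fmat D N k i * x i * P k j * x j)))).
    - rewrite (fsum_ext m _ _ (fun i _ => fsum_swap m m _)), fsum_swap.
      unfold bform, Fvec. fold m. apply fsum_ext; intros k Hk.
      rewrite fsum_swap. apply fsum_ext; intros j Hj. rewrite <- 2 fsum_scal_r.
      reflexivity.
    - intros i Hi. rewrite <- fsum_scal. apply fsum_ext; intros j Hj. unfold Fs.
      rewrite <- fsum_scal_r, <- fsum_scal. apply fsum_ext; intros; ring. }
  rewrite E1, E2, E3, !fsum_scal_r. fold y. ring.
Qed.

End BlockForms.

(** * Feasibility of the constraints *)

Section Feasibility.
Variable D : SysData.

Definition Pblk (N : nat) (P1 P2 : nat -> nat -> R) (c2 c3 c4 : R) (i j : nat) : R :=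
  let r := off D N i in let c := off D N j in
  match blk D N i, blk D N j with
  | O, O => P1 r c
  | S O, S O => c2 * P2 r c
  | S (S O), S (S O) => c3 * kd r c
  | S (S (S O)), S (S (S O)) => c4 * kd r c
  | _, _ => 0
  end.

Lemma Pblk_symm N P1 P2 c2 c3 c4 : (N0 D <= N)%nat -> symm (N0 D) P1 -> symm (N0 D) P2 ->
  symm (2 * N) (Pblk N P1 P2 c2 c3 c4).
Proof.
  intros HN H1 H2 i j Hi Hj. revert i Hi. apply (index_blocks D N HN); intros r Hr; revert j Hj;
  apply (index_blocks D N HN); intros s Hs; unfold Pblk;
  blk_simpl; try reflexivity.
  - apply H1; assumption.
  - f_equal. apply H2; assumption.
  - f_equal. unfold kd. rewrite Nat.eqb_sym. reflexivity.
  - f_equal. unfold kd. rewrite Nat.eqb_sym. reflexivity.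
Qed.

Lemma bform_Pblk N P1 P2 c2 c3 c4 x v : (N0 D <= N)%nat ->
  bform (2 * N) (Pblk N P1 P2 c2 c3 c4) x v =
  bform (N0 D) P1 x v
  + c2 * bform (N0 D) P2 (fun r => x (N0 D + r)%nat) (fun r => v (N0 D + r)%nat)
  + c3 * fsum (N - N0 D) (fun r => x (2 * N0 D + r)%nat * v (2 * N0 D + r)%nat)
  + c4 * fsum (N - N0 D) (fun r => x (N0 D + N + r)%nat * v (N0 D + N + r)%nat).
Proof.
  intros HN. unfold bform. rewrite (fsum_blocks D N HN), <- !fsum_scal.
  f_equal; [f_equal; [f_equal|]|]; apply fsum_ext; intros r Hr;
    rewrite (fsum_blocks D N HN); unfold Pblk.
  - rewrite (fsum_0 (N0 D) (fun c => _ * v (N0 D + c)%nat)) by (intros; blk_simpl; ring).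
    rewrite (fsum_0 (N - N0 D) (fun c => _ * v (2 * N0 D + c)%nat)) by (intros; blk_simpl; ring).
    rewrite (fsum_0 (N - N0 D) (fun c => _ * v (N0 D + N + c)%nat)) by (intros; blk_simpl; ring).
    rewrite !Rplus_0_r. apply fsum_ext; intros; blk_simpl; ring.
  - rewrite (fsum_0 (N0 D) (fun c => _ * v c)) by (intros; blk_simpl; ring).
    rewrite (fsum_0 (N - N0 D) (fun c => _ * v (2 * N0 D + c)%nat)) by (intros; blk_simpl; ring).
    rewrite (fsum_0 (N - N0 D) (fun c => _ * v (N0 D + N + c)%nat)) by (intros; blk_simpl; ring).
    rewrite !Rplus_0_r, Rplus_0_l, <- fsum_scal. apply fsum_ext; intros; blk_simpl; ring.
  - rewrite (fsum_0 (N0 D) (fun c => _ * v c)) by (intros; blk_simpl; ring).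
    rewrite (fsum_0 (N0 D) (fun c => _ * v (N0 D + c)%nat)) by (intros; blk_simpl; ring).
    rewrite (fsum_0 (N - N0 D) (fun c => _ * v (N0 D + N + c)%nat)) by (intros; blk_simpl; ring).
    rewrite !Rplus_0_r, !Rplus_0_l.
    rewrite <- (fsum_kd (N - N0 D) (fun c => c3 * (x (2 * N0 D + c)%nat * v (2 * N0 D + c)%nat)) r Hr).
    apply fsum_ext; intros c Hc; blk_simpl. unfold kd. destruct (Nat.eqb_spec r c) as [->|]; ring.
  - rewrite (fsum_0 (N0 D) (fun c => _ * v c)) by (intros; blk_simpl; ring).
    rewrite (fsum_0 (N0 D) (fun c => _ * v (N0 D + c)%nat)) by (intros; blk_simpl; ring).
    rewrite (fsum_0 (N - N0 D) (fun c => _ * v (2 * N0 D + c)%nat)) by (intros; blk_simpl; ring).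
    rewrite !Rplus_0_l.
    rewrite <- (fsum_kd (N - N0 D) (fun c => c4 * (x (N0 D + N + c)%nat * v (N0 D + N + c)%nat)) r Hr).
    apply fsum_ext; intros c Hc; blk_simpl. unfold kd. destruct (Nat.eqb_spec r c) as [->|]; ring.
Qed.

Lemma functional_bound n (a : nat -> R) : exists C, 0 < C /\
  forall x, fsum n (fun i => x i * a i) ^ 2 <= C * fsum n (fun i => x i ^ 2).
Proof.
  exists (fsum n (fun i => a i ^ 2) + 1).
  assert (H := fsum_nonneg n (fun i => a i ^ 2) (fun i _ => pow2_ge_0 (a i))).
  split; [lra|]. intros x.
  assert (Hx := fsum_nonneg n (fun i => x i ^ 2) (fun i _ => pow2_ge_0 (x i))).
  assert (A := fsum_cs n x a). nra.
Qed.

Lemma bform_functional n P (a : nat -> R) : exists C, 0 < C /\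
  forall x, bform n P x a ^ 2 <= C * fsum n (fun i => x i ^ 2).
Proof.
  destruct (functional_bound n (fun i => fsum n (fun j => P i j * a j))) as [C [HC H]].
  exists C. split; [exact HC|]. intros x. eapply Rle_trans; [|apply H]. right. f_equal.
  unfold bform. apply fsum_ext; intros i Hi. rewrite <- fsum_scal. apply fsum_ext; intros; ring.
Qed.

(* Cascade: X4 drives X2, both drive X1, which drives X3; the weights 1, c2, c3, c4 of the
   block-diagonal P absorb the couplings, whose norms do not depend on N. *)
Lemma Theta1_nsd P1 P2 Cphi Cbeta eta :
  symm (N0 D) P1 -> symm (N0 D) P2 -> 0 < Cphi -> 0 < Cbeta -> 0 < eta ->
  (forall x, 2 * bform (N0 D) P1 x (fun j => fsum (N0 D) (fun k => A0BK D j k * x k))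
     <= 2 * - delta D * qform (N0 D) P1 x - fsum (N0 D) (fun i => x i ^ 2)) ->
  (forall x, 2 * bform (N0 D) P2 x (fun j => fsum (N0 D) (fun k => A0LC D j k * x k))
     <= 2 * - delta D * qform (N0 D) P2 x - fsum (N0 D) (fun i => x i ^ 2)) ->
  exists c2 c3 c4 beta tau, 0 < c2 /\ 0 < c3 /\ 0 < c4 /\ 0 < beta /\ 0 < tau /\
  forall N, (N0 D <= N)%nat ->
    fsum (N - N0 D) (fun c => C1t D c ^ 2) <= Cphi ->
    fsum (N - N0 D) (fun c => B1t D c ^ 2) <= Cbeta ->
    (forall r, A1d D r <= - delta D - eta) ->
    0 <= tailsq D (acoef D) N <= tau -> 0 <= tailsq D (bcoef D) N <= tau ->
    nsd (2 * N + 1) (Theta1 D N (Pblk N P1 P2 c2 c3 c4) 2 beta 1).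
Proof.
  intros HS1 HS2 HCphi HCbeta Heta HP1 HP2.
  destruct (bform_functional (N0 D) P1 (fun r => eA0h D r * Lg D r)) as [k1 [Hk1 B1]].
  destruct (bform_functional (N0 D) P2 (Lg D)) as [k2 [Hk2 B2]].
  destruct (functional_bound (N0 D) (Kg D)) as [k3 [Hk3 B3]].
  destruct (functional_bound (N0 D) (C0 D)) as [k5 [Hk5 B5]].
  destruct (functional_bound (N0 D) (fun c => fsum (N0 D) (fun r => Kg D r * A0BK D r c)))
    as [k7 [Hk7 B7]].
  set (k8 := fsum (N0 D) (fun r => Kg D r * (eA0h D r * Lg D r)) ^ 2 + 1).
  assert (Hk8 : 0 < k8).
  { unfold k8. assert (H := pow2_ge_0 (fsum (N0 D) (fun r => Kg D r * (eA0h D r * Lg D r)))). lra. }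
  set (k6 := Cphi) in *. set (k4 := Cbeta) in *.
  (* The weights follow the cascade. [c3] makes the drive of X1 into X3 cost X1/4; [c2] makes X2 pay
     for its effect on X1 with a quarter of its own decay; [c4] makes X4 pay for its effect on both;
     [g] collects all occurrences of y^2. The decay of X1 is spent exactly, in four quarters. *)
  set (c3 := eta / (4 * k3 * k4)).
  set (c2 := 48 * k1 * k5 + 1).
  set (c4 := (12 * k1 * k6 + 8 * c2 * k2 * k6) / eta + 1).
  set (g := 12 * k1 + 8 * c2 * k2 + 1).
  (* The factor cancels exp(-2 delta h), so the net coefficient of y^2 in the form is -g. *)
  set (beta := g * exp (2 * delta D * hd D)).
  assert (P15 : 0 < k1 * k5) by (apply Rmult_lt_0_compat; assumption).
  assert (P16 : 0 < k1 * k6) by (apply Rmult_lt_0_compat; assumption).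
  assert (P34 : 0 < k3 * k4) by (apply Rmult_lt_0_compat; assumption).
  assert (P26 : 0 < k2 * k6) by (apply Rmult_lt_0_compat; assumption).
  assert (P85 : 0 < k8 * k5) by (apply Rmult_lt_0_compat; assumption).
  assert (P86 : 0 < k8 * k6) by (apply Rmult_lt_0_compat; assumption).
  assert (Hc3 : 0 < c3) by (apply Rdiv_lt_0_compat; nra).
  assert (Hc2 : 0 < c2) by (unfold c2; nra).
  assert (Hc2k2 : 0 < c2 * k2) by (apply Rmult_lt_0_compat; assumption).
  assert (Hc2k26 : 0 < c2 * (k2 * k6)) by (apply Rmult_lt_0_compat; assumption).
  assert (Hc4e : eta * c4 = 12 * k1 * k6 + 8 * c2 * k2 * k6 + eta) by (unfold c4; field; lra).
  assert (Hc4 : 0 < c4).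
  { apply Rmult_lt_reg_l with eta; [exact Heta|]. rewrite Hc4e. lra. }
  assert (Hg : 0 < g) by (unfold g; lra).
  assert (Hbeta : 0 < beta) by (apply Rmult_lt_0_compat; [exact Hg|apply exp_pos]).
  (* The tails of a and b are required to be at most 1/big. Each summand makes one contribution of
     the [tailsq] terms fit into the decay still unspent by X1, X2, X4 or y. *)
  set (big := 1 + 8 * k3 + 16 * k7 + 24 * (k8 * k5) / c2 + 24 * (k8 * k6) / (eta * c4) + 12 * k8).
  assert (T1 : 0 < 24 * (k8 * k5) / c2) by (apply Rdiv_lt_0_compat; lra).
  assert (T2 : 0 < 24 * (k8 * k6) / (eta * c4)).
  { apply Rdiv_lt_0_compat; [lra|]. apply Rmult_lt_0_compat; assumption. }
  assert (Hbig : 0 < big) by (unfold big; lra).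
  exists c2, c3, c4, beta, (/ big).
  repeat split; try assumption; [apply Rinv_0_lt_compat, Hbig|].
  intros N HN HC1 HB1 HA1 Hta Htb x.
  rewrite (Theta1_qform D N HN) by (apply Pblk_symm; assumption).
  set (y := x (2 * N)%nat).
  set (x2 := fun r => x (N0 D + r)%nat).
  set (n' := (N - N0 D)%nat) in *.
  set (x3 := fun r => x (2 * N0 D + r)%nat). set (x4 := fun r => x (N0 D + N + r)%nat).
  set (X1 := fsum (N0 D) (fun i => x i ^ 2)). set (X2 := fsum (N0 D) (fun i => x2 i ^ 2)).
  set (X3 := fsum n' (fun i => x3 i ^ 2)). set (X4 := fsum n' (fun i => x4 i ^ 2)).
  assert (HX1 : 0 <= X1) by (apply fsum_nonneg; intros; apply pow2_ge_0).
  assert (HX2 : 0 <= X2) by (apply fsum_nonneg; intros; apply pow2_ge_0).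
  assert (HX3 : 0 <= X3) by (apply fsum_nonneg; intros; apply pow2_ge_0).
  assert (HX4 : 0 <= X4) by (apply fsum_nonneg; intros; apply pow2_ge_0).
  set (sg := C0x D x + C1x D N x + y). set (ta := C1x D N x + y).
  assert (HC0 : C0x D x ^ 2 <= k5 * X2).
  { eapply Rle_trans; [|apply B5]. right. f_equal. apply fsum_ext; intros; unfold x2; ring. }
  assert (HC1x : C1x D N x ^ 2 <= k6 * X4).
  { eapply Rle_trans; [apply fsum_cs|]. apply Rmult_le_compat_r; [exact HX4|exact HC1]. }
  assert (HKx : Kx D x ^ 2 <= k3 * X1).
  { eapply Rle_trans; [|apply B3]. right. f_equal. apply fsum_ext; intros; ring. }
  assert (HB3 : fsum n' (fun r => x3 r * B1t D r) ^ 2 <= k4 * X3).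
  { eapply Rle_trans; [apply fsum_cs|]. rewrite Rmult_comm.
    apply Rmult_le_compat_r; [exact HX3|exact HB1]. }
  set (b1 := bform (N0 D) P1 x (fun r => eA0h D r * Lg D r)).
  assert (Hb1 : b1 ^ 2 <= k1 * X1) by apply B1.
  set (b2 := bform (N0 D) P2 x2 (Lg D)).
  assert (Hb2 : b2 ^ 2 <= k2 * X2) by apply B2.
  set (b3 := fsum n' (fun r => x3 r * B1t D r)) in *.
  rewrite qform_bform, !(bform_Pblk N P1 P2 c2 c3 c4) by exact HN.
  fold n' x2. change (fun r => x2 r) with x2.
  assert (E1 : bform (N0 D) P1 x (fun i => Fvec D N x i + Lvec D N i * y)
    = bform (N0 D) P1 x (fun j => fsum (N0 D) (fun k => A0BK D j k * x k)) + sg * b1).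
  { unfold b1. rewrite <- bform_scal_r, <- bform_plus_r. apply bform_ext; [reflexivity|].
    intros r Hr. rewrite (Fvec0 D N HN), (Lvec0 D N HN) by assumption. unfold sg. ring. }
  assert (E2 : bform (N0 D) P2 x2 (fun r => Fvec D N x (N0 D + r) + Lvec D N (N0 D + r) * y)
    = bform (N0 D) P2 x2 (fun j => fsum (N0 D) (fun k => A0LC D j k * x2 k)) + - ta * b2).
  { unfold b2. rewrite <- bform_scal_r, <- bform_plus_r. apply bform_ext; [reflexivity|].
    intros r Hr. rewrite (Fvec1 D N HN), (Lvec1 D N HN) by assumption. unfold ta, x2. ring. }
  assert (E3 : fsum n' (fun r => x3 r * (Fvec D N x (2 * N0 D + r) + Lvec D N (2 * N0 D + r) * y))
    <= Kx D x * b3 - (delta D + eta) * X3).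
  { unfold b3, X3, Rminus. rewrite Ropp_mult_distr_l, <- !fsum_scal, <- fsum_plus. apply fsum_le; intros r Hr.
    rewrite (Fvec2 D N HN), (Lvec2 D N HN) by assumption. fold (x3 r). specialize (HA1 r).
    assert (0 <= x3 r ^ 2) by apply pow2_ge_0. nra. }
  assert (E4 : fsum n' (fun r => x4 r * (Fvec D N x (N0 D + N + r) + Lvec D N (N0 D + N + r) * y))
    <= - (delta D + eta) * X4).
  { unfold X4. rewrite <- !fsum_scal. apply fsum_le; intros r Hr.
    rewrite (Fvec3 D N HN), (Lvec3 D N HN) by assumption. fold (x4 r). specialize (HA1 r).
    assert (0 <= x4 r ^ 2) by apply pow2_ge_0. nra. }
  assert (E5 : fsum (N0 D) (fun r => Kg D r * (Fvec D N x r + eA0h D r * Lg D r * y)) ^ 2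
    <= 2 * (k7 * X1) + 2 * (k8 * sg ^ 2)).
  { set (u := fsum (N0 D) (fun c => x c * fsum (N0 D) (fun r => Kg D r * A0BK D r c))).
    set (l := fsum (N0 D) (fun r => Kg D r * (eA0h D r * Lg D r))) in k8, Hk8.
    assert (E : fsum (N0 D) (fun r => Kg D r * (Fvec D N x r + eA0h D r * Lg D r * y)) = u + l * sg).
    { unfold u, l. rewrite <- fsum_scal_r.
      rewrite (fsum_ext (N0 D) (fun c => x c * _) (fun c => fsum (N0 D) (fun r => Kg D r * (A0BK D r c * x c))))
        by (intros; rewrite <- fsum_scal; apply fsum_ext; intros; ring).
      rewrite fsum_swap, <- fsum_plus. apply fsum_ext; intros r Hr.
      rewrite (Fvec0 D N HN), fsum_scal by assumption. unfold sg. ring. }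
    rewrite E. assert (Hu : u ^ 2 <= k7 * X1) by apply B7.
    assert (0 <= (u - l * sg) ^ 2) by apply pow2_ge_0.
    assert (l ^ 2 * sg ^ 2 <= k8 * sg ^ 2) by (unfold k8; assert (0 <= sg ^ 2) by apply pow2_ge_0; nra).
    nra. }
  rewrite E1, E2. clear E1 E2.
  assert (HP1x := HP1 x). assert (HP2x := HP2 x2). fold X1 in HP1x. fold X2 in HP2x.
  rewrite qform_bform in HP1x, HP2x.
  set (Q1 := bform (N0 D) P1 x x) in *. set (Q2 := bform (N0 D) P2 x2 x2) in *.
  set (R1 := bform (N0 D) P1 x (fun j => _)) in *. set (R2 := bform (N0 D) P2 x2 (fun j => _)) in *.
  set (R3 := fsum n' (fun r => x (2 * N0 D + r)%nat * (Fvec D N x (2 * N0 D + r) + _))).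
  set (R4 := fsum n' (fun r => x (N0 D + N + r)%nat * (Fvec D N x (N0 D + N + r) + _))).
  change (R3 <= Kx D x * b3 - (delta D + eta) * X3) in E3.
  change (R4 <= - (delta D + eta) * X4) in E4.
  replace (fsum n' (fun r => x (2 * N0 D + r)%nat * x (2 * N0 D + r)%nat)) with X3
    by (apply fsum_ext; intros; unfold x3; ring).
  replace (fsum n' (fun r => x (N0 D + N + r)%nat * x (N0 D + N + r)%nat)) with X4
    by (apply fsum_ext; intros; unfold x4; ring).
  set (e := fsum (N0 D) (fun r => Kg D r * (Fvec D N x r + _))) in *.
  replace (beta * exp (-2 * delta D * hd D)) with g.
  2:{ unfold beta. rewrite Rmult_assoc, <- exp_plus.
      replace (2 * delta D * hd D + -2 * delta D * hd D) with 0 by ring. rewrite exp_0. ring. }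
  assert (Hsg : sg ^ 2 <= 3 * (k5 * X2 + k6 * X4 + y ^ 2)).
  { unfold sg. set (u := C0x D x) in *. set (v := C1x D N x) in *.
    assert (0 <= (u - v) ^ 2) by apply pow2_ge_0. assert (0 <= (u - y) ^ 2) by apply pow2_ge_0.
    assert (0 <= (v - y) ^ 2) by apply pow2_ge_0. nra. }
  assert (Hta2 : ta ^ 2 <= 2 * (k6 * X4 + y ^ 2)).
  { unfold ta. set (v := C1x D N x) in *. assert (0 <= (v - y) ^ 2) by apply pow2_ge_0. nra. }
  assert (Y1 : 2 * (sg * b1) <= / 4 * X1 + 4 * k1 * sg ^ 2).
  { assert (0 <= / k1 * (/ 2 * b1 - 2 * k1 * sg) ^ 2).
    { apply Rmult_le_pos; [apply Rlt_le, Rinv_0_lt_compat, Hk1|apply pow2_ge_0]. }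
    replace (/ k1 * (/ 2 * b1 - 2 * k1 * sg) ^ 2)
      with (/ 4 * (/ k1 * b1 ^ 2) - 2 * (sg * b1) + 4 * k1 * sg ^ 2) in H by (field; lra).
    assert (/ k1 * b1 ^ 2 <= X1).
    { apply Rmult_le_reg_l with k1; [exact Hk1|]. rewrite <- Rmult_assoc, Rinv_r by lra. lra. }
    lra. }
  assert (Y2 : 2 * (- ta * b2) <= / 4 * X2 + 4 * k2 * ta ^ 2).
  { assert (0 <= / k2 * (/ 2 * b2 + 2 * k2 * ta) ^ 2).
    { apply Rmult_le_pos; [apply Rlt_le, Rinv_0_lt_compat, Hk2|apply pow2_ge_0]. }
    replace (/ k2 * (/ 2 * b2 + 2 * k2 * ta) ^ 2)
      with (/ 4 * (/ k2 * b2 ^ 2) + 2 * (ta * b2) + 4 * k2 * ta ^ 2) in H by (field; lra).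
    assert (/ k2 * b2 ^ 2 <= X2).
    { apply Rmult_le_reg_l with k2; [exact Hk2|]. rewrite <- Rmult_assoc, Rinv_r by lra. lra. }
    lra. }
  assert (Y3 : c3 * (2 * (Kx D x * b3)) <= c3 * (eta * X3) + / 4 * X1).
  { apply Rle_trans with (c3 * (eta * X3 + k4 * k3 / eta * X1)).
    - apply Rmult_le_compat_l; [lra|].
      assert (0 <= / (eta * k4) * (k4 * Kx D x - eta * b3) ^ 2).
      { apply Rmult_le_pos; [apply Rlt_le, Rinv_0_lt_compat; nra|apply pow2_ge_0]. }
      replace (/ (eta * k4) * (k4 * Kx D x - eta * b3) ^ 2)
        with (k4 / eta * Kx D x ^ 2 - 2 * (Kx D x * b3) + eta * (/ k4 * b3 ^ 2)) in H by (field; lra).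
      assert (/ k4 * b3 ^ 2 <= X3).
      { apply Rmult_le_reg_l with k4; [exact HCbeta|]. rewrite <- Rmult_assoc, Rinv_r by lra. lra. }
      assert (k4 / eta * Kx D x ^ 2 <= k4 / eta * (k3 * X1)).
      { apply Rmult_le_compat_l; [apply Rlt_le, Rdiv_lt_0_compat; lra|exact HKx]. }
      replace (k4 * k3 / eta * X1) with (k4 / eta * (k3 * X1)) by (field; lra).
      assert (eta * (/ k4 * b3 ^ 2) <= eta * X3) by (apply Rmult_le_compat_l; lra). lra.
    - right. unfold c3. field. lra. }
  assert (Z1 : 2 * 1 * tailsq D (acoef D) N * Kx D x ^ 2 <= / 4 * X1).
  { assert (A1 : tailsq D (acoef D) N * Kx D x ^ 2 <= / big * (k3 * X1)).
    { apply Rmult_le_compat; [lra|apply pow2_ge_0|lra|exact HKx]. }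
    assert (A2 : / big * (k3 * X1) <= / 8 * X1).
    { rewrite <- Rmult_assoc. apply Rmult_le_compat_r; [exact HX1|].
      apply Rmult_le_reg_l with big; [exact Hbig|]. rewrite <- Rmult_assoc, Rinv_r by lra.
      unfold big. lra. }
    lra. }
  assert (Z2 : 2 * 1 * tailsq D (bcoef D) N * e ^ 2
    <= / 4 * X1 + c2 / 2 * X2 + eta * c4 / 2 * X4 + y ^ 2).
  { assert (Hy : 0 <= y ^ 2) by apply pow2_ge_0.
    assert (A1 : tailsq D (bcoef D) N * e ^ 2
      <= / big * (2 * (k7 * X1) + 6 * (k8 * (k5 * X2 + k6 * X4 + y ^ 2)))).
    { apply Rmult_le_compat; [lra|apply pow2_ge_0|lra|].
      eapply Rle_trans; [exact E5|].
      apply Rmult_le_compat_l with (r := k8) in Hsg; [|lra]. lra. }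
    assert (A2 : forall k z, 0 <= z -> k <= big -> / big * (k * z) <= z).
    { intros k z Hz Hk. rewrite <- Rmult_assoc. rewrite <- (Rmult_1_l z) at 2.
      apply Rmult_le_compat_r; [exact Hz|].
      apply Rmult_le_reg_l with big; [exact Hbig|]. rewrite <- Rmult_assoc, Rinv_r by lra. lra. }
    assert (F1 := A2 (16 * k7) (/ 8 * X1) ltac:(lra) ltac:(unfold big; lra)).
    assert (F2 := A2 (24 * (k8 * k5) / c2) (c2 / 4 * X2) ltac:(nra) ltac:(unfold big; lra)).
    assert (F3 := A2 (24 * (k8 * k6) / (eta * c4)) (eta * c4 / 4 * X4)
      ltac:(apply Rmult_le_pos; [nra|exact HX4]) ltac:(unfold big; lra)).
    assert (F4 := A2 (12 * k8) (/ 2 * y ^ 2) ltac:(lra) ltac:(unfold big; lra)).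
    replace (24 * (k8 * k5) / c2 * (c2 / 4 * X2)) with (6 * (k8 * k5) * X2) in F2 by (field; lra).
    replace (24 * (k8 * k6) / (eta * c4) * (eta * c4 / 4 * X4)) with (6 * (k8 * k6) * X4) in F3
      by (field; lra).
    replace (/ big * (2 * (k7 * X1) + 6 * (k8 * (k5 * X2 + k6 * X4 + y ^ 2)))) with
      (/ big * (16 * k7 * (/ 8 * X1)) + / big * (6 * (k8 * k5) * X2) + / big * (6 * (k8 * k6) * X4)
        + / big * (12 * k8 * (/ 2 * y ^ 2))) in A1 by (field; lra).
    lra. }
  assert (W1 : 4 * k1 * sg ^ 2 <= 12 * (k1 * k5) * X2 + 12 * (k1 * k6) * X4 + 12 * k1 * y ^ 2).
  { apply Rmult_le_compat_l with (r := 4 * k1) in Hsg; [|lra]. lra. }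
  assert (W2 : c2 * (4 * k2 * ta ^ 2) <= 8 * (c2 * (k2 * k6)) * X4 + 8 * (c2 * k2) * y ^ 2).
  { apply Rmult_le_compat_l with (r := 4 * (c2 * k2)) in Hta2; [|lra]. lra. }
  apply Rmult_le_compat_l with (r := c2) in Y2; [|lra].
  apply Rmult_le_compat_l with (r := c2) in HP2x; [|lra].
  apply Rmult_le_compat_l with (r := 2 * c3) in E3; [|lra].
  apply Rmult_le_compat_l with (r := 2 * c4) in E4; [|lra].
  assert (V1 : 12 * (k1 * k5) * X2 <= / 4 * c2 * X2) by (apply Rmult_le_compat_r; [exact HX2|unfold c2; lra]).
  assert (V2 : (12 * (k1 * k6) + 8 * (c2 * (k2 * k6))) * X4 <= eta * c4 * X4).
  { apply Rmult_le_compat_r; [exact HX4|]. rewrite Hc4e. lra. }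
  assert (V3 : g * y ^ 2 = 12 * k1 * y ^ 2 + 8 * (c2 * k2) * y ^ 2 + y ^ 2) by (unfold g; ring).
  assert (0 <= c3 * (eta * X3)) by (apply Rmult_le_pos; [lra|apply Rmult_le_pos; lra]).
  assert (0 <= eta * c4 * X4) by (apply Rmult_le_pos; [apply Rmult_le_pos; lra|lra]).
  assert (0 <= c2 * X2) by (apply Rmult_le_pos; lra).
  lra.
Qed.

End Feasibility.

Section Data.
Variables (th1 th2 : R) (p dp q : R -> R) (qc delta : R) (N0 : nat)
  (lam : nat -> R) (phi dphi : nat -> R -> R) (K L : nat -> R) (h : R).
Hypothesis Hth1 : 0 <= th1 < PI / 2.
Hypothesis Hth2 : 0 <= th2 <= PI / 2.
Hypothesis Hp : deriv01 p dp.
Hypothesis Hdp : cont01 dp.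
Hypothesis Hppos : forall x, 0 <= x <= 1 -> 0 < p x.
Hypothesis Hq : cont01 q.
Hypothesis Hqpos : forall x, 0 <= x <= 1 -> 0 < q x.
Hypothesis HS : SL_spectrum p q th1 th2 lam phi dphi.
Hypothesis Hdelta : 0 < delta.
Hypothesis HN0 : (1 <= N0)%nat.
Hypothesis Hgap : forall n, (N0 + 1 <= n)%nat -> - lam n + qc < - delta.

Let D := mkData th1 th2 p dp q qc lam phi dphi N0 K L h delta.

Lemma den_pos : 0 < den D.
Proof.
  unfold den. simpl. destruct (trig2 th1 th2 Hth1 Hth2) as [Hc Hs].
  destruct Hs as [Hs|Hs]; [lra|]. destruct Hc as [Hc|Hc]; [lra|].
  assert (T := sin2_cos2 th2). unfold Rsqr in T. rewrite <- Hs, <- Hc in T. lra.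
Qed.

Lemma acoef_cont : cont01 (acoef D).
Proof.
  assert (cont01 p) by apply (deriv01_cont _ _ Hp).
  unfold acoef, qtil. simpl. auto 9 with c01.
Qed.

Lemma bcoef_cont : cont01 (bcoef D).
Proof. unfold bcoef. auto 8 with c01. Qed.

Let coef_sq f k := ip f (phi (S k)) ^ 2.

Lemma tailsq_shift f N : tailsq D f N = Series (fun k => coef_sq f (N + k)).
Proof.
  apply Series_ext. intros k. unfold coef_sq. simpl Defs.phi.
  replace (N + 1 + k)%nat with (S (N + k)) by lia. reflexivity.
Qed.

Lemma coef_sq_summable f : cont01 f -> ex_series (coef_sq f).
Proof.
  intros Hf. apply ex_series_bounded with (ip f f).
  - intros. apply pow2_ge_0.
  - intros. apply (bessel p dp q th1 th2 Hth1 Hth2 Hp Hq lam phi dphi HS), Hf.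
Qed.

Lemma tailsq_nonneg f N : cont01 f -> 0 <= tailsq D f N.
Proof.
  intros Hf. rewrite tailsq_shift. apply Series_nonneg; [intros; apply pow2_ge_0|].
  apply ex_series_shift, coef_sq_summable, Hf.
Qed.

Lemma tailsq_partial f N M : cont01 f ->
  fsum M (fun k => ip f (phi (S (N + k))) ^ 2) <= tailsq D f N.
Proof.
  intros Hf. rewrite tailsq_shift.
  apply (fsum_le_Series (fun k => coef_sq f (N + k))); [intros; apply pow2_ge_0|].
  apply ex_series_shift, coef_sq_summable, Hf.
Qed.

Lemma tailsq_small f tau : cont01 f -> 0 < tau ->
  exists n0, forall N, (n0 <= N)%nat -> 0 <= tailsq D f N <= tau.
Proof.
  intros Hf Ht.
  destruct (Series_tail_small (coef_sq f) tau) as [n0 Hn0];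
    [intros; apply pow2_ge_0|apply coef_sq_summable, Hf|exact Ht|].
  exists n0. intros N HN. split; [apply tailsq_nonneg, Hf|].
  rewrite tailsq_shift. apply Rlt_le, Hn0, HN.
Qed.

End Data.

Lemma fsum_sq_pos n x i : (i < n)%nat -> x i <> 0 -> 0 < fsum n (fun j => x j ^ 2).
Proof.
  intros Hi Hx. apply Rlt_le_trans with (x i ^ 2).
  - simpl. rewrite Rmult_1_r. apply Rsqr_pos_lt, Hx.
  - apply (fsum_term_le n (fun j => x j ^ 2)); [intros; apply pow2_ge_0|exact Hi].
Qed.

Lemma Pblk_posdef D N P1 P2 c2 c3 c4 e1 e2 : (N0 D <= N)%nat ->
  0 < c2 -> 0 < c3 -> 0 < c4 -> 0 < e1 -> 0 < e2 ->
  (forall x, e1 * fsum (N0 D) (fun i => x i ^ 2) <= qform (N0 D) P1 x) ->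
  (forall x, e2 * fsum (N0 D) (fun i => x i ^ 2) <= qform (N0 D) P2 x) ->
  posdef (2 * N) (Pblk D N P1 P2 c2 c3 c4).
Proof.
  intros HN Hc2 Hc3 Hc4 He1 He2 H1 H2 x [i [Hi Hx]].
  rewrite qform_bform, bform_Pblk by exact HN.
  set (x2 := fun r => x (N0 D + r)%nat).
  specialize (H1 x). specialize (H2 x2). rewrite qform_bform in H1, H2.
  set (x3 := fun r => x (2 * N0 D + r)%nat). set (x4 := fun r => x (N0 D + N + r)%nat).
  rewrite (fsum_ext (N - N0 D) (fun r => x (2 * N0 D + r)%nat * _) (fun r => x3 r ^ 2))
    by (intros; unfold x3; ring).
  rewrite (fsum_ext (N - N0 D) (fun r => x (N0 D + N + r)%nat * _) (fun r => x4 r ^ 2))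
    by (intros; unfold x4; ring).
  assert (S1 := fsum_nonneg (N0 D) (fun r => x r ^ 2) ltac:(intros; apply pow2_ge_0)).
  assert (S2 := fsum_nonneg (N0 D) (fun r => x2 r ^ 2) ltac:(intros; apply pow2_ge_0)).
  assert (S3 := fsum_nonneg (N - N0 D) (fun r => x3 r ^ 2) ltac:(intros; apply pow2_ge_0)).
  assert (S4 := fsum_nonneg (N - N0 D) (fun r => x4 r ^ 2) ltac:(intros; apply pow2_ge_0)).
  set (s1 := fsum (N0 D) (fun r => x r ^ 2)) in *.
  set (s2 := fsum (N0 D) (fun r => x2 r ^ 2)) in *.
  set (s3 := fsum (N - N0 D) (fun r => x3 r ^ 2)) in *.
  set (s4 := fsum (N - N0 D) (fun r => x4 r ^ 2)) in *.
  assert (0 <= c2 * (e2 * s2)) by (apply Rmult_le_pos; [lra|apply Rmult_le_pos; lra]).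
  assert (c2 * (e2 * s2) <= c2 * bform (N0 D) P2 x2 x2) by (apply Rmult_le_compat_l; lra).
  assert (0 <= e1 * s1) by (apply Rmult_le_pos; lra).
  assert (0 <= c3 * s3) by (apply Rmult_le_pos; lra).
  assert (0 <= c4 * s4) by (apply Rmult_le_pos; lra).
  assert (Hp : 0 < s1 \/ 0 < s2 \/ 0 < s3 \/ 0 < s4).
  { revert i Hi Hx. apply (index_blocks D N HN (fun i => x i <> 0 -> _)); intros r Hr Hx.
    - left. apply (fsum_sq_pos (N0 D) x r Hr Hx).
    - right; left. apply (fsum_sq_pos (N0 D) x2 r Hr Hx).
    - right; right; left. apply (fsum_sq_pos (N - N0 D) x3 r Hr Hx).
    - right; right; right. apply (fsum_sq_pos (N - N0 D) x4 r Hr Hx). }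
  assert (0 < e1 * s1 \/ 0 < c2 * (e2 * s2) \/ 0 < c3 * s3 \/ 0 < c4 * s4).
  { destruct Hp as [Hp|[Hp|[Hp|Hp]]]; [left|right; left|right; right; left|right; right; right];
    repeat apply Rmult_lt_0_compat; assumption. }
  lra.
Qed.

Section Data.
Variables (th1 th2 : R) (p dp q : R -> R) (qc delta : R) (N0 : nat)
  (lam : nat -> R) (phi dphi : nat -> R -> R) (K L : nat -> R) (h : R).
Hypothesis Hth1 : 0 <= th1 < PI / 2.
Hypothesis Hth2 : 0 <= th2 <= PI / 2.
Hypothesis Hp : deriv01 p dp.
Hypothesis Hdp : cont01 dp.
Hypothesis Hppos : forall x, 0 <= x <= 1 -> 0 < p x.
Hypothesis Hq : cont01 q.
Hypothesis Hqpos : forall x, 0 <= x <= 1 -> 0 < q x.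
Hypothesis HS : SL_spectrum p q th1 th2 lam phi dphi.
Hypothesis Hdelta : 0 < delta.
Hypothesis HN0 : (1 <= N0)%nat.
Hypothesis Hgap : forall n, (N0 + 1 <= n)%nat -> - lam n + qc < - delta.

Let D := mkData th1 th2 p dp q qc lam phi dphi N0 K L h delta.

(** At alpha = 2, gamma = 1, eps = 1/2 the powers of lam_{N+1} in Theta2 and Theta3 have exponents 1
    and 0. Since beta is chosen before N, large N gives beta M_phi <= 1/2; then Theta3 >= 1/2, and
    Theta2 <= -lam_{N+1}/2 + 2 (qc + delta), which is negative once lam_{N+1} > 4 (|qc| + delta). *)
Lemma feasibility : eig_re_lt N0 (A0BK D) (- delta) -> eig_re_lt N0 (A0LC D) (- delta) ->
  exists Nmin, forall N, (Nmin <= N)%nat ->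
    exists eps P alpha beta gamma, Constraints D N eps P alpha beta gamma.
Proof.
  intros HBK HLC.
  destruct (lyapunov N0 _ _ HN0 HBK) as (P1 & HS1 & (e1 & He1 & HP1) & HL1).
  destruct (lyapunov N0 _ _ HN0 HLC) as (P2 & HS2 & (e2 & He2 & HP2) & HL2).
  destruct (dphi0_summable p dp q th1 th2 Hth1 Hth2 Hp Hppos Hq lam phi dphi HS)
    as [Cphi [HCphi Hphi]].
  destruct (beta_summable p dp q th1 th2 Hth1 Hth2 Hp Hq lam phi dphi HS)
    as [Cbeta [HCbeta Hbeta]].
  set (eta := lam (N0 + 1)%nat - qc - delta).
  assert (Heta : 0 < eta) by (unfold eta; specialize (Hgap (N0 + 1)%nat (le_n _)); lra).
  destruct (Theta1_nsd D P1 P2 Cphi Cbeta eta HS1 HS2 HCphi HCbeta Heta HL1 HL2)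
    as (c2 & c3 & c4 & beta & tau & Hc2 & Hc3 & Hc4 & Hb & Htau & HT).
  destruct (tailsq_small th1 th2 p dp q qc delta N0 lam phi dphi K L h Hth1 Hth2 Hp Hq HS HN0
    (acoef D) tau (acoef_cont th1 th2 p dp q qc delta N0 lam phi dphi K L h Hp Hdp Hq) Htau) as [na Hna].
  destruct (tailsq_small th1 th2 p dp q qc delta N0 lam phi dphi K L h Hth1 Hth2 Hp Hq HS HN0
    (bcoef D) tau (bcoef_cont th1 th2 p dp q qc delta N0 lam phi dphi K L h) Htau) as [nb Hnb].
  set (m := fun k => (dphi (S k) 0 / lam (S k)) ^ 2).
  assert (Hm : ex_series m).
  { apply ex_series_bounded with Cphi; [intros; apply pow2_ge_0|].
    intros n. apply (Hphi n 1%nat). lia. }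
  destruct (Series_tail_small m (/ (2 * beta))) as [nm Hnm];
    [intros; apply pow2_ge_0|exact Hm|apply Rinv_0_lt_compat; lra|].
  destruct (lam_unbounded p dp q th1 th2 Hth1 Hth2 Hp Hppos Hq Hqpos lam phi dphi HS
    (4 * (Rabs qc + delta))) as [nl Hnl].
  exists (N0 + na + nb + nm + nl)%nat. intros N HN.
  assert (Hlp : forall k, 0 < lam (S k)).
  { intros k. apply (lam_pos p q th1 th2 lam phi dphi HS). lia. }
  assert (Hmt : forall k, Mphi_term D N (1 / 2) k = m (N + k)%nat).
  { intros k. unfold Mphi_term, m. simpl Defs.dphi. simpl Defs.lam.
    replace (N + 1 + k)%nat with (S (N + k)) by lia.
    replace (3 / 2 + 1 / 2) with (INR 2) by (simpl; lra).
    rewrite Rpower_pow by apply Hlp. specialize (Hlp (N + k)%nat). field. lra. }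
  assert (HM : Mphi D N (1 / 2) = Series (fun k => m (N + k)%nat)) by (apply Series_ext, Hmt).
  assert (HM1 : beta * Mphi D N (1 / 2) <= 1 / 2).
  { rewrite HM. specialize (Hnm N ltac:(lia)).
    apply Rmult_lt_compat_l with (r := beta) in Hnm; [|exact Hb].
    replace (beta * / (2 * beta)) with (1 / 2) in Hnm by (field; lra). lra. }
  exists (1 / 2), (Pblk D N P1 P2 c2 c3 c4), 2, beta, 1.
  assert (HNN : (Defs.N0 D <= N)%nat) by (simpl; lia).
  split; [lra|]. split; [apply Pblk_symm; assumption|].
  split; [apply (Pblk_posdef D N P1 P2 c2 c3 c4 e1 e2); assumption|].
  split; [lra|]. split; [exact Hb|]. split; [lra|]. split; [|split; [|split]].
  - apply (ex_series_ext (fun k => m (N + k)%nat)); [intros; symmetry; apply Hmt|].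
    apply ex_series_shift, Hm.
  - apply HT; try assumption.
    + apply (Hphi (N - N0)%nat (N0 + 1)%nat). lia.
    + apply (Hbeta (N - N0)%nat (N0 + 1)%nat). lia.
    + intros r. unfold A1d, eta. simpl.
      assert (lam (N0 + 1)%nat <= lam (N0 + 1 + r)%nat); [|lra].
      apply (lam_le p q th1 th2 lam phi dphi HS); lia.
    + apply Hna. lia.
    + apply Hnb. lia.
  - unfold Theta2. simpl Defs.lam. simpl Defs.qc. simpl Defs.delta.
    replace (1 / 2 + 1 / 2) with 1 by lra. replace (N + 1)%nat with (S N) by lia.
    rewrite Rpower_1 by apply Hlp. specialize (Hnl N ltac:(lia)).
    assert (qc <= Rabs qc) by apply Rle_abs. specialize (Hlp N).
    assert (beta * Mphi D N (1 / 2) * lam (S N) <= 1 / 2 * lam (S N)) by (apply Rmult_le_compat_r; lra).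
    lra.
  - unfold Theta3. replace (1 / 2 - 1 / 2) with 0 by lra. rewrite Rpower_O.
    + lra.
    + simpl Defs.lam. replace (N + 1)%nat with (S N) by lia. apply Hlp.
Qed.
End Data.

(** * Differential inequalities in time *)

Lemma cont_pos_ext f t : cont_pos f -> continuous (fun s => f (Rmax 0 s)) t.
Proof.
  intros H. apply continuous_eps. intros eps He.
  destruct (H (Rmax 0 t) (Rmax_l _ _) eps He) as [d [Hd Hf]].
  exists d. split; [exact Hd|]. intros s Hs. apply Hf; [apply Rmax_l|].
  eapply Rle_lt_trans; [|exact Hs]. unfold Rmax.
  destruct (Rle_dec 0 s), (Rle_dec 0 t); unfold Rabs; repeat destruct (Rcase_abs _); lra.
Qed.

Lemma continuous_cont_pos f : (forall t, 0 <= t -> continuous f t) -> cont_pos f.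
Proof.
  intros H t Ht eps He. destruct (continuous_eps_inv f t (H t Ht) eps He) as [d [Hd Hf]].
  exists d. split; [exact Hd|]. intros s _ Hs. apply Hf, Hs.
Qed.

Lemma cont_pos_eq f g : (forall t, 0 <= t -> f t = g t) -> cont_pos f -> cont_pos g.
Proof.
  intros E H t Ht eps He. destruct (H t Ht eps He) as [d [Hd Hf]].
  exists d. split; [exact Hd|]. intros s Hs Hst. rewrite <- !E by assumption. auto.
Qed.

Lemma cont_pos_of_ext f : (forall t, continuous (fun s => f (Rmax 0 s)) t) -> cont_pos f.
Proof.
  intros H. apply (cont_pos_eq (fun s => f (Rmax 0 s))).
  - intros t Ht. rewrite Rmax_right by exact Ht. reflexivity.
  - apply continuous_cont_pos. auto.
Qed.

Lemma cont_pos_const c : cont_pos (fun _ => c).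
Proof. apply continuous_cont_pos. intros. apply continuous_const. Qed.

Lemma cont_pos_plus f g : cont_pos f -> cont_pos g -> cont_pos (fun t => f t + g t).
Proof.
  intros Hf Hg. apply cont_pos_of_ext. intros t.
  apply (continuous_plus (U := R_UniformSpace) (V := R_NormedModule)
    (fun s => f (Rmax 0 s)) (fun s => g (Rmax 0 s))); apply cont_pos_ext; assumption.
Qed.

Lemma cont_pos_mult f g : cont_pos f -> cont_pos g -> cont_pos (fun t => f t * g t).
Proof.
  intros Hf Hg. apply cont_pos_of_ext. intros t.
  apply (continuous_mult (U := R_UniformSpace) (K := R_AbsRing)
    (fun s => f (Rmax 0 s)) (fun s => g (Rmax 0 s))); apply cont_pos_ext; assumption.
Qed.

Lemma cont_pos_opp f : cont_pos f -> cont_pos (fun t => - f t).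
Proof.
  intros H. apply (cont_pos_eq (fun t => (-1) * f t)); [intros; ring|].
  apply cont_pos_mult; [apply cont_pos_const|exact H].
Qed.

Lemma cont_pos_minus f g : cont_pos f -> cont_pos g -> cont_pos (fun t => f t - g t).
Proof. intros. unfold Rminus. apply cont_pos_plus; [|apply cont_pos_opp]; assumption. Qed.

Lemma cont_pos_pow f n : cont_pos f -> cont_pos (fun t => f t ^ n).
Proof. intros H. induction n; simpl; [apply cont_pos_const|apply cont_pos_mult; assumption]. Qed.

Lemma cont_pos_fsum n (f : nat -> R -> R) :
  (forall i, (i < n)%nat -> cont_pos (f i)) -> cont_pos (fun t => fsum n (fun i => f i t)).
Proof.
  induction n as [|n IH]; intros H; simpl; [apply cont_pos_const|].
  apply cont_pos_plus; [apply IH; intros|]; apply H; lia.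
Qed.

Lemma cont_pos_exp c : cont_pos (fun t => exp (c * t)).
Proof.
  apply continuous_cont_pos. intros t _.
  apply (ex_derive_continuous (K := R_AbsRing) (V := R_NormedModule)). auto_derive. trivial.
Qed.

Lemma cont_pos_bounded f T : cont_pos f -> 0 <= T -> exists B, 0 < B /\
  forall t, 0 <= t <= T -> Rabs (f t) <= B.
Proof.
  intros H HT.
  destruct (continuity_ab_maj (fun t => Rabs (f (Rmax 0 t))) 0 T HT) as [m [Hm _]].
  - intros t _. apply continuity_pt_filterlim.
    apply (continuous_comp (fun t => f (Rmax 0 t)) Rabs); [apply cont_pos_ext, H|apply continuous_Rabs].
  - exists (Rabs (f (Rmax 0 m)) + 1). split.
    + assert (A := Rabs_pos (f (Rmax 0 m))). lra.
    + intros t Ht. specialize (Hm t Ht). simpl in Hm. rewrite (Rmax_right 0 t) in Hm by lra. lra.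
Qed.

Lemma cont_pos_shift f h : cont_pos f -> 0 <= h -> cont_pos (fun t => f (t + h)).
Proof.
  intros H Hh t Ht eps He. destruct (H (t + h) ltac:(lra) eps He) as [d [Hd Hf]].
  exists d. split; [exact Hd|]. intros s Hs Hst. apply Hf; [lra|].
  replace (s + h - (t + h)) with (s - t) by ring. exact Hst.
Qed.

(** A mean value inequality asking for derivatives only inside the interval: trajectories are
    differentiable for t > 0 but merely continuous at 0. *)
Lemma increment_le f df a b c : cont_pos f -> 0 <= a -> a <= b ->
  (forall t, a < t < b -> is_derive f t (df t) /\ df t <= c) -> f b - f a <= c * (b - a).
Proof.
  intros Hf Ha Hab H. destruct Hab as [Hab| ->]; [|lra].
  set (F := fun s => f (Rmax 0 s)).
  assert (HF : forall t, a < t < b -> derivable_pt_lim F t (df t)).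
  { intros t Ht. apply is_derive_Reals. apply (is_derive_ext_loc f); [|apply H, Ht].
    exists (mkposreal t ltac:(lra)). intros s Hs. apply Rabs_lt_between in Hs. simpl in Hs.
    unfold minus, plus, opp in Hs; simpl in Hs. unfold F. rewrite Rmax_right by lra. reflexivity. }
  destruct (MVT F id a b (fun t Ht => exist _ (df t) (HF t Ht))
    (fun t _ => derivable_pt_id t) Hab) as [t [Ht E]].
  - intros t _. apply continuity_pt_filterlim, cont_pos_ext, Hf.
  - intros t _. apply derivable_continuous_pt, derivable_pt_id.
  - rewrite derive_pt_id in E. simpl in E. unfold id, F in E.
    rewrite (Rmax_right 0 a), (Rmax_right 0 b) in E by lra.
    destruct (H t Ht) as [_ Hc]. nra.
Qed.

Lemma gronwall_pos f df C r T : cont_pos f -> 0 <= C -> 0 <= r ->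
  (forall t, 0 < t < T -> is_derive f t (df t) /\ df t <= C * f t + r) ->
  forall t, 0 <= t <= T -> f t <= exp (C * t) * (f 0 + r * t).
Proof.
  intros Hf HC Hr H t Ht.
  assert (Hm : cont_pos (fun s => exp (- C * s) * f s)).
  { apply cont_pos_mult; [apply cont_pos_exp|exact Hf]. }
  assert (Hi := increment_le _ (fun s => - C * exp (- C * s) * f s + exp (- C * s) * df s) 0 t r Hm
    ltac:(lra) ltac:(lra)).
  assert (E : exp (- C * t) * f t - exp (- C * 0) * f 0 <= r * (t - 0)).
  { apply Hi. intros s Hs. destruct (H s ltac:(lra)) as [Hd Hle]. split.
    - apply (is_derive_mult (K := R_AbsRing) (fun s => exp (- C * s)) f).
      + auto_derive; [trivial|ring].
      + exact Hd.
      + intros; apply Rmult_comm.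
    - assert (exp (- C * s) <= 1).
      { rewrite <- exp_0. assert (0 <= C * s) by (apply Rmult_le_pos; lra).
        destruct (Req_dec (C * s) 0) as [E|E]; [replace (- C * s) with 0 by lra; lra|].
        apply Rlt_le, exp_increasing. lra. }
      assert (0 < exp (- C * s)) by apply exp_pos.
      replace (- C * exp (- C * s) * f s + exp (- C * s) * df s)
        with (exp (- C * s) * (df s - C * f s)) by ring.
      apply Rle_trans with (exp (- C * s) * r); [apply Rmult_le_compat_l; lra|nra]. }
  rewrite Rmult_0_r, exp_0 in E.
  assert (E' : exp (C * t) * exp (- C * t) = 1).
  { rewrite <- exp_plus. replace (C * t + - C * t) with 0 by ring. apply exp_0. }
  replace (f t) with (exp (C * t) * (exp (- C * t) * f t)) by (rewrite <- Rmult_assoc, E'; ring).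
  apply Rmult_le_compat_l; [apply Rlt_le, exp_pos|lra].
Qed.

Lemma derive_RInt_continuous (f : R -> R) a t : (forall s, continuous f s) ->
  is_derive (fun s => RInt f a s) t (f t).
Proof.
  intros H. apply (is_derive_RInt (V := R_NormedModule) f _ a); [|apply H].
  apply filter_forall. intros s. apply (RInt_correct (V := R_CompleteNormedModule)).
  apply (ex_RInt_continuous (V := R_CompleteNormedModule)). auto.
Qed.

Lemma is_derive_sq (f : R -> R) x l : is_derive f x l -> is_derive (fun s => f s ^ 2) x (2 * f x * l).
Proof.
  intros H. replace (2 * f x * l) with (INR 2 * l * f x ^ pred 2) by (simpl; ring).
  apply (is_derive_pow f 2), H.
Qed.

Lemma D_val (f : R -> R) (x l l' : R) : is_derive f x l -> l = l' -> is_derive f x l'.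
Proof. intros H <-. exact H. Qed.

Lemma D_plus (f g : R -> R) (x a b : R) : is_derive f x a -> is_derive g x b ->
  is_derive (fun t => f t + g t) x (a + b).
Proof. apply (is_derive_plus (K := R_AbsRing) (V := R_NormedModule)). Qed.

Lemma D_mult (f g : R -> R) (x a b : R) : is_derive f x a -> is_derive g x b ->
  is_derive (fun t => f t * g t) x (a * g x + f x * b).
Proof. intros Hf Hg. apply (is_derive_mult (K := R_AbsRing) f g x a b Hf Hg). intros; apply Rmult_comm. Qed.

Lemma D_scal (f : R -> R) (x c a : R) : is_derive f x a -> is_derive (fun t => c * f t) x (c * a).
Proof.
  intros H. eapply D_val; [apply (D_mult (fun _ => c) f x 0 a)|ring]; [|exact H].
  apply (is_derive_const (K := R_AbsRing) (V := R_NormedModule)).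
Qed.

Lemma D_minus (f g : R -> R) (x a b : R) : is_derive f x a -> is_derive g x b ->
  is_derive (fun t => f t - g t) x (a - b).
Proof. apply (is_derive_minus (K := R_AbsRing) (V := R_NormedModule)). Qed.

Lemma D_shift (f : R -> R) (x h l : R) : is_derive f (x - h) l -> is_derive (fun t => f (t - h)) x l.
Proof.
  intros H. eapply D_val; [apply (is_derive_comp (K := R_AbsRing) (V := R_NormedModule) f (fun t => t - h) x l 1 H)|].
  - eapply D_val; [apply (D_minus (fun t => t) (fun _ => h) x 1 0)|ring].
    + apply (is_derive_id (K := R_AbsRing)).
    + apply (is_derive_const (K := R_AbsRing) (V := R_NormedModule)).
  - apply Rmult_1_l.
Qed.

Lemma D_loc (f g : R -> R) (a x l : R) : a < x -> (forall t, a < t -> f t = g t) ->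
  is_derive f x l -> is_derive g x l.
Proof.
  intros Hx E. apply is_derive_ext_loc. exists (mkposreal (x - a) ltac:(lra)). intros t Ht.
  apply Rabs_lt_between in Ht. simpl in Ht. unfold minus, plus, opp in Ht; simpl in Ht.
  apply E. lra.
Qed.

(** The forcing may depend on the state, provided its square is bounded by the state and a constant
    E standing for the data. C depends only on n, a, c and T, hence serves all trajectories at
    once. *)
Lemma lin_gronwall n (a : nat -> R) c T : 0 <= c -> 0 <= T -> exists C, 0 < C /\
  forall (x f : nat -> R -> R) E, 0 <= E -> (forall r, (r < n)%nat -> cont_pos (x r)) ->
  (forall r t, (r < n)%nat -> 0 < t < T -> is_derive (x r) t (a r * x r t + f r t) /\
     f r t ^ 2 <= c * (fsum n (fun k => x k t ^ 2) + E)) ->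
  forall t, 0 <= t <= T -> fsum n (fun k => x k t ^ 2) <= C * (fsum n (fun k => x k 0 ^ 2) + E).
Proof.
  intros Hc HT. set (A := fsum n (fun r => Rabs (a r))).
  assert (HA : forall r, (r < n)%nat -> Rabs (a r) <= A).
  { intros r Hr. apply (fsum_term_le n (fun r => Rabs (a r))); [intros; apply Rabs_pos|exact Hr]. }
  assert (HA0 : 0 <= A) by (apply fsum_nonneg; intros; apply Rabs_pos).
  assert (Hn := pos_INR n).
  set (C1 := 2 * A + 1 + INR n * c). assert (HC1 : 0 < C1) by (unfold C1; nra).
  exists (exp (C1 * T) * (1 + INR n * c * T)).
  assert (He : 0 < exp (C1 * T)) by apply exp_pos.
  assert (HncT : 0 <= INR n * c * T) by (apply Rmult_le_pos; [apply Rmult_le_pos|]; assumption).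
  split; [nra|]. intros x f E HE Hx Hd t Ht.
  set (s := fun t => fsum n (fun k => x k t ^ 2)).
  assert (Hs0 : forall t, 0 <= s t) by (intros; apply fsum_nonneg; intros; apply pow2_ge_0).
  assert (Hs : cont_pos s) by (apply cont_pos_fsum; intros; apply cont_pos_pow; auto).
  assert (G := gronwall_pos s (fun t => fsum n (fun r => 2 * x r t * (a r * x r t + f r t))) C1
    (INR n * c * E) T Hs (Rlt_le _ _ HC1) ltac:(apply Rmult_le_pos; [apply Rmult_le_pos|]; assumption)).
  assert (Hg : s t <= exp (C1 * t) * (s 0 + INR n * c * E * t)).
  { apply G; [|exact Ht]. intros u Hu. split.
    - apply fsum_is_derive. intros r Hr. apply is_derive_sq, Hd; assumption.
    - apply Rle_trans with (fsum n (fun r => (2 * A + 1) * x r u ^ 2 + c * (s u + E))).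
      + apply fsum_le. intros r Hr. destruct (Hd r u Hr Hu) as [_ Hf]. specialize (HA r Hr).
        fold (s u) in Hf. apply Rabs_le_between in HA.
        assert (0 <= (x r u - f r u) ^ 2) by apply pow2_ge_0.
        assert (0 <= x r u ^ 2) by apply pow2_ge_0.
        assert (a r * x r u ^ 2 <= A * x r u ^ 2) by (apply Rmult_le_compat_r; lra). lra.
      + rewrite fsum_plus, fsum_scal, fsum_const. fold (s u). unfold C1. right. ring. }
  assert (H1 : exp (C1 * t) <= exp (C1 * T)).
  { destruct (Req_dec t T) as [->|]; [lra|]. apply Rlt_le, exp_increasing.
    apply Rmult_lt_compat_l; lra. }
  eapply Rle_trans; [exact Hg|]. rewrite (Rmult_assoc (exp (C1 * T))).
  assert (0 <= INR n * c * E) by (apply Rmult_le_pos; [apply Rmult_le_pos|]; assumption).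
  apply Rmult_le_compat; [apply Rlt_le, exp_pos| |exact H1|].
  - specialize (Hs0 0). assert (0 <= INR n * c * E * t) by (apply Rmult_le_pos; lra). lra.
  - fold (s 0). specialize (Hs0 0).
    assert (INR n * c * E * t <= INR n * c * E * T) by (apply Rmult_le_compat_l; lra).
    assert (0 <= INR n * c * T * s 0) by (apply Rmult_le_pos; assumption). lra.
Qed.

(** * Lebesgue integrals on [0,1] *)

Module LebFacts.
Import all_boot all_order all_algebra all_classical all_reals all_analysis Rstruct Rstruct_topology.
Import measurable_realfun.
Import Order.TTheory GRing.Theory Num.Theory numFieldNormedType.Exports.
Local Open Scope classical_set_scope.
Local Open Scope ring_scope.

Local Notation I01 := (`[(0 : R), (1 : R)]%classic : set R).
Local Notation mu := (@lebesgue_measure R).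

Definition meas01 (g : R -> R) : Prop := @measurable_fun _ _ Leb.MR Leb.MR I01 g.
Definition int01 (g : R -> R) : Prop := mu.-integrable I01 (EFin \o g).

Lemma mI : measurable (I01 : set Leb.MR). Proof. exact: measurable_itv. Qed.

Lemma mab (a b : R) : measurable (`[a, b]%classic : set Leb.MR). Proof. exact: measurable_itv. Qed.

Lemma in01P x : I01 x <-> Rle 0 x /\ Rle x 1.
Proof.
rewrite /= in_itv /=; split; first by move=> /andP[/RleP ? /RleP ?].
by case=> ? ?; apply/andP; split; apply/RleP.
Qed.

Lemma subI (a b : R) : Rle 0 a -> Rle b 1 -> `[a, b]%classic `<=` I01.
Proof.
move=> /RleP a0 /RleP b1 x /=; rewrite !in_itv /= => /andP[ax xb].
by rewrite (le_trans a0 ax) (le_trans xb b1).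
Qed.

Lemma meas_ext f g : (forall x, Rle 0 x /\ Rle x 1 -> f x = g x) -> meas01 f -> meas01 g.
Proof.
move=> fg; apply: eq_measurable_fun => x; rewrite inE => /in01P; exact: fg.
Qed.

Lemma meas_cont f : cont01 f -> meas01 f.
Proof.
move=> cf; apply: (@meas_ext (fun x => f (clamp x))); first by move=> x ?; rewrite clamp_id.
have: @measurable_fun _ _ Leb.MR Leb.MR setT (fun x => f (clamp x)).
  apply: continuous_measurable_fun => x; apply/continuity_pt_cvg.
  by apply/continuity_pt_filterlim; apply: cont01_ext.
exact: measurable_funS.
Qed.

Lemma meas_plus f g : meas01 f -> meas01 g -> meas01 (fun x => Rplus (f x) (g x)).
Proof. exact: measurable_funD. Qed.

Lemma meas_mult f g : meas01 f -> meas01 g -> meas01 (fun x => Rmult (f x) (g x)).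
Proof. exact: measurable_funM. Qed.

Lemma int_meas f : int01 f -> meas01 f.
Proof. by move=> /integrableP[/measurable_EFinP]. Qed.

Lemma int_le f g : meas01 f -> int01 g ->
  (forall x, Rle 0 x /\ Rle x 1 -> Rle (Rabs (f x)) (g x)) -> int01 f.
Proof.
move=> mf ig fg; apply: (le_integrable mI _ _ ig).
  exact/measurable_EFinP.
move=> x /in01P /fg /RleP fgx; rewrite /= lee_fin.
by apply: (le_trans fgx); exact: ler_norm.
Qed.

Lemma int_const c : int01 (fun _ => c).
Proof.
apply: (@measurable_bounded_integrable _ Leb.MR R mu (fun _ => c) I01 mI).
- have H : (@lebesgue_measure R (`[(0 : R), (1 : R)]%classic : set R) < +oo)%E.
    by rewrite lebesgue_measure_itv /= lte_fin ltr01 oppr0 adde0 ltry.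
  exact: H.
- exact: measurable_cst.
- by exists `|c|; split; [exact: num_real|move=> M cM x _ /=; exact: ltW].
Qed.

Lemma int_plus f g : int01 f -> int01 g -> int01 (fun x => Rplus (f x) (g x)).
Proof. move=> f1 g1; exact: (integrableD mI f1 g1). Qed.

Lemma int_scal c f : int01 f -> int01 (fun x => Rmult c (f x)).
Proof. move=> f1; exact: (integrableZl mI c f1). Qed.

Lemma sqint_iff g : Leb.sqint01 g <-> meas01 g /\ int01 (fun x => Rmult (g x) (g x)).
Proof. by []. Qed.

Lemma int_sub (a b : R) f : Rle 0 a -> Rle b 1 -> int01 f -> mu.-integrable `[a, b]%classic (EFin \o f).
Proof. move=> a0 b1; apply: integrableS; [exact: mI|exact: mab|exact: subI]. Qed.

Lemma lint_plus a b f g : Rle 0 a -> Rle b 1 -> int01 f -> int01 g ->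
  Leb.lint a b (fun x => Rplus (f x) (g x)) = Rplus (Leb.lint a b f) (Leb.lint a b g).
Proof. move=> a0 b1 f1 g1; apply: RintegralD; [exact: mab|exact: int_sub|exact: int_sub]. Qed.

Lemma lint_scal a b c f : Rle 0 a -> Rle b 1 -> int01 f ->
  Leb.lint a b (fun x => Rmult c (f x)) = Rmult c (Leb.lint a b f).
Proof. move=> a0 b1 f1; apply: RintegralZl; [exact: mab|exact: int_sub]. Qed.

Lemma lint_le a b f g : Rle 0 a -> Rle b 1 -> int01 f -> int01 g ->
  (forall x, Rle a x /\ Rle x b -> Rle (f x) (g x)) -> Rle (Leb.lint a b f) (Leb.lint a b g).
Proof.
move=> a0 b1 f1 g1 fg; apply/RleP/le_Rintegral; [exact: mab|exact: int_sub|exact: int_sub|].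
move=> x /=; rewrite in_itv /= => /andP[/RleP ? /RleP ?]; apply/RleP/fg; by split.
Qed.

Lemma lint_const a b c : Rle a b -> Leb.lint a b (fun _ => c) = Rmult c (Rminus b a).
Proof.
move=> /RleP ab; rewrite /Leb.lint Rintegral_cst; last exact: mab.
have H : fine (@lebesgue_measure R (`[a, b]%classic : set R)) = b - a.
  by rewrite lebesgue_measure_itv /= lte_fin; case: ltgtP ab => // -> _; rewrite subrr.
by congr (_ * _); exact: H.
Qed.

Lemma lint_Chasles a b c f : Rle 0 a -> Rle a b -> Rle b c -> Rle c 1 -> int01 f ->
  Leb.lint a c f = Rplus (Leb.lint a b f) (Leb.lint b c f).
Proof.
move=> a0 /RleP ab /RleP bc c1 f1.
have H := @Rintegral_itvB R f (BLeft a) (BRight c) b (int_sub a c f a0 c1 f1).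
rewrite /Leb.lint -(@Rintegral_itv_obnd_cbnd R b (BRight c) f).
  by rewrite -H ?bnd_simp //; symmetry; apply: Rplus_minus.
apply: (integrableS mI _ _ f1); first exact: measurable_itv.
move=> x /=; rewrite !in_itv /= => /andP[bx xc].
move/RleP: c1 => c1; move/RleP: a0 => a0.
by rewrite (le_trans a0 (le_trans ab (ltW bx))) (le_trans xc c1).
Qed.

Lemma lint_ext a b f g : (forall x, Rle a x /\ Rle x b -> f x = g x) ->
  Leb.lint a b f = Leb.lint a b g.
Proof.
move=> fg; apply: eq_Rintegral => x; rewrite inE /= in_itv /= => /andP[/RleP ? /RleP ?].
by apply: fg.
Qed.
End LebFacts.

Import LebFacts.

(** * Energy of an H^2 initial datum *)

Lemma cont01_uniform f eps : cont01 f -> 0 < eps -> exists d, 0 < d /\ forall x y,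
  0 <= x <= 1 -> 0 <= y <= 1 -> Rabs (x - y) < d -> Rabs (f x - f y) < eps.
Proof.
  intros Hf He.
  destruct (Heine (fun x => f (clamp x)) (fun c => 0 <= c <= 1) (compact_P3 0 1)) with (eps := mkposreal eps He)
    as [d Hd].
  - intros x _. apply continuity_pt_filterlim, cont01_ext, Hf.
  - exists d. split; [apply cond_pos|]. intros x y Hx Hy Hxy.
    specialize (Hd x y Hx Hy Hxy). simpl in Hd. rewrite !clamp_id in Hd by assumption. exact Hd.
Qed.

(** Summing over n equal steps of length below eta gives |H(x) - H(0)| <= eps x. This avoids
    almost-everywhere differentiation when the integrand is only square-integrable. *)
Lemma zero_increment (H : R -> R) :
  (forall eps, 0 < eps -> exists eta, 0 < eta /\ forall a b, 0 <= a -> a <= b -> b <= 1 ->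
     b - a < eta -> Rabs (H b - H a) <= eps * (b - a)) ->
  forall x, 0 <= x <= 1 -> H x = H 0.
Proof.
  intros Hinc x Hx. apply cond_eq. intros e He.
  destruct (Hinc (e / 2)) as [eta [Heta Hb]]; [lra|].
  destruct (INR_unbounded (1 / eta)) as [n Hn].
  assert (Hn0 : 0 < INR n).
  { eapply Rlt_trans; [|exact Hn]. apply Rdiv_lt_0_compat; lra. }
  set (t := fun k => x * (INR k / INR n)).
  assert (Hstep : forall k, t (S k) - t k = x / INR n).
  { intros k. unfold t. rewrite S_INR. field. lra. }
  assert (Hsmall : x / INR n < eta).
  { apply Rmult_lt_reg_r with (INR n); [exact Hn0|]. unfold Rdiv.
    rewrite Rmult_assoc, Rinv_l, Rmult_1_r by lra.
    apply Rmult_lt_compat_l with (r := eta) in Hn; [|exact Heta].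
    replace (eta * (1 / eta)) with 1 in Hn by (field; lra). lra. }
  assert (Hk : forall k, (k <= n)%nat -> Rabs (H (t k) - H 0) <= e / 2 * t k).
  { induction k as [|k IH]; intros Hkn.
    - unfold t. simpl. replace (x * (0 / INR n)) with 0 by (field; lra).
      rewrite Rminus_diag, Rabs_R0. lra.
    - assert (Htk : 0 <= t k).
      { unfold t. apply Rmult_le_pos; [lra|]. apply Rdiv_le_0_compat; [apply pos_INR|exact Hn0]. }
      assert (Htk1 : t (S k) <= 1).
      { unfold t. apply Rle_trans with (1 * 1); [|lra].
        apply Rmult_le_compat; try lra.
        - apply Rdiv_le_0_compat; [apply pos_INR|exact Hn0].
        - apply Rle_div_l; [exact Hn0|]. rewrite Rmult_1_l. apply le_INR, Hkn. }
      specialize (Hstep k).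
      assert (0 <= x / INR n) by (apply Rdiv_le_0_compat; lra).
      specialize (Hb (t k) (t (S k)) Htk ltac:(lra) Htk1 ltac:(lra)).
      specialize (IH ltac:(lia)).
      replace (H (t (S k)) - H 0) with ((H (t (S k)) - H (t k)) + (H (t k) - H 0)) by ring.
      eapply Rle_trans; [apply Rabs_triang|]. lra. }
  specialize (Hk n (le_n n)). replace (t n) with x in Hk by (unfold t; field; lra).
  eapply Rle_lt_trans; [exact Hk|]. nra.
Qed.

Lemma int_cont f : cont01 f -> int01 f.
Proof.
  intros Hf. destruct (cont01_bounded f Hf) as [B [_ HB]].
  apply (int_le f (fun _ => B)); [apply meas_cont, Hf|apply int_const|exact HB].
Qed.

Lemma int_cont_sq f g : cont01 f -> Leb.sqint01 g -> int01 (fun x => f x * g x).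
Proof.
  intros Hf Hg. apply sqint_iff in Hg. destruct Hg as [Hm Hi].
  destruct (cont01_bounded f Hf) as [B [HB0 HB]].
  apply (int_le _ (fun x => B * (1 + g x * g x))).
  - apply meas_mult; [apply meas_cont, Hf|exact Hm].
  - apply int_scal, int_plus; [apply int_const|exact Hi].
  - intros x Hx. rewrite Rabs_mult. apply Rmult_le_compat; try apply Rabs_pos; [apply HB, Hx|].
    assert (0 <= (g x - 1) ^ 2) by apply pow2_ge_0. assert (0 <= (g x + 1) ^ 2) by apply pow2_ge_0.
    assert (0 <= g x * g x) by nra.
    apply Rabs_le. split; lra.
Qed.

Lemma lint_bound a b f c : 0 <= a -> a <= b -> b <= 1 -> int01 f ->
  (forall x, a <= x <= b -> Rabs (f x) <= c) -> Rabs (Leb.lint a b f) <= c * (b - a).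
Proof.
  intros Ha Hab Hb Hf H. apply Rabs_le. split.
  - replace (- (c * (b - a))) with ((- c) * (b - a)) by ring. rewrite <- (lint_const a b (- c) Hab).
    apply lint_le; auto using int_const. intros x Hx. specialize (H x Hx).
    apply Rabs_le_between in H. lra.
  - rewrite <- (lint_const a b c Hab). apply lint_le; auto using int_const. intros x Hx.
    specialize (H x Hx). apply Rabs_le_between in H. lra.
Qed.

Lemma lint_minus a b f g : 0 <= a -> b <= 1 -> int01 f -> int01 g ->
  Leb.lint a b (fun x => f x - g x) = Leb.lint a b f - Leb.lint a b g.
Proof.
  intros Ha Hb Hf Hg.
  rewrite (lint_ext a b (fun x => f x - g x) (fun x => f x + (-1) * g x)) by (intros; ring).
  rewrite lint_plus, lint_scal; auto using int_scal. ring.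
Qed.

(** On a short interval both integrals differ from f(s) (t - s) by at most eps/2 (t - s), by uniform
    continuity, so [zero_increment] applies to the difference of the two primitives. *)
Lemma lint_RInt f a b : cont01 f -> 0 <= a -> a <= b -> b <= 1 -> Leb.lint a b f = RInt f a b.
Proof.
  intros Hf Ha Hab Hb. assert (Hi := int_cont f Hf).
  assert (HH : forall x, 0 <= x <= 1 -> Leb.lint 0 x f - RInt f 0 x = Leb.lint 0 0 f - RInt f 0 0).
  { apply (zero_increment (fun x => Leb.lint 0 x f - RInt f 0 x)). intros eps He.
    destruct (cont01_uniform f (eps / 2) Hf) as [d [Hd Hu]]; [lra|].
    exists d. split; [exact Hd|]. intros s t Hs Hst Ht Hsd.
    rewrite (lint_Chasles 0 s t) by (auto; lra).
    rewrite <- (RInt_c01_Chasles f 0 s t) by (auto; lra).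
    assert (E1 : Rabs (Leb.lint s t (fun x => f x - f s)) <= eps / 2 * (t - s)).
    { apply lint_bound; auto; [apply int_cont; auto with c01|]. intros x Hx.
      apply Rlt_le, Hu; [lra|lra|]. rewrite Rabs_right; lra. }
    assert (E2 : Rabs (RInt (fun x => f x - f s) s t) <= eps / 2 * (t - s)).
    { eapply Rle_trans; [apply RInt_c01_abs; auto with c01|].
      apply Rle_trans with (RInt (fun _ => eps / 2) s t); [|rewrite RInt_const01; lra].
      apply RInt_c01_le; auto with c01. intros x Hx.
      apply Rlt_le, Hu; [lra|lra|]. rewrite Rabs_right; lra. }
    rewrite lint_minus, lint_const in E1 by (auto using int_const; lra).
    rewrite RInt_c01_minus, RInt_const01 in E2 by (auto with c01; lra).
    apply Rabs_le_between in E1. apply Rabs_le_between in E2. apply Rabs_le. lra. }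
  assert (Ea := HH a ltac:(lra)). assert (Eb := HH b ltac:(lra)).
  rewrite (lint_Chasles 0 a b) in Eb by (auto; lra).
  rewrite <- (RInt_c01_Chasles f 0 a b) in Eb by (auto; lra). lra.
Qed.

(* The defect H of the product rule satisfies H(b) - H(a) = o(b - a) uniformly. *)
Lemma lint_by_parts psi dpsi W g : deriv01 psi dpsi -> cont01 W -> Leb.sqint01 g ->
  (forall x, 0 <= x <= 1 -> W x = W 0 + Leb.lint 0 x g) ->
  Leb.lint 0 1 (fun x => dpsi x * W x + psi x * g x) = psi 1 * W 1 - psi 0 * W 0.
Proof.
  intros Hpsi HW Hg HWg. assert (Hpc := deriv01_cont _ _ Hpsi). assert (Hdc := deriv01_cont_deriv _ _ Hpsi).
  assert (Hgi : int01 g).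
  { assert (X := int_cont_sq (fun _ => 1) g (cont01_const 1) Hg).
    apply (int_le _ (fun x => 1 + g x * g x)); apply sqint_iff in Hg; destruct Hg as [Hm Hi];
      [exact Hm|apply int_plus; [apply int_const|exact Hi]|].
    intros x _. apply Rabs_le.
    assert (0 <= (g x - 1) ^ 2) by apply pow2_ge_0. assert (0 <= (g x + 1) ^ 2) by apply pow2_ge_0.
    assert (0 <= g x * g x) by nra. split; lra. }
  assert (Hgg : int01 (fun x => g x * g x)) by (apply sqint_iff in Hg; apply Hg).
  set (F := fun x => dpsi x * W x + psi x * g x).
  assert (HF : int01 F).
  { apply int_plus; [apply int_cont; auto with c01|apply int_cont_sq; assumption]. }
  destruct (cont01_bounded dpsi Hdc) as [B [HB0 HB]].
  set (G := Leb.lint 0 1 (fun x => g x * g x)).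
  assert (HGab : forall a b, 0 <= a -> a <= b -> b <= 1 -> 0 <= Leb.lint a b (fun x => g x * g x)).
  { intros a b Ha Hab Hb. replace 0 with (0 * (b - a)) by ring. rewrite <- (lint_const a b 0 Hab).
    apply lint_le; auto using int_const. intros; nra. }
  assert (HG : forall a b, 0 <= a -> a <= b -> b <= 1 -> Leb.lint a b (fun x => g x * g x) <= G).
  { intros a b Ha Hab Hb. unfold G. rewrite (lint_Chasles 0 a 1) by (auto; lra).
    rewrite (lint_Chasles a b 1) by (auto; lra).
    assert (A1 := HGab 0 a ltac:(lra) ltac:(lra) ltac:(lra)).
    assert (A2 := HGab b 1 ltac:(lra) ltac:(lra) ltac:(lra)). lra. }
  assert (HG0 : 0 <= G) by (apply HGab; lra).
  assert (E : psi 1 * W 1 - Leb.lint 0 1 F = psi 0 * W 0 - Leb.lint 0 0 F).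
  { apply (zero_increment (fun x => psi x * W x - Leb.lint 0 x F)); [|lra]. intros eps He.
    destruct (cont01_uniform W (eps / (4 * B)) HW) as [d [Hd Hu]]; [apply Rdiv_lt_0_compat; lra|].
    (* Parameter of Young's inequality |g| <= (s + g^2 / s) / 2, chosen so that B G / s <= eps/2,
       where G is the integral of g^2 over [0,1]. *)
    set (s := 1 + 2 * B * G / eps).
    assert (Hs : 0 < s).
    { unfold s. assert (0 <= 2 * B * G / eps); [|lra]. apply Rdiv_le_0_compat; nra. }
    exists (Rmin d (eps / (B * s))). split.
    { apply Rmin_pos; [exact Hd|]. apply Rdiv_lt_0_compat; [lra|nra]. }
    intros a b Ha Hab Hb Hd'.
    assert (Hd1 : b - a < d) by (eapply Rlt_le_trans; [exact Hd'|apply Rmin_l]).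
    assert (Hd2 : b - a < eps / (B * s)) by (eapply Rlt_le_trans; [exact Hd'|apply Rmin_r]).
    assert (HWab : W b = W a + Leb.lint a b g).
    { rewrite (HWg a), (HWg b), (lint_Chasles 0 a b) by (auto; lra). ring. }
    (* The increment of the defect over [a,b] is the integral of this function: W(b) - W(x) is
       uniformly small, and psi(a) - psi(x) is of order b - a. *)
    set (h := fun x => dpsi x * (W b - W x) + (psi a - psi x) * g x).
    assert (Hhi : int01 h).
    { apply int_plus; [apply int_cont; auto with c01|].
      apply (int_cont_sq (fun x => psi a - psi x)); auto with c01. }
    assert (Eh : (psi b * W b - Leb.lint 0 b F) - (psi a * W a - Leb.lint 0 a F) = Leb.lint a b h).
    { rewrite (lint_Chasles 0 a b F) by (auto; lra).
      rewrite (lint_ext a b h (fun x => (W b * dpsi x + psi a * g x) - F x))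
        by (intros; unfold h, F; ring).
      rewrite lint_minus, lint_plus, !lint_scal; auto using int_scal, int_cont, int_plus.
      rewrite (lint_RInt dpsi), (FTC01 _ _ a b Hpsi), HWab by (auto; lra). ring. }
    rewrite Eh.
    assert (Hpw : forall x, a <= x <= b ->
      Rabs (h x) <= B * (eps / (4 * B)) + B * (b - a) * ((s + / s * (g x * g x)) / 2)).
    { intros x Hx. unfold h. eapply Rle_trans; [apply Rabs_triang|].
      apply Rplus_le_compat; rewrite Rabs_mult; apply Rmult_le_compat; try apply Rabs_pos.
      - apply HB; lra.
      - apply Rlt_le, Hu; [lra|lra|]. rewrite Rabs_right; lra.
      - rewrite Rabs_minus_sym, <- (FTC01 _ _ a x Hpsi) by lra.
        eapply Rle_trans; [apply RInt_c01_abs; auto; lra|].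
        apply Rle_trans with (RInt (fun _ => B) a x).
        + apply RInt_c01_le; auto with c01; try lra. intros; apply HB; lra.
        + rewrite RInt_const01. nra.
      - assert (0 < / s) by (apply Rinv_0_lt_compat, Hs).
        assert (0 <= / s * (g x - s) ^ 2) by (apply Rmult_le_pos; [lra|apply pow2_ge_0]).
        assert (0 <= / s * (g x + s) ^ 2) by (apply Rmult_le_pos; [lra|apply pow2_ge_0]).
        replace (/ s * (g x - s) ^ 2) with (/ s * (g x * g x) - 2 * g x + s) in H0 by (field; lra).
        replace (/ s * (g x + s) ^ 2) with (/ s * (g x * g x) + 2 * g x + s) in H1 by (field; lra).
        apply Rabs_le. split; lra. }
    set (bd := fun x => B * (eps / (4 * B)) + B * (b - a) * ((s + / s * (g x * g x)) / 2)).
    assert (Hbd : int01 bd).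
    { apply int_plus; [apply int_const|]. apply int_scal. unfold Rdiv.
      apply (int_le _ (fun x => / 2 * s + (/ 2 * / s) * (g x * g x))).
      - apply (meas_ext (fun x => / 2 * s + (/ 2 * / s) * (g x * g x))); [intros; ring|].
        apply int_meas. apply int_plus; [apply int_const|apply int_scal, Hgg].
      - apply int_plus; [apply int_const|apply int_scal, Hgg].
      - intros x _. right. rewrite Rabs_right; [ring|].
        assert (0 < / s) by (apply Rinv_0_lt_compat, Hs).
        assert (0 <= / s * (g x * g x)) by (apply Rmult_le_pos; nra). lra. }
    assert (Hbl : Leb.lint a b bd <= eps * (b - a)).
    { rewrite (lint_ext a b bd (fun x => (eps / 4 + B * (b - a) * s / 2)
          + B * (b - a) * / s / 2 * (g x * g x))) by (intros; unfold bd; field; lra).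
      rewrite lint_plus, lint_const, lint_scal by (auto using int_const, int_scal).
      specialize (HG a b Ha Hab Hb).
      assert (K1 : B * (b - a) * s / 2 <= eps / 2).
      { apply Rmult_lt_compat_r with (r := B * s) in Hd2; [|nra].
        replace (eps / (B * s) * (B * s)) with eps in Hd2 by (field; lra). lra. }
      assert (K2 : B * / s * G <= eps / 2).
      { apply Rmult_le_reg_l with s; [exact Hs|].
        replace (s * (B * / s * G)) with (B * G) by (field; lra).
        unfold s. replace ((1 + 2 * B * G / eps) * (eps / 2)) with (eps / 2 + B * G) by (field; lra).
        lra. }
      assert (0 < / s) by (apply Rinv_0_lt_compat, Hs).
      assert (K3 : B * (b - a) * / s / 2 * Leb.lint a b (fun x => g x * g x) <= (b - a) / 2 * (eps / 2)).
      { apply Rle_trans with ((b - a) / 2 * (B * / s * G)); [|apply Rmult_le_compat_l; lra].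
        replace ((b - a) / 2 * (B * / s * G)) with (B * (b - a) * / s / 2 * G) by (field; lra).
        apply Rmult_le_compat_l; [|exact HG].
        assert (0 <= B * (b - a)) by (apply Rmult_le_pos; lra).
        assert (0 <= B * (b - a) * / s) by (apply Rmult_le_pos; lra). lra. }
      apply Rmult_le_compat_r with (r := b - a) in K1; [|lra]. nra. }
    apply Rabs_le. split.
    - apply Rle_trans with (Leb.lint a b (fun x => (-1) * bd x)).
      + rewrite lint_scal by auto. lra.
      + apply lint_le; auto using int_scal. intros x Hx. specialize (Hpw x Hx).
        apply Rabs_le_between in Hpw. fold (bd x) in Hpw. lra.
    - eapply Rle_trans; [|exact Hbl]. apply lint_le; auto. intros x Hx. specialize (Hpw x Hx).
      apply Rabs_le_between in Hpw. apply Hpw. }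
  assert (E0 : Leb.lint 0 0 F = 0).
  { assert (X := lint_Chasles 0 0 0 F ltac:(lra) ltac:(lra) ltac:(lra) ltac:(lra) HF). lra. }
  fold F. lra.
Qed.

Lemma sqint_affine g c : Leb.sqint01 g -> Leb.sqint01 (fun x => g x - c).
Proof.
  intros Hg. apply sqint_iff in Hg. destruct Hg as [Hm Hi]. apply sqint_iff.
  assert (Hm' : meas01 (fun x => g x - c)).
  { apply (meas_plus g (fun _ => - c)); [exact Hm|]. apply meas_cont, cont01_const. }
  split; [exact Hm'|].
  apply (int_le _ (fun x => 2 * (g x * g x) + 2 * c ^ 2)).
  - apply meas_mult; exact Hm'.
  - apply int_plus; [apply int_scal, Hi|apply int_const].
  - intros x _. rewrite Rabs_right by (apply Rle_ge, Rle_0_sqr).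
    assert (0 <= (g x + c) ^ 2) by apply pow2_ge_0. lra.
Qed.

Lemma H2_shift f df d2f c : H2_01 f df d2f ->
  H2_01 (fun x => f x - c * x ^ 2) (fun x => df x - 2 * c * x) (fun x => d2f x - 2 * c).
Proof.
  intros (H1 & H2 & H3). split; [|split].
  - apply deriv01_minus; [exact H1|]. apply deriv01_is_derive; intros x.
    + auto_derive; [trivial|ring].
    + apply (ex_derive_continuous (K := R_AbsRing) (V := R_NormedModule)). auto_derive. trivial.
  - apply (sqint_affine d2f (2 * c)), H2.
  - intros x Hx.
    assert (Hi : int01 d2f).
    { assert (X := int_cont_sq (fun _ => 1) d2f (cont01_const 1) H2).
      apply (int_le _ (fun x => 1 + d2f x * d2f x)); apply sqint_iff in H2; destruct H2 as [Hm Hi];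
        [exact Hm|apply int_plus; [apply int_const|exact Hi]|].
      intros y _. apply Rabs_le.
      assert (0 <= (d2f y - 1) ^ 2) by apply pow2_ge_0. assert (0 <= (d2f y + 1) ^ 2) by apply pow2_ge_0.
      assert (0 <= d2f y * d2f y) by nra. split; lra. }
    rewrite lint_minus, lint_const, (H3 x Hx) by (auto using int_const; lra). ring.
Qed.

Section Energy.
Variables (p dp q : R -> R) (th1 th2 : R).
Hypothesis Hth1 : 0 <= th1 < PI / 2.
Hypothesis Hth2 : 0 <= th2 <= PI / 2.
Hypothesis Hp : deriv01 p dp.
Hypothesis Hppos : forall x, 0 <= x <= 1 -> 0 < p x.
Hypothesis Hq : cont01 q.
Hypothesis Hqpos : forall x, 0 <= x <= 1 -> 0 < q x.

(** Integration by parts turns the energy into the integral of (A w) w; Young's inequality with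
    weight m and coercivity absorb the |w|^2 term into half of the energy. This is how the Lebesgue
    norm of A w_0 enters the estimate. *)
Lemma H2_energy : exists C, 0 < C /\ forall w dw d2w, H2_01 w dw d2w -> bc th1 th2 w dw ->
  aform p q th1 th2 w dw w dw
  <= C * Leb.lint 0 1 (fun x => (- (dp x * dw x + p x * d2w x) + q x * w x) ^ 2).
Proof.
  assert (Hpc := deriv01_cont _ _ Hp). assert (Hdp : cont01 dp) by apply Hp.
  destruct (coercive p dp q th1 th2 Hth1 Hth2 Hp Hppos Hq Hqpos) as [m [Hm Hco]].
  exists (/ m). split; [apply Rinv_0_lt_compat, Hm|]. intros w dw d2w (H1 & H2 & H3) Hbc.
  assert (Hw := deriv01_cont _ _ H1). assert (Hdw := deriv01_cont_deriv _ _ H1).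
  set (A := fun x => - (dp x * dw x + p x * d2w x) + q x * w x).
  assert (H2' := proj1 (sqint_iff _) H2). destruct H2' as [Hm2 Hi2].
  assert (HAm : meas01 A).
  { apply (meas_ext (fun x => (q x * w x - dp x * dw x) + - p x * d2w x)); [intros; unfold A; ring|].
    apply meas_plus; [apply meas_cont; auto with c01|].
    apply meas_mult; [apply meas_cont; auto with c01|exact Hm2]. }
  destruct (cont01_bounded (fun x => q x * w x - dp x * dw x)) as [B1 [HB10 HB1]]; [auto with c01|].
  destruct (cont01_bounded p Hpc) as [B2 [HB20 HB2]].
  assert (HAi : int01 (fun x => A x ^ 2)).
  { apply (int_le _ (fun x => 2 * B1 ^ 2 + 2 * B2 ^ 2 * (d2w x * d2w x))).
    - apply (meas_ext (fun x => A x * A x)); [intros; ring|]. apply meas_mult; exact HAm.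
    - apply int_plus; [apply int_const|apply int_scal, Hi2].
    - intros x Hx. rewrite Rabs_right by (apply Rle_ge, pow2_ge_0).
      specialize (HB1 x Hx). specialize (HB2 x Hx).
      replace (A x) with ((q x * w x - dp x * dw x) - p x * d2w x) by (unfold A; ring).
      set (u := q x * w x - dp x * dw x) in *. set (v := p x * d2w x).
      assert (u ^ 2 <= B1 ^ 2) by (apply pow_maj_Rabs, HB1).
      assert (v ^ 2 <= B2 ^ 2 * (d2w x * d2w x)).
      { unfold v. replace ((p x * d2w x) ^ 2) with (p x ^ 2 * (d2w x * d2w x)) by ring.
        apply Rmult_le_compat_r; [nra|]. apply pow_maj_Rabs, HB2. }
      assert (0 <= (u + v) ^ 2) by apply pow2_ge_0. lra. }
  assert (Hparts := lint_by_parts (fun x => p x * w x) _ dw d2w (deriv01_mult _ _ _ _ Hp H1) Hdw H2 H3).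
  simpl in Hparts.
  set (F := fun x => (dp x * w x + p x * dw x) * dw x + p x * w x * d2w x) in Hparts.
  set (e := fun x => p x * dw x * dw x + q x * w x * w x).
  assert (Hec : cont01 e) by (unfold e; auto 6 with c01).
  assert (HFi : int01 F).
  { apply int_plus; [apply int_cont; auto 6 with c01|].
    apply (int_cont_sq (fun x => p x * w x)); [auto with c01|exact H2]. }
  assert (HE : RInt e 0 1 = Leb.lint 0 1 (fun x => e x - F x) + (p 1 * w 1 * dw 1 - p 0 * w 0 * dw 0)).
  { rewrite lint_minus, Hparts, (lint_RInt e); auto using int_cont; lra. }
  assert (Ha : aform p q th1 th2 w dw w dw = Leb.lint 0 1 (fun x => e x - F x)).
  { unfold aform. fold e.
    assert (E0 := k0_bc p th1 th2 Hth1 _ _ _ _ Hbc Hbc).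
    assert (E1 := k1_bc p th1 th2 Hth1 Hth2 _ _ _ _ Hbc Hbc).
    change (RInt (fun x => p x * dw x * dw x + q x * w x * w x) 0 1) with (RInt e 0 1).
    rewrite HE. lra. }
  assert (Hle : Leb.lint 0 1 (fun x => e x - F x)
    <= Leb.lint 0 1 (fun x => / (2 * m) * A x ^ 2 + m / 2 * (w x * w x))).
  { rewrite (lint_ext 0 1 (fun x => e x - F x) (fun x => e x + (-1) * F x)) by (intros; ring).
    apply lint_le; try lra.
    - apply int_plus; [apply int_cont, Hec|apply int_scal, HFi].
    - apply int_plus; [apply int_scal, HAi|apply int_scal, int_cont; auto with c01].
    - intros x Hx. replace (e x + (-1) * F x) with (A x * w x) by (unfold e, F, A; ring).
      assert (0 <= / (2 * m) * (A x - m * w x) ^ 2).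
      { apply Rmult_le_pos; [apply Rlt_le, Rinv_0_lt_compat; lra|apply pow2_ge_0]. }
      replace (/ (2 * m) * (A x - m * w x) ^ 2)
        with (/ (2 * m) * A x ^ 2 + m / 2 * (w x * w x) - A x * w x) in H by (field; lra). lra. }
  rewrite lint_plus, !lint_scal in Hle by (auto using int_scal, int_cont with c01; lra).
  rewrite (lint_RInt (fun x => w x * w x)) in Hle by (auto with c01; lra).
  fold (ip w w) in Hle. specialize (Hco w dw H1).
  assert (0 <= ip dw dw) by (apply ip_nonneg, Hdw).
  rewrite <- Ha in Hle. set (a := aform p q th1 th2 w dw w dw) in *.
  set (S := Leb.lint 0 1 (fun x => A x ^ 2)) in *.
  assert (Hle2 : a <= / (2 * m) * S + a / 2) by nra.
  replace (/ (2 * m)) with (/ m / 2) in Hle2 by (field; lra). change (a <= / m * S). lra.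
Qed.
End Energy.

(** * The modal system *)

(* [tzh] is the observer state, [tzm n] the n-th plant mode, [tu] the control, [tg] the boundary trace
   z_x(.,0), [ty] the delayed measurement, [tG] the energy of the homogenised state w and [tY] a
   bound on the initial measurement. *)
Record traj := mkTraj {
  tzh : nat -> R -> R; tzm : nat -> R -> R; tu : R -> R; tg : R -> R; ty : R -> R;
  tG : R -> R; tY : R }.

Section Modal.
Variables (D : SysData) (N : nat).

Definition wn (T : traj) (n : nat) (t : R) : R := tzm T n t + bn D n * tu T t.
(* The part of the trace w_x(t,0) carried by the modes n > N. *)
Definition zeta (T : traj) (t : R) : R :=
  tg T t - fsum N (fun k => wn T (S k) t * dphi D (S k) 0).
Definition innov (T : traj) (t : R) : R :=
  fsum N (fun k => (tzh T (S k) t + bn D (S k) * tu T (t - hd D)) * dphi D (S k) 0) - ty T t.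
(** Formed for every mode r < N in the sequel, although the control only reads r < N0: the
    predictors of the remaining modes make up the third block of the state. *)
Definition zap (T : traj) (r : nat) (t : R) : R := ZA D (tzh T) (tu T) r t.
(* The time derivative of the control, see [u_derive]. *)
Definition ud (T : traj) (t : R) : R :=
  fsum (N0 D) (fun r => Kg D r * (fsum (N0 D) (fun c => A0BK D r c * zap T c t)
     + eA0h D r * Lg D r * - innov T t)).
(** The observer gain extended by zero, so that the two families of controller equations take one
    form. *)
Definition inj (r : nat) : R := if Nat.ltb r (N0 D) then Lg D r else 0.

(** All that the decay proof knows about the plant. [m_G] is Bessel's inequality for the energy,
    [m_Glim] its sharpness, [m_trace] the convergence of the truncated trace. The last two are only
    asked for away from t = 0, where A w is a continuous function. *)
Record modal (T : traj) : Prop := mkModal {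
  m_zm : forall n, (1 <= n)%nat -> cont_pos (tzm T n);
  m_zh : forall n, (1 <= n <= N)%nat -> cont_pos (tzh T n);
  m_u : forall t, continuous (tu T) t;
  m_g : cont_pos (tg T);
  m_u0 : forall t, t <= 0 -> tu T t = tu T 0;
  m_K : forall t, 0 <= t -> tu T t = fsum (N0 D) (fun r => Kg D r * zap T r t);
  m_dzm : forall n t, (1 <= n)%nat -> 0 < t ->
    is_derive (tzm T n) t ((- lam D n + qc D) * tzm T n t + betan D n * tu T t);
  m_dzh : forall r t, (r < N)%nat -> 0 < t ->
    is_derive (tzh T (S r)) t (A0d D r * tzh T (S r) t + B0 D r * tu T (t - hd D)
                               - inj r * innov T t);
  m_Y : forall t, 0 <= t < hd D -> Rabs (ty T t) <= tY T;
  m_y : forall t, hd D <= t -> ty T t = tg T (t - hd D);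
  m_G : forall t M, 0 <= t -> fsum M (fun k => lam D (S k) * wn T (S k) t ^ 2) <= tG T t;
  m_Glim : forall t eta, 0 < t -> 0 < eta -> exists M,
    tG T t <= fsum M (fun k => lam D (S k) * wn T (S k) t ^ 2) + eta;
  m_trace : forall a b eta, 0 < a -> 0 < eta -> exists M0, forall M t, (M0 <= M)%nat -> a <= t <= b ->
    (tg T t - fsum M (fun k => wn T (S k) t * dphi D (S k) 0)) ^ 2 <= eta }.

Definition init_size (T : traj) : R :=
  tG T 0 + fsum N (fun k => tzh T (S k) 0 ^ 2) + tu T 0 ^ 2 + tY T ^ 2.

Hypothesis HN : (N0 D <= N)%nat.
Hypothesis Hh : 0 < hd D.
Hypothesis Hdel : 0 < delta D.
Hypothesis Hlp : forall n, (1 <= n)%nat -> 0 < lam D n.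
Hypothesis Hll : forall n m, (1 <= n)%nat -> (n <= m)%nat -> lam D n <= lam D m.
Hypothesis Hab : forall n, (1 <= n)%nat -> an D n = betan D n + (lam D n - qc D) * bn D n.
Hypothesis Hsa : exists C, 0 < C /\ forall M, fsum M (fun k => an D (S k) ^ 2) <= C.
Hypothesis Hsb : exists C, 0 < C /\ forall M, fsum M (fun k => bn D (S k) ^ 2) <= C.
Hypothesis Hsphi : exists C, 0 < C /\
  forall M, fsum M (fun k => (dphi D (S k) 0 / lam D (S k)) ^ 2) <= C.

Lemma init_size_nonneg T : modal T -> 0 <= tG T 0 /\ 0 <= init_size T.
Proof.
  intros HT. assert (A := m_G T HT 0 0 (Rle_refl 0)). simpl in A.
  assert (0 <= fsum N (fun k => tzh T (S k) 0 ^ 2)) by (apply fsum_nonneg; intros; apply pow2_ge_0).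
  assert (0 <= tu T 0 ^ 2) by apply pow2_ge_0. assert (0 <= tY T ^ 2) by apply pow2_ge_0.
  unfold init_size. lra.
Qed.

Lemma zap_formula T r t : modal T -> zap T r t = eA0h D r * tzh T (S r) t
  + B0 D r * exp (A0d D r * t) *
    (RInt (fun s => exp (- A0d D r * s) * tu T s) 0 t
     - RInt (fun s => exp (- A0d D r * s) * tu T s) 0 (t - hd D)).
Proof.
  intros HT. unfold zap, ZA. f_equal.
  set (f := fun s => exp (- A0d D r * s) * tu T s).
  assert (Hf : forall s, continuous f s).
  { intros s. apply (continuous_mult (U := R_UniformSpace) (K := R_AbsRing)); [|apply (m_u T HT)].
    apply (ex_derive_continuous (K := R_AbsRing) (V := R_NormedModule)). auto_derive. trivial. }
  assert (Hex : forall a b, ex_RInt f a b).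
  { intros. apply (ex_RInt_continuous (V := R_CompleteNormedModule)). auto. }
  rewrite (RInt_ext _ (fun s => B0 D r * exp (A0d D r * t) * f s)).
  - rewrite (RInt_scal (V := R_CompleteNormedModule) f) by apply Hex.
    unfold scal; simpl; unfold mult; simpl. apply Rmult_eq_compat_l.
    assert (E := RInt_Chasles (V := R_CompleteNormedModule) f 0 (t - hd D) t (Hex _ _) (Hex _ _)).
    unfold plus in E; simpl in E. lra.
  - intros s _. unfold f.
    replace (exp (A0d D r * (t - s))) with (exp (A0d D r * t) * exp (- A0d D r * s))
      by (rewrite <- exp_plus; f_equal; ring).
    change (@eq R (exp (A0d D r * t) * exp (- A0d D r * s) * B0 D r * tu T s)
      (B0 D r * exp (A0d D r * t) * (exp (- A0d D r * s) * tu T s))). ring.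
Qed.

Lemma weighted_u_continuous T c : modal T -> forall s, continuous (fun s => exp (c * s) * tu T s) s.
Proof.
  intros HT s. apply (continuous_mult (U := R_UniformSpace) (K := R_AbsRing)); [|apply (m_u T HT)].
  apply (ex_derive_continuous (K := R_AbsRing) (V := R_NormedModule)). auto_derive. trivial.
Qed.

(** The purpose of the predictor: the lower limit of the memory integral contributes exactly minus
    e^{A0 h} times the delayed input, so only the undelayed u(t) remains. *)
Lemma zap_derive T r t : modal T -> (r < N)%nat -> 0 < t ->
  is_derive (zap T r) t (A0d D r * zap T r t + B0 D r * tu T t - eA0h D r * (inj r * innov T t)).
Proof.
  intros HT Hr Ht.
  set (f := fun s => exp (- A0d D r * s) * tu T s).
  assert (Hf := weighted_u_continuous T (- A0d D r) HT). fold f in Hf.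
  apply (is_derive_ext (fun t => eA0h D r * tzh T (S r) t
    + B0 D r * exp (A0d D r * t) * (RInt f 0 t - RInt f 0 (t - hd D)))).
  { intros s. rewrite (zap_formula T r s HT). reflexivity. }
  assert (De : is_derive (fun t => B0 D r * exp (A0d D r * t)) t (B0 D r * (A0d D r * exp (A0d D r * t)))).
  { apply D_scal. auto_derive; [trivial|ring]. }
  eapply D_val.
  - apply D_plus; [apply D_scal, (m_dzh T HT r t Hr Ht)|].
    apply D_mult; [exact De|]. apply D_minus; [apply derive_RInt_continuous, Hf|].
    apply D_shift, derive_RInt_continuous, Hf.
  - rewrite (zap_formula T r t HT). fold f. unfold f at 3 4. unfold eA0h.
    replace (exp (A0d D r * hd D)) with (exp (A0d D r * t) * exp (- A0d D r * (t - hd D)))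
      by (rewrite <- exp_plus; f_equal; ring).
    assert (E : exp (A0d D r * t) * exp (- A0d D r * t) = 1).
    { rewrite <- exp_plus. replace (A0d D r * t + - A0d D r * t) with 0 by ring. apply exp_0. }
    set (a := exp (A0d D r * t)) in *. set (b := exp (- A0d D r * t)) in *.
    set (c := exp (- A0d D r * (t - hd D))).
    set (I1 := RInt f 0 t : R). set (I2 := RInt f 0 (t - hd D) : R).
    replace (B0 D r * tu T t) with (B0 D r * (a * b) * tu T t) by (rewrite E; ring). ring.
Qed.

Lemma zap_cont T r : modal T -> (r < N)%nat -> cont_pos (zap T r).
Proof.
  intros HT Hr.
  set (f := fun s => exp (- A0d D r * s) * tu T s).
  assert (Hf := weighted_u_continuous T (- A0d D r) HT). fold f in Hf.
  assert (HI : forall s, continuous (fun s => RInt f 0 s) s).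
  { intros s. apply (ex_derive_continuous (K := R_AbsRing) (V := R_NormedModule)).
    eexists. apply derive_RInt_continuous, Hf. }
  apply (cont_pos_eq (fun t => eA0h D r * tzh T (S r) t
    + B0 D r * exp (A0d D r * t) * (RInt f 0 t - RInt f 0 (t - hd D)))).
  { intros s _. rewrite (zap_formula T r s HT). reflexivity. }
  apply cont_pos_plus; [apply cont_pos_mult; [apply cont_pos_const|apply (m_zh T HT); lia]|].
  apply cont_pos_mult; [apply cont_pos_mult; [apply cont_pos_const|apply cont_pos_exp]|].
  apply cont_pos_minus; [apply continuous_cont_pos; intros; apply HI|].
  apply continuous_cont_pos. intros t _.
  apply (continuous_comp (fun t => t - hd D) (fun s => RInt f 0 s)); [|apply HI].
  apply (continuous_minus (U := R_UniformSpace) (V := R_NormedModule) (fun t => t) (fun _ => hd D));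
    [apply continuous_id|apply continuous_const].
Qed.

Lemma u_cont T : modal T -> cont_pos (tu T).
Proof. intros HT. apply continuous_cont_pos. intros. apply (m_u T HT). Qed.

Lemma u_derive T t : modal T -> 0 < t -> is_derive (tu T) t (ud T t).
Proof.
  intros HT Ht.
  apply (D_loc (fun t => fsum (N0 D) (fun r => Kg D r * zap T r t)) _ 0 t _ Ht).
  { intros s Hs. symmetry. apply (m_K T HT). lra. }
  unfold ud. apply (fsum_is_derive (N0 D) (fun r t => Kg D r * zap T r t)). intros r Hr.
  apply D_scal. eapply D_val; [apply (zap_derive T r t HT); [lia|exact Ht]|].
  unfold inj. destruct (Nat.ltb_spec r (N0 D)); [|lia].
  rewrite (m_K T HT t) by lra. unfold A0BK.
  rewrite (fsum_ext (N0 D) (fun c => (kd r c * A0d D r + B0 D r * Kg D c) * zap T c t)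
    (fun c => kd r c * (A0d D r * zap T c t) + B0 D r * (Kg D c * zap T c t))) by (intros; ring).
  rewrite fsum_plus, (fsum_kd (N0 D) (fun c => A0d D r * zap T c t) r Hr), fsum_scal. ring.
Qed.

Lemma wn_cont T n : modal T -> (1 <= n)%nat -> cont_pos (wn T n).
Proof.
  intros HT Hn. apply cont_pos_plus; [apply (m_zm T HT), Hn|].
  apply cont_pos_mult; [apply cont_pos_const|apply u_cont, HT].
Qed.

Lemma wn_derive T n t : modal T -> (1 <= n)%nat -> 0 < t ->
  is_derive (wn T n) t ((- lam D n + qc D) * wn T n t + an D n * tu T t + bn D n * ud T t).
Proof.
  intros HT Hn Ht. eapply D_val.
  - apply D_plus; [apply (m_dzm T HT n t Hn Ht)|]. apply D_scal, u_derive; assumption.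
  - rewrite (Hab n Hn). unfold wn. ring.
Qed.

Lemma zeta_cont T : modal T -> cont_pos (zeta T).
Proof.
  intros HT. apply cont_pos_minus; [apply (m_g T HT)|]. apply cont_pos_fsum. intros k Hk.
  apply cont_pos_mult; [apply wn_cont; [exact HT|lia]|apply cont_pos_const].
Qed.

(** * Crude bounds on the initial interval [0,h] *)

Lemma innov_early T t C : modal T -> 0 < t < hd D -> 0 <= C ->
  (forall M, fsum M (fun k => bn D (S k) ^ 2) <= C) ->
  innov T t ^ 2 <= 3 * (1 + (1 + C) * fsum N (fun k => dphi D (S k) 0 ^ 2)) *
    (fsum N (fun k => tzh T (S k) t ^ 2) + tu T 0 ^ 2 + tY T ^ 2).
Proof.
  intros HT Ht HC HCb. unfold innov. rewrite (m_u0 T HT (t - hd D)) by lra.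
  assert (Hy := m_Y T HT t ltac:(lra)).
  rewrite (fsum_ext N _ (fun k => tzh T (S k) t * dphi D (S k) 0
    + tu T 0 * (bn D (S k) * dphi D (S k) 0))) by (intros; ring).
  rewrite fsum_plus, fsum_scal.
  set (P := fsum N (fun k => dphi D (S k) 0 ^ 2)).
  set (s := fsum N (fun k => tzh T (S k) t ^ 2)).
  assert (A1 := fsum_cs N (fun k => tzh T (S k) t) (fun k => dphi D (S k) 0)).
  assert (A2 := fsum_cs N (fun k => bn D (S k)) (fun k => dphi D (S k) 0)).
  simpl in A1, A2. fold P s in A1. fold P in A2.
  set (x := fsum N (fun k => tzh T (S k) t * dphi D (S k) 0)) in *.
  set (y := fsum N (fun k => bn D (S k) * dphi D (S k) 0)) in *.
  assert (HP : 0 <= P) by (apply fsum_nonneg; intros; apply pow2_ge_0).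
  assert (Hs : 0 <= s) by (apply fsum_nonneg; intros; apply pow2_ge_0).
  assert (HCs : fsum N (fun k => bn D (S k) ^ 2) * P <= C * P) by (apply Rmult_le_compat_r; [exact HP|apply HCb]).
  assert (Hy2 : ty T t ^ 2 <= tY T ^ 2) by (apply pow_maj_Rabs, Hy).
  change (x * (x * 1) <= s * P) in A1.
  assert (E1 : x ^ 2 <= s * P) by exact A1. clear A1.
  assert (E2 : y ^ 2 <= C * P) by (eapply Rle_trans; [exact A2|exact HCs]). clear A2.
  assert (E3 : (tu T 0 * y) ^ 2 <= tu T 0 ^ 2 * (C * P)).
  { rewrite Rpow_mult_distr. apply Rmult_le_compat_l; [apply pow2_ge_0|exact E2]. }
  set (u0 := tu T 0) in *. set (v := ty T t) in *. set (Y := tY T) in *. set (w := u0 * y) in *.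
  assert (0 <= (x - w) ^ 2) by apply pow2_ge_0. assert (0 <= (x + v) ^ 2) by apply pow2_ge_0.
  assert (0 <= (w + v) ^ 2) by apply pow2_ge_0.
  assert (Hx3 : (x + w - v) ^ 2 <= 3 * (x ^ 2 + w ^ 2 + v ^ 2)) by lra.
  eapply Rle_trans; [exact Hx3|]. rewrite (Rmult_assoc 3). apply Rmult_le_compat_l; [lra|].
  assert (0 <= u0 ^ 2) by apply pow2_ge_0. assert (0 <= Y ^ 2) by apply pow2_ge_0.
  assert (HCP : 0 <= C * P) by (apply Rmult_le_pos; assumption).
  assert (0 <= C * P * (s + Y ^ 2)) by (apply Rmult_le_pos; lra).
  assert (0 <= P * (u0 ^ 2 + Y ^ 2)) by (apply Rmult_le_pos; lra).
  lra.
Qed.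

Lemma zap0_bound : exists C, 0 < C /\ forall T r, modal T -> (r < N)%nat ->
  zap T r 0 ^ 2 <= C * (tzh T (S r) 0 ^ 2 + tu T 0 ^ 2).
Proof.
  set (I := fun r => B0 D r * RInt (fun s => exp (- A0d D r * s)) (- hd D) 0).
  exists (2 * (fsum N (fun r => eA0h D r ^ 2) + fsum N (fun r => I r ^ 2)) + 1).
  assert (H1 : forall r, (r < N)%nat -> eA0h D r ^ 2 <= fsum N (fun r => eA0h D r ^ 2)).
  { intros r Hr. apply (fsum_term_le N (fun r => eA0h D r ^ 2)); [intros; apply pow2_ge_0|exact Hr]. }
  assert (H2 : forall r, (r < N)%nat -> I r ^ 2 <= fsum N (fun r => I r ^ 2)).
  { intros r Hr. apply (fsum_term_le N (fun r => I r ^ 2)); [intros; apply pow2_ge_0|exact Hr]. }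
  assert (P1 : 0 <= fsum N (fun r => eA0h D r ^ 2)) by (apply fsum_nonneg; intros; apply pow2_ge_0).
  assert (P2 : 0 <= fsum N (fun r => I r ^ 2)) by (apply fsum_nonneg; intros; apply pow2_ge_0).
  split; [lra|]. intros T r HT Hr. specialize (H1 r Hr). specialize (H2 r Hr).
  assert (E : zap T r 0 = eA0h D r * tzh T (S r) 0 + I r * tu T 0).
  { unfold zap, ZA. f_equal. unfold I. rewrite Rminus_0_l.
    assert (Hex : ex_RInt (fun s => exp (- A0d D r * s)) (- hd D) 0).
    { apply (ex_RInt_continuous (V := R_CompleteNormedModule)). intros s _.
      apply (ex_derive_continuous (K := R_AbsRing) (V := R_NormedModule)). auto_derive. trivial. }
    rewrite (RInt_ext _ (fun s => (B0 D r * tu T 0) * exp (- A0d D r * s))).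
    - rewrite (RInt_scal (V := R_CompleteNormedModule) (fun s => exp (- A0d D r * s))) by exact Hex.
      unfold scal; simpl; unfold mult; simpl.
      set (v := RInt (fun s => exp (- A0d D r * s)) (- hd D) 0 : R).
      change (B0 D r * tu T 0 * v = B0 D r * v * tu T 0). ring.
    - intros s Hs. rewrite Rmin_left, Rmax_right in Hs by lra. rewrite (m_u0 T HT s) by lra.
      replace (A0d D r * (0 - s)) with (- A0d D r * s) by ring.
      change (exp (- A0d D r * s) * B0 D r * tu T 0 = B0 D r * tu T 0 * exp (- A0d D r * s)). ring. }
  rewrite E. set (a := eA0h D r) in *. set (b := I r) in *. set (x := tzh T (S r) 0).
  set (y := tu T 0). set (SA := fsum N (fun r => eA0h D r ^ 2)) in *.
  set (SB := fsum N (fun r => I r ^ 2)) in *.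
  assert (0 <= (a * x - b * y) ^ 2) by apply pow2_ge_0.
  assert (0 <= x ^ 2) by apply pow2_ge_0. assert (0 <= y ^ 2) by apply pow2_ge_0.
  assert (a ^ 2 * x ^ 2 <= SA * x ^ 2) by (apply Rmult_le_compat_r; lra).
  assert (b ^ 2 * y ^ 2 <= SB * y ^ 2) by (apply Rmult_le_compat_r; lra).
  assert (0 <= SA * y ^ 2) by (apply Rmult_le_pos; lra).
  assert (0 <= SB * x ^ 2) by (apply Rmult_le_pos; lra). nra.
Qed.

(* On [0,h] the delayed input and the measurement are the prescribed initial data, so the observer
   and the predictor solve linear equations with bounded forcing. *)
Lemma crude_finite : exists C, 0 < C /\ forall T, modal T -> forall t, 0 <= t <= hd D ->
  fsum N (fun k => tzh T (S k) t ^ 2) <= C * init_size T /\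
  fsum N (fun k => zap T k t ^ 2) <= C * init_size T /\
  tu T t ^ 2 <= C * init_size T /\ (0 < t < hd D -> ud T t ^ 2 <= C * init_size T).
Proof.
  destruct Hsb as [Cb [HCb0 HCb]].
  set (cs := 3 * (1 + (1 + Cb) * fsum N (fun k => dphi D (S k) 0 ^ 2))).
  assert (HP : 0 <= fsum N (fun k => dphi D (S k) 0 ^ 2)) by (apply fsum_nonneg; intros; apply pow2_ge_0).
  assert (Hcs : 0 < cs) by (unfold cs; nra).
  assert (Hsum : forall (a : nat -> R), 0 <= fsum N (fun r => a r ^ 2)).
  { intros. apply fsum_nonneg; intros; apply pow2_ge_0. }
  set (c1 := 2 * fsum N (fun r => B0 D r ^ 2) + 2 * fsum N (fun r => inj r ^ 2) * cs).
  assert (Hc1 : 0 <= c1).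
  { unfold c1. assert (A := Hsum (B0 D)). assert (B := Hsum inj).
    assert (0 <= fsum N (fun r => inj r ^ 2) * cs) by (apply Rmult_le_pos; lra). lra. }
  (* On (0,h) the delayed input is the constant u(0), so the observer is closed by itself and is
     estimated first; its innovation then counts as given data for the predictor. *)
  destruct (lin_gronwall N (A0d D) c1 (hd D) Hc1 (Rlt_le _ _ Hh)) as [C1 [HC1 G1]].
  set (kk := fsum (N0 D) (fun r => Kg D r ^ 2)).
  assert (Hkk : 0 <= kk) by (apply fsum_nonneg; intros; apply pow2_ge_0).
  set (c2 := 2 * fsum N (fun r => B0 D r ^ 2) * kk + 2 * fsum N (fun r => (eA0h D r * inj r) ^ 2) * cs * (C1 + 1)).
  assert (Hc2 : 0 <= c2).
  { unfold c2. assert (A := Hsum (B0 D)). assert (B : 0 <= fsum N (fun r => (eA0h D r * inj r) ^ 2)) by apply (Hsum (fun r => eA0h D r * inj r)).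
    assert (0 <= fsum N (fun r => B0 D r ^ 2) * kk) by (apply Rmult_le_pos; lra).
    assert (0 <= fsum N (fun r => (eA0h D r * inj r) ^ 2) * cs * (C1 + 1)).
    { apply Rmult_le_pos; [apply Rmult_le_pos; [exact B|lra]|lra]. } lra. }
  (* Second pass, for the predictor. Its input u(t) is K times the predictor, which is why the
     forcing in [lin_gronwall] may involve the state. *)
  destruct (lin_gronwall N (A0d D) c2 (hd D) Hc2 (Rlt_le _ _ Hh)) as [C2 [HC2 G2]].
  destruct zap0_bound as [C0 [HC0 HZ0]].
  set (C3 := C2 * (C0 * (1 + INR N) + 1)).
  assert (HiN := pos_INR N).
  assert (HC3 : 0 < C3) by (unfold C3; apply Rmult_lt_0_compat; [exact HC2|nra]).
  set (kl := fsum (N0 D) (fun c => fsum (N0 D) (fun r => Kg D r * A0BK D r c) ^ 2)).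
  set (ke := fsum (N0 D) (fun r => Kg D r * (eA0h D r * Lg D r)) ^ 2).
  assert (Hkl : 0 <= kl) by (apply fsum_nonneg; intros; apply pow2_ge_0).
  assert (Hke : 0 <= ke) by apply pow2_ge_0.
  exists (C1 + C3 + kk * C3 + (2 * kl * C3 + 2 * ke * (cs * (C1 + 1)))).
  assert (Q1 : 0 <= kk * C3) by (apply Rmult_le_pos; lra).
  assert (Q2 : 0 <= kl * C3) by (apply Rmult_le_pos; lra).
  assert (Q3' : 0 <= cs * (C1 + 1)) by (apply Rmult_le_pos; lra).
  assert (Q3 : 0 <= ke * (cs * (C1 + 1))) by (apply Rmult_le_pos; assumption).
  split; [lra|]. intros T HT.
  destruct (init_size_nonneg T HT) as [HG0 HD0].
  set (d0 := init_size T) in *.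
  assert (Hd0 : fsum N (fun k => tzh T (S k) 0 ^ 2) + tu T 0 ^ 2 + tY T ^ 2 <= d0)
    by (unfold d0, init_size; lra).
  assert (Hu0 : 0 <= tu T 0 ^ 2) by apply pow2_ge_0. assert (HY : 0 <= tY T ^ 2) by apply pow2_ge_0.
  assert (Hzh0 : 0 <= fsum N (fun k => tzh T (S k) 0 ^ 2)) by apply (Hsum (fun k => tzh T (S k) 0)).
  assert (Hr1 : forall (a : nat -> R) r, (r < N)%nat -> a r ^ 2 <= fsum N (fun r => a r ^ 2)).
  { intros a r Hr. apply (fsum_term_le N (fun r => a r ^ 2)); [intros; apply pow2_ge_0|exact Hr]. }
  assert (S1 : forall t, 0 <= t <= hd D -> fsum N (fun k => tzh T (S k) t ^ 2) <= C1 * d0).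
  { intros t Ht. eapply Rle_trans; [apply (G1 (fun r => tzh T (S r))
      (fun r t => B0 D r * tu T (t - hd D) - inj r * innov T t) (tu T 0 ^ 2 + tY T ^ 2))|]; try exact Ht.
    - lra.
    - intros r Hr. apply (m_zh T HT). lia.
    - intros r s Hr Hs. split.
      + eapply D_val; [apply (m_dzh T HT r s Hr); lra|ring].
      + assert (Hsg := innov_early T s Cb HT Hs (Rlt_le _ _ HCb0) HCb). fold cs in Hsg.
        rewrite (m_u0 T HT (s - hd D)) by lra.
        set (ss := fsum N (fun k => tzh T (S k) s ^ 2)) in *.
        assert (Hss : 0 <= ss) by (apply (Hsum (fun k => tzh T (S k) s))).
        assert (A := Hr1 (B0 D) r Hr). assert (B := Hr1 inj r Hr).
        set (SB := fsum N (fun r => B0 D r ^ 2)) in *. set (SI := fsum N (fun r => inj r ^ 2)) in *.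
        assert (0 <= (B0 D r * tu T 0 + inj r * innov T s) ^ 2) by apply pow2_ge_0.
        assert (X1 : B0 D r ^ 2 * tu T 0 ^ 2 <= SB * (ss + (tu T 0 ^ 2 + tY T ^ 2))).
        { apply Rmult_le_compat; try apply pow2_ge_0; lra. }
        assert (X2 : inj r ^ 2 * innov T s ^ 2 <= SI * (cs * (ss + tu T 0 ^ 2 + tY T ^ 2))).
        { apply Rmult_le_compat; try apply pow2_ge_0; lra. }
        unfold c1. lra.
    - apply Rmult_le_compat_l; [lra|]. lra. }
  assert (Sg : forall t, 0 < t < hd D -> innov T t ^ 2 <= cs * (C1 + 1) * d0).
  { intros t Ht. assert (Hsg := innov_early T t Cb HT Ht (Rlt_le _ _ HCb0) HCb). fold cs in Hsg.
    specialize (S1 t ltac:(lra)). eapply Rle_trans; [exact Hsg|]. rewrite (Rmult_assoc cs (C1 + 1) d0).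
    apply Rmult_le_compat_l; [lra|]. lra. }
  assert (Hu : forall t, 0 <= t -> tu T t ^ 2 <= kk * fsum N (fun k => zap T k t ^ 2)).
  { intros t Ht. rewrite (m_K T HT t Ht). eapply Rle_trans; [apply fsum_cs|].
    apply Rmult_le_compat_l; [exact Hkk|]. apply fsum_mono; [intros; apply pow2_ge_0|exact HN]. }
  assert (S2 : forall t, 0 <= t <= hd D -> fsum N (fun k => zap T k t ^ 2) <= C3 * d0).
  { intros t Ht. eapply Rle_trans; [apply (G2 (zap T)
      (fun r t => B0 D r * tu T t - eA0h D r * (inj r * innov T t)) d0)|]; try exact Ht.
    - exact HD0.
    - intros r Hr. apply zap_cont; assumption.
    - intros r s Hr Hs. split.
      + eapply D_val; [apply (zap_derive T r s HT Hr); lra|ring].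
      + specialize (Sg s Hs). specialize (Hu s ltac:(lra)).
        set (ss := fsum N (fun k => zap T k s ^ 2)) in *.
        assert (Hss : 0 <= ss) by apply (Hsum (fun k => zap T k s)).
        assert (A := Hr1 (B0 D) r Hr). 
        set (SB := fsum N (fun r => B0 D r ^ 2)) in *.
        set (SI := fsum N (fun r => (eA0h D r * inj r) ^ 2)).
        assert (B' : (eA0h D r * inj r) ^ 2 <= SI) by exact (Hr1 (fun r => eA0h D r * inj r) r Hr).
        set (p := B0 D r) in *. set (w := eA0h D r * inj r) in *. set (v := innov T s) in *.
        replace (p * tu T s - eA0h D r * (inj r * v)) with (p * tu T s - w * v) by (unfold w; ring).
        assert (0 <= (p * tu T s + w * v) ^ 2) by apply pow2_ge_0.
        assert (X1 : p ^ 2 * tu T s ^ 2 <= SB * (kk * ss)).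
        { apply Rmult_le_compat; try apply pow2_ge_0; lra. }
        assert (X2 : w ^ 2 * v ^ 2 <= SI * (cs * (C1 + 1) * d0)).
        { apply Rmult_le_compat; try apply pow2_ge_0; lra. }
        assert (HSB : 0 <= SB) by apply (Hsum (B0 D)).
        assert (HSI : 0 <= SI) by apply (Hsum (fun r => eA0h D r * inj r)).
        assert (0 <= SB * kk * d0) by (apply Rmult_le_pos; [apply Rmult_le_pos|]; assumption).
        assert (0 <= SI * (cs * (C1 + 1)) * ss) by (apply Rmult_le_pos; [apply Rmult_le_pos|]; assumption).
        unfold c2. fold SI. lra.
    - unfold C3. rewrite (Rmult_assoc C2). apply Rmult_le_compat_l; [lra|].
      assert (Z : fsum N (fun k => zap T k 0 ^ 2) <= C0 * (1 + INR N) * d0); [|lra].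
      apply Rle_trans with (fsum N (fun k => C0 * tzh T (S k) 0 ^ 2 + C0 * tu T 0 ^ 2)).
      + apply fsum_le. intros k Hk. specialize (HZ0 T k HT Hk). lra.
      + rewrite fsum_plus, fsum_scal, fsum_const.
        assert (C0 * fsum N (fun k => tzh T (S k) 0 ^ 2) <= C0 * d0) by (apply Rmult_le_compat_l; lra).
        assert (INR N * (C0 * tu T 0 ^ 2) <= INR N * (C0 * d0)).
        { apply Rmult_le_compat_l; [exact HiN|]. apply Rmult_le_compat_l; lra. }
        lra. }
  intros t Ht. specialize (S1 t Ht). specialize (S2 t Ht). specialize (Hu t ltac:(lra)).
  assert (P1 : 0 <= C1 * d0) by (apply Rmult_le_pos; lra).
  assert (P3 : 0 <= C3 * d0) by (apply Rmult_le_pos; lra).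
  assert (P4 : 0 <= kk * C3 * d0) by (apply Rmult_le_pos; lra).
  assert (P5 : 0 <= kl * C3 * d0) by (apply Rmult_le_pos; lra).
  assert (P6 : 0 <= ke * (cs * (C1 + 1)) * d0) by (apply Rmult_le_pos; lra).
  assert (kk * fsum N (fun k => zap T k t ^ 2) <= kk * (C3 * d0)) by (apply Rmult_le_compat_l; lra).
  repeat split; try lra.
  intros Ht'. specialize (Sg t Ht').
  assert (E : ud T t = fsum (N0 D) (fun c => fsum (N0 D) (fun r => Kg D r * A0BK D r c) * zap T c t)
    + fsum (N0 D) (fun r => Kg D r * (eA0h D r * Lg D r)) * - innov T t).
  { unfold ud. rewrite (fsum_ext (N0 D) (fun c => fsum _ _ * zap T c t)
      (fun c => fsum (N0 D) (fun r => Kg D r * (A0BK D r c * zap T c t))))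
      by (intros; rewrite <- fsum_scal_r; apply fsum_ext; intros; ring).
    rewrite fsum_swap, <- fsum_scal_r, <- fsum_plus. apply fsum_ext; intros. rewrite fsum_scal. ring. }
  rewrite E. set (x := fsum (N0 D) (fun c => _)). set (y := fsum (N0 D) (fun r => Kg D r * (eA0h D r * Lg D r))) in *.
  assert (X1 : x ^ 2 <= kl * (C3 * d0)).
  { eapply Rle_trans; [apply fsum_cs|]. fold kl. apply Rmult_le_compat_l; [exact Hkl|].
    eapply Rle_trans; [|exact S2]. apply fsum_mono; [intros; apply pow2_ge_0|exact HN]. }
  assert (X2 : y ^ 2 * innov T t ^ 2 <= ke * (cs * (C1 + 1) * d0)).
  { apply Rmult_le_compat_l; [exact Hke|exact Sg]. }
  assert (0 <= (x + y * innov T t) ^ 2) by apply pow2_ge_0. lra.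
Qed.

Lemma exp_le_compat a b : a <= b -> exp a <= exp b.
Proof. intros [H| ->]; [apply Rlt_le, exp_increasing, H|apply Rle_refl]. Qed.

Lemma young_sq x f : 2 * (x * f) <= x ^ 2 + f ^ 2.
Proof. assert (0 <= (x - f) ^ 2) by apply pow2_ge_0. lra. Qed.

Definition smod (T : traj) (M : nat) (t : R) : R := fsum M (fun k => lam D (S k) * wn T (S k) t ^ 2).

Lemma smod_nonneg T M t : 0 <= smod T M t.
Proof.
  apply fsum_nonneg. intros k _. apply Rmult_le_pos; [|apply pow2_ge_0].
  apply Rlt_le, Hlp. lia.
Qed.

Lemma smod_cont T M : modal T -> cont_pos (smod T M).
Proof.
  intros HT. apply cont_pos_fsum. intros k _. apply cont_pos_mult; [apply cont_pos_const|].
  apply cont_pos_pow, wn_cont; [exact HT|lia].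
Qed.

Lemma smod_derive T M t : modal T -> 0 < t -> is_derive (smod T M) t
  (fsum M (fun k => lam D (S k) * (2 * wn T (S k) t *
    ((- lam D (S k) + qc D) * wn T (S k) t + an D (S k) * tu T t + bn D (S k) * ud T t)))).
Proof.
  intros HT Ht. apply (fsum_is_derive M (fun k s => lam D (S k) * wn T (S k) s ^ 2)).
  intros k _. apply D_scal, is_derive_sq, wn_derive; [exact HT|lia|exact Ht].
Qed.

(** The derivative of the energy contains -2 (lam_n w_n)^2; Young's inequality spends one half on
    the coupling with a_n u + b_n u'. The other half is kept in the second clause, for
    [crude_trace]. Both bounds are uniform in the truncation M. *)
Lemma crude_energy : exists C, 0 < C /\ forall T, modal T ->
  (forall t M, 0 <= t <= hd D -> smod T M t <= C * init_size T) /\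
  (forall t M, 0 < t < hd D -> exists d, is_derive (smod T M) t d /\
    d <= - fsum M (fun k => (lam D (S k) * wn T (S k) t) ^ 2) + C * init_size T).
Proof.
  destruct crude_finite as [C1 [HC1 HF]].
  destruct Hsa as [Ca [HCa0 HCa]]. destruct Hsb as [Cb [HCb0 HCb]].
  set (c := 2 * (Ca + Cb) * C1). assert (Hc : 0 < c) by (unfold c; nra).
  set (q := 2 * Rabs (qc D)). assert (Hq : 0 <= q) by (unfold q; assert (A := Rabs_pos (qc D)); lra).
  set (C2 := exp (q * hd D) * (1 + c * hd D)).
  assert (Hch : 0 < c * hd D) by (apply Rmult_lt_0_compat; assumption).
  assert (HC2 : 0 < C2) by (apply Rmult_lt_0_compat; [apply exp_pos|lra]).
  exists (C2 + (q * C2 + c)). assert (0 <= q * C2) by (apply Rmult_le_pos; lra).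
  split; [lra|]. intros T HT. destruct (init_size_nonneg T HT) as [HG HD0].
  assert (Hd : forall t M, 0 < t < hd D -> exists d, is_derive (smod T M) t d /\
    d <= q * smod T M t - fsum M (fun k => (lam D (S k) * wn T (S k) t) ^ 2) + c * init_size T).
  { intros t M Ht. eexists. split; [apply smod_derive; [exact HT|lra]|].
    destruct (HF T HT t ltac:(lra)) as [_ [_ [Hu Hud]]]. specialize (Hud Ht).
    set (u := tu T t) in *. set (v := ud T t) in *.
    eapply Rle_trans; [apply fsum_le with (g := fun k =>
      q * (lam D (S k) * wn T (S k) t ^ 2) - (lam D (S k) * wn T (S k) t) ^ 2
      + (2 * u ^ 2 * an D (S k) ^ 2 + 2 * v ^ 2 * bn D (S k) ^ 2))|].
    - intros k _. cbv beta. assert (L := Hlp (S k) ltac:(lia)).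
      assert (A := young_sq (lam D (S k) * wn T (S k) t) (an D (S k) * u + bn D (S k) * v)).
      assert (A2 := young_sq (an D (S k) * u) (bn D (S k) * v)).
      assert (A3 : qc D * (lam D (S k) * wn T (S k) t ^ 2) <= Rabs (qc D) * (lam D (S k) * wn T (S k) t ^ 2)).
      { apply Rmult_le_compat_r; [apply Rmult_le_pos; [lra|apply pow2_ge_0]|apply Rle_abs]. }
      unfold q. lra.
    - rewrite fsum_plus, fsum_minus, fsum_plus, !fsum_scal. fold (smod T M t).
      specialize (HCa M). specialize (HCb M).
      assert (u ^ 2 * fsum M (fun k => an D (S k) ^ 2) <= C1 * init_size T * Ca).
      { apply Rmult_le_compat; [apply pow2_ge_0|apply fsum_nonneg; intros; apply pow2_ge_0|exact Hu|exact HCa]. }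
      assert (v ^ 2 * fsum M (fun k => bn D (S k) ^ 2) <= C1 * init_size T * Cb).
      { apply Rmult_le_compat; [apply pow2_ge_0|apply fsum_nonneg; intros; apply pow2_ge_0|exact Hud|exact HCb]. }
      unfold c. lra. }
  assert (HB : forall t M, 0 <= t <= hd D -> smod T M t <= C2 * init_size T).
  { intros t M Ht.
    set (df := fun t => fsum M (fun k => lam D (S k) * (2 * wn T (S k) t *
      ((- lam D (S k) + qc D) * wn T (S k) t + an D (S k) * tu T t + bn D (S k) * ud T t)))).
    assert (Hc0 : 0 <= c * init_size T) by (apply Rmult_le_pos; lra).
    eapply Rle_trans; [apply (gronwall_pos (smod T M) df q (c * init_size T) (hd D)); try assumption|].
    - apply smod_cont, HT.
    - intros s Hs. assert (E := smod_derive T M s HT (proj1 Hs)). split; [exact E|].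
      destruct (Hd s M Hs) as [d [Ed Hle]].
      assert (Eq : df s = d) by (transitivity (Derive (smod T M) s); [symmetry; apply is_derive_unique, E|apply is_derive_unique, Ed]).
      apply Rle_trans with d; [right; exact Eq|].
      assert (0 <= fsum M (fun k => (lam D (S k) * wn T (S k) s) ^ 2))
        by (apply fsum_nonneg; intros; apply pow2_ge_0). lra.
    - unfold C2. rewrite (Rmult_assoc (exp _)). apply Rmult_le_compat.
      + apply Rlt_le, exp_pos.
      + assert (0 <= c * init_size T * t) by (apply Rmult_le_pos; lra). assert (A := smod_nonneg T M 0). lra.
      + apply exp_le_compat. apply Rmult_le_compat_l; lra.
      + assert (A : smod T M 0 <= init_size T).
        { eapply Rle_trans; [apply (m_G T HT 0 M); lra|]. unfold init_size.
          assert (0 <= fsum N (fun k => tzh T (S k) 0 ^ 2)) by (apply fsum_nonneg; intros; apply pow2_ge_0).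
          assert (0 <= tu T 0 ^ 2) by apply pow2_ge_0. assert (0 <= tY T ^ 2) by apply pow2_ge_0. lra. }
        assert (c * init_size T * t <= c * init_size T * hd D) by (apply Rmult_le_compat_l; lra). lra. }
  assert (P1 : 0 <= (q * C2 + c) * init_size T) by (apply Rmult_le_pos; lra).
  assert (P2 : 0 <= C2 * init_size T) by (apply Rmult_le_pos; lra).
  split.
  - intros t M Ht. specialize (HB t M Ht). lra.
  - intros t M Ht. destruct (Hd t M Ht) as [d [Ed Hle]]. exists d. split; [exact Ed|].
    assert (q * smod T M t <= q * (C2 * init_size T)) by (apply Rmult_le_compat_l; [lra|apply HB; lra]). lra.
Qed.

(** The argument of [zeta] is retracted to [0,+oo), where continuity is known, so that the integrand
    is continuous on the whole line and its primitive differentiable everywhere. *)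
Definition zsq (T : traj) (s : R) : R := exp (2 * delta D * s) * zeta T (Rmax 0 s) ^ 2.
Definition Zint (T : traj) (t : R) : R := RInt (zsq T) 0 t.

Lemma zsq_continuous T : modal T -> forall s, continuous (zsq T) s.
Proof.
  intros HT s. apply (continuous_mult (U := R_UniformSpace) (K := R_AbsRing)).
  - apply (ex_derive_continuous (K := R_AbsRing) (V := R_NormedModule)). auto_derive. trivial.
  - apply (cont_pos_ext (fun s => zeta T s ^ 2)), cont_pos_pow, zeta_cont, HT.
Qed.

Lemma Zint_derive T t : modal T -> is_derive (Zint T) t (zsq T t).
Proof. intros HT. apply derive_RInt_continuous, zsq_continuous, HT. Qed.

Lemma Zint_cont T : modal T -> cont_pos (Zint T).
Proof.
  intros HT. apply continuous_cont_pos. intros t _.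
  apply (ex_derive_continuous (K := R_AbsRing) (V := R_NormedModule)).
  eexists. apply Zint_derive, HT.
Qed.

Lemma Zint_0 T : Zint T 0 = 0.
Proof. apply (RInt_point (V := R_CompleteNormedModule)). Qed.

Lemma Zint_mono T a b : modal T -> 0 <= a <= b -> Zint T a <= Zint T b.
Proof.
  intros HT Hab'.
  assert (- Zint T b - - Zint T a <= 0 * (b - a)); [|lra].
  apply (increment_le (fun t => - Zint T t) (fun t => - zsq T t));
    [apply cont_pos_opp, Zint_cont, HT|lra|lra|].
  intros t _. split.
  - apply (is_derive_opp (K := R_AbsRing) (V := R_NormedModule)), Zint_derive, HT.
  - assert (0 <= zsq T t); [|lra]. apply Rmult_le_pos; [apply Rlt_le, exp_pos|apply pow2_ge_0].
Qed.

Lemma zsq_late (T : traj) t : 0 <= t -> zsq T t = exp (2 * delta D * t) * zeta T t ^ 2.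
Proof. intros Ht. unfold zsq. rewrite Rmax_right by exact Ht. reflexivity. Qed.

(* The trace residual is dominated by [sum lam_n^2 w_n^2], which is integrable since it is the
   dissipation of the energy. *)
Lemma crude_trace : exists C, 0 < C /\ forall T, modal T -> Zint T (hd D) <= C * init_size T.
Proof.
  destruct crude_energy as [C1 [HC1 HE]].
  destruct Hsphi as [Cp [HCp0 HCp]].
  set (e := exp (2 * delta D * hd D)). assert (He : 0 < e) by apply exp_pos.
  (* [k0] times the dissipation pays for the term e (2 Cp) sum lam_n^2 w_n^2 bounding the weighted
     square of [zeta], so [Zint T] plus [k0] times the energy grows at a rate bounded by the
     data. *)
  set (k0 := e * (2 * Cp)). assert (Hk0 : 0 < k0) by (unfold k0; nra).
  exists (k0 * C1 + k0 * C1 * hd D).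
  assert (P : 0 < k0 * C1) by nra. split; [nra|]. intros T HT.
  destruct (HE T HT) as [HE1 HE2]. destruct (init_size_nonneg T HT) as [_ HD0].
  apply le_epsilon. intros eps Heps.
  (* The trace expansion converges uniformly only away from 0. A short interval [0,tau] is cut off,
     on which [Zint] is small by continuity; tau may depend on the trajectory, since it leaves no
     mark on the constant. *)
  destruct (Zint_cont T HT 0 (Rle_refl 0) (eps / 2) ltac:(lra)) as [d [Hd Htau]].
  set (tau := Rmin (d / 2) (hd D / 2)).
  assert (Ht1 : 0 < tau) by (apply Rmin_glb_lt; lra).
  assert (Ht2 : tau <= d / 2) by apply Rmin_l. assert (Ht3 : tau <= hd D / 2) by apply Rmin_r.
  specialize (Htau tau ltac:(lra)). rewrite Zint_0, !Rminus_0_r, Rabs_right in Htau by lra.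
  specialize (Htau ltac:(lra)). assert (Hz := Rle_abs (Zint T tau)).
  (* Squared truncation error allowed on [tau,h]: its total contribution e (2 th) h is eps/2. *)
  set (th := eps / 2 / (e * 2 * hd D)).
  assert (Hth : 0 < th) by (apply Rdiv_lt_0_compat; [lra|]; apply Rmult_lt_0_compat; lra).
  destruct (m_trace T HT tau (hd D) th Ht1 Hth) as [M0 HM0].
  set (M := (M0 + N)%nat).
  assert (Hinc : Zint T (hd D) + k0 * smod T M (hd D) - (Zint T tau + k0 * smod T M tau)
    <= (e * (2 * th) + k0 * (C1 * init_size T)) * (hd D - tau)).
  { apply (increment_le (fun t => Zint T t + k0 * smod T M t)
      (fun t => zsq T t + k0 * Derive (smod T M) t)).
    - apply cont_pos_plus; [apply Zint_cont, HT|].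
      apply cont_pos_mult; [apply cont_pos_const|apply smod_cont, HT].
    - lra.
    - lra.
    - intros t Ht. destruct (HE2 t M ltac:(lra)) as [dd [Ed Hle]].
      rewrite (is_derive_unique _ _ _ Ed). split.
      + apply D_plus; [apply Zint_derive, HT|]. apply D_scal, Ed.
      + rewrite zsq_late by lra. specialize (HM0 M t ltac:(lia) ltac:(lra)).
        set (SM := fsum M (fun k => (lam D (S k) * wn T (S k) t) ^ 2)) in *.
        set (rr := tg T t - fsum M (fun k => wn T (S k) t * dphi D (S k) 0)) in *.
        set (Sm := fsum M0 (fun k => (lam D (S (N + k)) * wn T (S (N + k)) t)
           * (dphi D (S (N + k)) 0 / lam D (S (N + k))))).
        assert (Ez : zeta T t = rr + Sm).
        { unfold rr, zeta, M. rewrite Nat.add_comm, fsum_app.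
          rewrite (fsum_ext M0 (fun i => wn T (S (N + i)) t * dphi D (S (N + i)) 0)
            (fun k => (lam D (S (N + k)) * wn T (S (N + k)) t)
             * (dphi D (S (N + k)) 0 / lam D (S (N + k))))).
          - fold Sm. ring.
          - intros k _. assert (L := Hlp (S (N + k)) ltac:(lia)). field. lra. }
        assert (HSm : Sm ^ 2 <= Cp * SM).
        { eapply Rle_trans; [apply fsum_cs|]. rewrite Rmult_comm. apply Rmult_le_compat.
          - apply fsum_nonneg; intros; apply pow2_ge_0.
          - apply fsum_nonneg; intros; apply pow2_ge_0.
          - eapply Rle_trans; [|apply (HCp (N + M0)%nat)]. rewrite fsum_app.
            assert (0 <= fsum N (fun k => (dphi D (S k) 0 / lam D (S k)) ^ 2))
              by (apply fsum_nonneg; intros; apply pow2_ge_0). lra.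
          - unfold SM, M. rewrite Nat.add_comm, fsum_app.
            assert (0 <= fsum N (fun k => (lam D (S k) * wn T (S k) t) ^ 2))
              by (apply fsum_nonneg; intros; apply pow2_ge_0). lra. }
        assert (Hzz : zeta T t ^ 2 <= 2 * th + 2 * Cp * SM).
        { rewrite Ez. assert (0 <= (rr - Sm) ^ 2) by apply pow2_ge_0. lra. }
        assert (Hex : exp (2 * delta D * t) * zeta T t ^ 2 <= e * (2 * th + 2 * Cp * SM)).
        { apply Rmult_le_compat; [apply Rlt_le, exp_pos|apply pow2_ge_0| |exact Hzz].
          apply exp_le_compat. apply Rmult_le_compat_l; lra. }
        assert (k0 * dd <= k0 * (- SM + C1 * init_size T)) by (apply Rmult_le_compat_l; lra).
        unfold k0 in *. lra. }
  assert (A1 := HE1 tau M ltac:(lra)). assert (A2 := smod_nonneg T M (hd D)).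
  assert (A3 : k0 * smod T M tau <= k0 * (C1 * init_size T)) by (apply Rmult_le_compat_l; lra).
  assert (A4 : 0 <= k0 * smod T M (hd D)) by (apply Rmult_le_pos; lra).
  assert (A5 : e * (2 * th) * hd D = eps / 2) by (unfold th; field; split; lra).
  assert (P1 : 0 <= C1 * init_size T) by (apply Rmult_le_pos; lra).
  assert (P2 : 0 <= e * (2 * th)) by (apply Rmult_le_pos; lra).
  assert (P3 : 0 <= k0 * (C1 * init_size T)) by (apply Rmult_le_pos; lra).
  assert (A6 : (e * (2 * th) + k0 * (C1 * init_size T)) * (hd D - tau)
    <= (e * (2 * th) + k0 * (C1 * init_size T)) * hd D) by (apply Rmult_le_compat_l; lra).
  lra.
Qed.

(** * Lyapunov analysis *)

(** Both input and measurement reach the observer with delay h, so at time s + h it estimates the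
    plant at time s. In this pairing the delayed input cancels from the error equation. *)
Definition ev (T : traj) (k : nat) (s : R) : R := tzm T (S k) s - tzh T (S k) (s + hd D).

(* The extended state of the Lyapunov analysis at time [s + h], completed by the delayed trace
   residual in the slot [2N]. *)
Definition Xs (T : traj) (s : R) (i : nat) : R :=
  if Nat.ltb i (2 * N) then
    match blk D N i with
    | O => zap T (off D N i) (s + hd D)
    | S O => ev T (off D N i) s
    | S (S O) => zap T (N0 D + off D N i) (s + hd D) / lam D (N0 D + 1 + off D N i)
    | _ => lam D (N0 D + 1 + off D N i) * ev T (N0 D + off D N i) s
    end
  else zeta T s.

Lemma Xs0 T s r : (r < N0 D)%nat -> Xs T s r = zap T r (s + hd D).
Proof. intros Hr. unfold Xs. blk_simpl. destruct (Nat.ltb_spec r (2 * N)); [reflexivity|lia]. Qed.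
Lemma Xs1 T s r : (r < N0 D)%nat -> Xs T s (N0 D + r) = ev T r s.
Proof. intros Hr. unfold Xs. blk_simpl. destruct (Nat.ltb_spec (N0 D + r) (2 * N)); [reflexivity|lia]. Qed.
Lemma Xs2 T s r : (r < N - N0 D)%nat ->
  Xs T s (2 * N0 D + r) = zap T (N0 D + r) (s + hd D) / lam D (N0 D + 1 + r).
Proof. intros Hr. unfold Xs. blk_simpl. destruct (Nat.ltb_spec (2 * N0 D + r) (2 * N)); [reflexivity|lia]. Qed.
Lemma Xs3 T s r : (r < N - N0 D)%nat ->
  Xs T s (N0 D + N + r) = lam D (N0 D + 1 + r) * ev T (N0 D + r) s.
Proof. intros Hr. unfold Xs. blk_simpl. destruct (Nat.ltb_spec (N0 D + N + r) (2 * N)); [reflexivity|lia]. Qed.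
Lemma Xs_last T s : Xs T s (2 * N) = zeta T s.
Proof. unfold Xs. rewrite Nat.ltb_irrefl. reflexivity. Qed.

Lemma u_Kx T s : modal T -> 0 <= s -> tu T (s + hd D) = Kx D (Xs T s).
Proof.
  intros HT Hs. rewrite (m_K T HT) by lra. apply fsum_ext. intros r Hr. rewrite Xs0 by exact Hr. reflexivity.
Qed.

(** The measurement at s + h is z_x(s,0), that is, the first N modal contributions of w plus [zeta].
    The terms b_n u(s) of plant and observer cancel, and what remains is the error [ev] read off by
    C0 and C1t. *)
Lemma innov_late T s : modal T -> 0 <= s ->
  - innov T (s + hd D) = C0x D (Xs T s) + C1x D N (Xs T s) + zeta T s.
Proof.
  intros HT Hs. unfold innov, zeta. rewrite (m_y T HT) by lra.
  replace (s + hd D - hd D) with s by ring.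
  assert (E : C0x D (Xs T s) + C1x D N (Xs T s) = fsum N (fun k => ev T k s * dphi D (S k) 0)).
  { replace N with (N0 D + (N - N0 D))%nat at 2 by lia. rewrite fsum_app. f_equal; apply fsum_ext; intros r Hr.
    - rewrite Xs1 by exact Hr. unfold C0. ring.
    - rewrite Xs3 by exact Hr. unfold C1t. replace (N0 D + 1 + r)%nat with (S (N0 D + r)) by lia.
      assert (L := Hlp (S (N0 D + r)) ltac:(lia)). field. lra. }
  rewrite E.
  replace (fsum N (fun k => ev T k s * dphi D (S k) 0)) with
    (fsum N (fun k => wn T (S k) s * dphi D (S k) 0)
     - fsum N (fun k => (tzh T (S k) (s + hd D) + bn D (S k) * tu T s) * dphi D (S k) 0)); [ring|].
  rewrite <- fsum_minus. apply fsum_ext. intros k _. unfold ev, wn. ring.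
Qed.

Lemma D_shift_plus (f : R -> R) (x h l : R) : is_derive f (x + h) l -> is_derive (fun t => f (t + h)) x l.
Proof.
  intros H. apply (is_derive_ext (fun t => f (t - - h))); [intros t; f_equal; ring|].
  apply D_shift. replace (x - - h) with (x + h) by ring. exact H.
Qed.

Lemma A0BK_sum x r : (r < N0 D)%nat ->
  fsum (N0 D) (fun c => A0BK D r c * x c) = A0d D r * x r + B0 D r * Kx D x.
Proof.
  intros Hr. unfold A0BK, Kx.
  rewrite (fsum_ext (N0 D) _ (fun c => kd r c * (A0d D r * x c) + B0 D r * (Kg D c * x c)))
    by (intros; ring).
  rewrite fsum_plus, (fsum_kd (N0 D) (fun c => A0d D r * x c) r Hr), fsum_scal. reflexivity.
Qed.

Lemma A0LC_sum x r : (r < N0 D)%nat -> fsum (N0 D) (fun c => A0LC D r c * x (N0 D + c)%nat)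
  = A0d D r * x (N0 D + r)%nat - Lg D r * C0x D x.
Proof.
  intros Hr. unfold A0LC, C0x.
  rewrite (fsum_ext (N0 D) _ (fun c => kd r c * (A0d D r * x (N0 D + c)%nat)
    - Lg D r * (C0 D c * x (N0 D + c)%nat))) by (intros; ring).
  rewrite fsum_minus, (fsum_kd (N0 D) (fun c => A0d D r * x (N0 D + c)%nat) r Hr), fsum_scal. reflexivity.
Qed.

Lemma ev_derive T r s : modal T -> (r < N)%nat -> 0 < s ->
  is_derive (ev T r) s (A0d D r * ev T r s + inj r * innov T (s + hd D)).
Proof.
  intros HT Hr Hs. eapply D_val.
  - apply D_minus; [apply (m_dzm T HT (S r) s); [lia|exact Hs]|].
    apply D_shift_plus, (m_dzh T HT r); [exact Hr|lra].
  - replace (s + hd D - hd D) with s by ring. unfold A0d, B0, ev. ring.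
Qed.

Lemma zap_derive_shift T r s : modal T -> (r < N)%nat -> 0 < s ->
  is_derive (fun s => zap T r (s + hd D)) s
    (A0d D r * zap T r (s + hd D) + B0 D r * Kx D (Xs T s) - eA0h D r * (inj r * innov T (s + hd D))).
Proof.
  intros HT Hr Hs. apply D_shift_plus. rewrite <- u_Kx by (try lra; exact HT).
  apply zap_derive; [exact HT|exact Hr|lra].
Qed.

Lemma inj_low r : (r < N0 D)%nat -> inj r = Lg D r.
Proof. intros Hr. unfold inj. destruct (Nat.ltb_spec r (N0 D)); [reflexivity|lia]. Qed.
Lemma inj_high r : inj (N0 D + r) = 0.
Proof. unfold inj. destruct (Nat.ltb_spec (N0 D + r) (N0 D)); [lia|reflexivity]. Qed.

(** The factors 1/lam_n in block 2 and lam_n in block 3 turn the couplings into beta_n / lam_n and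
    phi_n'(0) / lam_n, which are square summable uniformly in N. *)
Lemma Xs_derive T i s : modal T -> (i < 2 * N)%nat -> 0 < s ->
  is_derive (fun s => Xs T s i) s (Fvec D N (Xs T s) i + Lvec D N i * zeta T s).
Proof.
  intros HT Hi Hs. assert (Hsg := innov_late T s HT (Rlt_le _ _ Hs)).
  revert i Hi. apply (index_blocks D N HN); intros r Hr.
  - apply (is_derive_ext (fun s => zap T r (s + hd D))); [intros; symmetry; apply Xs0, Hr|].
    eapply D_val; [apply zap_derive_shift; [exact HT|lia|exact Hs]|].
    rewrite (Fvec0 D N HN), (Lvec0 D N HN), A0BK_sum, inj_low, Xs0 by exact Hr.
    replace (innov T (s + hd D)) with (- - innov T (s + hd D)) by ring. rewrite Hsg. ring.
  - apply (is_derive_ext (ev T r)); [intros; symmetry; apply Xs1, Hr|].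
    eapply D_val; [apply ev_derive; [exact HT|lia|exact Hs]|].
    rewrite (Fvec1 D N HN), (Lvec1 D N HN), A0LC_sum, inj_low, Xs1 by exact Hr.
    replace (innov T (s + hd D)) with (- - innov T (s + hd D)) by ring. rewrite Hsg. ring.
  - apply (is_derive_ext (fun s => / lam D (N0 D + 1 + r) * zap T (N0 D + r) (s + hd D))).
    { intros t. rewrite Xs2 by exact Hr. unfold Rdiv. apply Rmult_comm. }
    eapply D_val; [apply D_scal, zap_derive_shift; [exact HT|lia|exact Hs]|].
    rewrite (Fvec2 D N HN), (Lvec2 D N HN), inj_high, Xs2 by exact Hr.
    unfold B1t, A1d, A0d, B0. replace (N0 D + 1 + r)%nat with (S (N0 D + r)) by lia.
    assert (L := Hlp (S (N0 D + r)) ltac:(lia)). field. lra.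
  - apply (is_derive_ext (fun s => lam D (N0 D + 1 + r) * ev T (N0 D + r) s)).
    { intros t. rewrite Xs3 by exact Hr. reflexivity. }
    eapply D_val; [apply D_scal, ev_derive; [exact HT|lia|exact Hs]|].
    rewrite (Fvec3 D N HN), (Lvec3 D N HN), inj_high, Xs3 by exact Hr.
    unfold A1d, A0d. replace (N0 D + 1 + r)%nat with (S (N0 D + r)) by lia. ring.
Qed.

Lemma Xs_cont T i : modal T -> (i < 2 * N)%nat -> cont_pos (fun s => Xs T s i).
Proof.
  intros HT Hi. revert i Hi.
  assert (He : forall r, (r < N)%nat -> cont_pos (ev T r)).
  { intros r Hr. apply cont_pos_minus; [apply (m_zm T HT); lia|].
    apply cont_pos_shift; [apply (m_zh T HT); lia|lra]. }
  assert (Hz : forall r, (r < N)%nat -> cont_pos (fun s => zap T r (s + hd D))).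
  { intros r Hr. apply cont_pos_shift; [apply zap_cont; assumption|lra]. }
  apply (index_blocks D N HN); intros r Hr.
  - apply (cont_pos_eq (fun s => zap T r (s + hd D))); [intros; symmetry; apply Xs0, Hr|apply Hz; lia].
  - apply (cont_pos_eq (ev T r)); [intros; symmetry; apply Xs1, Hr|apply He; lia].
  - apply (cont_pos_eq (fun s => zap T (N0 D + r) (s + hd D) * / lam D (N0 D + 1 + r)));
      [intros; symmetry; apply Xs2, Hr|].
    apply cont_pos_mult; [apply Hz; lia|apply cont_pos_const].
  - apply (cont_pos_eq (fun s => lam D (N0 D + 1 + r) * ev T (N0 D + r) s));
      [intros; symmetry; apply Xs3, Hr|].
    apply cont_pos_mult; [apply cont_pos_const|apply He; lia].
Qed.

(** The right-hand side is the row E applied to the completed state, so the E^T E term of Theta1 is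
    what pays for (u')^2 in the tail. *)
Lemma ud_late T s : modal T -> 0 <= s -> ud T (s + hd D) =
  fsum (N0 D) (fun r => Kg D r * (Fvec D N (Xs T s) r + eA0h D r * Lg D r * Xs T s (2 * N)%nat)).
Proof.
  intros HT Hs. unfold ud. apply fsum_ext. intros r Hr. rewrite (innov_late T s HT Hs), Xs_last, (Fvec0 D N HN) by exact Hr.
  rewrite (fsum_ext (N0 D) (fun c => A0BK D r c * zap T c (s + hd D)) (fun c => A0BK D r c * Xs T s c))
    by (intros c Hc; rewrite Xs0 by exact Hc; reflexivity). ring.
Qed.

(** Theta2 is the case n = N+1. Since y^{1/2+eps} = y / y^{1/2-eps} with 1/2 - eps >= 0, passing
    from L = lam_{N+1} to lam_n changes the expression by at most -(lam_n - L) Theta3, which is not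
    positive. *)
Lemma Gamma_nonpos eps P alpha beta gamma n : Constraints D N eps P alpha beta gamma -> (N + 1 <= n)%nat ->
  2 * gamma * (- (1 - 1 / alpha) * lam D n + qc D + delta D)
  + beta * Mphi D N eps * Rpower (lam D n) (1 / 2 + eps) <= 0.
Proof.
  intros (Heps & _ & _ & Ha & Hb & Hg & Hex & _ & H2 & H3) Hn. unfold Theta2, Theta3 in *.
  set (L := lam D (N + 1)) in *. set (l := lam D n).
  assert (HL : 0 < L) by (apply Hlp; lia). assert (HLl : L <= l) by (apply Hll; lia).
  assert (HM : 0 <= Mphi D N eps).
  { apply Series_nonneg; [|exact Hex]. intros k. apply Rmult_le_pos; [apply pow2_ge_0|].
    apply Rlt_le, Rinv_0_lt_compat, exp_pos. }
  assert (E : forall y, 0 < y -> Rpower y (1 / 2 + eps) = y / Rpower y (1 / 2 - eps)).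
  { intros y Hy. rewrite <- (Rpower_1 y Hy) at 2. unfold Rdiv. rewrite <- Rpower_Ropp, <- Rpower_plus.
    f_equal. lra. }
  rewrite E in * by lra.
  assert (HR : 0 < Rpower L (1 / 2 - eps)) by apply exp_pos.
  assert (HRl : Rpower L (1 / 2 - eps) <= Rpower l (1 / 2 - eps)) by (apply Rle_Rpower_l; lra).
  assert (X : / Rpower l (1 / 2 - eps) <= / Rpower L (1 / 2 - eps)) by (apply Rinv_le_contravar; assumption).
  assert (HbM : 0 <= beta * Mphi D N eps) by (apply Rmult_le_pos; lra).
  set (bM := beta * Mphi D N eps) in *. set (iL := / Rpower L (1 / 2 - eps)) in *.
  set (il := / Rpower l (1 / 2 - eps)) in *.
  unfold Rdiv in *. fold iL in H2, H3. fold il. set (ia := 1 - 1 * / alpha) in *.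
  assert (A1 : bM * (l * il) <= bM * (l * iL)).
  { apply Rmult_le_compat_l; [exact HbM|]. apply Rmult_le_compat_l; lra. }
  assert (A2 : 0 <= (l - L) * (2 * gamma * ia - bM * iL)) by (apply Rmult_le_pos; lra).
  lra.
Qed.

Lemma bform_is_derive n P (x : R -> nat -> R) (y dx dy : nat -> R) s z :
  (forall i, (i < n)%nat -> is_derive (fun s => x s i) s (dx i)) ->
  (forall i, (i < n)%nat -> is_derive (fun s => z s i) s (dy i)) ->
  is_derive (fun s => bform n P (x s) (z s)) s (bform n P dx (z s) + bform n P (x s) dy).
Proof.
  intros Hx Hz. unfold bform. eapply D_val.
  - apply (fsum_is_derive n (fun i s => fsum n (fun j => x s i * P i j * z s j))). intros i Hi.
    apply (fsum_is_derive n (fun j s => x s i * P i j * z s j)). intros j Hj.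
    apply D_mult; [|apply Hz, Hj]. apply D_mult; [apply Hx, Hi|].
    apply (is_derive_const (K := R_AbsRing) (V := R_NormedModule)).
  - rewrite <- fsum_plus. apply fsum_ext; intros i Hi. rewrite <- fsum_plus.
    apply fsum_ext; intros j Hj. unfold zero; simpl. ring.
Qed.

Definition tailmod (T : traj) (M : nat) (t : R) : R :=
  fsum M (fun k => lam D (S (N + k)) * wn T (S (N + k)) t ^ 2).

Lemma tailmod_nonneg T M t : 0 <= tailmod T M t.
Proof.
  apply fsum_nonneg. intros k _. apply Rmult_le_pos; [|apply pow2_ge_0].
  apply Rlt_le, Hlp. lia.
Qed.

Lemma tailmod_cont T M : modal T -> cont_pos (tailmod T M).
Proof.
  intros HT. apply cont_pos_fsum. intros k _. apply cont_pos_mult; [apply cont_pos_const|].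
  apply cont_pos_pow, wn_cont; [exact HT|lia].
Qed.

Lemma tailmod_smod T M t : smod T (N + M) t = smod T N t + tailmod T M t.
Proof. unfold smod. rewrite fsum_app. reflexivity. Qed.

Lemma tailmod_derive T M t : modal T -> 0 < t -> is_derive (tailmod T M) t
  (fsum M (fun k => lam D (S (N + k)) * (2 * wn T (S (N + k)) t *
    ((- lam D (S (N + k)) + qc D) * wn T (S (N + k)) t + an D (S (N + k)) * tu T t
      + bn D (S (N + k)) * ud T t)))).
Proof.
  intros HT Ht. apply (fsum_is_derive M (fun k s => lam D (S (N + k)) * wn T (S (N + k)) s ^ 2)).
  intros k _. apply D_scal, is_derive_sq, wn_derive; [exact HT|lia|exact Ht].
Qed.

Lemma trace_tail_cs T eps M t : 0 < eps <= 1 / 2 -> ex_series (Mphi_term D N eps) ->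
  fsum M (fun k => wn T (S (N + k)) t * dphi D (S (N + k)) 0) ^ 2 <= Mphi D N eps *
    fsum M (fun k => lam D (S (N + k)) * wn T (S (N + k)) t ^ 2 * Rpower (lam D (S (N + k))) (1 / 2 + eps)).
Proof.
  intros Heps Hex.
  assert (HR : forall k, 0 < Rpower (lam D (S (N + k))) ((3 / 2 + eps) / 2)) by (intros; apply exp_pos).
  set (rt := fun k => Rpower (lam D (S (N + k))) ((3 / 2 + eps) / 2)).
  assert (E2 : forall k, rt k ^ 2 = Rpower (lam D (S (N + k))) (3 / 2 + eps)).
  { intros k. unfold rt. simpl. rewrite Rmult_1_r, <- Rpower_plus. f_equal. lra. }
  assert (Hr : forall k, 0 < rt k) by exact HR.
  rewrite (fsum_ext M _ (fun k => (dphi D (S (N + k)) 0 / rt k) * (wn T (S (N + k)) t * rt k))).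
  2:{ intros k _. specialize (Hr k). field. lra. }
  eapply Rle_trans; [apply fsum_cs|]. apply Rmult_le_compat.
  - apply fsum_nonneg; intros; apply pow2_ge_0.
  - apply fsum_nonneg; intros; apply pow2_ge_0.
  - rewrite (fsum_ext M _ (Mphi_term D N eps)).
    + apply fsum_le_Series; [|exact Hex]. intros k. apply Rmult_le_pos; [apply pow2_ge_0|].
      apply Rlt_le, Rinv_0_lt_compat, exp_pos.
    + intros k _. unfold Mphi_term. replace (N + 1 + k)%nat with (S (N + k)) by lia.
      rewrite <- E2. specialize (Hr k). field. lra.
  - apply fsum_le. intros k _. right. rewrite Rpow_mult_distr, E2.
    assert (L := Hlp (S (N + k)) ltac:(lia)).
    replace (3 / 2 + eps) with (1 + (1 / 2 + eps)) by lra. rewrite Rpower_plus, Rpower_1 by exact L. ring.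
Qed.

Section Lyapunov.
Variables (eps : R) (P : nat -> nat -> R) (alpha beta gamma : R).
Hypothesis HC : Constraints D N eps P alpha beta gamma.
Hypothesis Hta : forall M, fsum M (fun k => an D (S (N + k)) ^ 2) <= tailsq D (acoef D) N.
Hypothesis Htb : forall M, fsum M (fun k => bn D (S (N + k)) ^ 2) <= tailsq D (bcoef D) N.

(** The functional at time t = s + h with the tail cut at M modes: its memory window is [s, s+h],
    and s >= 0 skips the initial phase. *)
Definition Lyap (T : traj) (M : nat) (s : R) : R :=
  exp (2 * delta D * (s + hd D)) * (bform (2 * N) P (Xs T s) (Xs T s) + gamma * tailmod T M (s + hd D))
  + beta * (Zint T (s + hd D) - Zint T s).

Lemma Lyap_cont T M : modal T -> cont_pos (Lyap T M).
Proof.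
  intros HT. apply cont_pos_plus; [apply cont_pos_mult|].
  - apply (cont_pos_shift (fun s => exp (2 * delta D * s))); [apply cont_pos_exp|lra].
  - apply cont_pos_plus.
    + apply (cont_pos_fsum (2 * N) (fun i s => fsum (2 * N) (fun j => Xs T s i * P i j * Xs T s j))).
      intros i Hi. apply (cont_pos_fsum (2 * N) (fun j s => Xs T s i * P i j * Xs T s j)). intros j Hj.
      apply cont_pos_mult; [apply cont_pos_mult; [|apply cont_pos_const]|]; apply Xs_cont; assumption.
    + apply cont_pos_mult; [apply cont_pos_const|]. apply cont_pos_shift; [apply tailmod_cont, HT|lra].
  - apply cont_pos_mult; [apply cont_pos_const|].
    apply cont_pos_minus; [apply cont_pos_shift; [|lra]|]; apply Zint_cont, HT.
Qed.

(* The Theta_1 quadratic form bounds the finite-dimensional part, the modes n > N are controlled by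
   [Gamma_nonpos]; [eta] accounts for the truncation of the trace series. *)
Lemma Lyap_derive T M s eta : modal T -> 0 < s ->
  zeta T (s + hd D) ^ 2 <=
    fsum M (fun k => wn T (S (N + k)) (s + hd D) * dphi D (S (N + k)) 0) ^ 2 + eta ->
  exists d, is_derive (Lyap T M) s d /\ d <= exp (2 * delta D * (s + hd D)) * (beta * eta).
Proof.
  intros HT Hs Hz. assert (HG := Gamma_nonpos eps P alpha beta gamma).
  destruct HC as (Heps & HP & _ & Ha & Hb & Hg & Hex & H1 & _).
  set (t := s + hd D) in *. set (u := tu T t). set (v := ud T t).
  eexists. split.
  - apply D_plus; [apply D_mult|apply D_scal, D_minus].
    + apply (D_shift_plus (fun s => exp (2 * delta D * s))). fold t. assert (E : is_derive (fun s => exp (2 * delta D * s)) t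
        (2 * delta D * exp (2 * delta D * t))) by (auto_derive; [trivial|ring]). exact E.
    + apply D_plus.
      * apply (bform_is_derive (2 * N) P (Xs T) (Xs T s)); intros i Hi; apply Xs_derive; assumption.
      * apply D_scal, (D_shift_plus (tailmod T M)). fold t. apply tailmod_derive; [exact HT|unfold t; lra].
    + apply (D_shift_plus (Zint T)). fold t. apply Zint_derive, HT.
    + apply Zint_derive, HT.
  - rewrite !zsq_late by (unfold t; lra).
    rewrite (bform_sym (2 * N) P (fun i => Fvec D N (Xs T s) i + Lvec D N i * zeta T s) (Xs T s) HP).
    replace (exp (2 * delta D * s)) with (exp (2 * delta D * t) * exp (- 2 * delta D * hd D))
      by (rewrite <- exp_plus; f_equal; unfold t; ring).
    set (e := exp (2 * delta D * t)). assert (He : 0 < e) by apply exp_pos.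
    specialize (H1 (Xs T s)). rewrite (Theta1_qform D N HN P alpha beta gamma _ HP) in H1.
    rewrite <- (ud_late T s HT (Rlt_le _ _ Hs)), <- (u_Kx T s HT (Rlt_le _ _ Hs)), Xs_last, qform_bform in H1.
    fold t u v in H1. fold u v. fold (tailmod T M t).
    set (Q := bform (2 * N) P (Xs T s) (Xs T s)) in *.
    set (Q' := bform (2 * N) P (Xs T s) (fun i => Fvec D N (Xs T s) i + Lvec D N i * zeta T s)) in *.
    set (SS := fsum M (fun k => wn T (S (N + k)) t * dphi D (S (N + k)) 0)) in *.
    set (ta := tailsq D (acoef D) N) in *. set (tb := tailsq D (bcoef D) N) in *.
    assert (HS2 := trace_tail_cs T eps M t Heps Hex). fold SS in HS2.
    assert (Hia : 0 < / alpha) by (apply Rinv_0_lt_compat; lra).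
    assert (Hmod : gamma * (2 * delta D * tailmod T M t +
      fsum M (fun k => lam D (S (N + k)) * (2 * wn T (S (N + k)) t *
        ((- lam D (S (N + k)) + qc D) * wn T (S (N + k)) t + an D (S (N + k)) * u + bn D (S (N + k)) * v))))
      + beta * (Mphi D N eps * fsum M (fun k => lam D (S (N + k)) * wn T (S (N + k)) t ^ 2
           * Rpower (lam D (S (N + k))) (1 / 2 + eps)))
      <= alpha * gamma * (ta * u ^ 2) + alpha * gamma * (tb * v ^ 2)).
    { unfold tailmod. rewrite <- !fsum_scal, <- fsum_plus, <- fsum_scal, <- fsum_plus.
      apply Rle_trans with (fsum M (fun k =>
        (alpha * gamma * u ^ 2) * an D (S (N + k)) ^ 2 + (alpha * gamma * v ^ 2) * bn D (S (N + k)) ^ 2)).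
      - apply fsum_le. intros k _. cbv beta. specialize (HG (S (N + k)) HC ltac:(lia)).
        assert (L := Hlp (S (N + k)) ltac:(lia)).
        set (l := lam D (S (N + k))) in *. set (w := wn T (S (N + k)) t). set (a := an D (S (N + k))).
        set (b := bn D (S (N + k))). set (Rp := Rpower l (1 / 2 + eps)) in *.
        (* Each of the two couplings, a_n u and b_n u', costs gamma / alpha times (lam_n w_n)^2;
           together they turn -2 gamma lam_n into -2 gamma (1 - 1/alpha) lam_n, the coefficient in
           [Gamma_nonpos]. *)
        assert (Y : forall f, 2 * (l * w) * f <= / alpha * (l * w) ^ 2 + alpha * f ^ 2).
        { intros f. assert (0 <= / alpha * (l * w - alpha * f) ^ 2)
            by (apply Rmult_le_pos; [lra|apply pow2_ge_0]).
          replace (/ alpha * (l * w - alpha * f) ^ 2)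
            with (/ alpha * (l * w) ^ 2 - 2 * (l * w) * f + alpha * f ^ 2) in H by (field; lra). lra. }
        assert (Y1 := Rmult_le_compat_l gamma _ _ (Rlt_le _ _ Hg) (Y (a * u))).
        assert (Y2 := Rmult_le_compat_l gamma _ _ (Rlt_le _ _ Hg) (Y (b * v))).
        assert (G : 0 <= - (l * w ^ 2 * (2 * gamma * (- (1 - 1 / alpha) * l + qc D + delta D)
          + beta * Mphi D N eps * Rp))).
        { rewrite Ropp_mult_distr_r. apply Rmult_le_pos; [apply Rmult_le_pos; [lra|apply pow2_ge_0]|lra]. }
        unfold Rdiv in G. lra.
      - rewrite fsum_plus, !fsum_scal. specialize (Hta M). specialize (Htb M). fold ta in Hta. fold tb in Htb.
        assert (0 <= alpha * gamma * u ^ 2) by (apply Rmult_le_pos; [nra|apply pow2_ge_0]).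
        assert (0 <= alpha * gamma * v ^ 2) by (apply Rmult_le_pos; [nra|apply pow2_ge_0]).
        assert (alpha * gamma * u ^ 2 * fsum M (fun k => an D (S (N + k)) ^ 2) <= alpha * gamma * u ^ 2 * ta)
          by (apply Rmult_le_compat_l; assumption).
        assert (alpha * gamma * v ^ 2 * fsum M (fun k => bn D (S (N + k)) ^ 2) <= alpha * gamma * v ^ 2 * tb)
          by (apply Rmult_le_compat_l; assumption).
        lra. }
    match type of Hmod with ?g * (?d2 + ?W) + beta * ?mp <= _ =>
      set (WW := W) in *; set (mm := mp) in * end.
    assert (Hbz : beta * zeta T t ^ 2 <= beta * (mm + eta)) by (apply Rmult_le_compat_l; lra).
    apply Rle_trans with (e * (2 * delta D * Q + 2 * Q' + gamma * (2 * delta D * tailmod T M t + WW)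
      + beta * zeta T t ^ 2 - beta * exp (- 2 * delta D * hd D) * zeta T s ^ 2)); [right; fold t; fold e; ring|].
    apply Rmult_le_compat_l; lra.
Qed.

(** Writing zeta = SS + r with r the truncation error, the cross term 2 r zeta is split by Young's
    inequality with c = 2 B^2 / eta, where B bounds zeta on the compact interval, and r^2 is then
    asked to be at most eta / (2 c). *)
Lemma zeta_truncation T b eta : modal T -> 0 <= b -> 0 < eta -> exists M0, forall M s,
  (M0 <= M)%nat -> 0 <= s <= b -> zeta T (s + hd D) ^ 2 <=
    fsum M (fun k => wn T (S (N + k)) (s + hd D) * dphi D (S (N + k)) 0) ^ 2 + eta.
Proof.
  intros HT Hb Heta.
  destruct (cont_pos_bounded (zeta T) (b + hd D) (zeta_cont T HT) ltac:(lra)) as [B [HB Hbd]].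
  set (c := 2 * B ^ 2 / eta). assert (HB2 : 0 < B ^ 2) by (apply pow_lt; exact HB).
  assert (Hc : 0 < c) by (apply Rdiv_lt_0_compat; lra).
  set (th := eta / (2 * c)). assert (Hth : 0 < th) by (apply Rdiv_lt_0_compat; lra).
  destruct (m_trace T HT (hd D) (b + hd D) th Hh Hth) as [M0 HM0].
  exists M0. intros M s HM Hs. specialize (HM0 (N + M)%nat (s + hd D) ltac:(lia) ltac:(lra)).
  specialize (Hbd (s + hd D) ltac:(lra)). apply (pow_maj_Rabs _ _ 2) in Hbd.
  rewrite fsum_app in HM0. set (t := s + hd D) in *.
  set (SS := fsum M (fun k => wn T (S (N + k)) t * dphi D (S (N + k)) 0)) in *.
  set (z := zeta T t) in *.
  assert (E : tg T t - (fsum N (fun k => wn T (S k) t * dphi D (S k) 0) + SS) = z - SS)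
    by (unfold z, zeta; ring).
  rewrite E in HM0. clear E. set (r := z - SS) in *.
  assert (ES : SS = z - r) by (unfold r; ring). rewrite ES.
  assert (Y : 2 * (r * z) <= c * r ^ 2 + / c * z ^ 2).
  { assert (0 <= / c * (c * r - z) ^ 2) by (apply Rmult_le_pos; [apply Rlt_le, Rinv_0_lt_compat, Hc|apply pow2_ge_0]).
    replace (/ c * (c * r - z) ^ 2) with (c * r ^ 2 - 2 * (r * z) + / c * z ^ 2) in H by (field; lra). lra. }
  assert (Y1 : c * r ^ 2 <= eta / 2).
  { apply Rle_trans with (c * th); [apply Rmult_le_compat_l; lra|right; unfold th; field; lra]. }
  assert (Y2 : / c * z ^ 2 <= eta / 2).
  { apply Rle_trans with (/ c * B ^ 2).
    - apply Rmult_le_compat_l; [apply Rlt_le, Rinv_0_lt_compat, Hc|exact Hbd].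
    - right. unfold c. field. lra. }
  assert (0 <= r ^ 2) by apply pow2_ge_0. lra.
Qed.

(** For fixed s the truncated functional increases by at most e on [0,s] if M is large enough. Since
    B bounds the initial tail for all truncations, the estimate passes down to each smaller M, and
    then e tends to 0. *)
Lemma Lyap_decreases T s B : modal T -> 0 <= s -> (forall M, tailmod T M (hd D) <= B) ->
  forall M,
  exp (2 * delta D * (s + hd D)) * (bform (2 * N) P (Xs T s) (Xs T s) + gamma * tailmod T M (s + hd D))
  <= exp (2 * delta D * hd D) * (bform (2 * N) P (Xs T 0) (Xs T 0) + gamma * B) + beta * Zint T (hd D).
Proof.
  intros HT Hs HB M. destruct HC as (_ & _ & _ & _ & Hb & Hg & _).
  apply le_epsilon. intros e He.
  set (E := exp (2 * delta D * (s + hd D))). assert (HE : 0 < E) by apply exp_pos.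
  (* The rate beta eta, weighted by at most E and accumulated over a time s, stays below e. *)
  set (eta := e / (E * beta * (s + 1))).
  assert (Hden : 0 < E * beta * (s + 1)) by (apply Rmult_lt_0_compat; [apply Rmult_lt_0_compat|]; lra).
  assert (Heta : 0 < eta) by (apply Rdiv_lt_0_compat; assumption).
  destruct (zeta_truncation T s eta HT Hs Heta) as [M0 HM0].
  set (M' := (M + M0)%nat).
  assert (Hinc : Lyap T M' s - Lyap T M' 0 <= (E * (beta * eta)) * (s - 0)).
  { apply (increment_le (Lyap T M') (Derive (Lyap T M'))); [apply Lyap_cont, HT|lra|exact Hs|].
    intros r Hr. destruct (Lyap_derive T M' r eta HT (proj1 Hr)) as [d [Hd Hle]].
    { apply HM0; [unfold M'; lia|lra]. }
    rewrite (is_derive_unique _ _ _ Hd). split; [exact Hd|]. eapply Rle_trans; [exact Hle|].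
    apply Rmult_le_compat_r; [apply Rmult_le_pos; lra|]. apply exp_le_compat.
    apply Rmult_le_compat_l; lra. }
  assert (Hsm : E * (beta * eta) * (s - 0) <= e).
  { apply Rle_trans with (E * (beta * eta) * (s + 1)).
    - apply Rmult_le_compat_l; [|lra]. apply Rmult_le_pos; [lra|]. apply Rmult_le_pos; lra.
    - right. unfold eta. field. repeat split; lra. }
  unfold Lyap in Hinc. rewrite Zint_0, Rplus_0_l in Hinc. fold E in Hinc.
  assert (HZ := Zint_mono T s (s + hd D) HT ltac:(lra)).
  assert (HbZ : 0 <= beta * (Zint T (s + hd D) - Zint T s)) by (apply Rmult_le_pos; lra).
  assert (Hmono : E * (gamma * tailmod T M (s + hd D)) <= E * (gamma * tailmod T M' (s + hd D))).
  { apply Rmult_le_compat_l; [lra|]. apply Rmult_le_compat_l; [lra|].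
    apply (fsum_mono (fun k => lam D (S (N + k)) * wn T (S (N + k)) (s + hd D) ^ 2)).
    - intros k. apply Rmult_le_pos; [apply Rlt_le, Hlp; lia|apply pow2_ge_0].
    - unfold M'. lia. }
  assert (HB' : exp (2 * delta D * hd D) * (gamma * tailmod T M' (hd D)) <= exp (2 * delta D * hd D) * (gamma * B)).
  { apply Rmult_le_compat_l; [apply Rlt_le, exp_pos|]. apply Rmult_le_compat_l; [lra|apply HB]. }
  lra.
Qed.

End Lyapunov.

(** * Decay estimates *)

(** The order of quantifiers is the point: one constant for all trajectories. The closure lemmas
    below let each component be estimated without carrying constants along. *)
Definition dominated (S : R -> Prop) (f : traj -> R -> R) : Prop := exists C, 0 < C /\
  forall T, modal T -> forall t, S t -> f T t <= C * (exp (- 2 * delta D * t) * init_size T).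

Lemma weight_nonneg T t : modal T -> 0 <= exp (- 2 * delta D * t) * init_size T.
Proof. intros HT. apply Rmult_le_pos; [apply Rlt_le, exp_pos|apply (init_size_nonneg T HT)]. Qed.

Lemma dominated_le (S S' : R -> Prop) (f g : traj -> R -> R) : (forall t, S' t -> S t) ->
  (forall T t, modal T -> S' t -> f T t <= g T t) -> dominated S g -> dominated S' f.
Proof.
  intros HS H [C [HC Hg]]. exists C. split; [exact HC|]. intros T HT t Ht.
  eapply Rle_trans; [apply H; assumption|apply Hg; auto].
Qed.

Lemma dominated_plus S f g : dominated S f -> dominated S g -> dominated S (fun T t => f T t + g T t).
Proof.
  intros [C [HC Hf]] [C' [HC' Hg]]. exists (C + C'). split; [lra|]. intros T HT t Ht.
  specialize (Hf T HT t Ht). specialize (Hg T HT t Ht). lra.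
Qed.

Lemma dominated_scal S c f : 0 <= c -> dominated S f -> dominated S (fun T t => c * f T t).
Proof.
  intros Hc [C [HC Hf]]. exists ((c + 1) * C). split; [nra|]. intros T HT t Ht.
  specialize (Hf T HT t Ht). assert (W := weight_nonneg T t HT).
  apply (Rmult_le_compat_l c) in Hf; [|exact Hc].
  assert (0 <= C * (exp (- 2 * delta D * t) * init_size T)) by (apply Rmult_le_pos; lra). lra.
Qed.

Lemma dominated_fsum S n (f : nat -> traj -> R -> R) : (forall i, (i < n)%nat -> dominated S (f i)) ->
  dominated S (fun T t => fsum n (fun i => f i T t)).
Proof.
  induction n as [|n IH]; intros H.
  - exists 1. split; [lra|]. intros T HT t Ht. simpl. assert (W := weight_nonneg T t HT). lra.
  - cbn [fsum]. apply dominated_plus; [apply IH; intros|]; apply H; lia.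
Qed.

Lemma dominated_shift (S S' : R -> Prop) f c : (forall t, S' t -> S (t + c)) -> dominated S f ->
  dominated S' (fun T t => f T (t + c)).
Proof.
  intros HS [C [HC Hf]]. exists (C * exp (- 2 * delta D * c)).
  split; [apply Rmult_lt_0_compat; [exact HC|apply exp_pos]|]. intros T HT t Ht.
  eapply Rle_trans; [apply Hf; auto|]. right.
  replace (- 2 * delta D * (t + c)) with (- 2 * delta D * c + - 2 * delta D * t) by ring.
  rewrite exp_plus. ring.
Qed.

Lemma dominated_cover (S S1 S2 : R -> Prop) f : (forall t, S t -> S1 t \/ S2 t) ->
  dominated S1 f -> dominated S2 f -> dominated S f.
Proof.
  intros HS [C [HC Hf]] [C' [HC' Hg]]. exists (C + C'). split; [lra|]. intros T HT t Ht.
  assert (W := weight_nonneg T t HT).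
  assert (0 <= C * (exp (- 2 * delta D * t) * init_size T)) by (apply Rmult_le_pos; lra).
  assert (0 <= C' * (exp (- 2 * delta D * t) * init_size T)) by (apply Rmult_le_pos; lra).
  destruct (HS t Ht) as [H1|H1]; [specialize (Hf T HT t H1)|specialize (Hg T HT t H1)]; lra.
Qed.

Definition early (t : R) : Prop := 0 <= t <= hd D.
Definition late (t : R) : Prop := 0 <= t.
Definition initial (t : R) : Prop := t = 0.

Lemma dominated_early f : (exists C, 0 < C /\ forall T, modal T -> forall t, early t -> f T t <= C * init_size T) ->
  dominated early f.
Proof.
  intros [C [HC H]]. exists (C * exp (2 * delta D * hd D)).
  split; [apply Rmult_lt_0_compat; [exact HC|apply exp_pos]|]. intros T HT t Ht.
  eapply Rle_trans; [apply H; assumption|]. destruct (init_size_nonneg T HT) as [_ HD0].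
  rewrite Rmult_assoc. apply Rmult_le_compat_l; [lra|]. rewrite <- Rmult_assoc, <- exp_plus.
  rewrite <- (Rmult_1_l (init_size T)) at 1. apply Rmult_le_compat_r; [exact HD0|].
  rewrite <- exp_0. apply exp_le_compat. destruct Ht. nra.
Qed.

(** The Lyapunov state with parameter s describes time s + h, so an estimate for all t >= 0 is
    assembled from one on [0,h] and one on the shifted function. *)
Lemma late_cover f : dominated early f -> dominated late (fun T s => f T (s + hd D)) -> dominated late f.
Proof.
  intros H1 H2. apply (dominated_cover late early (fun t => hd D <= t)); [|exact H1|].
  - unfold late, early. intros t Ht. destruct (Rle_dec t (hd D)); [left|right]; lra.
  - apply (dominated_le (fun t => hd D <= t) _ _ (fun T t => f T (t + - hd D + hd D))); [auto| |].
    + intros T t _ _. right. f_equal. ring.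
    + apply (dominated_shift late _ (fun T s => f T (s + hd D))); [|exact H2]. unfold late. intros; lra.
Qed.

Lemma fsum_sq_term n (a : nat -> R) r : (r < n)%nat -> a r ^ 2 <= fsum n (fun k => a k ^ 2).
Proof. intros Hr. apply (fsum_term_le n (fun k => a k ^ 2)); [intros; apply pow2_ge_0|exact Hr]. Qed.

Lemma early_zh r : (r < N)%nat -> dominated early (fun T t => tzh T (S r) t ^ 2).
Proof.
  intros Hr. apply dominated_early. destruct crude_finite as [C [HC H]]. exists C. split; [exact HC|].
  intros T HT t Ht. destruct (H T HT t Ht) as [H1 _].
  eapply Rle_trans; [apply (fsum_sq_term N (fun k => tzh T (S k) t)), Hr|exact H1].
Qed.

Lemma early_zap r : (r < N)%nat -> dominated early (fun T t => zap T r t ^ 2).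
Proof.
  intros Hr. apply dominated_early. destruct crude_finite as [C [HC H]]. exists C. split; [exact HC|].
  intros T HT t Ht. destruct (H T HT t Ht) as [_ [H1 _]].
  eapply Rle_trans; [apply (fsum_sq_term N (fun k => zap T k t)), Hr|exact H1].
Qed.

Lemma early_u : dominated early (fun T t => tu T t ^ 2).
Proof.
  apply dominated_early. destruct crude_finite as [C [HC H]]. exists C. split; [exact HC|].
  intros T HT t Ht. apply (H T HT t Ht).
Qed.

Lemma wn_smod T r t : (r < N)%nat -> wn T (S r) t ^ 2 <= / lam D 1 * smod T N t.
Proof.
  intros Hr. assert (L1 := Hlp 1 ltac:(lia)). assert (L2 := Hll 1 (S r) ltac:(lia) ltac:(lia)).
  apply Rle_trans with (/ lam D 1 * (lam D (S r) * wn T (S r) t ^ 2)).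
  - rewrite <- Rmult_assoc. rewrite <- (Rmult_1_l (wn T (S r) t ^ 2)) at 1.
    apply Rmult_le_compat_r; [apply pow2_ge_0|]. rewrite <- (Rinv_l (lam D 1)) by lra.
    apply Rmult_le_compat_l; [apply Rlt_le, Rinv_0_lt_compat, L1|exact L2].
  - apply Rmult_le_compat_l; [apply Rlt_le, Rinv_0_lt_compat, L1|].
    apply (fsum_term_le N (fun k => lam D (S k) * wn T (S k) t ^ 2)); [|exact Hr].
    intros k _. apply Rmult_le_pos; [apply Rlt_le, Hlp; lia|apply pow2_ge_0].
Qed.

Lemma sq_sum2 a b : (a + b) ^ 2 <= 2 * a ^ 2 + 2 * b ^ 2.
Proof. assert (0 <= (a - b) ^ 2) by apply pow2_ge_0. lra. Qed.

Lemma initial_ev r : (r < N)%nat -> dominated initial (fun T s => ev T r s ^ 2).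
Proof.
  intros Hr. apply (dominated_le initial initial _ (fun T s => 2 * tzh T (S r) (s + hd D) ^ 2
    + 4 * (/ lam D 1 * smod T N s) + 4 * bn D (S r) ^ 2 * tu T s ^ 2)); [auto| |].
  - intros T t _ _. assert (W := wn_smod T r t Hr). unfold ev.
    assert (E : tzm T (S r) t = wn T (S r) t + - (bn D (S r) * tu T t)) by (unfold wn; ring).
    assert (A := sq_sum2 (tzm T (S r) t) (- tzh T (S r) (t + hd D))).
    assert (B := sq_sum2 (wn T (S r) t) (- (bn D (S r) * tu T t))). rewrite <- E in B. lra.
  - assert (HI : forall t, initial t -> early (t + hd D)) by (unfold initial, early; intros; lra).
    assert (HI' : forall t, initial t -> early t) by (unfold initial, early; intros; lra).
    apply dominated_plus; [apply dominated_plus|].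
    + apply dominated_scal; [lra|].
      apply (dominated_shift early initial (fun T s => tzh T (S r) s ^ 2) (hd D) HI), early_zh, Hr.
    + apply dominated_scal; [lra|]. apply dominated_scal; [apply Rlt_le, Rinv_0_lt_compat, Hlp; lia|].
      apply (dominated_le early _ _ (fun T t => smod T N t)); [exact HI'|intros; lra|].
      apply dominated_early. destruct crude_energy as [C [HC H]]. exists C. split; [exact HC|].
      intros T HT t Ht. apply (H T HT), Ht.
    + apply dominated_scal; [assert (A := pow2_ge_0 (bn D (S r))); lra|].
      apply (dominated_le early _ _ (fun T t => tu T t ^ 2)); [exact HI'|intros; lra|exact early_u].
Qed.

Lemma initial_Xs i : (i < 2 * N)%nat -> dominated initial (fun T s => Xs T s i ^ 2).
Proof.
  assert (HI : forall t, initial t -> early (t + hd D)) by (unfold initial, early; intros; lra).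
  assert (Hz : forall r, (r < N)%nat -> dominated initial (fun T s => zap T r (s + hd D) ^ 2)).
  { intros r Hr. apply (dominated_shift early initial (fun T s => zap T r s ^ 2) (hd D) HI), early_zap, Hr. }
  revert i. apply (index_blocks D N HN); intros r Hr.
  - apply (dominated_le initial _ _ (fun T s => zap T r (s + hd D) ^ 2)); [auto| |apply Hz; lia].
    intros. rewrite Xs0 by exact Hr. lra.
  - apply (dominated_le initial _ _ (fun T s => ev T r s ^ 2)); [auto| |apply initial_ev; lia].
    intros. rewrite Xs1 by exact Hr. lra.
  - apply (dominated_le initial _ _ (fun T s => (/ lam D (N0 D + 1 + r)) ^ 2 * zap T (N0 D + r) (s + hd D) ^ 2));
      [auto| |apply dominated_scal; [apply pow2_ge_0|apply Hz; lia]].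
    intros. rewrite Xs2 by exact Hr. unfold Rdiv. lra.
  - apply (dominated_le initial _ _ (fun T s => lam D (N0 D + 1 + r) ^ 2 * ev T (N0 D + r) s ^ 2));
      [auto| |apply dominated_scal; [apply pow2_ge_0|apply initial_ev; lia]].
    intros. rewrite Xs3 by exact Hr. lra.
Qed.

Section Decay.
Variables (eps : R) (P : nat -> nat -> R) (alpha beta gamma : R).
Hypothesis HC : Constraints D N eps P alpha beta gamma.
Hypothesis Hta : forall M, fsum M (fun k => an D (S (N + k)) ^ 2) <= tailsq D (acoef D) N.
Hypothesis Htb : forall M, fsum M (fun k => bn D (S (N + k)) ^ 2) <= tailsq D (bcoef D) N.

(** The functional at s = 0 is bounded by the data: its quadratic part by [initial_Xs], its tail by
    [crude_energy], its integral by [crude_trace]. Positive definiteness of P and gamma > 0 then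
    recover the two parts separately. *)
Lemma lyapunov_decay : exists C, 0 < C /\ forall T, modal T -> forall s, 0 <= s ->
  fsum (2 * N) (fun i => Xs T s i ^ 2) <= C * (exp (- 2 * delta D * s) * init_size T) /\
  forall M, tailmod T M (s + hd D) <= C * (exp (- 2 * delta D * s) * init_size T).
Proof.
  assert (HLyap := Lyap_decreases eps P alpha beta gamma HC Hta Htb).
  destruct HC as (_ & HP & Hpd & Ha & Hb & Hg & _).
  destruct (posdef_lower (2 * N) P HP Hpd) as [c [Hc Hlow]].
  destruct (qform_upper (2 * N) P) as [Cq [HCq Hup]].
  destruct (dominated_fsum initial (2 * N) (fun i T s => Xs T s i ^ 2)) as [CX [HCX HX]].
  { intros i Hi. apply initial_Xs, Hi. }
  destruct crude_energy as [CE [HCE HE]]. destruct crude_trace as [CZ [HCZ HZ]].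
  set (K := Cq * CX + gamma * CE + beta * CZ).
  assert (0 < Cq * CX) by (apply Rmult_lt_0_compat; assumption).
  assert (0 < gamma * CE) by (apply Rmult_lt_0_compat; assumption).
  assert (0 < beta * CZ) by (apply Rmult_lt_0_compat; assumption).
  assert (HK : 0 < K) by (unfold K; lra).
  exists (K / c + K / gamma). assert (0 < K / c) by (apply Rdiv_lt_0_compat; assumption).
  assert (0 < K / gamma) by (apply Rdiv_lt_0_compat; assumption).
  split; [lra|]. intros T HT s Hs. destruct (init_size_nonneg T HT) as [_ HD0].
  assert (HB : forall M, tailmod T M (hd D) <= CE * init_size T).
  { intros M. assert (A := proj1 (HE T HT) (hd D) (N + M)%nat ltac:(lra)).
    rewrite tailmod_smod in A. assert (A2 := smod_nonneg T N (hd D)). lra. }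
  assert (HQ0 : bform (2 * N) P (Xs T 0) (Xs T 0) <= Cq * CX * init_size T).
  { rewrite <- qform_bform. eapply Rle_trans; [apply Rle_abs|]. eapply Rle_trans; [apply Hup|].
    rewrite Rmult_assoc. apply Rmult_le_compat_l; [lra|]. eapply Rle_trans; [apply (HX T HT 0); reflexivity|].
    rewrite Rmult_0_r, exp_0. lra. }
  assert (Hmain : forall M, bform (2 * N) P (Xs T s) (Xs T s) + gamma * tailmod T M (s + hd D)
    <= K * (exp (- 2 * delta D * s) * init_size T)).
  { intros M. specialize (HLyap T s (CE * init_size T) HT Hs HB M). specialize (HZ T HT).
    set (V := bform (2 * N) P (Xs T s) (Xs T s) + gamma * tailmod T M (s + hd D)) in *.
    set (e := exp (2 * delta D * hd D)) in *.
    assert (He1 : 1 <= e) by (unfold e; rewrite <- exp_0; apply exp_le_compat; nra).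
    replace (exp (2 * delta D * (s + hd D))) with (e * exp (2 * delta D * s)) in HLyap
      by (unfold e; rewrite <- exp_plus; f_equal; ring).
    assert (Hinv : exp (- 2 * delta D * s) * exp (2 * delta D * s) = 1).
    { rewrite <- exp_plus, <- exp_0. f_equal. ring. }
    set (x := exp (2 * delta D * s)) in *. set (y := exp (- 2 * delta D * s)) in *.
    assert (Hy : 0 < y) by apply exp_pos.
    assert (HZ' : beta * Zint T (hd D) <= e * (beta * CZ * init_size T)).
    { apply Rle_trans with (1 * (beta * CZ * init_size T)).
      - rewrite Rmult_1_l, Rmult_assoc. apply Rmult_le_compat_l; lra.
      - apply Rmult_le_compat_r; [apply Rmult_le_pos; lra|exact He1]. }
    assert (Hall : e * x * V <= e * (K * init_size T)).
    { eapply Rle_trans; [exact HLyap|].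
      assert (e * bform (2 * N) P (Xs T 0) (Xs T 0) <= e * (Cq * CX * init_size T)) by (apply Rmult_le_compat_l; lra).
      unfold K. lra. }
    rewrite Rmult_assoc in Hall. apply Rmult_le_reg_l in Hall; [|lra].
    apply (Rmult_le_compat_l y) in Hall; [|lra].
    replace (y * (x * V)) with V in Hall by (rewrite <- Rmult_assoc, Hinv; ring). lra. }
  set (W := exp (- 2 * delta D * s) * init_size T) in *.
  assert (HW : 0 <= W) by apply (weight_nonneg T s HT).
  assert (P1 : 0 <= K / c * W) by (apply Rmult_le_pos; lra).
  assert (P2 : 0 <= K / gamma * W) by (apply Rmult_le_pos; lra).
  specialize (Hlow (Xs T s)). rewrite qform_bform in Hlow.
  set (xx := fsum (2 * N) (fun i => Xs T s i ^ 2)) in *.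
  assert (Hxx : 0 <= xx) by (apply fsum_nonneg; intros; apply pow2_ge_0).
  split.
  - specialize (Hmain 0%nat). assert (T0 := tailmod_nonneg T 0 (s + hd D)).
    assert (0 <= gamma * tailmod T 0 (s + hd D)) by (apply Rmult_le_pos; lra).
    assert (c * xx <= c * (K / c * W)).
    { replace (c * (K / c * W)) with (K * W) by (field; lra). lra. }
    apply Rmult_le_reg_l in H5; lra.
  - intros M. specialize (Hmain M).
    assert (0 <= c * xx) by (apply Rmult_le_pos; lra).
    assert (gamma * tailmod T M (s + hd D) <= gamma * (K / gamma * W)).
    { replace (gamma * (K / gamma * W)) with (K * W) by (field; lra). lra. }
    apply Rmult_le_reg_l in H5; lra.
Qed.

Lemma late_Xs i : (i < 2 * N)%nat -> dominated late (fun T s => Xs T s i ^ 2).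
Proof.
  intros Hi. destruct lyapunov_decay as [C [HC0 H]]. exists C. split; [exact HC0|].
  intros T HT s Hs. destruct (H T HT s Hs) as [H1 _].
  eapply Rle_trans; [apply (fsum_sq_term (2 * N) (Xs T s)), Hi|exact H1].
Qed.

Lemma late_u : dominated late (fun T t => tu T t ^ 2).
Proof.
  apply late_cover; [exact early_u|].
  destruct (functional_bound (N0 D) (Kg D)) as [C [HC0 H]].
  apply (dominated_le late _ _ (fun T s => C * fsum (N0 D) (fun i => Xs T s i ^ 2))); [auto| |].
  - intros T s HT Hs. rewrite (u_Kx T s HT Hs). unfold Kx.
    rewrite (fsum_ext (N0 D) _ (fun i => Xs T s i * Kg D i)) by (intros; ring). apply H.
  - apply dominated_scal; [lra|]. apply dominated_fsum. intros i Hi. apply late_Xs. lia.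
Qed.

Lemma split_index (Q : nat -> Prop) : (forall r, (r < N0 D)%nat -> Q r) ->
  (forall r, (r < N - N0 D)%nat -> Q (N0 D + r)%nat) -> forall r, (r < N)%nat -> Q r.
Proof.
  intros H1 H2 r Hr. destruct (Nat.lt_ge_cases r (N0 D)); [auto|].
  replace r with (N0 D + (r - N0 D))%nat by lia. apply H2. lia.
Qed.

Lemma late_zap r : (r < N)%nat -> dominated late (fun T t => zap T r t ^ 2).
Proof.
  intros Hr. apply late_cover; [apply early_zap, Hr|]. revert r Hr. apply split_index; intros r Hr.
  - apply (dominated_le late _ _ (fun T s => Xs T s r ^ 2)); [auto| |apply late_Xs; lia].
    intros. rewrite Xs0 by exact Hr. lra.
  - apply (dominated_le late _ _ (fun T s => lam D (N0 D + 1 + r) ^ 2 * Xs T s (2 * N0 D + r) ^ 2)); [auto| |].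
    + intros. rewrite Xs2 by exact Hr. assert (L := Hlp (N0 D + 1 + r) ltac:(lia)). right. field. lra.
    + apply dominated_scal; [apply pow2_ge_0|]. apply late_Xs. lia.
Qed.

Lemma late_ev r : (r < N)%nat -> dominated late (fun T t => ev T r t ^ 2).
Proof.
  revert r. apply split_index; intros r Hr.
  - apply (dominated_le late _ _ (fun T s => Xs T s (N0 D + r) ^ 2)); [auto| |apply late_Xs; lia].
    intros. rewrite Xs1 by exact Hr. lra.
  - apply (dominated_le late _ _ (fun T s => (/ lam D (N0 D + 1 + r)) ^ 2 * Xs T s (N0 D + N + r) ^ 2)); [auto| |].
    + intros. rewrite Xs3 by exact Hr. assert (L := Hlp (N0 D + 1 + r) ltac:(lia)). right. field. lra.
    + apply dominated_scal; [apply pow2_ge_0|]. apply late_Xs. lia.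
Qed.

Definition memory (T : traj) (r : nat) (t : R) : R :=
  RInt (fun s => exp (A0d D r * (t - s)) * B0 D r * tu T s) (t - hd D) t.

(** The integral runs over [s, s+h], where |u| is already bounded by its decay rate at the left end
    s. *)
Lemma late_memory r : dominated late (fun T s => memory T r (s + hd D) ^ 2).
Proof.
  destruct late_u as [C [HC0 Hu]].
  set (b := exp (Rabs (A0d D r) * hd D) * Rabs (B0 D r)).
  assert (Hb : 0 <= b) by (apply Rmult_le_pos; [apply Rlt_le, exp_pos|apply Rabs_pos]).
  exists ((hd D * b) ^ 2 * C + 1). assert (Hq : 0 <= (hd D * b) ^ 2) by apply pow2_ge_0.
  split; [nra|]. intros T HT s Hs.
  set (W := exp (- 2 * delta D * s) * init_size T).
  assert (HW : 0 <= W) by apply (weight_nonneg T s HT).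
  destruct (init_size_nonneg T HT) as [_ HD0].
  set (f := fun x => exp (A0d D r * (s + hd D - x)) * B0 D r * tu T x).
  assert (Hf : forall x, continuous f x).
  { intros x. apply (continuous_mult (U := R_UniformSpace) (K := R_AbsRing)); [|apply (m_u T HT)].
    apply (ex_derive_continuous (K := R_AbsRing) (V := R_NormedModule)). auto_derive. trivial. }
  set (U := sqrt (C * W)).
  assert (HU2 : U ^ 2 = C * W) by (apply pow2_sqrt, Rmult_le_pos; lra).
  assert (Hbd : Rabs (memory T r (s + hd D)) <= hd D * (b * U)).
  { unfold memory. fold f. replace (s + hd D - hd D) with s by ring.
    replace (hd D * (b * U)) with ((s + hd D - s) * (b * U)) by ring.
    apply (abs_RInt_le_const f); [lra| |].
    - apply (ex_RInt_continuous (V := R_CompleteNormedModule)). auto.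
    - intros x Hx. unfold f. rewrite !Rabs_mult. apply Rmult_le_compat.
      + apply Rmult_le_pos; apply Rabs_pos.
      + apply Rabs_pos.
      + apply Rmult_le_compat_r; [apply Rabs_pos|]. rewrite Rabs_right by (apply Rle_ge, Rlt_le, exp_pos).
        apply exp_le_compat. apply Rle_trans with (Rabs (A0d D r) * (s + hd D - x)).
        * apply Rmult_le_compat_r; [lra|apply Rle_abs].
        * apply Rmult_le_compat_l; [apply Rabs_pos|lra].
      + rewrite <- sqrt_Rsqr_abs. apply sqrt_le_1_alt. rewrite Rsqr_pow2.
        eapply Rle_trans; [apply (Hu T HT x); unfold late in *; lra|]. apply Rmult_le_compat_l; [lra|].
        apply Rmult_le_compat_r; [exact HD0|]. apply exp_le_compat. nra. }
  apply (pow_maj_Rabs _ _ 2) in Hbd. eapply Rle_trans; [exact Hbd|].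
  replace ((hd D * (b * U)) ^ 2) with ((hd D * b) ^ 2 * U ^ 2) by ring. rewrite HU2.
  fold W. lra.
Qed.

(** The predictor is inverted: the observer state is e^{-A0 h} times the predictor minus its memory
    term, and both decay. *)
Lemma late_zh r : (r < N)%nat -> dominated late (fun T t => tzh T (S r) t ^ 2).
Proof.
  intros Hr. apply late_cover; [apply early_zh, Hr|].
  apply (dominated_le late _ _ (fun T s => (/ eA0h D r) ^ 2 *
    (2 * zap T r (s + hd D) ^ 2 + 2 * memory T r (s + hd D) ^ 2))); [auto| |].
  - intros T s HT Hs. assert (He : 0 < eA0h D r) by apply exp_pos.
    assert (E : tzh T (S r) (s + hd D) = / eA0h D r * (zap T r (s + hd D) + - memory T r (s + hd D))).
    { unfold zap, ZA. fold (memory T r (s + hd D)). field. lra. }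
    rewrite E, Rpow_mult_distr. apply Rmult_le_compat_l; [apply pow2_ge_0|].
    assert (A := sq_sum2 (zap T r (s + hd D)) (- memory T r (s + hd D))). lra.
  - apply dominated_scal; [apply pow2_ge_0|]. apply dominated_plus; apply dominated_scal; try lra.
    + apply (dominated_shift late late (fun T s => zap T r s ^ 2)); [unfold late; intros; lra|].
      apply late_zap, Hr.
    + apply late_memory.
Qed.

(** The plant mode at time t is the error [ev] at t plus the observer state at t + h. *)
Lemma late_wn r : (r < N)%nat -> dominated late (fun T t => wn T (S r) t ^ 2).
Proof.
  intros Hr. apply (dominated_le late _ _ (fun T t => 4 * ev T r t ^ 2 + 4 * tzh T (S r) (t + hd D) ^ 2
    + 2 * bn D (S r) ^ 2 * tu T t ^ 2)); [auto| |].
  - intros T t _ _. assert (A := sq_sum2 (ev T r t) (tzh T (S r) (t + hd D))).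
    assert (B := sq_sum2 (tzm T (S r) t) (bn D (S r) * tu T t)).
    replace (ev T r t + tzh T (S r) (t + hd D)) with (tzm T (S r) t) in A by (unfold ev; ring).
    unfold wn. lra.
  - apply dominated_plus; [apply dominated_plus|]; apply dominated_scal; try lra.
    + apply late_ev, Hr.
    + apply (dominated_shift late late (fun T t => tzh T (S r) t ^ 2)); [unfold late; intros; lra|].
      apply late_zh, Hr.
    + assert (A := pow2_ge_0 (bn D (S r))). lra.
    + exact late_u.
Qed.

Lemma tail_decay : exists C, 0 < C /\ forall T, modal T -> forall t M, 0 <= t ->
  tailmod T M t <= C * (exp (- 2 * delta D * t) * init_size T).
Proof.
  destruct lyapunov_decay as [C1 [HC1 H1]]. destruct crude_energy as [C2 [HC2 H2]].
  set (e := exp (2 * delta D * hd D)). assert (He : 0 < e) by apply exp_pos.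
  exists ((C1 + C2) * e). split; [apply Rmult_lt_0_compat; lra|]. intros T HT t M Ht.
  destruct (init_size_nonneg T HT) as [_ HD0].
  assert (E : forall s, e * (exp (- 2 * delta D * s) * init_size T) = exp (- 2 * delta D * (s - hd D)) * init_size T).
  { intros s. rewrite <- Rmult_assoc. f_equal. unfold e. rewrite <- exp_plus. f_equal. ring. }
  rewrite Rmult_assoc, E. assert (W := weight_nonneg T (t - hd D) HT).
  set (w := exp (- 2 * delta D * (t - hd D)) * init_size T) in *.
  assert (0 <= C1 * w) by (apply Rmult_le_pos; lra). assert (0 <= C2 * w) by (apply Rmult_le_pos; lra).
  destruct (Rle_dec t (hd D)) as [Hl|Hl].
  - assert (A := proj1 (H2 T HT) t (N + M)%nat ltac:(lra)). rewrite tailmod_smod in A.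
    assert (A2 := smod_nonneg T N t).
    assert (C2 * init_size T <= C2 * w).
    { apply Rmult_le_compat_l; [lra|]. unfold w. rewrite <- (Rmult_1_l (init_size T)) at 1.
      apply Rmult_le_compat_r; [exact HD0|]. rewrite <- exp_0. apply exp_le_compat. nra. }
    lra.
  - assert (A := proj2 (H1 T HT (t - hd D) ltac:(lra)) M). replace (t - hd D + hd D) with t in A by ring.
    fold w in A. lra.
Qed.

Theorem modal_decay : exists C, 0 < C /\ forall T, modal T -> forall t, 0 <= t ->
  tG T t + tu T t ^ 2 + fsum N (fun k => tzh T (S k) t ^ 2) <= C * (exp (- 2 * delta D * t) * init_size T).
Proof.
  assert (HG : dominated late (fun T t => tG T t)).
  { destruct tail_decay as [C1 [HC1 H1]].
    destruct (dominated_fsum late N (fun k T t => lam D (S k) * wn T (S k) t ^ 2)) as [C2 [HC2 H2]].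
    { intros k Hk. apply dominated_scal; [apply Rlt_le, Hlp; lia|apply late_wn, Hk]. }
    exists (C1 + C2 + 1). split; [lra|]. intros T HT t Ht.
    assert (W := weight_nonneg T t HT). destruct (init_size_nonneg T HT) as [_ HD0].
    assert (0 <= C1 * (exp (- 2 * delta D * t) * init_size T)) by (apply Rmult_le_pos; lra).
    assert (0 <= C2 * (exp (- 2 * delta D * t) * init_size T)) by (apply Rmult_le_pos; lra).
    (* [m_Glim] is available only for t > 0; at t = 0 the energy is itself a summand of
       [init_size]. *)
    destruct (Req_dec t 0) as [->|Hne].
    - rewrite Rmult_0_r, exp_0, Rmult_1_l in *.
      assert (tG T 0 <= init_size T); [|lra]. unfold init_size.
      assert (0 <= fsum N (fun k => tzh T (S k) 0 ^ 2)) by (apply fsum_nonneg; intros; apply pow2_ge_0).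
      assert (0 <= tu T 0 ^ 2) by apply pow2_ge_0. assert (0 <= tY T ^ 2) by apply pow2_ge_0. lra.
    - apply Rle_trans with ((C1 + C2) * (exp (- 2 * delta D * t) * init_size T)); [|lra].
      apply le_epsilon. intros e He. unfold late in Ht.
      destruct (m_Glim T HT t e ltac:(lra) He) as [M HM].
      assert (Hm : smod T M t <= smod T (N + M) t).
      { apply (fsum_mono (fun k => lam D (S k) * wn T (S k) t ^ 2)); [|lia].
        intros k. apply Rmult_le_pos; [apply Rlt_le, Hlp; lia|apply pow2_ge_0]. }
      rewrite tailmod_smod in Hm. specialize (H1 T HT t M Ht). specialize (H2 T HT t Ht).
      fold (smod T N t) in H2. fold (smod T M t) in HM. lra. }
  destruct (dominated_plus late _ _ (dominated_plus late _ _ HG late_u)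
    (dominated_fsum late N (fun k T t => tzh T (S k) t ^ 2) late_zh)) as [C [HC0 H]].
  exists C. split; [exact HC0|]. intros T HT t Ht. apply (H T HT t Ht).
Qed.

End Decay.

End Modal.

(** * From the plant to its modes *)

(* Joint continuity on [a, +oo) x [0,1], expressed through the retraction onto that set. *)
Definition jcont (a : R) (f : R -> R -> R) : Prop :=
  forall t x, continuity_2d_pt (fun s y => f (Rmax a s) (clamp y)) t x.

Lemma Rmax_lip a s t : Rabs (Rmax a s - Rmax a t) <= Rabs (s - t).
Proof.
  unfold Rmax. destruct (Rle_dec a s), (Rle_dec a t); unfold Rabs; repeat destruct (Rcase_abs _); lra.
Qed.

Lemma jcont_cont2 (S : R -> R -> Prop) a f : (forall t x, a <= t -> 0 <= x <= 1 -> S t x) ->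
  cont2 S f -> jcont a f.
Proof.
  intros HS H t x eps.
  destruct (H (Rmax a t) (clamp x) (HS _ _ (Rmax_l _ _) (clamp_in x)) eps (cond_pos eps)) as [d [Hd Hf]].
  exists (mkposreal d Hd). intros s y Hs Hy. simpl in Hs, Hy. apply Hf.
  - apply HS; [apply Rmax_l|apply clamp_in].
  - eapply Rle_lt_trans; [apply Rmax_lip|exact Hs].
  - eapply Rle_lt_trans; [apply clamp_lip|exact Hy].
Qed.

Lemma jcont_minus a f g : jcont a f -> jcont a g -> jcont a (fun t x => f t x - g t x).
Proof. intros Hf Hg t x. apply (continuity_2d_pt_minus _ _ t x (Hf t x) (Hg t x)). Qed.

Lemma jcont_mult a f g : jcont a f -> jcont a g -> jcont a (fun t x => f t x * g t x).
Proof. intros Hf Hg t x. apply (continuity_2d_pt_mult _ _ t x (Hf t x) (Hg t x)). Qed.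

Lemma jcont_time a g : (forall t, continuous g t) -> jcont a (fun t _ => g t).
Proof.
  intros H t x eps. destruct (continuous_eps_inv g (Rmax a t) (H _) eps (cond_pos eps)) as [d [Hd Hg]].
  exists (mkposreal d Hd). intros s y Hs _. apply Hg. eapply Rle_lt_trans; [apply Rmax_lip|exact Hs].
Qed.

Lemma jcont_space a f : cont01 f -> jcont a (fun _ x => f x).
Proof.
  intros H t x eps. destruct (H (clamp x) (clamp_in x) eps (cond_pos eps)) as [d [Hd Hf]].
  exists (mkposreal d Hd). intros s y _ Hy. apply Hf; [apply clamp_in|].
  eapply Rle_lt_trans; [apply clamp_lip|exact Hy].
Qed.

Lemma jcont_const a c : jcont a (fun _ _ => c).
Proof. intros t x. apply continuity_2d_pt_const. Qed.

Lemma jcont_cont01 a f t : jcont a f -> a <= t -> cont01 (f t).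
Proof.
  intros H Ht x Hx eps He. destruct (H t x (mkposreal eps He)) as [d Hd]. exists d. split; [apply cond_pos|].
  intros y Hy Hyx. specialize (Hd t y). rewrite Rmax_right, !clamp_id in Hd by assumption.
  apply Hd; [|exact Hyx]. rewrite Rminus_diag, Rabs_R0. apply cond_pos.
Qed.

Lemma jcont_integral a f : jcont a f -> forall t, continuous (fun s => RInt (f (Rmax a s)) 0 1) t.
Proof.
  intros H t. apply continuous_eps. intros eps He.
  destruct (uniform_continuity_2d_1d' (fun s y => f (Rmax a s) (clamp y)) 0 1 t) with
    (eps := mkposreal (eps / 2) ltac:(lra)) as [d Hd]; [intros; apply H|].
  exists d. split; [apply cond_pos|]. intros s Hs.
  assert (C : forall r, cont01 (f (Rmax a r))) by (intros r; apply (jcont_cont01 a); [exact H|apply Rmax_l]).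
  rewrite <- RInt_c01_minus by (auto; lra).
  eapply Rle_lt_trans; [apply RInt_c01_abs; (auto with c01; lra)|].
  apply Rle_lt_trans with (RInt (fun _ => eps / 2) 0 1).
  - apply RInt_c01_le; auto with c01; try lra. intros x Hx.
    assert (Hpd := cond_pos d). apply Rabs_lt_between in Hs.
    specialize (Hd x t x s Hx ltac:(lra) Hx ltac:(lra)). simpl in Hd.
    rewrite !clamp_id in Hd by exact Hx. apply Rlt_le, Hd. rewrite Rminus_diag, Rabs_R0. exact Hpd.
  - rewrite RInt_const01. lra.
Qed.

Lemma jcont_ip_cont_pos f g : jcont 0 f -> jcont 0 g -> cont_pos (fun t => ip (f t) (g t)).
Proof. intros Hf Hg. apply cont_pos_of_ext, (jcont_integral 0 _ (jcont_mult 0 f g Hf Hg)). Qed.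

Lemma jcont_ip_bounded f a b : jcont a f ->
  exists B, 0 < B /\ forall t, a <= t <= b -> ip (f t) (f t) <= B.
Proof.
  intros Hf. destruct (Rle_dec a b) as [Hab|Hab].
  2:{ exists 1. split; [lra|]. intros; lra. }
  destruct (continuity_ab_maj (fun s => RInt (fun x => f (Rmax a s) x * f (Rmax a s) x) 0 1) a b Hab) as [m [Hm _]].
  - intros t _. apply continuity_pt_filterlim, (jcont_integral a _ (jcont_mult a f f Hf Hf)).
  - exists (Rabs (RInt (fun x => f (Rmax a m) x * f (Rmax a m) x) 0 1) + 1).
    assert (A := Rabs_pos (RInt (fun x => f (Rmax a m) x * f (Rmax a m) x) 0 1)).
    split; [lra|]. intros t Ht. specialize (Hm t Ht). simpl in Hm. rewrite (Rmax_right a t) in Hm by lra.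
    assert (A2 := Rle_abs (RInt (fun x => f (Rmax a m) x * f (Rmax a m) x) 0 1)). unfold ip. lra.
Qed.

(** Differentiation under the integral needs joint continuity of z_t near t. It holds only for
    positive times, so the retraction at a = t/2 is used. *)
Lemma ip_derive (z zt : R -> R -> R) g t :
  (forall s x, 0 < s -> 0 <= x <= 1 -> is_derive (fun s => z s x) s (zt s x)) ->
  (forall s, 0 < s -> cont01 (z s)) -> (forall a, 0 < a -> jcont a zt) -> cont01 g -> 0 < t ->
  is_derive (fun s => ip (z s) g) t (ip (zt t) g).
Proof.
  intros Hd Hz Hzt Hg Ht.
  set (f := fun s x => z s (clamp x) * g (clamp x)).
  assert (Df : forall s x, 0 < s -> is_derive (fun s => f s x) s (zt s (clamp x) * g (clamp x))).
  { intros s x Hs. unfold f. apply (is_derive_ext (fun s => g (clamp x) * z s (clamp x))); [intros; apply Rmult_comm|].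
    eapply D_val; [apply D_scal, Hd; [exact Hs|apply clamp_in]|ring]. }
  assert (Hloc : forall (Q : R -> Prop), (forall s, 0 < s -> Q s) -> locally t Q).
  { intros Q HQ. exists (mkposreal t Ht). intros s Hs. apply HQ.
    apply Rabs_lt_between in Hs. simpl in Hs. unfold minus, plus, opp in Hs; simpl in Hs. lra. }
  assert (E : forall s, ip (z s) g = RInt (f s) 0 1).
  { intros s. apply RInt_c01_ext; [lra|lra|]. intros x Hx. unfold f. rewrite clamp_id by exact Hx. reflexivity. }
  apply (is_derive_ext (fun s => RInt (f s) 0 1)); [intros; symmetry; apply E|].
  eapply D_val; [apply (is_derive_RInt_param f 0 1 t)|].
  - apply Hloc. intros s Hs x _. eexists. apply Df, Hs.
  - intros x _. assert (J := jcont_mult (t / 2) zt (fun _ x => g x) (Hzt (t / 2) ltac:(lra)) (jcont_space _ g Hg) t x).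
    eapply continuity_2d_pt_ext_loc; [|exact J]. exists (mkposreal (t / 2) ltac:(lra)). intros s y Hs _. simpl in Hs.
    apply Rabs_lt_between in Hs. rewrite Rmax_right by lra. symmetry. apply is_derive_unique, Df. lra.
  - apply Hloc. intros s Hs. apply ex_RInt_c01; [|lra|lra].
    apply (cont01_eq (fun x => z s x * g x)); [|apply cont01_mult; [apply Hz, Hs|exact Hg]].
    intros x Hx. unfold f. rewrite clamp_id by exact Hx. reflexivity.
  - apply RInt_c01_ext; [lra|lra|]. intros x Hx.
    transitivity (zt t (clamp x) * g (clamp x)); [apply is_derive_unique, Df, Ht|].
    rewrite clamp_id by exact Hx. reflexivity.
Qed.

Section Plant.
Variables (th1 th2 : R) (p dp q : R -> R) (qc delta : R) (N0 : nat)
  (lam : nat -> R) (phi dphi : nat -> R -> R) (K L : nat -> R) (h : R).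
Hypothesis Hth1 : 0 <= th1 < PI / 2.
Hypothesis Hth2 : 0 <= th2 <= PI / 2.
Hypothesis Hp : deriv01 p dp.
Hypothesis Hdp : cont01 dp.
Hypothesis Hppos : forall x, 0 <= x <= 1 -> 0 < p x.
Hypothesis Hq : cont01 q.
Hypothesis Hqpos : forall x, 0 <= x <= 1 -> 0 < q x.
Hypothesis HS : SL_spectrum p q th1 th2 lam phi dphi.
Hypothesis Hh : 0 < h.

Let D := mkData th1 th2 p dp q qc lam phi dphi N0 K L h delta.
Let aenergy w dw := aform p q th1 th2 w dw w dw.

(** Green's identity in both orders. At 0 both functions satisfy the same condition and the boundary
    terms cancel; at 1 the inhomogeneous value u survives with factor beta_n. *)
Lemma lagrange f df Af u n : (1 <= n)%nat -> deriv01 f df ->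
  deriv01 (fun x => p x * df x) (fun x => q x * f x - Af x) -> cont01 Af ->
  cos th1 * f 0 - sin th1 * df 0 = 0 -> cos th2 * f 1 + sin th2 * df 1 = u ->
  ip Af (phi n) = lam n * ip f (phi n) - betan D n * u.
Proof.
  intros Hn Hf HpA HA H0 H1.
  destruct (phi_inD p q th1 th2 lam phi dphi HS n Hn) as [Hg [Hpg [G0 G1]]].
  assert (Hfc := deriv01_cont _ _ Hf). assert (Hgc := deriv01_cont _ _ Hg).
  assert (E1 := green p dp q Hp Hq f df Af (phi n) (dphi n) Hf HpA Hg HA).
  assert (E2 := green p dp q Hp Hq (phi n) (dphi n) _ f df Hg Hpg Hf (cont01_scal (lam n) _ Hgc)).
  rewrite ip_scal_l, (ip_comm (phi n) f) in E2 by assumption.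
  assert (E3 : RInt (fun x => p x * df x * dphi n x + q x * f x * phi n x) 0 1
    = RInt (fun x => p x * dphi n x * df x + q x * phi n x * f x) 0 1 :> R).
  { apply RInt_c01_ext; [lra|lra|]. intros; ring. }
  assert (T1 := sin2_cos2 th1). assert (T2 := sin2_cos2 th2). unfold Rsqr in T1, T2.
  assert (Z : df 0 * phi n 0 = dphi n 0 * f 0).
  { destruct (trig1 th1 Hth1) as [Hc _]. assert (F0 : f 0 = sin th1 * df 0 / cos th1).
    { apply Rmult_eq_reg_l with (cos th1); [|lra]. field_simplify; lra. }
    assert (P0 : phi n 0 = sin th1 * dphi n 0 / cos th1).
    { apply Rmult_eq_reg_l with (cos th1); [|lra]. field_simplify; lra. }
    rewrite F0, P0. field. lra. }
  (* By its condition at 1 the eigenfunction has data phi_n(1) = mu sin th2 and phi_n'(1) = -mu cos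
     th2, and then beta_n = p(1) mu. *)
  set (mu := sin th2 * phi n 1 - cos th2 * dphi n 1).
  assert (M1 : phi n 1 = mu * sin th2).
  { unfold mu. replace (phi n 1) with (phi n 1 * (sin th2 * sin th2 + cos th2 * cos th2)) at 1 by (rewrite T2; ring).
    replace (phi n 1 * (sin th2 * sin th2 + cos th2 * cos th2))
      with ((sin th2 * phi n 1 - cos th2 * dphi n 1) * sin th2
            + cos th2 * (cos th2 * phi n 1 + sin th2 * dphi n 1)) by ring.
    rewrite G1. ring. }
  assert (M2 : dphi n 1 = - mu * cos th2).
  { unfold mu. replace (dphi n 1) with (dphi n 1 * (sin th2 * sin th2 + cos th2 * cos th2)) at 1 by (rewrite T2; ring).
    replace (dphi n 1 * (sin th2 * sin th2 + cos th2 * cos th2))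
      with (- (sin th2 * phi n 1 - cos th2 * dphi n 1) * cos th2
            + sin th2 * (cos th2 * phi n 1 + sin th2 * dphi n 1)) by ring.
    rewrite G1. ring. }
  assert (B : betan D n * u = p 1 * (df 1 * phi n 1 - dphi n 1 * f 1)).
  { unfold betan. simpl. rewrite <- H1, M1, M2.
    replace (- cos th2 * (- mu * cos th2) + sin th2 * (mu * sin th2)) with mu.
    - ring.
    - transitivity (mu * (sin th2 * sin th2 + cos th2 * cos th2)); [rewrite T2|]; ring. }
  rewrite B.
  assert (Z' : p 0 * df 0 * phi n 0 = p 0 * dphi n 0 * f 0) by (rewrite !Rmult_assoc; f_equal; lra).
  lra.
Qed.

(** * The lifting x^2 / den of the boundary input *)

Lemma quad_deriv : deriv01 (fun x => x ^ 2 / den D) (fun x => 2 * x / den D).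
Proof.
  apply (deriv01_eq (fun x => / den D * (x * x)) (fun x => / den D * (1 * x + x * 1)));
    [intros; unfold Rdiv; ring|intros; unfold Rdiv; ring|].
  apply deriv01_scal, deriv01_mult; apply deriv01_id.
Qed.

(** The operator A applied to x^2 / den; thus a = qc x^2 / den - [Aquad] and b = - x^2 / den. *)
Let Aquad (x : R) : R := q x * (x ^ 2 / den D) - (2 * p x + 2 * x * dp x) / den D.

Lemma Aquad_cont : cont01 Aquad.
Proof. assert (Hpc := deriv01_cont _ _ Hp). unfold Aquad. auto 9 with c01. Qed.

Lemma quad_A : deriv01 (fun x => p x * (2 * x / den D)) (fun x => q x * (x ^ 2 / den D) - Aquad x).
Proof.
  apply (deriv01_eq (fun x => p x * (/ den D * (2 * x))) (fun x => dp x * (/ den D * (2 * x)) + p x * (/ den D * (2 * 1))));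
    [intros; unfold Rdiv; ring|intros; unfold Aquad, Rdiv; ring|].
  apply deriv01_mult; [exact Hp|]. apply deriv01_scal, deriv01_scal, deriv01_id.
Qed.

Lemma quad_bc : cos th1 * (0 ^ 2 / den D) - sin th1 * (2 * 0 / den D) = 0 /\
  cos th2 * (1 ^ 2 / den D) + sin th2 * (2 * 1 / den D) = 1.
Proof.
  assert (Hd := den_pos th1 th2 p dp q qc delta N0 lam phi dphi K L h Hth1 Hth2). fold D in Hd.
  split; [field; lra|]. unfold den in *. simpl in *. field. lra.
Qed.

(** [lagrange] for the lifting x^2 / den, whose boundary value at 1 is 1. *)
Lemma an_betan n : (1 <= n)%nat -> an D n = betan D n + (lam n - qc) * bn D n.
Proof.
  intros Hn. assert (Hpc := deriv01_cont _ _ Hp). assert (Hfc := phi_cont p q th1 th2 lam phi dphi HS n Hn).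
  assert (Hqd := deriv01_cont _ _ quad_deriv).
  assert (E := lagrange _ _ Aquad 1 n Hn quad_deriv quad_A Aquad_cont (proj1 quad_bc) (proj2 quad_bc)).
  assert (Ea : an D n = qc * ip (fun x => x ^ 2 / den D) (phi n) - ip Aquad (phi n)).
  { rewrite <- ip_scal_l, <- ip_minus_l by auto using cont01_scal, Aquad_cont.
    unfold an. simpl. apply ip_ext; [|reflexivity]. intros x _. unfold acoef, Aquad, qtil, Rdiv. simpl. ring. }
  assert (Eb : bn D n = - ip (fun x => x ^ 2 / den D) (phi n)).
  { replace (- ip (fun x => x ^ 2 / den D) (phi n)) with (-1 * ip (fun x => x ^ 2 / den D) (phi n)) by ring.
    rewrite <- ip_scal_l by assumption. unfold bn. simpl. apply ip_ext; [|reflexivity].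
    intros x _. unfold bcoef, Rdiv. ring. }
  rewrite Ea, Eb, E. ring.
Qed.

(** The Lipschitz condition makes the supremum finite, so that [real] returns the true supremum and
    not its default value at infinity. *)
Lemma supnorm_bound y0 Ly t : 0 <= h ->
  (forall s1 s2, - h <= s1 <= 0 -> - h <= s2 <= 0 -> Rabs (y0 s1 - y0 s2) <= Ly * Rabs (s1 - s2)) ->
  - h <= t <= 0 -> Rabs (y0 t) <= supnorm h y0.
Proof.
  intros Hh0 HL Ht. unfold supnorm.
  set (E := fun r => exists s, - h <= s <= 0 /\ r = Rabs (y0 s)).
  destruct (Lub_Rbar_correct E) as [Hub Hlub].
  assert (Hb : is_ub_Rbar E (Finite (Rabs (y0 0) + Rabs Ly * h))).
  { intros r [s [Hs ->]]. simpl. assert (A := HL s 0 Hs ltac:(lra)).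
    replace (y0 s) with (y0 0 + (y0 s - y0 0)) by ring.
    eapply Rle_trans; [apply Rabs_triang|]. apply Rplus_le_compat_l.
    eapply Rle_trans; [exact A|]. rewrite Rminus_0_r. apply Rle_trans with (Rabs Ly * Rabs s).
    - apply Rmult_le_compat_r; [apply Rabs_pos|apply Rle_abs].
    - apply Rmult_le_compat_l; [apply Rabs_pos|]. unfold Rabs. destruct (Rcase_abs s); lra. }
  specialize (Hlub _ Hb). assert (A := Hub (Rabs (y0 t)) ltac:(exists t; auto)).
  destruct (Lub_Rbar E); simpl in *; [exact A|contradiction|contradiction].
Qed.

(** * A closed-loop trajectory satisfies the modal system *)

Section Trajectory.
Variable N : nat.
Hypothesis HN : (N0 <= N)%nat.
Variables (z0 dz0 d2z0 : R -> R) (u0 : R) (y0 : R -> R)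
  (z zx zt : R -> R -> R) (zh : nat -> R -> R) (u : R -> R) (Ly : R).
Hypothesis Hz0 : deriv01 z0 dz0.
Hypothesis Hbc0 : cos th1 * z0 0 - sin th1 * dz0 0 = 0.
Hypothesis Hbc1 : cos th2 * z0 1 + sin th2 * dz0 1 = u0.
Hypothesis HLy : forall s1 s2, - h <= s1 <= 0 -> - h <= s2 <= 0 ->
  Rabs (y0 s1 - y0 s2) <= Ly * Rabs (s1 - s2).
Hypothesis HCL : closed_loop D N z0 u0 y0 z zx zt zh u.

Definition wt (t x : R) : R := z t x - x ^ 2 / den D * u t.
Definition dwt (t x : R) : R := zx t x - 2 * x / den D * u t.
(** A w without second derivatives: the plant equation gives A z = qc z - z_t. *)
Definition Awt (t x : R) : R := (qc * z t x - zt t x) - Aquad x * u t.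

Definition closed_traj : traj :=
  mkTraj zh (fun n t => ip (z t) (phi n)) u (fun t => zx t 0) (yN D zx y0)
    (fun t => aenergy (wt t) (dwt t)) (supnorm h y0).

Lemma z_initial x : 0 <= x <= 1 -> z 0 x = z0 x.
Proof. apply HCL. Qed.

Lemma z_deriv t : 0 <= t -> deriv01 (z t) (zx t).
Proof. apply HCL. Qed.

Lemma zx_initial x : 0 <= x <= 1 -> zx 0 x = dz0 x.
Proof.
  apply (deriv01_unique z0); [|exact Hz0].
  apply (deriv01_eq (z 0) (zx 0)); [exact z_initial|auto|apply z_deriv; lra].
Qed.

Lemma z_jcont : jcont 0 z.
Proof. apply (jcont_cont2 (fun t x => 0 <= t /\ 0 <= x <= 1)); [auto|apply HCL]. Qed.

Lemma zx_jcont : jcont 0 zx.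
Proof. apply (jcont_cont2 (fun t x => 0 <= t /\ 0 <= x <= 1)); [auto|apply HCL]. Qed.

Lemma zt_jcont a : 0 < a -> jcont a zt.
Proof.
  intros Ha. apply (jcont_cont2 (fun t x => 0 < t /\ 0 <= x <= 1)); [intros; split; lra|apply HCL].
Qed.

Lemma z_bc t : 0 <= t ->
  cos th1 * z t 0 - sin th1 * zx t 0 = 0 /\ cos th2 * z t 1 + sin th2 * zx t 1 = u t.
Proof.
  destruct HCL as (_ & _ & _ & _ & _ & _ & B0 & B1 & _ & Hu & _). simpl in B0, B1.
  intros [Ht| <-]; [auto|]. rewrite !z_initial, !zx_initial, Hu by lra. auto.
Qed.

Lemma jcont_section f x : jcont 0 f -> 0 <= x <= 1 -> cont_pos (fun t => f t x).
Proof.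
  intros H Hx. apply cont_pos_of_ext. intros t. apply continuous_eps. intros eps He.
  destruct (H t x (mkposreal eps He)) as [d Hd]. exists d. split; [apply cond_pos|].
  intros s Hs. specialize (Hd s x Hs). rewrite !(clamp_id x) in Hd by exact Hx. apply Hd.
  rewrite Rminus_diag, Rabs_R0. apply cond_pos.
Qed.

(** [closed_loop] does not postulate continuity of u. It is read off the boundary condition at 1: u
    is a trace of z and z_x for t >= 0, the case t = 0 by compatibility of the data, and constant
    before. *)
Lemma control_continuous t : continuous u t.
Proof.
  assert (Hc : cont_pos (fun s => cos th2 * z s 1 + sin th2 * zx s 1)).
  { apply cont_pos_plus; apply cont_pos_mult; try apply cont_pos_const.
    - apply (jcont_section z 1 z_jcont). lra.
    - apply (jcont_section zx 1 zx_jcont). lra. }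
  assert (E : forall s, cos th2 * z (Rmax 0 s) 1 + sin th2 * zx (Rmax 0 s) 1 = u s).
  { intros s. rewrite (proj2 (z_bc _ (Rmax_l 0 s))). destruct (Rle_dec 0 s) as [Hs|Hs].
    - rewrite Rmax_right by exact Hs. reflexivity.
    - rewrite Rmax_left by lra. destruct HCL as (_ & _ & _ & _ & _ & _ & _ & _ & _ & Hu & _).
      rewrite !Hu by lra. reflexivity. }
  apply (continuous_ext (fun s => cos th2 * z (Rmax 0 s) 1 + sin th2 * zx (Rmax 0 s) 1)); [exact E|].
  apply (cont_pos_ext _ t Hc).
Qed.

Lemma w_deriv t : 0 <= t -> deriv01 (wt t) (dwt t).
Proof.
  intros Ht. apply (deriv01_eq (fun x => z t x - u t * (x ^ 2 / den D)) (fun x => zx t x - u t * (2 * x / den D)));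
    [intros; unfold wt; ring|intros; unfold dwt; ring|].
  apply deriv01_minus; [apply z_deriv, Ht|apply deriv01_scal, quad_deriv].
Qed.

Lemma w_bc t : 0 <= t -> bc th1 th2 (wt t) (dwt t).
Proof.
  intros Ht. destruct (z_bc t Ht) as [B0 B1]. destruct quad_bc as [Q0 Q1]. unfold bc, wt, dwt. split.
  - transitivity ((cos th1 * z t 0 - sin th1 * zx t 0)
      - (cos th1 * (0 ^ 2 / den D) - sin th1 * (2 * 0 / den D)) * u t); [ring|]. rewrite B0, Q0. ring.
  - transitivity ((cos th2 * z t 1 + sin th2 * zx t 1)
      - (cos th2 * (1 ^ 2 / den D) + sin th2 * (2 * 1 / den D)) * u t); [ring|]. rewrite B1, Q1. ring.
Qed.

Lemma z_A t : 0 < t -> deriv01 (fun x => p x * zx t x) (fun x => q x * z t x - (qc * z t x - zt t x)).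
Proof.
  intros Ht. destruct HCL as (_ & _ & _ & _ & _ & HA & _). simpl in HA.
  apply (deriv01_eq (fun x => p x * zx t x) (fun x => zt t x + qtil D x * z t x)); [auto| |apply HA, Ht].
  intros x _. unfold qtil. simpl. ring.
Qed.

Lemma w_inD t : 0 < t -> inD p q th1 th2 (wt t) (dwt t) (Awt t).
Proof.
  intros Ht. split; [apply w_deriv; lra|]. split; [|apply w_bc; lra].
  apply (deriv01_eq (fun x => p x * zx t x - u t * (p x * (2 * x / den D)))
    (fun x => (q x * z t x - (qc * z t x - zt t x)) - u t * (q x * (x ^ 2 / den D) - Aquad x)));
    [intros; unfold dwt; ring|intros; unfold wt, Awt; ring|].
  apply deriv01_minus; [apply z_A, Ht|apply deriv01_scal, quad_A].
Qed.

Lemma wn_ip n t : (1 <= n)%nat -> 0 <= t -> wn D closed_traj n t = ip (wt t) (phi n).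
Proof.
  intros Hn Ht. unfold wn. simpl. assert (Hz := deriv01_cont _ _ (z_deriv t Ht)).
  assert (Hf := phi_cont p q th1 th2 lam phi dphi HS n Hn).
  assert (Hb := bcoef_cont th1 th2 p dp q qc delta N0 lam phi dphi K L h). fold D in Hb.
  rewrite (ip_ext (wt t) (phi n) (fun x => z t x + u t * bcoef D x) (phi n)); [|intros; unfold wt, bcoef, Rdiv; ring|auto].
  rewrite ip_plus_l, ip_scal_l by auto using cont01_scal. unfold bn. simpl. ring.
Qed.

Lemma wn_sum (F : nat -> R -> R) M t : 0 <= t ->
  fsum M (fun k => F k (wn D closed_traj (S k) t)) = fsum M (fun k => F k (ip (wt t) (phi (S k)))).
Proof. intros Ht. apply fsum_ext. intros k _. rewrite wn_ip by (lia || exact Ht). reflexivity. Qed.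

Lemma closed_traj_modal : modal D N closed_traj.
Proof.
  assert (Hphi := phi_cont p q th1 th2 lam phi dphi HS).
  assert (HCL' := HCL). destruct HCL' as (_ & _ & _ & _ & Hdz & _ & _ & _ & _ & Hu0 & HuK & Hzh & Hobs & Hopen).
  constructor; simpl.
  - intros n Hn. apply jcont_ip_cont_pos; [exact z_jcont|apply jcont_space, Hphi, Hn].
  - exact Hzh.
  - exact control_continuous.
  - apply (jcont_section zx 0 zx_jcont). lra.
  - intros t Ht. rewrite !Hu0 by lra. reflexivity.
  - exact HuK.
  - intros n t Hn Ht. eapply D_val.
    + apply (ip_derive z zt (phi n) t); auto.
      * intros s Hs. apply (deriv01_cont _ (zx s)), z_deriv. lra.
      * exact zt_jcont.
    + destruct (z_bc t (Rlt_le _ _ Ht)) as [B0 B1].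
      assert (Hzc := deriv01_cont _ _ (z_deriv t (Rlt_le _ _ Ht))).
      assert (Hztc := jcont_cont01 t zt t (zt_jcont t Ht) (Rle_refl t)).
      assert (E := lagrange (z t) (zx t) _ (u t) n Hn (z_deriv t (Rlt_le _ _ Ht)) (z_A t Ht)
        ltac:(auto using cont01_minus, cont01_scal) B0 B1).
      rewrite ip_minus_l, ip_scal_l in E by auto using cont01_scal. lra.
  - intros r t Hr Ht. unfold inj, A0d, B0. simpl. destruct (Nat.ltb_spec r N0) as [Hr0|Hr0].
    + eapply D_val; [apply (Hobs (S r) t); [simpl; lia|exact Ht]|].
      replace (S r - 1)%nat with r by lia. unfold innov. simpl. ring.
    + eapply D_val; [apply (Hopen (S r) t); [simpl; lia|exact Ht]|]. simpl. ring.
  - intros t Ht. unfold yN. simpl. destruct (Rlt_dec t h); [|lra].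
    apply (supnorm_bound y0 Ly); [lra|exact HLy|lra].
  - intros t Ht. unfold yN. simpl. destruct (Rlt_dec t h); [lra|reflexivity].
  - intros t M Ht.
    change (fsum M (fun k => lam (S k) * wn D closed_traj (S k) t ^ 2) <= aenergy (wt t) (dwt t)).
    rewrite (wn_sum (fun k x => lam (S k) * x ^ 2) M t Ht).
    exact (bessel_energy p dp q th1 th2 Hth1 Hth2 Hp Hppos Hq Hqpos lam phi dphi HS
      M (wt t) (dwt t) (w_deriv t Ht) (w_bc t Ht)).
  - intros t eta Ht Heta.
    assert (HA := inD_cA p q th1 th2 Hq _ _ _ (w_inD t Ht)).
    (* M with |A w|^2 / lam_{M+1} < eta, so that [energy_tail] leaves less than eta of the energy
       beyond M. *)
    destruct (lam_unbounded p dp q th1 th2 Hth1 Hth2 Hp Hppos Hq Hqpos lam phi dphi HS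
      (ip (Awt t) (Awt t) / eta)) as [M HM]. specialize (HM M (Nat.le_refl M)).
    exists M.
    change (aenergy (wt t) (dwt t) <= fsum M (fun k => lam (S k) * wn D closed_traj (S k) t ^ 2) + eta).
    rewrite (wn_sum (fun k x => lam (S k) * x ^ 2) M t (Rlt_le _ _ Ht)).
    assert (E := energy_tail p dp q th1 th2 Hth1 Hth2 Hp Hppos Hq Hqpos lam phi dphi HS M _ _ _ (w_inD t Ht)).
    assert (Lp := lam_pos p q th1 th2 lam phi dphi HS (S M) ltac:(lia)).
    fold (aenergy (wt t) (dwt t)) in E.
    set (X := fsum M (fun k => lam (S k) * ip (wt t) (phi (S k)) ^ 2)) in *.
    apply Rmult_lt_compat_r with (r := eta) in HM; [|exact Heta].
    replace (ip (Awt t) (Awt t) / eta * eta) with (ip (Awt t) (Awt t)) in HM by (field; lra).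
    assert (lam (S M) * (aenergy (wt t) (dwt t) - X) <= lam (S M) * eta) by lra.
    apply Rmult_le_reg_l in H; lra.
  - intros a b eta Ha Heta.
    (* Joint continuity for t >= a > 0 bounds |A w| on [a,b], which makes the trace estimate of
       [trace_tail] uniform in t. *)
    assert (HJ : jcont a Awt).
    { apply jcont_minus; [apply jcont_minus|].
      - apply jcont_mult; [apply jcont_const|].
        apply (jcont_cont2 (fun t x => 0 <= t /\ 0 <= x <= 1)); [intros; split; lra|apply HCL].
      - apply zt_jcont, Ha.
      - apply jcont_mult; [apply jcont_space, Aquad_cont|apply jcont_time, control_continuous]. }
    destruct (jcont_ip_bounded Awt a b HJ) as [B [HB HBd]].
    destruct (trace_tail p dp q th1 th2 Hth1 Hth2 Hp Hppos Hq Hqpos lam phi dphi HS (eta / B)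
      ltac:(apply Rdiv_lt_0_compat; assumption)) as [M0 HM0].
    exists M0. intros M t HM Ht. specialize (HM0 M _ _ _ HM (w_inD t ltac:(lra))).
    change ((zx t 0 - fsum M (fun k => wn D closed_traj (S k) t * dphi (S k) 0)) ^ 2 <= eta).
    rewrite (wn_sum (fun k x => x * dphi (S k) 0) M t) by lra.
    replace (zx t 0) with (dwt t 0) by (unfold dwt, Rdiv; ring).
    eapply Rle_trans; [exact HM0|]. apply Rle_trans with (eta / B * B); [|right; field; lra].
    apply Rmult_le_compat_l; [apply Rlt_le, Rdiv_lt_0_compat; assumption|apply HBd, Ht].
Qed.

End Trajectory.
End Plant.

(** * The decay estimate *)

Lemma aform_ext p q th1 th2 f df g dg f' df' g' dg' :
  (forall x, 0 <= x <= 1 -> f x = f' x) -> (forall x, 0 <= x <= 1 -> df x = df' x) ->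
  (forall x, 0 <= x <= 1 -> g x = g' x) -> (forall x, 0 <= x <= 1 -> dg x = dg' x) ->
  aform p q th1 th2 f df g dg = aform p q th1 th2 f' df' g' dg'.
Proof.
  intros Hf Hdf Hg Hdg. unfold aform. rewrite !Hf, !Hg by lra. f_equal. f_equal.
  apply RInt_c01_ext; [lra|lra|]. intros x Hx. rewrite Hf, Hdf, Hg, Hdg by exact Hx. reflexivity.
Qed.

Lemma ip_sum_sq f g c : cont01 f -> cont01 g ->
  ip (fun x => f x + c * g x) (fun x => f x + c * g x) <= 2 * ip f f + 2 * ip g g * c ^ 2.
Proof.
  intros Hf Hg. assert (A := ip_nonneg (fun x => f x + - c * g x) ltac:(auto using cont01_plus, cont01_scal)).
  rewrite !ip_quad in * by assumption. assert (B : (- c) ^ 2 = c ^ 2) by ring. rewrite B in A. lra.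
Qed.

Section Performance.
Variables (th1 th2 : R) (p dp q : R -> R) (qc delta : R) (N0 : nat)
  (lam : nat -> R) (phi dphi : nat -> R -> R) (K L : nat -> R) (h : R).
Hypothesis Hth1 : 0 <= th1 < PI / 2.
Hypothesis Hth2 : 0 <= th2 <= PI / 2.
Hypothesis Hp : deriv01 p dp.
Hypothesis Hdp : cont01 dp.
Hypothesis Hppos : forall x, 0 <= x <= 1 -> 0 < p x.
Hypothesis Hq : cont01 q.
Hypothesis Hqpos : forall x, 0 <= x <= 1 -> 0 < q x.
Hypothesis HS : SL_spectrum p q th1 th2 lam phi dphi.
Hypothesis Hdelta : 0 < delta.
Hypothesis HN0 : (1 <= N0)%nat.
Hypothesis Hh : 0 < h.

Let D := mkData th1 th2 p dp q qc lam phi dphi N0 K L h delta.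

Lemma coefficients_bounded f : cont01 f ->
  exists C, 0 < C /\ forall M, fsum M (fun k => ip f (phi (S k)) ^ 2) <= C.
Proof.
  intros Hf. exists (ip f f + 1). assert (A := ip_nonneg f Hf). split; [lra|]. intros M.
  assert (B := bessel p dp q th1 th2 Hth1 Hth2 Hp Hq lam phi dphi HS M f Hf). lra.
Qed.

Lemma closed_loop_decay N eps P alpha beta gamma : (N0 <= N)%nat ->
  Constraints D N eps P alpha beta gamma ->
  exists C, 0 < C /\ forall T, modal D N T -> forall t, 0 <= t ->
    tG T t + tu T t ^ 2 + fsum N (fun k => tzh T (S k) t ^ 2) <= C * (exp (- 2 * delta * t) * init_size N T).
Proof.
  intros HN HC.
  assert (Ha := acoef_cont th1 th2 p dp q qc delta N0 lam phi dphi K L h Hp Hdp Hq).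
  assert (Hb := bcoef_cont th1 th2 p dp q qc delta N0 lam phi dphi K L h).
  apply (modal_decay D N HN Hh Hdelta) with (eps := eps) (P := P) (alpha := alpha) (beta := beta) (gamma := gamma).
  - exact (lam_pos p q th1 th2 lam phi dphi HS).
  - exact (lam_le p q th1 th2 lam phi dphi HS).
  - exact (an_betan th1 th2 p dp q qc delta N0 lam phi dphi K L h Hth1 Hth2 Hp Hdp Hq HS).
  - apply (coefficients_bounded _ Ha).
  - apply (coefficients_bounded _ Hb).
  - destruct (dphi0_summable p dp q th1 th2 Hth1 Hth2 Hp Hppos Hq lam phi dphi HS) as [C [HC0 H]].
    exists C. split; [exact HC0|]. intros M. apply (H M 1%nat). lia.
  - exact HC.
  - intros M. apply (tailsq_partial th1 th2 p dp q qc delta N0 lam phi dphi K L h Hth1 Hth2 Hp Hq HS HN0 _ N M Ha).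
  - intros M. apply (tailsq_partial th1 th2 p dp q qc delta N0 lam phi dphi K L h Hth1 Hth2 Hp Hq HS HN0 _ N M Hb).
Qed.

Lemma initial_energy : exists C, 0 < C /\ forall z0 dz0 d2z0 u0, H2_01 z0 dz0 d2z0 ->
  cos th1 * z0 0 - sin th1 * dz0 0 = 0 -> cos th2 * z0 1 + sin th2 * dz0 1 = u0 ->
  aform p q th1 th2 (fun x => z0 x - x ^ 2 / den D * u0) (fun x => dz0 x - 2 * x / den D * u0)
    (fun x => z0 x - x ^ 2 / den D * u0) (fun x => dz0 x - 2 * x / den D * u0)
  <= C * Aw0_sq D z0 dz0 d2z0 u0.
Proof.
  destruct (H2_energy p dp q th1 th2 Hth1 Hth2 Hp Hppos Hq Hqpos) as [C [HC H]].
  assert (Hd := den_pos th1 th2 p dp q qc delta N0 lam phi dphi K L h Hth1 Hth2). fold D in Hd.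
  exists C. split; [exact HC|]. intros z0 dz0 d2z0 u0 HH B0 B1.
  specialize (H _ _ _ (H2_shift z0 dz0 d2z0 (u0 / den D) HH)).
  destruct (quad_bc th1 th2 p dp q qc delta N0 lam phi dphi K L h Hth1 Hth2) as [Q0 Q1]. fold D in Q0, Q1.
  rewrite (aform_ext p q th1 th2 _ _ _ _ (fun x => z0 x - u0 / den D * x ^ 2) (fun x => dz0 x - 2 * (u0 / den D) * x)
    (fun x => z0 x - u0 / den D * x ^ 2) (fun x => dz0 x - 2 * (u0 / den D) * x))
    by (intros; unfold Rdiv; ring).
  eapply Rle_trans; [apply H|].
  - split.
    + transitivity ((cos th1 * z0 0 - sin th1 * dz0 0)
        - (cos th1 * (0 ^ 2 / den D) - sin th1 * (2 * 0 / den D)) * u0); [unfold Rdiv; ring|]. rewrite B0, Q0. ring.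
    + transitivity ((cos th2 * z0 1 + sin th2 * dz0 1)
        - (cos th2 * (1 ^ 2 / den D) + sin th2 * (2 * 1 / den D)) * u0); [unfold Rdiv; ring|]. rewrite B1, Q1. ring.
  - right. f_equal. unfold Aw0_sq. apply LebFacts.lint_ext. intros x _. simpl. unfold Rdiv. ring.
Qed.

(** Undoes the homogenisation: z = w + u x^2 / den, so the H^1 norm of z is controlled by the energy
    of w and u^2, while at t = 0 the energy is bounded by |A w_0|^2. *)
Theorem exponential_decay N eps P alpha beta gamma : (N0 <= N)%nat ->
  Constraints D N eps P alpha beta gamma ->
  exists M, 0 < M /\
      forall (z0 dz0 d2z0 : R -> R) (u0 : R) (y0 : R -> R)
             (z zx zt : R -> R -> R) (zh : nat -> R -> R) (u : R -> R),
        H2_01 z0 dz0 d2z0 ->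
        cos th1 * z0 0 - sin th1 * dz0 0 = 0 ->
        cos th2 * z0 1 + sin th2 * dz0 1 = u0 ->
        (exists Ly, forall s1 s2, - h <= s1 <= 0 -> - h <= s2 <= 0 ->
           Rabs (y0 s1 - y0 s2) <= Ly * Rabs (s1 - s2)) ->
        closed_loop D N z0 u0 y0 z zx zt zh u ->
        forall t, 0 <= t ->
          state_sq N z zx zh t <=
          M * exp (- 2 * delta * t) *
            (Aw0_sq D z0 dz0 d2z0 u0 + fsum N (fun k => (zh (S k) 0) ^ 2)
             + u0 ^ 2 + (supnorm h y0) ^ 2).
Proof.
  intros HN HC.
  destruct (closed_loop_decay N eps P alpha beta gamma HN HC) as [Cd [HCd Hdec]].
  destruct initial_energy as [Ce [HCe HE]].
  destruct (aform_controls p dp q th1 th2 Hth1 Hth2 Hp Hppos Hq Hqpos) as [Ca [HCa HA]].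
  set (g := fun x => x ^ 2 / den D). set (dg := fun x => 2 * x / den D).
  assert (Hg : cont01 g) by (unfold g; auto with c01).
  assert (Hdg : cont01 dg) by (unfold dg; auto with c01).
  set (c1 := ip g g). set (c2 := ip dg dg).
  assert (Hc1 : 0 <= c1) by (apply ip_nonneg, Hg). assert (Hc2 : 0 <= c2) by (apply ip_nonneg, Hdg).
  set (Cs := 2 * Ca + 2 * (c1 + c2) + 1). assert (HCs : 0 < Cs) by (unfold Cs; lra).
  exists (Cs * Cd * (Ce + 1)).
  split; [apply Rmult_lt_0_compat; [apply Rmult_lt_0_compat|]; lra|].
  intros z0 dz0 d2z0 u0 y0 z zx zt zh u HH B0 B1 [Ly HLy] HCL t Ht.
  set (T := closed_traj th1 th2 p dp q qc delta N0 lam phi dphi K L h y0 z zx zh u).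
  assert (Hz0 := proj1 HH).
  assert (HT : modal D N T) by apply (closed_traj_modal th1 th2 p dp q qc delta N0 lam phi dphi K L h
    Hth1 Hth2 Hp Hdp Hppos Hq Hqpos HS Hh N HN z0 dz0 u0 y0 z zx zt zh u Ly Hz0 B0 B1 HLy HCL).
  specialize (Hdec T HT t Ht). specialize (HE z0 dz0 d2z0 u0 HH B0 B1).
  set (e := exp (- 2 * delta * t)) in *. assert (He : 0 < e) by apply exp_pos.
  set (w := wt th1 th2 p dp q qc delta N0 lam phi dphi K L h z u t).
  set (dw := dwt th1 th2 p dp q qc delta N0 lam phi dphi K L h zx u t).
  assert (Hw : deriv01 w dw) by apply (w_deriv th1 th2 p dp q qc delta N0 lam phi dphi K L h N
    z0 u0 y0 z zx zt zh u HCL t Ht).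
  assert (HG : tG T t = aform p q th1 th2 w dw w dw) by reflexivity.
  destruct (HA w dw Hw) as [HA1 _]. rewrite <- HG in HA1.
  assert (Hwc := deriv01_cont _ _ Hw). assert (Hdwc := deriv01_cont_deriv _ _ Hw).
  assert (Sz : RInt (fun x => z t x ^ 2) 0 1 <= 2 * ip w w + 2 * c1 * u t ^ 2).
  { apply Rle_trans with (ip (fun x => w x + u t * g x) (fun x => w x + u t * g x));
      [right; apply RInt_c01_ext; [lra|lra|]; intros x _; unfold w, wt, g; cbv zeta; fold D; ring|].
    apply ip_sum_sq; assumption. }
  assert (Szx : RInt (fun x => zx t x ^ 2) 0 1 <= 2 * ip dw dw + 2 * c2 * u t ^ 2).
  { apply Rle_trans with (ip (fun x => dw x + u t * dg x) (fun x => dw x + u t * dg x));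
      [right; apply RInt_c01_ext; [lra|lra|]; intros x _; unfold dw, dwt, dg; cbv zeta; fold D; ring|].
    apply ip_sum_sq; assumption. }
  change (tu T t) with (u t) in Hdec. change (tzh T) with zh in Hdec.
  set (SH := fsum N (fun k => zh (S k) t ^ 2)) in *.
  assert (PSH : 0 <= SH) by (apply fsum_nonneg; intros; apply pow2_ge_0).
  assert (Pu : 0 <= u t ^ 2) by apply pow2_ge_0.
  assert (PG : 0 <= tG T t).
  { rewrite HG. apply (aform_nonneg p dp q th1 th2 Hth1 Hth2 Hp Hppos Hq Hqpos), Hw. }
  assert (Hst : state_sq N z zx zh t <= Cs * (tG T t + u t ^ 2 + SH)).
  { unfold state_sq. fold SH. unfold Cs.
    assert (0 <= (c1 + c2) * tG T t) by (apply Rmult_le_pos; lra).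
    assert (0 <= (c1 + c2) * SH) by (apply Rmult_le_pos; lra).
    assert (0 <= Ca * SH) by (apply Rmult_le_pos; lra).
    assert (0 <= Ca * u t ^ 2) by (apply Rmult_le_pos; lra). lra. }
  assert (HD0 : init_size N T <= (Ce + 1) * (Aw0_sq D z0 dz0 d2z0 u0 + fsum N (fun k => zh (S k) 0 ^ 2)
     + u0 ^ 2 + supnorm h y0 ^ 2)).
  { destruct (init_size_nonneg D N T HT) as [PG0 _].
    assert (EG : tG T 0 = aform p q th1 th2 (fun x => z0 x - x ^ 2 / den D * u0) (fun x => dz0 x - 2 * x / den D * u0)
      (fun x => z0 x - x ^ 2 / den D * u0) (fun x => dz0 x - 2 * x / den D * u0)).
    { assert (Eu : u 0 = u0) by (apply HCL; lra).
      assert (Ez : forall x, 0 <= x <= 1 -> z 0 x = z0 x) by apply HCL.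
      assert (Ezx : forall x, 0 <= x <= 1 -> zx 0 x = dz0 x)
        by apply (zx_initial th1 th2 p dp q qc delta N0 lam phi dphi K L h N z0 dz0 u0 y0 z zx zt zh u Hz0 HCL).
      assert (Ew : forall x, 0 <= x <= 1 ->
        wt th1 th2 p dp q qc delta N0 lam phi dphi K L h z u 0 x = z0 x - x ^ 2 / den D * u0)
        by (intros x Hx; unfold wt; rewrite Eu, Ez by exact Hx; reflexivity).
      assert (Edw : forall x, 0 <= x <= 1 ->
        dwt th1 th2 p dp q qc delta N0 lam phi dphi K L h zx u 0 x = dz0 x - 2 * x / den D * u0)
        by (intros x Hx; unfold dwt; rewrite Eu, Ezx by exact Hx; reflexivity).
      exact (aform_ext p q th1 th2 _ _ _ _ _ _ _ _ Ew Edw Ew Edw). }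
    rewrite <- EG in HE.
    unfold init_size. change (tu T 0) with (u 0). replace (u 0) with u0 by (symmetry; apply HCL; lra).
    change (tzh T) with zh. change (tY T) with (supnorm h y0).
    assert (0 <= fsum N (fun k => zh (S k) 0 ^ 2)) by (apply fsum_nonneg; intros; apply pow2_ge_0).
    assert (0 <= u0 ^ 2) by apply pow2_ge_0. assert (0 <= supnorm h y0 ^ 2) by apply pow2_ge_0.
    (* Nonnegativity of the Lebesgue integral is deduced from the energy bound just obtained. *)
    assert (PA : 0 <= Aw0_sq D z0 dz0 d2z0 u0).
    { apply Rmult_le_reg_l with Ce; [exact HCe|]. lra. }
    assert (0 <= Ce * (fsum N (fun k => zh (S k) 0 ^ 2) + u0 ^ 2 + supnorm h y0 ^ 2)) by (apply Rmult_le_pos; lra).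
    lra. }
  eapply Rle_trans; [exact Hst|]. eapply Rle_trans; [apply Rmult_le_compat_l; [lra|exact Hdec]|].
  apply (Rmult_le_compat_l (Cs * Cd * e)) in HD0; [lra|].
  apply Rmult_le_pos; [apply Rmult_le_pos|]; lra.
Qed.

End Performance.

Theorem theorem2
  (th1 th2 : R) (p dp q : R -> R) (qc delta : R) (N0 : nat)
  (lam : nat -> R) (phi dphi : nat -> R -> R) (K L : nat -> R) (h : R) :
  0 <= th1 < PI / 2 -> 0 <= th2 <= PI / 2 ->
  (* p in C^2([0,1]), p > 0 *)
  deriv01 p dp -> (exists d2p, deriv01 dp d2p) ->
  (forall x, 0 <= x <= 1 -> 0 < p x) ->
  (* q in C^0([0,1]), q > 0; qtil = q - qc *)
  cont01 q -> (forall x, 0 <= x <= 1 -> 0 < q x) ->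
  (* spectral data of A *)
  SL_spectrum p q th1 th2 lam phi dphi ->
  0 < delta -> (1 <= N0)%nat ->
  (forall n, (N0 + 1 <= n)%nat -> - lam n + qc < - delta) ->
  let D := mkData th1 th2 p dp q qc lam phi dphi N0 K L h delta in
  (exists i, (i < N0)%nat /\ K i <> 0) ->
  eig_re_lt N0 (A0BK D) (- delta) ->
  eig_re_lt N0 (A0LC D) (- delta) ->
  0 < h ->
  (forall N, (N0 + 1 <= N)%nat ->
    (exists eps P alpha beta gamma, Constraints D N eps P alpha beta gamma) ->
    exists M, 0 < M /\
      forall (z0 dz0 d2z0 : R -> R) (u0 : R) (y0 : R -> R)
             (z zx zt : R -> R -> R) (zh : nat -> R -> R) (u : R -> R),
        H2_01 z0 dz0 d2z0 ->
        cos th1 * z0 0 - sin th1 * dz0 0 = 0 ->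
        cos th2 * z0 1 + sin th2 * dz0 1 = u0 ->
        u0 = fsum N0 (fun r => K r * ZA D zh u r 0) ->
        (exists Ly, forall s1 s2, - h <= s1 <= 0 -> - h <= s2 <= 0 ->
           Rabs (y0 s1 - y0 s2) <= Ly * Rabs (s1 - s2)) ->
        y0 0 = dz0 0 ->
        closed_loop D N z0 u0 y0 z zx zt zh u ->
        forall t, 0 <= t ->
          state_sq N z zx zh t <=
          M * exp (- 2 * delta * t) *
            (Aw0_sq D z0 dz0 d2z0 u0 + fsum N (fun k => (zh (S k) 0) ^ 2)
             + u0 ^ 2 + (supnorm h y0) ^ 2))
  /\
  (exists Nmin, forall N, (Nmin <= N)%nat ->
     exists eps P alpha beta gamma, Constraints D N eps P alpha beta gamma).
Proof.
  intros Hth1 Hth2 Hp [d2p Hd2p] Hppos Hq Hqpos HS Hdelta HN0 Hgap D _ HBK HLC Hh.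
  assert (Hdp := deriv01_cont _ _ Hd2p). split.
  - intros N HN [eps [P [alpha [beta [gamma HC]]]]].
    destruct (exponential_decay th1 th2 p dp q qc delta N0 lam phi dphi K L h Hth1 Hth2 Hp Hdp Hppos
      Hq Hqpos HS Hdelta HN0 Hh N eps P alpha beta gamma ltac:(lia) HC) as [M [HM H]].
    exists M. split; [exact HM|]. intros. eapply H; eassumption.
  - exact (feasibility th1 th2 p dp q qc delta N0 lam phi dphi K L h Hth1 Hth2 Hp Hdp Hppos
      Hq Hqpos HS HN0 Hgap HBK HLC).
Qed.
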